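(* Let $0<\theta\le1$, let $P\in A^\infty_{1/\theta}$ be a projection, and consider the operator $$D=P\Bigl(x+\frac{d}{dx}\Bigr)P:\;P(S(\mathbb R))\longrightarrow P(S(\mathbb R))$$ on the Schwartz space $S(\mathbb R)$ of the real line. Then $D$ is Fredholm and $$\operatorname{ind}D=\frac1\theta\int_0^\theta\Bigl(P-P\bigl[[\varphi,P],\tfrac{dP}{d\varphi}\bigr]\Bigr)(0)\,d\varphi .$$
   Context: On functions on $\mathbb R$ with coordinate $x$ let $(Uf)(x)=f(x+1)$ and $(Vf)(x)=e^{-2\pi ix/\theta}f(x)$. $A^\infty_{1/\theta}$ is the algebra of operators $\sum_{j,k\in\mathbb Z}a_{jk}U^jV^k$ with $a_{jk}\in\mathbb C$ rapidly decaying (for every $l$ there is $C$ with $|a_{jk}|\le C(1+|j|+|k|)^{-l}$). Equivalently, its elements are uniquely written $B=\sum_{j\in\mathbb Z}U^jb_j$ with $b_j$ smooth $\theta$-periodic functions acting by multiplication (rapidly decaying in $j$). A projection is an idempotent $P=P^2$. Notation: $B(0)=b_0$ is the coefficient at the zeroth power of $U$, a $\theta$-periodic function of $\varphi=x$. $[\varphi,B]$ is the commutator with the operator of multiplication by the coordinate on $\mathbb R$; it is again in $A^\infty_{1/\theta}$, since $[\varphi,U^j]=-jU^j$, so $[\varphi,B]=\sum_j(-j)U^jb_j$. $\frac{dB}{d\varphi}=\sum_jU^jb_j'$. The outer bracket is the commutator in $A^\infty_{1/\theta}$. The index is $\dim\ker D-\dim\operatorname{coker}D$. *)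

(* Defs.v *)
From HB Require Import structures.
From mathcomp Require Import all_boot all_order all_algebra.
From mathcomp Require Export complex.
From mathcomp Require Import all_classical all_reals all_analysis.

Set Implicit Arguments.
Unset Strict Implicit.
Unset Printing Implicit Defensive.

Import Order.TTheory GRing.Theory Num.Theory.
Import numFieldNormedType.Exports.

Local Open Scope classical_set_scope.
Local Open Scope ring_scope.
Local Open Scope complex_scope.

(* R[i] carries no normed-module structure over R in the libraries, so limits,
   derivatives and integrals of C-valued functions are taken on the real and
   imaginary parts. *)

Definition cderive (R : realType) (f : R -> R[i]) : R -> R[i] :=
  fun x => derive1 (fun t => complex.Re (f t)) x +i*
           derive1 (fun t => complex.Im (f t)) x.

Definition csmooth (R : realType) (f : R -> R[i]) : Prop :=
  forall (n : nat) (x : R),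
    derivable (fun t => complex.Re (iter n (@cderive R) f t)) x 1 /\
    derivable (fun t => complex.Im (iter n (@cderive R) f t)) x 1.

Definition cintegral (R : realType) (a b : R) (f : R -> R[i]) : R[i] :=
  (\int[lebesgue_measure]_(x in `[a, b]) complex.Re (f x)) +i*
  (\int[lebesgue_measure]_(x in `[a, b]) complex.Im (f x)).

(* Sum over Z as the limit of the partial sums over {-N, ..., N}; it is only
   used for absolutely convergent families. *)
Definition zsum (R : realType) (u : int -> R[i]) : R[i] :=
  limn (fun N : nat => \sum_(i < N.*2.+1) complex.Re (u (i%:Z - N%:Z))) +i*
  limn (fun N : nat => \sum_(i < N.*2.+1) complex.Im (u (i%:Z - N%:Z))).

Definition expi (R : realType) (t : R) : R[i] := cos t +i* sin t.

Definition schwartz (R : realType) : set (R -> R[i]) :=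
  [set f | csmooth f /\
    forall m n : nat, exists C : R, forall x : R,
      `|x| ^+ m * Normc.normc (iter n (@cderive R) f x) <= C].

(* Elements of the algebra act on S(R). They are represented by maps on all
   functions R -> C, of which only the restriction to S(R) is meaningful. *)
Definition operator (R : realType) := (R -> R[i]) -> (R -> R[i]).

Definition Upow (R : realType) (j : int) : operator R :=
  fun f x => f (x + j%:~R).

Definition Vpow (R : realType) (theta : R) (k : int) : operator R :=
  fun f x => expi (- (2 * pi * k%:~R * x / theta)) * f x.

Definition rapid_decay (R : realType) (a : int -> int -> R[i]) : Prop :=
  forall l : nat, exists C : R, forall j k : int,
    Normc.normc (a j k) <= C * (1 + `|j|%:~R + `|k|%:~R) ^- l.

Definition has_coef (R : realType) (theta : R) (T : operator R)
    (a : int -> int -> R[i]) : Prop :=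
  rapid_decay a /\
  forall f, schwartz f ->
    T f = fun x =>
      zsum (fun j => zsum (fun k => a j k * Upow j (Vpow theta k f) x)).

Definition Ainf (R : realType) (theta : R) : set (operator R) :=
  [set T | exists a, has_coef theta T a].

(* The coefficients of an element of the algebra, which are unique. *)
Definition coef (R : realType) (theta : R) (T : operator R) :
    int -> int -> R[i] :=
  xget (fun _ _ => 0) [set a | has_coef theta T a].

(* The function b_j in T = \sum_j U^j b_j, that is
   b_j = \sum_k a_jk e^{-2 pi i k x / theta}; T(0) is zcoef theta T 0. *)
Definition zcoef (R : realType) (theta : R) (T : operator R) (j : int) :
    R -> R[i] :=
  fun x => zsum (fun k => coef theta T j k * Vpow theta k (fun=> 1) x).

Definition op_comm (R : realType) (S T : operator R) : operator R :=
  fun f => S (T f) - T (S f).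

Definition phi_mul (R : realType) : operator R := fun f x => x%:C * f x.

Definition dphi (R : realType) (theta : R) (T : operator R) : operator R :=
  fun f x =>
    zsum (fun j => Upow j (fun y => cderive (zcoef theta T j) y * f y) x).

(* W / N has dimension n: the classes of some e_1, ..., e_n in W form a basis *)
Definition has_quot_dim (K : fieldType) (V : lmodType K) (W N : set V)
    (n : nat) : Prop :=
  exists e : 'I_n -> V,
    (forall i, W (e i)) /\
    (forall w, W w ->
       exists! c : 'rV[K]_n, N (w - \sum_(i < n) c ord0 i *: e i)).

Definition quot_dim (K : fieldType) (V : lmodType K) (W N : set V) : nat :=
  xget 0%N [set n | has_quot_dim W N n].

(* D is meant to map the subspace W linearly to itself. Kernel and cokernel are
   the algebraic ones; for continuous maps of Frechet spaces a range of finite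
   codimension is automatically closed. *)
Definition kernel_in (K : fieldType) (V : lmodType K) (W : set V)
    (D : V -> V) : set V := [set f | W f /\ D f = 0].

Definition fredholm (K : fieldType) (V : lmodType K) (W : set V)
    (D : V -> V) : Prop :=
  (exists n, has_quot_dim (kernel_in W D) [set 0] n) /\
  (exists n, has_quot_dim W (D @` W) n).

Definition fredholm_index (K : fieldType) (V : lmodType K) (W : set V)
    (D : V -> V) : int :=
  (quot_dim (kernel_in W D) [set 0])%:Z - (quot_dim W (D @` W))%:Z.

Definition compressed (R : realType) (P : operator R) : operator R :=
  fun f => P (fun x => x%:C * P f x + cderive (P f) x).

Definition index_integrand (R : realType) (theta : R) (P : operator R) :
    operator R :=
  fun f => P f - P (op_comm (op_comm (@phi_mul R) P) (dphi theta P) f).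

(* Main.v *)
From HB Require Import structures.
Require Import Defs.
From mathcomp Require Import all_boot all_order all_algebra.
From mathcomp Require Import all_classical all_reals all_analysis.
From mathcomp Require Import ring lra zify.

(** Translations by theta and multiplications by e^(2 pi i n x) commute with [U] and [V]. The frame
    is built so that they permute its elements up to phases; this is where the covariance of the
    matrices comes from. The price is redundancy: well localised windows on such a lattice do not
    form a basis, so the identity operator is represented by an idempotent [Me] that need not be 1,
    and every matrix identity has to be compressed by it. The bound theta <= 1 enters through the
    supports. A synthesis window has length theta, hence fits into one period of the frequencies 2
    pi Z, and its translates by nonzero integers do not meet it. The first fact gives reconstruction
    by Fourier series, the second the uniqueness of coefficients and the value of the trace per unit
    cell. No topology on the Schwartz space is used. Continuity of the index along a path is
    replaced by the remark that a polynomial with integer values is constant, and closedness of the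
    range never comes up because finite-rank remainders give kernel and cokernel by linear algebra.
    The lattice sum behind the constant is likewise not computed: telescoping shows its shape
    only. *)

(* A Gabor frame of Schwartz functions, with windows of length theta/3 and
   frequencies in 2 pi Z, turns operators on the Schwartz space into matrices
   over Z^2: P becomes an idempotent p of order 0 that is invariant under the
   shifts of a cell (three windows, one frequency), and x + d/dx becomes u + B
   with B of order 0 and u = theta (m - 1/2) + 2 pi i k on the cell (m, k).
   The index of p (u + B) p is Tr R1^N - Tr R2^N for the remainders R1, R2 of
   the parametrix p u^-1 p; replacing B by t B gives an integer-valued
   polynomial in t, so B can be dropped, and then Fedosov's formula reduces the
   index to Tr (p - u^-1 p u)^3.  Summing this cubic trace over the lattice of
   cells leaves, for each pair of differences, an alternating biadditive
   function, that is, a universal constant times a determinant; the result is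
   the trace per unit cell of p [[X, p], [Y, p]].  Up to a factor, that trace
   is the coefficient a_00 of the curvature P - P [[phi, P], dP/dphi], and the
   constant is found from P = 1, for which x + d/dx is onto with the Gaussian as
   kernel. *)

Set Implicit Arguments.
Unset Strict Implicit.

Import Order.TTheory GRing.Theory Num.Theory.
Import numFieldNormedType.Exports.

Local Open Scope classical_set_scope.
Local Open Scope ring_scope.
Local Open Scope complex_scope.

Notation nrm := Normc.normc.
Notation cRe := complex.Re.
Notation cIm := complex.Im.

(** * Absolutely convergent sums *)

Section RealSum.
Variable R : realType.

Definition nsum (T : choiceType) (g : T -> R) : \bar R :=
  (\esum_(x in [set: T]) (g x)%:E)%E.

Definition rsummable (T : choiceType) (g : T -> R) : Prop :=
  (nsum (fun x => (`|g x|)%R) < +oo)%E.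

(* |g| + g and |g| are nonnegative, so that both sums make sense. *)
Definition rsum (T : choiceType) (g : T -> R) : R :=
  fine (nsum (fun x => (`|g x| + g x)%R)) - fine (nsum (fun x => (`|g x|)%R)).

Lemma nsum_ge0 (T : choiceType) (g : T -> R) :
  (forall x, 0 <= g x) -> (0 <= nsum g)%E.
Proof. by move=> g0; apply: esum_ge0 => x _; rewrite lee_fin. Qed.

Lemma le_nsum (T : choiceType) (f g : T -> R) :
  (forall x, f x <= g x) -> (nsum f <= nsum g)%E.
Proof. by move=> fg; apply: le_esum => x _; rewrite lee_fin. Qed.

Lemma nsumD (T : choiceType) (f g : T -> R) :
  (forall x, 0 <= f x) -> (forall x, 0 <= g x) ->
  nsum (fun x => (f x + g x)%R) = (nsum f + nsum g)%E.
Proof.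
move=> f0 g0; rewrite /nsum -esumD; last 2 first.
- by move=> x _; rewrite lee_fin.
- by move=> x _; rewrite lee_fin.
by apply: eq_esum => x _; rewrite EFinD.
Qed.

Lemma nsum_fin_num (T : choiceType) (g : T -> R) :
  (forall x, 0 <= g x) -> (nsum g < +oo)%E -> nsum g \is a fin_num.
Proof. by move=> g0 goo; rewrite ge0_fin_numE// nsum_ge0. Qed.

Lemma nsum0 (T : choiceType) : nsum (fun _ : T => 0) = 0%E.
Proof. by rewrite /nsum esum1. Qed.

Lemma rsummable_le (T : choiceType) (f g : T -> R) :
  (forall x, `|f x| <= g x) -> rsummable g -> rsummable f.
Proof.
move=> fg; apply: le_lt_trans; apply: le_nsum => x.
exact: le_trans (fg x) (ler_norm _).
Qed.

Lemma rsummable_ge0 (T : choiceType) (g : T -> R) :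
  (forall x, 0 <= g x) -> rsummable g = (nsum g < +oo)%E :> Prop.
Proof.
move=> g0; rewrite /rsummable (_ : (fun x => `|g x|) = g)//.
by apply/funext => x; rewrite ger0_norm.
Qed.

Lemma rsummable_norm (T : choiceType) (g : T -> R) :
  rsummable g -> rsummable (fun x => `|g x|).
Proof.
apply: le_lt_trans; apply: le_nsum => x; by rewrite normr_id.
Qed.

Lemma rsummableD (T : choiceType) (f g : T -> R) :
  rsummable f -> rsummable g -> rsummable (fun x => f x + g x).
Proof.
move=> sf sg; apply: (@rsummable_le _ _ (fun x => `|f x| + `|g x|)).
  by move=> x; exact: ler_normD.
rewrite rsummable_ge0; last by move=> x /=; rewrite addr_ge0 ?normr_ge0.
by rewrite nsumD// lte_add_pinfty.
Qed.

(** Only additivity of extended sums is at hand: natural multiples follow by induction, and a scalar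
    is dominated by a natural number. *)
Lemma rsummableZ (T : choiceType) (c : R) (f : T -> R) :
  rsummable f -> rsummable (fun x => c * f x).
Proof.
have H n : rsummable f -> rsummable (fun x => f x *+ n).
  move=> sf; elim: n => [|n IH].
    rewrite /rsummable /nsum esum1// => x _.
    by rewrite mulr0n normr0.
  apply: (@rsummable_le _ _ (fun x => `|f x *+ n| + `|f x|)).
    by move=> x; rewrite mulrSr; exact: ler_normD.
  by apply: rsummableD; exact: rsummable_norm.
move=> sf; have [n cn] : exists n : nat, `|c| <= n%:R.
  by exists (Num.truncn `|c|).+1; exact/ltW/truncnS_gt.
apply: (@rsummable_le _ _ (fun x => `|f x *+ n|)).
  move=> x; rewrite normrM -mulr_natl normrM ler_wpM2r//.
  by rewrite (ger0_norm (ler0n R n)).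
exact/rsummable_norm/H.
Qed.

(** Every splitting into nonnegative summable parts gives the same value. The identity
    [(|g| + g) + b = |g| + a] is summed instead of a difference, so that no infinite quantities are
    subtracted. *)
Lemma rsumB_nneg (T : choiceType) (g a b : T -> R) :
  (forall x, 0 <= a x) -> (forall x, 0 <= b x) ->
  (nsum a < +oo)%E -> (nsum b < +oo)%E ->
  (forall x, g x = a x - b x) ->
  rsum g = fine (nsum a) - fine (nsum b).
Proof.
move=> a0 b0 sa sb gab; rewrite /rsum.
have p0 x : 0 <= `|g x| + g x by have := ler_norm (- g x); rewrite normrN; lra.
have E : (nsum (fun x => (`|g x| + g x)%R) + nsum b = nsum (fun x => (`|g x|)%R) + nsum a)%E.
  rewrite -!nsumD//; congr nsum; apply/funext => x; rewrite gab; lra.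
have sg : (nsum (fun x => (`|g x|)%R) < +oo)%E.
  apply: le_lt_trans (_ : (nsum (fun x => (a x + b x)%R) < +oo)%E).
    apply: le_nsum => x; rewrite gab; apply: le_trans (ler_normB _ _) _.
    by rewrite !ger0_norm.
  by rewrite nsumD// lte_add_pinfty.
have sp : (nsum (fun x => (`|g x| + g x)%R) < +oo)%E.
  apply: le_lt_trans (_ : (nsum (fun x => (`|g x| + `|g x|)%R) < +oo)%E).
    by apply: le_nsum => x; rewrite lerD2l ler_norm.
  by rewrite nsumD// lte_add_pinfty.
have n1 := nsum_fin_num p0 sp; have n2 := nsum_fin_num a0 sa.
have n3 := nsum_fin_num b0 sb.
have n4 := nsum_fin_num (fun x => normr_ge0 (g x)) sg.
have := congr1 fine E; rewrite !fineD//; lra.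
Qed.

Lemma rsum_nneg (T : choiceType) (g : T -> R) :
  (forall x, 0 <= g x) -> rsummable g -> rsum g = fine (nsum g).
Proof.
move=> g0 sg; rewrite (@rsumB_nneg _ g g (fun=> 0))//; last by move=> x; rewrite subr0.
- by rewrite nsum0 subr0.
- by rewrite -rsummable_ge0.
- by rewrite nsum0.
Qed.

Lemma nsum_rsum (T : choiceType) (g : T -> R) :
  (forall x, 0 <= g x) -> rsummable g -> nsum g = (rsum g)%:E.
Proof.
move=> g0 sg; rewrite rsum_nneg// fineK// nsum_fin_num//.
by rewrite -rsummable_ge0.
Qed.

Lemma rsumE (T : choiceType) (g : T -> R) : rsummable g ->
  rsum g = rsum (fun x => `|g x| + g x) - rsum (fun x => `|g x|).
Proof.
move=> sg.
have p0 x : 0 <= `|g x| + g x by have := ler_norm (- g x); rewrite normrN; lra.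
have sn := rsummable_norm sg; have sp := rsummableD sn sg.
by rewrite (rsum_nneg p0 sp) (rsum_nneg (fun x => normr_ge0 (g x)) sn).
Qed.

Lemma rsumD (T : choiceType) (f g : T -> R) : rsummable f -> rsummable g ->
  rsum (fun x => f x + g x) = rsum f + rsum g.
Proof.
move=> sf sg.
have p0 (h : T -> R) x : 0 <= `|h x| + h x.
  by have := ler_norm (- h x); rewrite normrN; lra.
have sp (h : T -> R) : rsummable h -> (nsum (fun x => (`|h x| + h x)%R) < +oo)%E.
  move=> sh; rewrite -rsummable_ge0//.
  by apply: rsummableD => //; exact: rsummable_norm.
rewrite (@rsumB_nneg _ _ (fun x => (`|f x| + f x) + (`|g x| + g x))
           (fun x => `|f x| + `|g x|)).
- have n1 := nsum_fin_num (p0 f) (sp f sf); have n2 := nsum_fin_num (p0 g) (sp g sg).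
  have n3 := nsum_fin_num (fun x => normr_ge0 (f x)) sf.
  have n4 := nsum_fin_num (fun x => normr_ge0 (g x)) sg.
  rewrite [in LHS]nsumD// [X in _ - fine X]nsumD// !fineD//.
  by rewrite /rsum opprD addrACA.
- by move=> x; rewrite addr_ge0.
- by move=> x; rewrite addr_ge0.
- by rewrite nsumD// lte_add_pinfty//; apply: sp.
- by rewrite nsumD// lte_add_pinfty.
- by move=> x; lra.
Qed.

Lemma rsumN (T : choiceType) (f : T -> R) : rsummable f ->
  rsum (fun x => - f x) = - rsum f.
Proof.
move=> sf.
have p0 (h : T -> R) x : 0 <= `|h x| + h x.
  by have := ler_norm (- h x); rewrite normrN; lra.
rewrite (@rsumB_nneg _ _ (fun x => `|f x|) (fun x => `|f x| + f x)).
- by rewrite /rsum opprB.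
- by [].
- by [].
- by [].
- rewrite -rsummable_ge0//.
  by apply: rsummableD => //; exact: rsummable_norm.
- by move=> x; lra.
Qed.

Lemma rsum_ge0 (T : choiceType) (f : T -> R) : (forall x, 0 <= f x) ->
  0 <= rsum f.
Proof.
move=> f0; rewrite /rsum (_ : (fun x => `|f x| + f x) = (fun x => f x + f x)); last first.
  by apply/funext => x; rewrite ger0_norm.
rewrite (_ : (fun x => `|f x|) = f); last by apply/funext => x; rewrite ger0_norm.
rewrite nsumD//; have := nsum_ge0 f0; case: (nsum f) => //= r; rewrite ?subrr//.
by rewrite lee_fin; lra.
Qed.

Lemma ler_rsum (T : choiceType) (f g : T -> R) : rsummable f -> rsummable g ->
  (forall x, f x <= g x) -> rsum f <= rsum g.
Proof.
move=> sf sg fg; rewrite -subr_ge0 -rsumN// -rsumD//; last first.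
  by apply: rsummable_le (rsummable_norm sf) => x; rewrite normrN.
by apply: rsum_ge0 => x; rewrite subr_ge0.
Qed.

Lemma rsum0 (T : choiceType) : rsum (fun _ : T => 0) = 0.
Proof.
by rewrite /rsum /nsum !esum1 ?subrr// => x _; rewrite normr0 ?addr0.
Qed.

Lemma rsummable0 (T : choiceType) : rsummable (fun _ : T => 0).
Proof. by rewrite /rsummable /nsum esum1// => x _; rewrite normr0. Qed.

Lemma rsumZ (T : choiceType) (c : R) (f : T -> R) : rsummable f ->
  rsum (fun x => c * f x) = c * rsum f.
Proof.
(* a monotone additive function of c is linear *)
move=> sf; wlog f0 : f sf / forall x, 0 <= f x => [H|].
  have p0 x : 0 <= `|f x| + f x.
    by have := ler_norm (- f x); rewrite normrN; lra.
  have sp := rsummableD (rsummable_norm sf) sf.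
  rewrite (rsumE sf) mulrBr -!H//; last exact: rsummable_norm.
  rewrite -rsumN; last exact/rsummableZ/rsummable_norm.
  rewrite -rsumD; first by congr rsum; apply/funext => x; ring.
    exact: rsummableZ.
  by apply: rsummable_le (rsummableZ `|c| (rsummable_norm sf)) => x;
     rewrite normrN normrM normr_id.
pose F c := rsum (fun x => c * f x).
have FD a b : F (a + b) = F a + F b.
  rewrite /F -rsumD; try exact: rsummableZ.
  by congr rsum; apply/funext => x; rewrite mulrDl.
have F1 : F 1 = rsum f by congr rsum; apply/funext => x; rewrite mul1r.
have Fle a b : a <= b -> F a <= F b.
  move=> ab; apply: ler_rsum; try exact: rsummableZ.
  by move=> x; rewrite ler_wpM2r.
have F0 : F 0 = 0.
  rewrite /F (_ : (fun x => 0 * f x) = fun=> 0) ?rsum0//.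
  by apply/funext => x; rewrite mul0r.
have FN a : F (- a) = - F a by apply/eqP; rewrite -addr_eq0 -FD addNr F0.
have Fn a n : F (a *+ n) = F a *+ n.
  by elim: n => [|n IH]; rewrite ?mulr0n// !mulrS FD IH.
have Fz a (z : int) : F (z%:~R * a) = z%:~R * F a.
  case: z => n; first by rewrite -!pmulrn !mulr_natl Fn.
  by rewrite NegzE !mulrNz !mulNr FN -!pmulrn !mulr_natl Fn.
have L0 := rsum_ge0 f0.
(* The floor of [c * (n + 1)] puts [F c] and [c * F 1] into one interval of length [F 1 / (n + 1)];
   as [n] is arbitrary they agree. *)
have key n : `|F c - c * F 1| *+ n.+1 <= F 1.
  pose z := Num.floor (c * n.+1%:R).
  have /andP[zl zu] : z%:~R <= c * n.+1%:R < (z + 1)%:~R by exact: floor_itv.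
  have e : F (c * n.+1%:R) = F c *+ n.+1 by rewrite mulr_natr Fn.
  have u : F c *+ n.+1 <= (z + 1)%:~R * F 1.
    by rewrite -e -Fz mulr1; apply/Fle/ltW.
  have l : z%:~R * F 1 <= F c *+ n.+1.
    by rewrite -e -Fz mulr1; apply/Fle.
  rewrite intrD in zu u; rewrite mulrDl mul1r in u.
  rewrite F1 in u l *.
  have zl' := ler_wpM2r L0 zl; have zu' := ler_wpM2r L0 (ltW zu).
  rewrite mulrDl mul1r in zu'.
  rewrite -mulr_natr -(ger0_norm (ler0n R n.+1)) -normrM mulrBl ler_norml.
  rewrite -mulr_natr in u l.
  set N : R := n.+1%:R in zl' zu' u l *.
  by apply/andP; split; lra.
rewrite -F1 -/(F c); apply/eqP; rewrite -subr_eq0 -normr_eq0; apply/eqP.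
apply/eqP; apply/negPn/negP => ne0.
have pos : 0 < `|F c - c * F 1| by rewrite lt_def ne0 normr_ge0.
have := key (Num.truncn (F 1 / `|F c - c * F 1|)).
rewrite leNgt => /negP; apply.
rewrite -mulr_natr mulrC -ltr_pdivrMr//; exact: truncnS_gt.
Qed.

Lemma reindex_rsum (T U : choiceType) (h : T -> U) (g : U -> R) :
  bijective h -> rsum (fun x => g (h x)) = rsum g.
Proof.
move=> bh; have sb : set_bij [set: T] [set: U] h.
  split => //; first by move=> x y _ _; apply: bij_inj.
  by move=> y _; case: bh => k kK hK; exists (k y).
rewrite /rsum /nsum.
rewrite -(@reindex_esum R T U _ _ h (fun y => (`|g y| + g y)%:E) sb).
by rewrite -(@reindex_esum R T U _ _ h (fun y => `|g y|%:E) sb).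
Qed.

Lemma reindex_rsummable (T U : choiceType) (h : T -> U) (g : U -> R) :
  bijective h -> rsummable (fun x => g (h x)) <-> rsummable g.
Proof.
move=> bh; have sb : set_bij [set: T] [set: U] h.
  split => //; first by move=> x y _ _; apply: bij_inj.
  by move=> y _; case: bh => k kK hK; exists (k y).
by rewrite /rsummable /nsum -(@reindex_esum R T U _ _ h (fun y => `|g y|%:E) sb).
Qed.

Lemma nsum_pair (T U : choiceType) (g : T * U -> R) :
  (forall p, 0 <= g p) ->
  nsum g = (\esum_(x in [set: T]) nsum (fun y => (g (x, y))%R))%E.
Proof.
move=> g0; rewrite /nsum esum_esum; last by move=> *; rewrite lee_fin.
rewrite (_ : [set: T] `*`` (fun=> [set: U]) = setT); last first.
  by apply/seteqP; split.
by apply: eq_esum => -[].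
Qed.

Lemma rsummable_pair (T U : choiceType) (g : T * U -> R) : rsummable g ->
  [/\ forall x, rsummable (fun y => g (x, y)),
      rsummable (fun x => rsum (fun y => `|g (x, y)|)) &
      rsummable (fun x => rsum (fun y => g (x, y)))].
Proof.
move=> sg; have h x : rsummable (fun y => g (x, y)).
  move: sg; rewrite /rsummable nsum_pair//; apply: le_lt_trans.
  rewrite (esumID [set x])//; last by move=> *; exact: nsum_ge0.
  rewrite setTI esum_set1//; last exact: nsum_ge0.
  by rewrite leeDl// esum_ge0// => *; exact: nsum_ge0.
have h2 : rsummable (fun x => rsum (fun y => `|g (x, y)|)).
  rewrite rsummable_ge0; last by move=> x; exact: rsum_ge0.
  move: sg; rewrite /rsummable nsum_pair//; apply: le_lt_trans.
  by apply: le_esum => x _; rewrite nsum_rsum//; exact: rsummable_norm.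
split => //; apply: rsummable_le h2 => x.
rewrite ler_norml -rsumN; last exact: rsummable_norm.
have nh := rsummable_norm (h x).
have nh' : rsummable (fun y => - `|g (x, y)|).
  by apply: rsummable_le nh => y; rewrite normrN normr_id.
apply/andP; split; apply: (ler_rsum _ _) => // y; last exact: ler_norm.
by rewrite lerNl -normrN ler_norm.
Qed.

(** Tonelli settles the nonnegative families [|g| + g] and [|g|]; the general case is their
    difference. *)
Lemma rsum_pair (T U : choiceType) (g : T * U -> R) : rsummable g ->
  rsum g = rsum (fun x => rsum (fun y => g (x, y))).
Proof.
have H (k : T * U -> R) : (forall p, 0 <= k p) -> rsummable k ->
    rsum k = rsum (fun x => rsum (fun y => k (x, y))).
  move=> k0 sk; have [s1 s2 s3] := rsummable_pair sk.
  apply: EFin_inj; rewrite -nsum_rsum// -nsum_rsum//; last first.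
    by move=> x; exact: rsum_ge0.
  by rewrite nsum_pair//; apply: eq_esum => x _; rewrite nsum_rsum.
move=> sg; have [s1 s2 s3] := rsummable_pair sg.
have p0 x : 0 <= `|g x| + g x by have := ler_norm (- g x); rewrite normrN; lra.
rewrite (rsumE sg) !H//; last 2 first.
- exact: rsummable_norm.
- by apply: rsummableD => //; exact: rsummable_norm.
rewrite -rsumN// -rsumD//; last 2 first.
- have := rsummable_pair (rsummableD (rsummable_norm sg) sg).
  by case.
- by apply: rsummable_le (rsummable_norm s2) => x; rewrite normrN.
congr rsum; apply/funext => x.
by rewrite rsumD//; [rewrite addrAC subrr add0r|exact: rsummable_norm].
Qed.

Lemma rsummable_prod (T U : choiceType) (g : T * U -> R) (k : T -> R) :
  (forall p, 0 <= g p) ->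
  (forall x, rsummable (fun y => g (x, y))) ->
  (forall x, rsum (fun y => g (x, y)) <= k x) -> rsummable k ->
  rsummable g.
Proof.
move=> g0 s1 gk sk; rewrite rsummable_ge0// nsum_pair//.
have k0 x : 0 <= k x by apply: le_trans (gk x); exact: rsum_ge0.
move: sk; rewrite rsummable_ge0//; apply: le_lt_trans.
by apply: le_esum => x _; rewrite nsum_rsum// lee_fin.
Qed.

Lemma rsum_fsupp (T : choiceType) (s : seq T) (g : T -> R) :
  uniq s -> (forall x, x \notin s -> g x = 0) ->
  rsummable g /\ rsum g = \sum_(x <- s) g x.
Proof.
elim: s g => [|a s IH] g /=.
  move=> _ g0; have -> : g = fun=> 0 by apply/funext => x; exact: g0.
  by rewrite rsum0 big_nil; split => //; exact: rsummable0.
move=> /andP[ans us] g0.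
pose g1 x := if x == a then g a else 0; pose g2 x := if x == a then 0 else g x.
have gE : g = fun x => g1 x + g2 x.
  apply/funext => x; rewrite /g1 /g2; case: eqP => [->|_]; first by rewrite addr0.
  by rewrite add0r.
have [] := IH g2 us.
  move=> x xs; rewrite /g2; case: eqP => // /eqP xa.
  by apply: g0; rewrite inE negb_or xa.
move=> s2 r2.
have n1 (k : R) : nsum (fun x => (if x == a then `|k| else 0)%R) = `|k|%:E.
  rewrite /nsum (esumID [set a])//; last by move=> x _; case: ifP => //; rewrite lee_fin.
  rewrite setTI esum_set1 ?eqxx//.
  rewrite esum1 ?adde0// => x [_ /= xa].
  by case: eqP => // /xa.
have s1 : rsummable g1.
  rewrite /rsummable (_ : (fun x => `|g1 x|) = (fun x => if x == a then `|g a| else 0)).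
    by rewrite n1 ltry.
  by apply/funext => x; rewrite /g1; case: ifP => // _; rewrite normr0.
split; first by rewrite gE; exact: rsummableD.
rewrite gE rsumD// big_cons r2; congr (_ + _).
  rewrite (@rsumB_nneg _ _ (fun x => if x == a then `|(`|g a| + g a)| else 0)
     (fun x => if x == a then `|(`|g a|)| else 0)).
  - rewrite !n1 /= normr_id /g1 /g2 eqxx addr0 ger0_norm; first by ring.
    by have := ler_norm (- g a); rewrite normrN; lra.
  - by move=> x; case: ifP.
  - by move=> x; case: ifP.
  - by rewrite n1 ltry.
  - by rewrite n1 ltry.
  - move=> x; rewrite /g1; case: ifP => _; last by rewrite subr0.
    rewrite normr_id ger0_norm; first by ring.
    by have := ler_norm (- g a); rewrite normrN; lra.
rewrite big_seq [RHS]big_seq; apply: eq_bigr => x xs; rewrite /g1 /g2.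
by case: eqP => [xa|_]; [rewrite -xa xs in ans|rewrite add0r].
Qed.

Lemma rsummable_bounded (T : choiceType) (g : T -> R) (B : R) :
  (forall x, 0 <= g x) ->
  (forall s, uniq s -> \sum_(x <- s) g x <= B) ->
  rsummable g /\ rsum g <= B.
Proof.
move=> g0 gB; have n : (nsum g <= B%:E)%E.
  apply: ge_ereal_sup => _ [X [finX _] <-].
  by rewrite fsbig_finite//= sumEFin lee_fin gB// fset_uniq.
have s : rsummable g by rewrite rsummable_ge0//; apply: le_lt_trans n _; rewrite ltry.
by split => //; rewrite -lee_fin -nsum_rsum.
Qed.

Lemma fsum_le_rsum (T : choiceType) (g : T -> R) (s : seq T) :
  (forall x, 0 <= g x) -> rsummable g -> uniq s -> \sum_(x <- s) g x <= rsum g.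
Proof.
move=> g0 sg us.
have [] := @rsum_fsupp _ s (fun x => if x \in s then g x else 0) us.
  by move=> x /negbTE ->.
move=> s1; rewrite big_seq (eq_bigr g); last by move=> x ->.
rewrite -big_seq => <-; apply: ler_rsum => // x; by case: ifP.
Qed.

End RealSum.

(** * Complex sums *)

Section Normc.
Variable R : realType.
Implicit Types z : R[i].

Lemma nrm_ge0 z : 0 <= nrm z. Proof. by case: z => a b /=; exact: sqrtr_ge0. Qed.

Lemma nrm0P z : (nrm z == 0) = (z == 0).
Proof.
apply/eqP/eqP => [|->]; first exact: Normc.eq0_normc.
exact: Normc.normc0.
Qed.

Lemma nrm_real (x : R) : nrm x%:C = `|x|.
Proof. by rewrite /= expr0n /= addr0 sqrtr_sqr. Qed.

Lemma nrmB z1 z2 : nrm (z1 - z2) <= nrm z1 + nrm z2.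
Proof. by apply: le_trans (le_normcD _ _) _; rewrite normcN. Qed.

Lemma nrm_Re z : `|cRe z| <= nrm z.
Proof.
case: z => a b /=; rewrite -[leLHS]sqrtr_sqr ler_sqrt ?lerDl ?sqr_ge0//.
by rewrite addr_ge0 ?sqr_ge0.
Qed.

Lemma nrm_Im z : `|cIm z| <= nrm z.
Proof.
case: z => a b /=; rewrite -[leLHS]sqrtr_sqr ler_sqrt ?lerDr ?sqr_ge0//.
by rewrite addr_ge0 ?sqr_ge0.
Qed.

Lemma nrm_le_ReIm z : nrm z <= `|cRe z| + `|cIm z|.
Proof.
have -> : z = (cRe z)%:C + (cIm z)%:C * 'i.
  by case: z => a b; rewrite /=; congr Complex; ring.
apply: le_trans (le_normcD _ _) _; rewrite Normc.normcM !nrm_real /=.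
by rewrite !(mul0r, mulr0, mulr1, addr0, subr0, add0r, expr0n, expr1n) /= sqrtr1 mulr1.
Qed.

Lemma cReD z1 z2 : cRe (z1 + z2) = cRe z1 + cRe z2.
Proof. by case: z1 z2 => a b []. Qed.

Lemma cImD z1 z2 : cIm (z1 + z2) = cIm z1 + cIm z2.
Proof. by case: z1 z2 => a b []. Qed.

Lemma cReM z1 z2 : cRe (z1 * z2) = cRe z1 * cRe z2 - cIm z1 * cIm z2.
Proof. by case: z1 z2 => a b []. Qed.

Lemma cImM z1 z2 : cIm (z1 * z2) = cRe z1 * cIm z2 + cIm z1 * cRe z2.
Proof. by case: z1 z2 => a b []. Qed.

Lemma cReN z : cRe (- z) = - cRe z. Proof. by case: z. Qed.

Lemma cImN z : cIm (- z) = - cIm z. Proof. by case: z. Qed.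

Lemma cRe_sum (I : Type) (s : seq I) (F : I -> R[i]) :
  cRe (\sum_(i <- s) F i) = \sum_(i <- s) cRe (F i).
Proof. by elim: s => [|a s IH]; rewrite ?big_nil// !big_cons cReD IH. Qed.

Lemma cIm_sum (I : Type) (s : seq I) (F : I -> R[i]) :
  cIm (\sum_(i <- s) F i) = \sum_(i <- s) cIm (F i).
Proof. by elim: s => [|a s IH]; rewrite ?big_nil// !big_cons cImD IH. Qed.

End Normc.

Section ComplexSum.
Variable R : realType.

Definition absum (T : choiceType) (f : T -> R[i]) : Prop :=
  rsummable (fun x => nrm (f x)).

Definition csum (T : choiceType) (f : T -> R[i]) : R[i] :=
  rsum (fun x => cRe (f x)) +i* rsum (fun x => cIm (f x)).

Lemma absum_le (T : choiceType) (f : T -> R[i]) (g : T -> R) :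
  (forall x, nrm (f x) <= g x) -> rsummable g -> absum f.
Proof. by move=> fg; apply: rsummable_le => x; rewrite ger0_norm ?nrm_ge0. Qed.

Lemma absum_Re (T : choiceType) (f : T -> R[i]) :
  absum f -> rsummable (fun x => cRe (f x)).
Proof. by apply: rsummable_le => x; exact: nrm_Re. Qed.

Lemma absum_Im (T : choiceType) (f : T -> R[i]) :
  absum f -> rsummable (fun x => cIm (f x)).
Proof. by apply: rsummable_le => x; exact: nrm_Im. Qed.

Lemma absumD (T : choiceType) (f g : T -> R[i]) :
  absum f -> absum g -> absum (fun x => f x + g x).
Proof.
by move=> sf sg; apply: absum_le (rsummableD sf sg) => x; exact: le_normcD.
Qed.

Lemma absumZ (T : choiceType) (c : R[i]) (f : T -> R[i]) :
  absum f -> absum (fun x => c * f x).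
Proof.
move=> sf; apply: absum_le (rsummableZ (nrm c) sf) => x.
by rewrite Normc.normcM.
Qed.

Lemma absumN (T : choiceType) (f : T -> R[i]) :
  absum f -> absum (fun x => - f x).
Proof. by apply: absum_le => x; rewrite normcN. Qed.

Lemma absumB (T : choiceType) (f g : T -> R[i]) :
  absum f -> absum g -> absum (fun x => f x - g x).
Proof. by move=> sf sg; exact/absumD/absumN. Qed.

Lemma csumD (T : choiceType) (f g : T -> R[i]) : absum f -> absum g ->
  csum (fun x => f x + g x) = csum f + csum g.
Proof.
move=> sf sg; rewrite /csum.
under [X in rsum X]eq_fun do rewrite cReD.
under [X in _ +i* rsum X]eq_fun do rewrite cImD.
have h1 := absum_Re sf; have h2 := absum_Re sg.
have h3 := absum_Im sf; have h4 := absum_Im sg.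
by rewrite (rsumD h1 h2) (rsumD h3 h4).
Qed.

Lemma csumZ (T : choiceType) (c : R[i]) (f : T -> R[i]) : absum f ->
  csum (fun x => c * f x) = c * csum f.
Proof.
move=> sf; have sR := absum_Re sf; have sI := absum_Im sf; rewrite /csum.
under [X in rsum X]eq_fun do rewrite cReM -mulNr.
under [X in _ +i* rsum X]eq_fun do rewrite cImM.
rewrite !rsumD ?rsumZ//; try exact: rsummableZ.
by case: c => a b /=; rewrite mulNr.
Qed.

Lemma csumZr (T : choiceType) (c : R[i]) (f : T -> R[i]) : absum f ->
  csum (fun x => f x * c) = csum f * c.
Proof.
by move=> sf; rewrite mulrC -csumZ//; congr csum; apply/funext => x; rewrite mulrC.
Qed.

Lemma csumN (T : choiceType) (f : T -> R[i]) : absum f ->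
  csum (fun x => - f x) = - csum f.
Proof.
move=> sf; rewrite -mulN1r -csumZ//; congr csum; apply/funext => x.
by rewrite mulN1r.
Qed.

Lemma csumB (T : choiceType) (f g : T -> R[i]) : absum f -> absum g ->
  csum (fun x => f x - g x) = csum f - csum g.
Proof. by move=> sf sg; rewrite csumD ?csumN//; exact: absumN. Qed.

Lemma absum0 (T : choiceType) : absum (fun _ : T => 0 : R[i]).
Proof. by apply: absum_le (rsummable0 R T) => x; rewrite Normc.normc0. Qed.

Lemma csum0 (T : choiceType) : csum (fun _ : T => 0 : R[i]) = 0.
Proof. by rewrite /csum /= !rsum0. Qed.

Lemma absum_sum (T : choiceType) (I : Type) (s : seq I) (f : I -> T -> R[i]) :
  (forall i, absum (f i)) -> absum (fun x => \sum_(i <- s) f i x).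
Proof.
move=> sf; elim: s => [|a s IH].
  under eq_fun do rewrite big_nil; exact: absum0.
by under eq_fun do rewrite big_cons; exact: absumD.
Qed.

Lemma csum_sum (T : choiceType) (I : Type) (s : seq I) (f : I -> T -> R[i]) :
  (forall i, absum (f i)) ->
  csum (fun x => \sum_(i <- s) f i x) = \sum_(i <- s) csum (f i).
Proof.
move=> sf; elim: s => [|a s IH].
  by under [X in csum X]eq_fun do rewrite big_nil; rewrite csum0 big_nil.
under [X in csum X]eq_fun do rewrite big_cons.
by rewrite csumD ?IH ?big_cons//; exact: absum_sum.
Qed.

Lemma nrm_csum (T : choiceType) (f : T -> R[i]) : absum f ->
  nrm (csum f) <= rsum (fun x => nrm (f x)).
Proof.
move=> sf; have [z0|z0] := eqVneq (nrm (csum f)) 0.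
  by rewrite z0; apply: rsum_ge0 => x; exact: nrm_ge0.
set z := csum f in z0 *; have zp : 0 < nrm z by rewrite lt_def z0 nrm_ge0.
(* rotate the sum to the positive real axis *)
pose w := z^* * ((nrm z)^-1)%:C.
have nw : nrm w = 1.
  rewrite /w Normc.normcM nrm_real ger0_norm ?invr_ge0 ?nrm_ge0//.
  have -> : nrm z^* = nrm z by case: (z) => a b /=; rewrite sqrrN.
  by rewrite divff.
have wz : cRe (w * z) = nrm z.
  rewrite /w mulrAC.
  have -> : z^* * z = (nrm z ^+ 2)%:C.
    case: (z) => a b /=; rewrite sqr_sqrtr ?addr_ge0 ?sqr_ge0//.
    by congr Complex; ring.
  by rewrite cReM /= mulr0 subr0 expr2 mulfK.
rewrite -wz -csumZ//=; apply: ler_rsum => //.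
  exact/absum_Re/absumZ.
move=> x; apply: (le_trans (ler_norm (cRe (w * f x)))).
apply: (le_trans (nrm_Re (w * f x))).
by rewrite Normc.normcM nw mul1r.
Qed.

Lemma nrm_csum_le (T : choiceType) (f : T -> R[i]) (g : T -> R) (B : R) :
  (forall x, nrm (f x) <= g x) -> rsummable g -> rsum g <= B ->
  nrm (csum f) <= B.
Proof.
move=> fg sg gB; have sf := absum_le fg sg.
by apply: le_trans (nrm_csum sf) _; apply: le_trans gB; exact: ler_rsum.
Qed.

Lemma reindex_csum (T U : choiceType) (h : T -> U) (g : U -> R[i]) :
  bijective h -> csum (fun x => g (h x)) = csum g.
Proof.
move=> bh; rewrite /csum (reindex_rsum (fun y => cRe (g y)) bh).
by rewrite (reindex_rsum (fun y => cIm (g y)) bh).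
Qed.

Lemma reindex_absum (T U : choiceType) (h : T -> U) (g : U -> R[i]) :
  bijective h -> absum (fun x => g (h x)) <-> absum g.
Proof. by move=> bh; exact: (reindex_rsummable (fun y => nrm (g y)) bh). Qed.

Lemma absum_pair (T U : choiceType) (g : T * U -> R[i]) : absum g ->
  (forall x, absum (fun y => g (x, y))) /\
  absum (fun x => csum (fun y => g (x, y))).
Proof.
move=> sg; have [h1 h2 h3] := rsummable_pair sg; split; first exact: h1.
apply: absum_le h3 => x; exact/nrm_csum/h1.
Qed.

Lemma csum_pair (T U : choiceType) (g : T * U -> R[i]) : absum g ->
  csum g = csum (fun x => csum (fun y => g (x, y))).
Proof.
move=> sg; rewrite {1}/csum (rsum_pair (absum_Re sg)).
by rewrite (rsum_pair (absum_Im sg)).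
Qed.

Lemma absum_prod (T U : choiceType) (g : T * U -> R[i]) (k : T -> R) :
  (forall x, absum (fun y => g (x, y))) ->
  (forall x, rsum (fun y => nrm (g (x, y))) <= k x) -> rsummable k ->
  absum g.
Proof.
move=> s1 gk sk; apply: (rsummable_prod (k := k)) => // p; exact: nrm_ge0.
Qed.

Lemma bij_swap (T U : Type) : bijective (fun p : T * U => (p.2, p.1)).
Proof. by exists (fun p : U * T => (p.2, p.1)); case. Qed.

Lemma absum_swap (T U : choiceType) (g : T * U -> R[i]) : absum g ->
  absum (fun p : U * T => g (p.2, p.1)).
Proof. by move=> sg; apply/(reindex_absum g (@bij_swap U T)). Qed.

Lemma csum_exchange (T U : choiceType) (g : T -> U -> R[i]) :
  absum (fun p : T * U => g p.1 p.2) ->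
  csum (fun x => csum (fun y => g x y)) = csum (fun y => csum (fun x => g x y)).
Proof.
move=> sg; have := csum_pair sg; have := csum_pair (absum_swap sg).
by rewrite (reindex_csum (fun p : T * U => g p.1 p.2) (@bij_swap U T)) /= => -> ->.
Qed.

Lemma csum_fsupp (T : choiceType) (s : seq T) (f : T -> R[i]) :
  uniq s -> (forall x, x \notin s -> f x = 0) ->
  absum f /\ csum f = \sum_(x <- s) f x.
Proof.
move=> us f0; split.
  apply: (rsum_fsupp us _).1 => x /f0 ->; exact: Normc.normc0.
rewrite /csum !(rsum_fsupp us _).2; try by move=> x /f0 ->.
by apply/eqP; rewrite eq_complex /= cRe_sum cIm_sum !eqxx.
Qed.

Lemma csum_one (T : choiceType) (a : T) (f : T -> R[i]) :
  (forall x, x != a -> f x = 0) -> absum f /\ csum f = f a.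
Proof.
move=> f0; have [//||sf ->] := @csum_fsupp T [:: a] f; last by rewrite big_seq1.
by move=> x; rewrite inE => /f0.
Qed.

Lemma rsum_approx (T : choiceType) (g : T -> R) (e : R) :
  (forall x, 0 <= g x) -> rsummable g -> 0 < e ->
  exists2 s, uniq s & rsum g - e < \sum_(x <- s) g x.
Proof.
move=> g0 sg e0; apply: contrapT => /forall2NP H.
have [] := @rsummable_bounded R T g (rsum g - e) g0.
  by move=> s us; have [//|/negP] := H s; rewrite -leNgt.
by move=> _; lra.
Qed.

(** Convergence along the net of finite index sets. Limits over boxes of integers and over initial
    segments are special cases, whatever the enumeration. *)
Lemma csum_approx (T : choiceType) (f : T -> R[i]) (e : R) :
  absum f -> 0 < e -> exists2 s, uniq s & forall s', uniq s' ->
    {subset s <= s'} -> nrm (csum f - \sum_(x <- s') f x) <= e.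
Proof.
move=> sf e0; have [|//||s us H] := @rsum_approx T (fun x => nrm (f x)) e.
- by move=> x; exact: nrm_ge0.
- exact: e0.
exists s => // s' us' ss'.
pose f1 x := if x \in s' then f x else 0; pose f2 x := if x \in s' then 0 else f x.
have [s1 e1] : absum f1 /\ csum f1 = \sum_(x <- s') f1 x.
  by apply: csum_fsupp => // x /negbTE xs; rewrite /f1 xs.
have s2 : absum f2.
  by apply: absum_le sf => x; rewrite /f2; case: ifP; rewrite ?Normc.normc0 ?nrm_ge0.
have fE : f = fun x => f1 x + f2 x.
  by apply/funext => x; rewrite /f1 /f2; case: ifP; rewrite ?addr0 ?add0r.
have e1' : \sum_(x <- s') f1 x = \sum_(x <- s') f x.
  by rewrite big_seq [RHS]big_seq; apply: eq_bigr => x xs; rewrite /f1 xs.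
have -> : csum f - \sum_(x <- s') f x = csum f2.
  by rewrite {1}fE csumD// e1 e1' addrAC subrr add0r.
apply: le_trans (nrm_csum s2) _.
have nE : rsum (fun x => nrm (f x)) = rsum (fun x => nrm (f1 x)) + rsum (fun x => nrm (f2 x)).
  rewrite -rsumD//; congr rsum; apply/funext => x; rewrite /f1 /f2.
  by case: ifP; rewrite Normc.normc0 ?addr0 ?add0r.
have : rsum (fun x => nrm (f1 x)) = \sum_(x <- s') nrm (f x).
  rewrite (@rsum_fsupp _ _ s' _ us' _).2.
    by rewrite big_seq [RHS]big_seq; apply: eq_bigr => x xs; rewrite /f1 xs.
  by move=> x /negbTE xs; rewrite /f1 xs Normc.normc0.
have : \sum_(x <- s) nrm (f x) <= \sum_(x <- s') nrm (f x).
  pose g x := if x \in s then nrm (f x) else 0.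
  have gs : \sum_(x <- s) g x = \sum_(x <- s) nrm (f x).
    by rewrite big_seq [RHS]big_seq; apply: eq_bigr => x xs; rewrite /g xs.
  have gs' : rsum g = \sum_(x <- s') g x.
    apply: (rsum_fsupp us' _).2 => x xs'; rewrite /g.
    by case: ifP => // /ss'; rewrite (negbTE xs').
  rewrite -gs -(rsum_fsupp us (g := g) _).2; last by move=> x /negbTE xs; rewrite /g xs.
  rewrite gs'; apply: ler_sum => x _; rewrite /g; case: ifP => // _; exact: nrm_ge0.
lra.
Qed.

End ComplexSum.

(** * Sums over the integers *)

Section IntSum.
Variable R : realType.

Definition zbox (N : nat) : seq int := [seq i%:Z - N%:Z | i <- iota 0 N.*2.+1].

Lemma mem_zbox (N : nat) (z : int) : (z \in zbox N) = (`|z| <= N)%N.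
Proof.
apply/mapP/idP => [[j]|zN].
  by rewrite mem_iota => /andP[_ jN] ->; lia.
by exists (absz (z + N%:Z)); [rewrite mem_iota; lia|lia].
Qed.

Lemma zbox_uniq N : uniq (zbox N).
Proof. by rewrite map_inj_uniq ?iota_uniq// => i j; lia. Qed.

Lemma sum_zbox (V : nmodType) (N : nat) (f : int -> V) :
  \sum_(x <- zbox N) f x = \sum_(i < N.*2.+1) f (i%:Z - N%:Z).
Proof. by rewrite big_map -{1}(subn0 N.*2.+1) -/(index_iota 0 _) big_mkord. Qed.

Lemma seq_sub_zbox (s : seq int) : exists N0, forall N, (N0 <= N)%N ->
  {subset s <= zbox N}.
Proof.
elim: s => [|a s [N0 H]]; first by exists 0%N.
exists (maxn `|a| N0) => N; rewrite geq_max => /andP[aN N0N] x.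
rewrite inE => /orP[/eqP->|]; first by rewrite mem_zbox.
exact: H.
Qed.

Lemma csum_zbox (f : int -> R[i]) (e : R) : absum f -> 0 < e ->
  exists N0, forall N, (N0 <= N)%N ->
  nrm (csum f - \sum_(i < N.*2.+1) f (i%:Z - N%:Z)) <= e.
Proof.
move=> sf e0; have [s us H] := csum_approx sf e0.
have [N0 HN] := seq_sub_zbox s; exists N0 => N NN.
by rewrite -sum_zbox; apply: H; [exact: zbox_uniq|exact: HN].
Qed.

(** Links the sums of the statement, which are limits over symmetric boxes, to the order-free [csum]
    of the proof. *)
Lemma zsum_csum (f : int -> R[i]) : absum f -> zsum f = csum f.
Proof.
move=> sf; rewrite /zsum.
have H (g : R[i] -> R) (l : R) : (forall z, `|g z| <= nrm z) ->
    (forall (s : seq int) (F : int -> R[i]),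
        g (csum f - \sum_(i <- s) F i) = l - \sum_(i <- s) g (F i)) ->
    limn (fun N : nat => \sum_(i < N.*2.+1) g (f (i%:Z - N%:Z))) = l.
  move=> gn gs; apply/cvg_lim => //; apply/cvgrPdist_le => e e0.
  have [N0 HN] := csum_zbox sf e0; near=> N.
  rewrite -(sum_zbox N (fun x => g (f x))) -gs; apply: le_trans (gn _) _.
  rewrite sum_zbox; apply: HN; near: N; exact: nbhs_infty_ge.
rewrite (H _ (rsum (fun x => cRe (f x))))//; last 2 first.
- exact: nrm_Re.
- by move=> s F; rewrite cReD cReN cRe_sum.
rewrite (H _ (rsum (fun x => cIm (f x))))//.
- exact: nrm_Im.
- by move=> s F; rewrite cImD cImN cIm_sum.
Unshelve. all: by end_near.
Qed.

Lemma nrm_le_eps (z : R[i]) : (forall e : R, 0 < e -> nrm z <= e) -> z = 0.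
Proof.
move=> H; apply/eqP; rewrite -nrm0P; apply/negPn/negP => z0.
have zp : 0 < nrm z by rewrite lt_def z0 nrm_ge0.
by have := H (nrm z / 2) (divr_gt0 zp (ltr0Sn _ 1)); lra.
Qed.

Lemma telescope_box (H : int -> R[i]) (N : nat) :
  \sum_(i < N.*2.+1) (H (i%:Z - N%:Z + 1) - H (i%:Z - N%:Z)) =
  H (N%:Z + 1) - H (- N%:Z).
Proof.
have : \sum_(0 <= i < N.*2.+1) (H (i.+1%:Z - N%:Z) - H (i%:Z - N%:Z)) =
    H (N.*2.+1%:Z - N%:Z) - H (0%:Z - N%:Z).
  by rewrite telescope_sumr.
rewrite big_mkord (_ : N.*2.+1%:Z - N%:Z = N%:Z + 1); last by lia.
rewrite (_ : 0%:Z - N%:Z = - N%:Z); last by lia.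
by move=> <-; apply: eq_bigr => i _; congr (H _ - _); lia.
Qed.

Lemma csum_telescope (H : int -> R[i]) (lp lm : R[i]) :
  absum (fun n : int => H (n + 1) - H n) ->
  (forall e : R, 0 < e -> exists N0, forall N : nat, (N0 <= N)%N ->
     nrm (H N%:Z - lp) <= e /\ nrm (H (- N%:Z) - lm) <= e) ->
  csum (fun n : int => H (n + 1) - H n) = lp - lm.
Proof.
move=> sH HL; apply/eqP; rewrite -subr_eq0; apply/eqP/nrm_le_eps => e e0.
have e3 : 0 < e / 3 by rewrite divr_gt0.
have [N1 H1] := csum_zbox sH e3; have [N2 H2] := HL _ e3.
pose N := maxn N1 N2.
have := H1 N (leq_maxl _ _); rewrite telescope_box.
have [_ b] := H2 N (leq_maxr _ _).
have [a _] := H2 N.+1 (leq_trans (leq_maxr _ _) (leqnSn _)).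
rewrite (_ : N.+1%:Z = N%:Z + 1) in a; last by lia.
set A := csum _; set B := H (_ + 1) in a *; set D := H _ in b *.
move=> c; have -> : A - (lp - lm) = (A - (B - D)) + ((B - lp) - (D - lm)) by ring.
apply: le_trans (le_normcD _ _) _; have := nrmB (B - lp) (D - lm); lra.
Qed.

Lemma rsummable_zbox (g : int -> R) (B : R) : (forall z, 0 <= g z) ->
  (forall N : nat, \sum_(i < N.*2.+1) g (i%:Z - N%:Z) <= B) ->
  rsummable g /\ rsum g <= B.
Proof.
move=> g0 gB; apply: rsummable_bounded => // s us.
have [N HN] := seq_sub_zbox s; apply: le_trans (gB N).
rewrite -sum_zbox; pose h x := if x \in s then g x else 0.
have hs : \sum_(x <- s) h x = \sum_(x <- s) g x.
  by rewrite big_seq [RHS]big_seq; apply: eq_bigr => x xs; rewrite /h xs.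
rewrite -hs -(rsum_fsupp us (g := h) _).2; last by move=> x /negbTE xs; rewrite /h xs.
rewrite (rsum_fsupp (zbox_uniq N) (g := h) _).2; last first.
  move=> x xs; rewrite /h; case: ifP => // /(HN _ (leqnn _)); by rewrite (negbTE xs).
by apply: ler_sum => x _; rewrite /h; case: ifP.
Qed.

(** An integral test: [phi] plays the part of the integral of [g] from [x] to infinity, and the two
    half-lines give the factor 2. *)
Lemma rsummable_decay (g phi : R -> R) (a : R) :
  1 <= a -> (forall x, 1 <= x -> 0 <= g x) -> (forall x, 1 <= x -> 0 <= phi x) ->
  (forall x, 1 <= x -> g x <= phi x - phi (x + 1)) ->
  rsummable (fun k : int => g (a + `|k|%:~R)) /\
  rsum (fun k : int => g (a + `|k|%:~R)) <= 2 * phi a.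
Proof.
move=> a1 g0 p0 gp.
have nk (k : int) : 0 <= `|k|%:~R :> R by rewrite ler0z.
apply: rsummable_zbox => [z|N]; first by apply: g0; have := nk z; lra.
apply: (@le_trans _ _ (2 * (phi a - phi (a + N%:R + 1)))); last first.
  have : 0 <= phi (a + N%:R + 1) by apply: p0; have := ler0n R N; lra.
  lra.
elim: N => [|N IH].
  rewrite big_ord1 /= subrr normr0 addr0.
  by have := gp _ a1; have := g0 _ a1; lra.
rewrite doubleS big_ord_recl big_ord_recr /=.
rewrite (eq_bigr (fun i : 'I_N.*2.+1 => g (a + `|i%:Z - N%:Z|%:~R))); last first.
  by move=> i _; congr (g (a + _%:~R)); rewrite /bump /=; lia.
set S := (X in _ + (X + _) <= _).
have e1 : a + `|0%:Z - N.+1%:Z|%:~R = a + N%:R + 1 :> R.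
  rewrite -addrA; congr (_ + _); rewrite (_ : `|_| = N.+1%:Z); last by lia.
  by rewrite -pmulrn -natr1.
have e2 : a + `|(bump 0 N.*2.+1)%:Z - N.+1%:Z|%:~R = a + N%:R + 1 :> R.
  rewrite (_ : `|_| = N.+1%:Z); last by rewrite /bump /=; lia.
  by rewrite -pmulrn -natr1 addrA.
rewrite e1 e2 -[N.+1%:R]natr1.
have x1 : 1 <= a + N%:R + 1 by have := ler0n R N; lra.
have := gp _ x1; rewrite [a + (N%:R + 1)]addrA => gx.
by move: IH; rewrite -/S; lra.
Qed.

End IntSum.

(** * Polynomial weights on the lattice *)

Section Weight.
Variable R : realType.

Definition wt (x : int * int) : R := 1 + `|x.1|%:~R + `|x.2|%:~R.

Lemma wt_ge1 x : 1 <= wt x.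
Proof. by rewrite /wt -addrA lerDl addr_ge0// ler0z. Qed.

Lemma wt_gt0 x : 0 < wt x. Proof. exact: lt_le_trans (wt_ge1 x). Qed.

Lemma wt_ge0 x : 0 <= wt x. Proof. exact/ltW/wt_gt0. Qed.

Lemma wt_neq0 x : wt x != 0. Proof. by rewrite gt_eqF ?wt_gt0. Qed.

Lemma wtN x : wt (- x) = wt x.
Proof. by rewrite /wt /= !normrN. Qed.

Lemma wtB x y : wt (x - y) = wt (y - x).
Proof. by rewrite -wtN opprB. Qed.

(** Peetre's inequality: a weight moves from one index to another at the price of off-diagonal
    decay. *)
Lemma wt_peetre x y : wt x <= wt y * wt (x - y).
Proof.
rewrite /wt /=; set a : R := `|y.1|%:~R; set b : R := `|y.2|%:~R.
set c : R := `|x.1 - y.1|%:~R; set d : R := `|x.2 - y.2|%:~R.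
have a0 : 0 <= a by rewrite ler0z.
have b0 : 0 <= b by rewrite ler0z.
have c0 : 0 <= c by rewrite ler0z.
have d0 : 0 <= d by rewrite ler0z.
have h1 : `|x.1|%:~R <= a + c by rewrite -intrD ler_int -{1}(subrK y.1 x.1) addrC ler_normD.
have h2 : `|x.2|%:~R <= b + d by rewrite -intrD ler_int -{1}(subrK y.2 x.2) addrC ler_normD.
have : 0 <= (a + b) * (c + d) by rewrite mulr_ge0// addr_ge0.
lra.
Qed.

Lemma wt_triangle x y : wt (x + y) <= wt x * wt y.
Proof. by have := wt_peetre (x + y) x; rewrite addrAC subrr add0r. Qed.

Lemma wtXV_le x m n : (m <= n)%N -> wt x ^- n <= wt x ^- m.
Proof.
by move=> mn; rewrite lef_pV2 ?posrE ?exprn_gt0 ?wt_gt0// ler_weXn2l ?wt_ge1.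
Qed.

Lemma wtXV_gt0 x n : 0 < wt x ^- n.
Proof. by rewrite invr_gt0 exprn_gt0// wt_gt0. Qed.

Lemma wtXV_ge0 x n : 0 <= wt x ^- n.
Proof. exact/ltW/wtXV_gt0. Qed.

(** 3 is the least integer exponent above the dimension 2. Rows are compared with the differences of
    [2 x^-2], the row sums with those of [2 x^-1]. *)
Lemma rsummable_wt3 : rsummable (fun x => wt x ^- 3).
Proof.
have row (j : int) : rsummable (fun k : int => wt (j, k) ^- 3) /\
    rsum (fun k : int => wt (j, k) ^- 3) <= 4 * (1 + `|j|%:~R) ^- 2.
  have a1 : 1 <= 1 + `|j|%:~R :> R by rewrite lerDl ler0z.
  have [] := @rsummable_decay R (fun x => x ^- 3) (fun x => 2 * x ^- 2) _ a1.
  - by move=> x x1; rewrite invr_ge0 exprn_ge0//; lra.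
  - by move=> x x1; rewrite mulr_ge0// invr_ge0 exprn_ge0//; lra.
  - move=> x x1; have x0 : x != 0 by lra.
    have x2 : x + 1 != 0 by lra.
    have -> : 2 * x ^- 2 - 2 * (x + 1) ^- 2 = x ^- 3 + (3 * x ^+ 2 - 1) / (x ^+ 3 * (x + 1) ^+ 2).
      by field; rewrite x0 x2.
    rewrite lerDl divr_ge0//; first by nra.
    by rewrite mulr_ge0// exprn_ge0//; lra.
  by rewrite /wt /=; move=> s1 s2; split=> //; lra.
apply: (rsummable_prod (k := fun j : int => 4 * (1 + `|j|%:~R) ^- 2)) => [p|j|j|].
- exact: wtXV_ge0.
- exact: (row j).1.
- exact: (row j).2.
- apply: rsummableZ.
  have [||||s _] := @rsummable_decay R (fun x => x ^- 2) (fun x => 2 * x ^-1) 1; last exact: s.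
  - by [].
  - by move=> x x1; rewrite invr_ge0 exprn_ge0//; lra.
  - by move=> x x1; rewrite mulr_ge0// invr_ge0; lra.
  - move=> x x1; have x0 : x != 0 by lra.
    have x2 : x + 1 != 0 by lra.
    have -> : 2 * x^-1 - 2 * (x + 1)^-1 = x ^- 2 + (x - 1) / (x ^+ 2 * (x + 1)).
      by field; rewrite x0 x2.
    rewrite lerDl divr_ge0//; first by lra.
    by rewrite mulr_ge0// ?exprn_ge0//; lra.
Qed.

Lemma rsummable_wt n : (3 <= n)%N -> rsummable (fun x => wt x ^- n).
Proof.
move=> n3; apply: rsummable_le rsummable_wt3 => x.
by rewrite ger0_norm ?wtXV_ge0// wtXV_le.
Qed.

Lemma addr_bij (V : zmodType) (a : V) : bijective (fun x => a + x).
Proof. by exists (fun x => - a + x) => x; rewrite addrA ?addNr ?subrr add0r. Qed.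

Lemma subr_bij (V : zmodType) (a : V) : bijective (fun x => a - x).
Proof. by exists (fun x => a - x) => x; rewrite opprB addrC subrK. Qed.

Lemma rsummable_wtB (y : int * int) n : (3 <= n)%N ->
  rsummable (fun x : int * int => wt (y - x) ^- n).
Proof.
move=> n3.
apply/(@reindex_rsummable R _ _ (fun x : int * int => y - x) (fun x => wt x ^- n)).
  exact: subr_bij.
exact: rsummable_wt.
Qed.

Lemma rsum_wtB (y : int * int) n :
  rsum (fun x : int * int => wt (y - x) ^- n) = rsum (fun x : int * int => wt x ^- n).
Proof. apply: (@reindex_rsum R _ _ (fun x : int * int => y - x) (fun x => wt x ^- n)).
exact: subr_bij. Qed.

End Weight.

(** * Matrices indexed by the lattice Z^2 *)

Notation Z2 := (int * int)%type.

Section Weights.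
Variable R : realType.
Notation wt := (@wt R).

Lemma wtz_gt0 (x : Z2) (k : int) : 0 < wt x ^ k.
Proof. by rewrite exprz_gt0 ?wt_gt0. Qed.

Lemma wtz_ge0 (x : Z2) (k : int) : 0 <= wt x ^ k.
Proof. exact/ltW/wtz_gt0. Qed.

Lemma wtz_le (x : Z2) (k l : int) : k <= l -> wt x ^ k <= wt x ^ l.
Proof. by move=> kl; apply: ler_weXz2l => //; exact: wt_ge1. Qed.

Lemma wtzD (x : Z2) (k l : int) : wt x ^ (k + l) = wt x ^ k * wt x ^ l.
Proof. by rewrite expfzDr ?wt_neq0. Qed.

Lemma wtzN (x : Z2) (n : nat) : wt x ^ (- n%:Z) = wt x ^- n.
Proof. by rewrite -exprnN. Qed.

Lemma wt_peetrez (x z : Z2) (l : int) : wt z ^ l <= wt x ^ l * wt (x - z) ^+ absz l.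
Proof.
case: l => n.
  rewrite /= -!exprnP -exprMn lerXn2r ?nnegrE ?mulr_ge0 ?wt_ge0//.
  by rewrite wtB wt_peetre.
rewrite NegzE !wtzN abszN absz_nat.
rewrite mulrC ler_pdivlMr ?exprn_gt0 ?wt_gt0// mulrC.
rewrite ler_pdivrMr ?exprn_gt0 ?wt_gt0// -exprMn mulrC.
by rewrite lerXn2r ?nnegrE ?mulr_ge0 ?wt_ge0// wt_peetre.
Qed.

Definition sig3 : R := rsum (fun x : Z2 => wt x ^- 3).

Lemma sig3_ge0 : 0 <= sig3.
Proof. by apply: rsum_ge0 => x; exact: wtXV_ge0. Qed.

Lemma rsummable_wt33 :
  rsummable (fun p : Z2 * Z2 => wt p.1 ^- 3 * wt p.2 ^- 3).
Proof.
have s3 := @rsummable_wt3 R.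
apply: (rsummable_prod (k := fun x => wt x ^- 3 * sig3)) => [p|x|x|] /=.
- by rewrite mulr_ge0 ?wtXV_ge0.
- exact: rsummableZ.
- by rewrite rsumZ.
- by under eq_fun do rewrite mulrC; exact: rsummableZ.
Qed.

(** Of the [n + 3] powers, 3 are kept for the sum over [z]; the others combine with those of [z - y]
    by the triangle inequality. *)
Lemma wt_conv (x y z : Z2) (n : nat) :
  wt (x - z) ^- (n + 3) * wt (z - y) ^- n <= wt (x - z) ^- 3 * wt (x - y) ^- n.
Proof.
rewrite exprD invfM mulrAC mulrC ler_wpM2l ?wtXV_ge0//.
rewrite -invfM lef_pV2 ?posrE ?mulr_gt0 ?exprn_gt0 ?wt_gt0// -exprMn.
rewrite lerXn2r ?nnegrE ?mulr_ge0 ?wt_ge0//.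
by rewrite (_ : x - y = (x - z) + (z - y)) ?wt_triangle// addrA subrK.
Qed.

End Weights.

Section Tame.
Variable R : realType.
Notation wt := (@wt R).
Notation mat := (Z2 -> Z2 -> R[i]).

Definition rapid (v : Z2 -> R[i]) : Prop :=
  forall n : nat, exists C : R, forall x, nrm (v x) <= C * wt x ^- n.

(** Continuity of the matrix on rapidly decreasing sequences. Polynomial growth in the column index
    is allowed, so unbounded diagonal matrices belong to the class and all products still
    converge. *)
Definition tame (M : mat) : Prop := forall n : nat, exists (m : nat) (C : R),
  forall x y, nrm (M x y) <= C * wt x ^- n * wt y ^+ m.

Definition rawmul (M N : mat) : mat := fun x y => csum (fun z => M x z * N z y).

Definition rawapp (M : mat) (v : Z2 -> R[i]) : Z2 -> R[i] :=
  fun x => csum (fun z => M x z * v z).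

Lemma bound_pos (T : Type) (f : T -> R[i]) (g : T -> R) (C : R) :
  (forall x, 0 <= g x) -> (forall x, nrm (f x) <= C * g x) ->
  exists2 C', 0 < C' & forall x, nrm (f x) <= C' * g x.
Proof.
move=> g0 H; exists (`|C| + 1); first by rewrite ltr_pwDr.
move=> x; apply: le_trans (H x) _; apply: ler_wpM2r => //.
by apply: le_trans (ler_norm C) _; rewrite lerDl.
Qed.

Lemma tameP (M : mat) (n : nat) : tame M -> exists (m : nat) (C : R), 0 < C /\
  forall x y, nrm (M x y) <= C * wt x ^- n * wt y ^+ m.
Proof.
move=> /(_ n)[m [C H]]; exists m.
have [] := @bound_pos _ (fun p => M p.1 p.2) (fun p : Z2 * Z2 => wt p.1 ^- n * wt p.2 ^+ m) C.
- by move=> p; rewrite mulr_ge0 ?wtXV_ge0 ?exprn_ge0 ?wt_ge0.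
- by move=> p; rewrite mulrA.
by move=> C' C0 H'; exists C'; split=> // x y; rewrite -mulrA (H' (x, y)).
Qed.

Lemma rapidP (v : Z2 -> R[i]) (n : nat) : rapid v -> exists C : R, 0 < C /\
  forall x, nrm (v x) <= C * wt x ^- n.
Proof.
move=> /(_ n)[C H]; have [] := @bound_pos _ v (fun x => wt x ^- n) C => //.
  by move=> x; exact: wtXV_ge0.
by move=> C' C0 H'; exists C'.
Qed.

Lemma tame_col (M : mat) (y : Z2) : tame M -> rapid (fun x => M x y).
Proof.
move=> tM n; have [m [C H]] := tM n; exists (C * wt y ^+ m) => x.
by apply: le_trans (H x y) _; rewrite mulrAC.
Qed.

Lemma tame_row (M : mat) (x : Z2) : tame M -> exists (m : nat) (C : R), 0 < C /\
  forall y, nrm (M x y) <= C * wt y ^+ m.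
Proof.
move=> /(tameP 0)[m [C [C0 H]]]; exists m, C; split=> // y.
by have := H x y; rewrite expr0 invr1 mulr1.
Qed.

Lemma rapid_absum (f v : Z2 -> R[i]) (m : nat) (C : R) : 0 < C ->
  (forall y, nrm (f y) <= C * wt y ^+ m) -> rapid v ->
  absum (fun z => f z * v z).
Proof.
move=> C0 fC rv; have [D [D0 vD]] := rapidP (m + 3) rv.
apply: absum_le (rsummableZ (C * D) (@rsummable_wt3 R)) => x.
rewrite Normc.normcM; apply: le_trans (ler_pM (nrm_ge0 _) (nrm_ge0 _) (fC x) (vD x)) _.
rewrite exprD invfM le_eqVlt; apply/orP; left; apply/eqP.
by field; rewrite ?expf_neq0 ?wt_neq0.
Qed.

Lemma absum_rawapp (M : mat) (v : Z2 -> R[i]) (x : Z2) : tame M -> rapid v ->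
  absum (fun z => M x z * v z).
Proof. by move=> /(tame_row x)[m [C [C0 H]]]; exact: rapid_absum C0 H. Qed.

Lemma absum_rawmul (M N : mat) (x y : Z2) : tame M -> tame N ->
  absum (fun z => M x z * N z y).
Proof. by move=> tM tN; apply: absum_rawapp => //; exact: tame_col. Qed.

Lemma csum_wt_bound (f : Z2 -> R[i]) (B : R) :
  (forall z, nrm (f z) <= B * wt z ^- 3) -> nrm (csum f) <= B * sig3 R.
Proof.
move=> H; apply: nrm_csum_le H (rsummableZ _ (@rsummable_wt3 R)) _.
by rewrite rsumZ//; exact: rsummable_wt3.
Qed.

Lemma rapid_rawapp (M : mat) v : tame M -> rapid v -> rapid (rawapp M v).
Proof.
move=> tM rv n; have [m [C [C0 H]]] := tameP n tM.
have [D [D0 vD]] := rapidP (m + 3) rv.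
exists (C * D * sig3 R) => x; rewrite mulrAC; apply: csum_wt_bound => z.
rewrite Normc.normcM; apply: le_trans (ler_pM (nrm_ge0 _) (nrm_ge0 _) (H x z) (vD z)) _.
rewrite exprD invfM le_eqVlt; apply/orP; left; apply/eqP.
by field; rewrite ?expf_neq0 ?wt_neq0.
Qed.

Lemma tame_rawmul (M N : mat) : tame M -> tame N -> tame (rawmul M N).
Proof.
move=> tM tN n; have [m [C [C0 H]]] := tameP n tM.
have [k [D [D0 HD]]] := tameP (m + 3) tN.
exists k, (C * D * sig3 R) => x y.
have -> : C * D * sig3 R * wt x ^- n * wt y ^+ k =
    C * D * wt x ^- n * wt y ^+ k * sig3 R by ring.
apply: csum_wt_bound => z.
rewrite Normc.normcM; apply: le_trans (ler_pM (nrm_ge0 _) (nrm_ge0 _) (H x z) (HD z y)) _.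
rewrite exprD invfM le_eqVlt; apply/orP; left; apply/eqP.
by field; rewrite ?expf_neq0 ?wt_neq0.
Qed.

Lemma rawapp_mul (M N : mat) v : tame M -> tame N -> rapid v ->
  rawapp (rawmul M N) v = rawapp M (rawapp N v).
Proof.
move=> tM tN rv; apply/funext => x; rewrite /rawapp /rawmul.
have [m1 [C1 [C10 H1]]] := tame_row x tM.
have [m2 [C2 [C20 H2]]] := tameP (m1 + 3) tN.
have [D [D0 vD]] := rapidP (m2 + 3) rv.
rewrite [LHS](_ : _ = csum (fun y => csum (fun z => M x z * N z y * v y))); last first.
  by congr csum; apply/funext => y; rewrite csumZr//; exact: absum_rawmul.
rewrite (csum_exchange (g := fun y z => M x z * N z y * v y)).
  congr csum; apply/funext => z; rewrite -csumZ; last exact: absum_rawapp.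
  by congr csum; apply/funext => y; rewrite mulrA.
apply: absum_le (rsummableZ (C1 * C2 * D) (@rsummable_wt33 R)) => -[y z] /=.
rewrite !Normc.normcM.
apply: le_trans (ler_pM _ (nrm_ge0 _) (ler_pM (nrm_ge0 _) (nrm_ge0 _) (H1 z) (H2 z y)) (vD y)) _.
  by rewrite mulr_ge0 ?nrm_ge0.
rewrite !exprD !invfM le_eqVlt; apply/orP; left; apply/eqP.
by field; rewrite ?expf_neq0 ?wt_neq0.
Qed.

(** Columns of a tame matrix are rapidly decreasing vectors, and a product acts column by column, so
    associativity is [rawapp_mul] applied to a column of [P]. *)
Lemma rawmulA (M N P : mat) : tame M -> tame N -> tame P ->
  rawmul M (rawmul N P) = rawmul (rawmul M N) P.
Proof.
move=> tM tN tP; apply/funext => x; apply/funext => y.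
exact: (esym (congr1 (fun f => f x) (rawapp_mul tM tN (tame_col y tP)))).
Qed.

Lemma tameD (M N : mat) : tame M -> tame N -> tame (fun x y => M x y + N x y).
Proof.
move=> tM tN n; have [m [C [C0 H]]] := tameP n tM.
have [k [D [D0 HD]]] := tameP n tN.
exists (m + k)%N, (C + D) => x y; apply: le_trans (le_normcD _ _) _.
have w0 := wtXV_ge0 R x n.
have w1 : 1 <= wt y ^+ m by rewrite exprn_ege1// wt_ge1.
have w2 : 1 <= wt y ^+ k by rewrite exprn_ege1// wt_ge1.
apply: le_trans (lerD (H x y) (HD x y)) _.
rewrite exprD 2!mulrDl lerD// ler_wpM2l ?mulr_ge0 ?(ltW C0) ?(ltW D0)//.
  by rewrite ler_peMr// (le_trans ler01).
by rewrite ler_peMl// (le_trans ler01).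
Qed.

Lemma tameZ (c : R[i]) (M : mat) : tame M -> tame (fun x y => c * M x y).
Proof.
move=> tM n; have [m [C [C0 H]]] := tameP n tM.
exists m, (nrm c * C) => x y; rewrite Normc.normcM -!mulrA ler_wpM2l ?nrm_ge0//.
by rewrite mulrA.
Qed.

Lemma tame_diag (d : Z2 -> R[i]) (C : R) (m : nat) :
  (forall x, nrm (d x) <= C * wt x ^+ m) ->
  tame (fun x y => if x == y then d x else 0).
Proof.
move=> dC n; exists (m + n)%N, (`|C| + 1) => x y; case: eqP => [->|_]; last first.
  by rewrite Normc.normc0 !mulr_ge0 ?wtXV_ge0 ?exprn_ge0 ?wt_ge0// addr_ge0.
have -> : (`|C| + 1) * wt y ^- n * wt y ^+ (m + n) = (`|C| + 1) * wt y ^+ m.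
  by rewrite exprD; field; rewrite expf_neq0 ?wt_neq0.
apply: le_trans (dC y) _; rewrite ler_wpM2r ?exprn_ge0 ?wt_ge0//.
by apply: le_trans (ler_norm C) _; rewrite lerDl.
Qed.

Lemma tame0 : tame (fun _ _ => 0).
Proof.
by move=> n; exists 0%N, 0 => x y; rewrite Normc.normc0 !mul0r.
Qed.

Lemma rapidD (v w : Z2 -> R[i]) : rapid v -> rapid w -> rapid (v + w).
Proof.
move=> rv rw n; have [C H] := rv n; have [D HD] := rw n; exists (C + D) => x.
by rewrite mulrDl; apply: le_trans (le_normcD _ _) _; exact: lerD.
Qed.

Lemma rapidZ (c : R[i]) (v : Z2 -> R[i]) : rapid v -> rapid (fun x => c * v x).
Proof.
move=> rv n; have [C H] := rv n; exists (nrm c * C) => x.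
by rewrite Normc.normcM -mulrA ler_wpM2l ?nrm_ge0.
Qed.

End Tame.

Section TameRing.
Variable R : realType.
Notation wt := (@wt R).
Notation mat := (Z2 -> Z2 -> R[i]).

(** With the bound bundled in, associativity and distributivity hold without side conditions, and
    unbounded operators can be handled by ring rewriting. *)
Record tmx : Type := TMx { tmx_val :> mat; tmx_tame : tame tmx_val }.

Lemma tmxP (M N : tmx) : (forall x y, M x y = N x y) -> M = N.
Proof.
case: M N => M tM [N tN] /= MN.
have E : M = N by apply/funext => x; apply/funext => y.
by subst N; congr TMx; exact: Prop_irrelevance.
Qed.

HB.instance Definition _ := gen_eqMixin tmx.
HB.instance Definition _ := gen_choiceMixin tmx.

Definition tmx_add (M N : tmx) := TMx (tameD (tmx_tame M) (tmx_tame N)).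
Definition tmx_scale (c : R[i]) (M : tmx) := TMx (tameZ c (tmx_tame M)).
Definition tmx_opp (M : tmx) := tmx_scale (-1) M.
Definition tmx_zero := TMx (@tame0 R).
Definition tmx_mul (M N : tmx) := TMx (tame_rawmul (tmx_tame M) (tmx_tame N)).

Lemma tame_one : tame (fun x y : Z2 => if x == y then 1 else 0 : R[i]).
Proof.
by apply: (@tame_diag R (fun=> 1) 1 0) => x; rewrite Normc.normc1 expr0 mulr1.
Qed.
Definition tmx_one := TMx tame_one.

Lemma tmx_addA : associative tmx_add.
Proof. by move=> M N P; apply: tmxP => x y /=; rewrite addrA. Qed.
Lemma tmx_addC : commutative tmx_add.
Proof. by move=> M N; apply: tmxP => x y /=; rewrite addrC. Qed.
Lemma tmx_add0 : left_id tmx_zero tmx_add.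
Proof. by move=> M; apply: tmxP => x y /=; rewrite add0r. Qed.
Lemma tmx_addN : left_inverse tmx_zero tmx_opp tmx_add.
Proof. by move=> M; apply: tmxP => x y /=; rewrite mulN1r addNr. Qed.

HB.instance Definition _ :=
  GRing.isZmodule.Build tmx tmx_addA tmx_addC tmx_add0 tmx_addN.

Lemma tmx_mulA : associative tmx_mul.
Proof.
move=> M N P; apply: tmxP => x y /=.
by rewrite rawmulA//; exact: tmx_tame.
Qed.
Lemma tmx_mul1 : left_id tmx_one tmx_mul.
Proof.
move=> M; apply: tmxP => x y /=; rewrite /rawmul.
have [|_ ->] := @csum_one R _ x (fun z => (if x == z then 1 else 0) * M z y).
  by move=> z; rewrite eq_sym => /negbTE ->; rewrite mul0r.
by rewrite eqxx mul1r.
Qed.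
Lemma tmx_mulr1 : right_id tmx_one tmx_mul.
Proof.
move=> M; apply: tmxP => x y /=; rewrite /rawmul.
have [|_ ->] := @csum_one R _ y (fun z => M x z * (if z == y then 1 else 0)).
  by move=> z /negbTE ->; rewrite mulr0.
by rewrite eqxx mulr1.
Qed.
Lemma tmx_mulDl : left_distributive tmx_mul tmx_add.
Proof.
move=> M N P; apply: tmxP => x y /=; rewrite /rawmul -csumD.
- by congr csum; apply/funext => z; rewrite mulrDl.
- exact: absum_rawmul (tmx_tame M) (tmx_tame P).
- exact: absum_rawmul (tmx_tame N) (tmx_tame P).
Qed.
Lemma tmx_mulDr : right_distributive tmx_mul tmx_add.
Proof.
move=> M N P; apply: tmxP => x y /=; rewrite /rawmul -csumD.
- by congr csum; apply/funext => z; rewrite mulrDr.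
- exact: absum_rawmul (tmx_tame M) (tmx_tame N).
- exact: absum_rawmul (tmx_tame M) (tmx_tame P).
Qed.

HB.instance Definition _ := GRing.Zmodule_isPzRing.Build tmx
  tmx_mulA tmx_mul1 tmx_mulr1 tmx_mulDl tmx_mulDr.

Lemma tmx_scaleA (a b : R[i]) (M : tmx) :
  tmx_scale a (tmx_scale b M) = tmx_scale (a * b) M.
Proof. by apply: tmxP => x y /=; rewrite mulrA. Qed.
Lemma tmx_scale1 : left_id 1 tmx_scale.
Proof. by move=> M; apply: tmxP => x y /=; rewrite mul1r. Qed.
Lemma tmx_scaleDr : right_distributive tmx_scale +%R.
Proof. by move=> a M N; apply: tmxP => x y /=; rewrite mulrDr. Qed.
Lemma tmx_scaleDl (M : tmx) : {morph tmx_scale^~ M : a b / a + b}.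
Proof. by move=> a b; apply: tmxP => x y /=; rewrite mulrDl. Qed.

HB.instance Definition _ := GRing.Zmodule_isLmodule.Build R[i] tmx
  tmx_scaleA tmx_scale1 tmx_scaleDr tmx_scaleDl.

Lemma tmxDE (M N : tmx) x y : (M + N) x y = M x y + N x y. Proof. by []. Qed.
Lemma tmxNE (M : tmx) x y : (- M) x y = - M x y.
Proof. exact: mulN1r. Qed.
Lemma tmxBE (M N : tmx) x y : (M - N) x y = M x y - N x y.
Proof. by rewrite tmxDE tmxNE. Qed.
Lemma tmxZE (c : R[i]) (M : tmx) x y : (c *: M) x y = c * M x y. Proof. by []. Qed.
Lemma tmxME (M N : tmx) x y : (M * N) x y = csum (fun z => M x z * N z y).
Proof. by []. Qed.
Lemma tmx1E x y : (1 : tmx) x y = if x == y then 1 else 0. Proof. by []. Qed.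
Lemma absum_tmxM (M N : tmx) x y : absum (fun z => M x z * N z y).
Proof. by apply: absum_rawmul; exact: tmx_tame. Qed.

Lemma tmx_scaleAl (c : R[i]) (M N : tmx) : c *: (M * N) = (c *: M) * N.
Proof.
apply: tmxP => x y; rewrite tmxZE !tmxME -csumZ; last exact: absum_tmxM.
by congr csum; apply/funext => z; rewrite tmxZE mulrA.
Qed.

Lemma tmx_scaleAr (c : R[i]) (M N : tmx) : c *: (M * N) = M * (c *: N).
Proof.
apply: tmxP => x y; rewrite tmxZE !tmxME -csumZ; last exact: absum_tmxM.
by congr csum; apply/funext => z; rewrite tmxZE mulrCA.
Qed.

Definition tapp (M : tmx) (v : Z2 -> R[i]) : Z2 -> R[i] := rawapp M v.

Lemma tapp_rapid (M : tmx) v : rapid v -> rapid (tapp M v).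
Proof. by move=> rv; apply: rapid_rawapp => //; exact: tmx_tame. Qed.

Lemma absum_tapp (M : tmx) v x : rapid v -> absum (fun z => M x z * v z).
Proof. by move=> rv; apply: absum_rawapp => //; exact: tmx_tame. Qed.

Lemma tapp_mul (M N : tmx) v : rapid v -> tapp (M * N) v = tapp M (tapp N v).
Proof. by move=> rv; apply: rawapp_mul => //; exact: tmx_tame. Qed.

Lemma tappD (M N : tmx) v : rapid v -> tapp (M + N) v = tapp M v + tapp N v.
Proof.
move=> rv; apply/funext => x; rewrite /tapp /rawapp -[RHS]csumD; last 2 first.
- exact: absum_tapp.
- exact: absum_tapp.
by congr csum; apply/funext => z; rewrite mulrDl.
Qed.

Lemma tappZ c (M : tmx) v : rapid v -> tapp (c *: M) v = fun x => c * tapp M v x.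
Proof.
move=> rv; apply/funext => x; rewrite /tapp /rawapp -csumZ; last exact: absum_tapp.
by congr csum; apply/funext => z; rewrite tmxZE mulrA.
Qed.

Lemma tappN (M : tmx) v : rapid v -> tapp (- M) v = - tapp M v.
Proof.
move=> rv; rewrite (_ : - M = (-1) *: M); last by rewrite scaleN1r.
by rewrite tappZ//; apply/funext => x; rewrite mulN1r.
Qed.

Lemma tappB (M N : tmx) v : rapid v -> tapp (M - N) v = tapp M v - tapp N v.
Proof. by move=> rv; rewrite tappD// tappN. Qed.

Lemma tapp_lin (M : tmx) c v w : rapid v -> rapid w ->
  tapp M (fun x => c * v x + w x) = fun x => c * tapp M v x + tapp M w x.
Proof.
move=> rv rw; apply/funext => x; rewrite /tapp /rawapp.
have sv := absum_tapp M x rv; have sw := absum_tapp M x rw.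
rewrite -(csumZ c sv) -(csumD (absumZ c sv) sw).
by congr csum; apply/funext => z; rewrite mulrDr mulrCA.
Qed.

End TameRing.

(** * Orders, traces and Neumann series *)

Section NatSum.
Variable R : realType.

Lemma seq_sub_iota (s : seq nat) : exists N0, forall N, (N0 <= N)%N ->
  {subset s <= iota 0 N}.
Proof.
elim: s => [|a s [N0 H]]; first by exists 0%N.
exists (maxn a.+1 N0) => N; rewrite geq_max => /andP[aN N0N] x.
rewrite inE => /orP[/eqP->|]; first by rewrite mem_iota.
exact: H.
Qed.

Lemma csum_nat (f : nat -> R[i]) (e : R) : absum f -> 0 < e ->
  exists N0, forall N, (N0 <= N)%N -> nrm (csum f - \sum_(i < N) f i) <= e.
Proof.
move=> sf e0; have [s us H] := csum_approx sf e0.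
have [N0 HN] := seq_sub_iota s; exists N0 => N NN.
have -> : \sum_(i < N) f i = \sum_(i <- iota 0 N) f i.
  by rewrite -[in RHS](subn0 N) -/(index_iota 0 N) big_mkord.
by apply: H; [exact: iota_uniq|exact: HN].
Qed.

Lemma csum_shift (f : nat -> R[i]) (m : nat) : absum f ->
  absum (fun i => f (m + i)%N) ->
  csum f = \sum_(i < m) f i + csum (fun i => f (m + i)%N).
Proof.
move=> sf sm; apply/eqP; rewrite -subr_eq0; apply/eqP/nrm_le_eps => e e0.
have e2 : 0 < e / 2 by rewrite divr_gt0.
have [N1 H1] := csum_nat sf e2; have [N2 H2] := csum_nat sm e2.
have := H1 (m + maxn N1 N2)%N (leq_trans (leq_maxl _ _) (leq_addl _ _)).
rewrite big_split_ord /=; have := H2 _ (leq_maxr N1 N2).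
set A := csum f; set B := csum _; set S := \sum_(i < m) _; set T := \sum_(i < maxn _ _) _.
move=> h2 h1; have -> : A - (S + B) = (A - (S + T)) - (B - T) by ring.
by apply: le_trans (nrmB _ _) _; lra.
Qed.

Lemma rsummable_geo : rsummable (fun m : nat => (2^-1 : R) ^+ m).
Proof.
have h0 n : 0 <= (2^-1 : R) ^+ n by rewrite exprn_ge0// invr_ge0.
apply: (rsummable_bounded (B := 2) h0 _).1 => s us.
have [N HN] := seq_sub_iota s.
apply: (@le_trans _ _ (\sum_(i <- iota 0 N) (2^-1 : R) ^+ i)).
  pose g x : R := if x \in s then 2^-1 ^+ x else 0.
  have gs : \sum_(x <- s) g x = \sum_(x <- s) 2^-1 ^+ x.
    by rewrite big_seq [RHS]big_seq; apply: eq_bigr => x xs; rewrite /g xs.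
  rewrite -gs -(rsum_fsupp us (g := g) _).2; last by move=> x /negbTE xs; rewrite /g xs.
  rewrite (rsum_fsupp (iota_uniq 0 N) (g := g) _).2; last first.
    by move=> x xs; rewrite /g; case: ifP => // /(HN _ (leqnn _)); rewrite (negbTE xs).
  by apply: ler_sum => x _; rewrite /g; case: ifP.
rewrite -[iota 0 N]/(iota 0 N) -(subn0 N) -/(index_iota 0 N) big_mkord.
suff -> : \sum_(i < N) (2^-1 : R) ^+ i = 2 - 2 * 2^-1 ^+ N.
  by have := h0 N; lra.
elim: N {HN} => [|N IH]; first by rewrite big_ord0 expr0; lra.
by rewrite big_ord_recr /= IH exprS; field.
Qed.

Lemma rsummable_tensor (T U : choiceType) (a : T -> R) (b : U -> R) :
  (forall x, 0 <= a x) -> (forall y, 0 <= b y) ->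
  rsummable a -> rsummable b -> rsummable (fun p : T * U => a p.1 * b p.2).
Proof.
move=> a0 b0 sa sb.
apply: (rsummable_prod (k := fun x => a x * rsum b)) => [p|x|x|] /=.
- by rewrite mulr_ge0.
- exact: rsummableZ.
- by rewrite rsumZ.
- by under eq_fun do rewrite mulrC; exact: rsummableZ.
Qed.

End NatSum.

Section Orders.
Variable R : realType.
Notation wt := (@wt R).
Notation mat := (Z2 -> Z2 -> R[i]).

(** The discrete analogue of a pseudodifferential operator of order [k]: the [k]-th power of the
    weight along the diagonal, rapid decay away from it. *)
Definition mord (k : int) (M : mat) : Prop :=
  forall n : nat, exists C : R,
  forall x y, nrm (M x y) <= C * (wt x ^ k * wt (x - y) ^- n).

(** A smoothing operator of finite rate. This is the property that [neumann] establishes for the sum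
    of a Neumann series, for which no order is proved. *)
Definition decay (s : nat) (M : mat) : Prop := exists C : R,
  forall x y, nrm (M x y) <= C * (wt x ^- s * wt y ^- s).

Lemma mordP k (M : mat) n : mord k M -> exists C : R, 0 < C /\
  forall x y, nrm (M x y) <= C * (wt x ^ k * wt (x - y) ^- n).
Proof.
move=> /(_ n)[C H].
have [] := @bound_pos R _ (fun p => M p.1 p.2)
  (fun p : Z2 * Z2 => wt p.1 ^ k * wt (p.1 - p.2) ^- n) C.
- by move=> p; rewrite mulr_ge0 ?wtXV_ge0 ?wtz_ge0.
- by move=> p; exact: H.
by move=> C' C0 H'; exists C'; split=> // x y; exact: (H' (x, y)).
Qed.

Lemma decayP s (M : mat) : decay s M -> exists C : R, 0 < C /\
  forall x y, nrm (M x y) <= C * (wt x ^- s * wt y ^- s).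
Proof.
move=> [C H].
have [] := @bound_pos R _ (fun p => M p.1 p.2)
  (fun p : Z2 * Z2 => wt p.1 ^- s * wt p.2 ^- s) C.
- by move=> p; rewrite mulr_ge0 ?wtXV_ge0.
- by move=> p; exact: H.
by move=> C' C0 H'; exists C'; split=> // x y; exact: (H' (x, y)).
Qed.

Lemma csum_wtB_bound (x : Z2) (f : Z2 -> R[i]) (B : R) :
  (forall z, nrm (f z) <= B * wt (x - z) ^- 3) -> nrm (csum f) <= B * sig3 R.
Proof.
have s := @rsummable_wtB R x 3 isT.
move=> H; apply: nrm_csum_le H (rsummableZ _ s) _.
by rewrite rsumZ// rsum_wtB.
Qed.

Lemma mord_tame k (M : mat) : mord k M -> tame M.
Proof.
move=> oM n; have [C [C0 H]] := mordP (absz (k + n%:Z)) oM.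
exists (absz k + n)%N, C => x y; apply: le_trans (H x y) _.
rewrite -mulrA ler_wpM2l ?(ltW C0)// ler_pdivrMr ?exprn_gt0 ?wt_gt0//.
rewrite -mulrA mulrC ler_pdivlMr ?exprn_gt0 ?wt_gt0//.
have -> : wt x ^ k * wt x ^+ n = wt x ^ (k + n%:Z) by rewrite wtzD.
apply: le_trans (wt_peetrez R y x _) _; rewrite wtB.
rewrite ler_wpM2r ?exprn_ge0 ?wt_ge0// [leRHS]exprnP.
by apply: wtz_le; rewrite PoszD lerD2r; lia.
Qed.

Lemma mordD k (M N : mat) : mord k M -> mord k N -> mord k (fun x y => M x y + N x y).
Proof.
move=> oM oN n; have [C H] := oM n; have [D HD] := oN n.
exists (C + D) => x y; rewrite mulrDl; apply: le_trans (le_normcD _ _) _.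
exact: lerD.
Qed.

Lemma mordZ k c (M : mat) : mord k M -> mord k (fun x y => c * M x y).
Proof.
move=> oM n; have [C H] := oM n; exists (nrm c * C) => x y.
by rewrite Normc.normcM -mulrA ler_wpM2l ?nrm_ge0.
Qed.

Lemma mord_le k l (M : mat) : k <= l -> mord k M -> mord l M.
Proof.
move=> kl oM n; have [C [C0 H]] := mordP n oM; exists C => x y.
apply: le_trans (H x y) _; rewrite ler_wpM2l ?(ltW C0)//.
by rewrite ler_wpM2r ?wtXV_ge0// wtz_le.
Qed.

Lemma mordM k l (M N : mat) : mord k M -> mord l N -> mord (k + l) (rawmul M N).
Proof.
(* [n] powers give the off-diagonal decay of the product, 3 the convergence of the sum over [z], and
   [absz l] moves the weight of [N] from [z] to [x]. *)
move=> oM oN n; have [C [C0 H]] := mordP (n + 3 + absz l) oM.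
have [D [D0 HD]] := mordP n oN.
exists (C * D * sig3 R) => x y; rewrite mulrAC; apply: (@csum_wtB_bound x) => z.
rewrite Normc.normcM; apply: le_trans (ler_pM (nrm_ge0 _) (nrm_ge0 _) (H x z) (HD z y)) _.
have h1 := wt_peetrez R x z l; have h2 := wt_conv R x y z n.
rewrite mulrACA -[leRHS]mulrA ler_wpM2l ?mulr_ge0 ?(ltW C0) ?(ltW D0)//.
rewrite wtzD exprD invfM.
have -> : wt x ^ k * (wt (x - z) ^- (n + 3) * wt (x - z) ^- absz l) * (wt z ^ l * wt (z - y) ^- n)
  = wt x ^ k * (wt (x - z) ^- (n + 3) * wt (z - y) ^- n) * (wt z ^ l * wt (x - z) ^- absz l) by ring.
have -> : wt x ^ k * wt x ^ l * wt (x - y) ^- n * wt (x - z) ^- 3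
  = wt x ^ k * (wt (x - z) ^- 3 * wt (x - y) ^- n) * wt x ^ l by ring.
apply: ler_pM.
- by rewrite !mulr_ge0 ?wtXV_ge0 ?wtz_ge0.
- by rewrite !mulr_ge0 ?wtXV_ge0 ?wtz_ge0.
- by rewrite ler_wpM2l ?wtz_ge0.
- by rewrite ler_pdivrMr ?exprn_gt0 ?wt_gt0.
Qed.

Lemma mord_one : mord 0 (@tmx_one R).
Proof.
move=> n; exists 1 => x y; rewrite /= mul1r expr0z mul1r; case: eqP => [->|_].
  by rewrite subrr Normc.normc1 /wt /= !addr0 expr1n invr1.
by rewrite Normc.normc0 wtXV_ge0.
Qed.

Lemma mord_tmxD k (M N : tmx R) : mord k M -> mord k N -> mord k (M + N : tmx R).
Proof. exact: mordD. Qed.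

Lemma mord_tmxZ k c (M : tmx R) : mord k M -> mord k (c *: M : tmx R).
Proof. exact: mordZ. Qed.

Lemma mord_tmxN k (M : tmx R) : mord k M -> mord k (- M : tmx R).
Proof. exact: mordZ. Qed.

Lemma mord_tmxB k (M N : tmx R) : mord k M -> mord k N -> mord k (M - N : tmx R).
Proof. by move=> oM oN; apply: mord_tmxD => //; exact: mord_tmxN. Qed.

Lemma mord_tmxM k l (M N : tmx R) : mord k M -> mord l N -> mord (k + l) (M * N : tmx R).
Proof. exact: mordM. Qed.

Lemma mord_tmx1 : mord 0 (1 : tmx R). Proof. exact: mord_one. Qed.

Lemma mord_tmxX k (M : tmx R) n : mord k M -> mord (k * n%:Z) (M ^+ n : tmx R).
Proof.
move=> oM; elim: n => [|n IH]; first by rewrite mulr0 expr0; exact: mord_tmx1.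
by rewrite exprS intS mulrDr mulr1; exact: mord_tmxM.
Qed.

Lemma mord_tmx0 k : mord k (0 : tmx R).
Proof. by move=> n; exists 0 => x y; rewrite Normc.normc0 mul0r. Qed.

Lemma mord_tmx_sum k (I : Type) (s : seq I) (F : I -> tmx R) :
  (forall i, mord k (F i)) -> mord k (\sum_(i <- s) F i : tmx R).
Proof.
move=> oF; elim: s => [|a s IH]; first by rewrite big_nil; exact: mord_tmx0.
by rewrite big_cons; exact: mord_tmxD.
Qed.

Lemma mord_decay (s : nat) (M : mat) : mord (- (s + s)%N%:Z) M -> decay s M.
Proof.
move=> oM; have [C [C0 H]] := mordP s oM; exists C => x y.
apply: le_trans (H x y) _; rewrite ler_wpM2l ?(ltW C0)// wtzN exprD invfM -mulrA.
rewrite ler_wpM2l ?wtXV_ge0// -invfM -exprMn lef_pV2 ?posrE ?exprn_gt0 ?mulr_gt0 ?wt_gt0//.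
by rewrite lerXn2r ?nnegrE ?mulr_ge0 ?wt_ge0// wtB wt_peetre.
Qed.

Lemma decayMr s (M N : mat) : decay s M -> mord 0 N -> decay s (rawmul M N).
Proof.
move=> dM oN; have [C [C0 H]] := mordP (s + 3) oN; have [D [D0 HD]] := decayP dM.
exists (D * C * sig3 R) => x y; rewrite mulrAC; apply: (@csum_wtB_bound y) => z.
rewrite Normc.normcM; apply: le_trans (ler_pM (nrm_ge0 _) (nrm_ge0 _) (HD x z) (H z y)) _.
rewrite expr0z mul1r mulrACA -[leRHS]mulrA ler_wpM2l ?mulr_ge0 ?(ltW C0) ?(ltW D0)//.
have := wt_peetrez R y z (- s%:Z); rewrite !wtzN abszN absz_nat => h.
rewrite [wt (z - y)]wtB exprD invfM.
have -> : wt x ^- s * wt z ^- s * (wt (y - z) ^- s * wt (y - z) ^- 3)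
  = (wt z ^- s * wt (y - z) ^- s) * (wt x ^- s * wt (y - z) ^- 3) by ring.
have -> : wt x ^- s * wt y ^- s * wt (y - z) ^- 3
  = wt y ^- s * (wt x ^- s * wt (y - z) ^- 3) by ring.
rewrite ler_wpM2r ?mulr_ge0 ?wtXV_ge0//.
by rewrite ler_pdivrMr ?exprn_gt0 ?wt_gt0.
Qed.

Definition mtr (M : mat) : R[i] := csum (fun x => M x x).

Lemma mord_trace k (M : mat) : k <= - 3 -> mord k M -> absum (fun x => M x x).
Proof.
move=> k3 oM; have [C [C0 H]] := mordP 0 oM.
apply: absum_le (rsummableZ C (@rsummable_wt3 R)) => x.
apply: le_trans (H x x) _; rewrite ler_wpM2l ?(ltW C0)// expr0 invr1 mulr1.
by apply: le_trans (wtz_le R x k3) _; rewrite (wtzN R x 3).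
Qed.

Lemma mtr_cyc (M N : tmx R) : absum (fun p : Z2 * Z2 => M p.1 p.2 * N p.2 p.1) ->
  mtr (M * N : tmx R) = mtr (N * M : tmx R).
Proof.
move=> sMN; rewrite /mtr; under [X in csum X]eq_fun do rewrite tmxME.
rewrite (csum_exchange (g := fun x z => M x z * N z x))//.
congr csum; apply/funext => z; rewrite tmxME; congr csum; apply/funext => x.
exact: mulrC.
Qed.

(** Cyclicity needs the double sum over both indices to converge absolutely. The total order
    decides: Peetre's inequality moves the weight of [N] to the index [x], where the exponent is at
    most -3. *)
Lemma mord_cyc k l (M N : tmx R) : k + l <= - 3 -> mord k M -> mord l N ->
  mtr (M * N : tmx R) = mtr (N * M : tmx R).
Proof.
move=> kl oM oN; apply: mtr_cyc.
have [C [C0 H]] := mordP (3 + absz l) oM; have [D [D0 HD]] := mordP 0 oN.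
have b x y : nrm (M x y * N y x) <= C * D * wt x ^- 3 * wt (x - y) ^- 3.
  rewrite Normc.normcM; apply: le_trans (ler_pM (nrm_ge0 _) (nrm_ge0 _) (H x y) (HD y x)) _.
  rewrite expr0 invr1 mulr1 mulrACA -[leRHS]mulrA ler_wpM2l ?mulr_ge0 ?(ltW C0) ?(ltW D0)//.
  have := wt_peetrez R x y l; rewrite exprD invfM => h.
  have -> : wt x ^ k * (wt (x - y) ^- 3 * wt (x - y) ^- absz l) * wt y ^ l =
    (wt x ^ k * (wt y ^ l * wt (x - y) ^- absz l)) * wt (x - y) ^- 3 by ring.
  rewrite ler_wpM2r ?wtXV_ge0// -(wtzN R x 3).
  apply: le_trans (wtz_le R x kl); rewrite wtzD ler_wpM2l ?wtz_ge0//.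
  by rewrite ler_pdivrMr ?exprn_gt0 ?wt_gt0.
have s3 x := @rsummable_wtB R x 3 isT.
apply: (absum_prod (k := fun x => C * D * sig3 R * wt x ^- 3)) => [x|x|] /=.
- by apply: absum_le (rsummableZ (C * D * wt x ^- 3) (s3 x)) => y; exact: b.
- apply: (@le_trans _ _ (rsum (fun y : Z2 => C * D * wt x ^- 3 * wt (x - y) ^- 3))).
    apply: ler_rsum => //; first exact: absum_le (rsummableZ (C * D * wt x ^- 3) (s3 x)).
    exact: rsummableZ.
  by rewrite rsumZ// rsum_wtB -/(sig3 R) mulrAC.
- by apply: rsummableZ; exact: rsummable_wt3.
Qed.

(** The variant for Neumann corrections, which are only known to decay. Of the four powers, three
    serve the sum and one absorbs the growth of [N]. *)
Lemma decay_cyc s (M N : tmx R) : (4 <= s)%N -> decay s M -> mord 1 N ->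
  mtr (M * N : tmx R) = mtr (N * M : tmx R).
Proof.
move=> s4 /decayP[C [C0 H]] oN; apply: mtr_cyc.
have [D [D0 HD]] := mordP 0 oN.
apply: absum_le (rsummableZ (C * D) (@rsummable_wt33 R)) => -[x y] /=.
rewrite Normc.normcM; apply: le_trans (ler_pM (nrm_ge0 _) (nrm_ge0 _) (H x y) (HD y x)) _.
rewrite expr0 invr1 mulr1 expr1z mulrACA ler_wpM2l ?mulr_ge0 ?(ltW C0) ?(ltW D0)//.
rewrite -mulrA; apply: ler_pM; rewrite ?mulr_ge0 ?wtXV_ge0 ?wt_ge0//.
  by apply: wtXV_le; lia.
rewrite mulrC ler_pdivrMr ?exprn_gt0 ?wt_gt0// mulrC ler_pdivlMr ?exprn_gt0 ?wt_gt0//.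
by rewrite -exprS ler_weXn2l ?wt_ge1.
Qed.

Lemma mtrD (M N : tmx R) : absum (fun x => M x x) -> absum (fun x => N x x) ->
  mtr (M + N : tmx R) = mtr M + mtr N.
Proof. exact: csumD. Qed.

Lemma mtrB (M N : tmx R) : absum (fun x => M x x) -> absum (fun x => N x x) ->
  mtr (M - N : tmx R) = mtr M - mtr N.
Proof.
move=> sM sN; rewrite -csumB//; congr csum; apply/funext => x; exact: tmxBE.
Qed.

(* Geometric decay of the powers makes the Neumann series of K converge; the
   order of K makes its tail after m terms decay like |x|^-m. *)
Lemma neumann (s : nat) (e : R) (K : tmx R) : (2 <= s)%N -> 0 < e ->
  e * sig3 R <= 2^-1 ->
  (forall x y, nrm (K x y) <= e * (wt x ^- s * wt y ^- s)) ->
  mord (-1) K ->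
  exists L : tmx R, [/\ decay s L, L = K + K * L & L = K + L * K].
Proof.
move=> s2 e0 es HK oK.
have pw m x y : nrm ((K ^+ m.+1 : tmx R) x y) <= e * 2^-1 ^+ m * (wt x ^- s * wt y ^- s).
  elim: m x y => [|m IH] x y; first by rewrite expr1 expr0 mulr1.
  rewrite exprS tmxME.
  have -> : e * 2^-1 ^+ m.+1 * (wt x ^- s * wt y ^- s) =
     e * 2^-1 ^+ m * (wt x ^- s * wt y ^- s) * 2^-1 by rewrite exprS; ring.
  apply: (@le_trans _ _ (e * 2^-1 ^+ m * (wt x ^- s * wt y ^- s) * (e * sig3 R))); last first.
    by rewrite ler_wpM2l// !mulr_ge0 ?wtXV_ge0 ?exprn_ge0 ?invr_ge0// ltW.
  rewrite mulrA; apply: csum_wt_bound => z; rewrite Normc.normcM.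
  apply: le_trans (ler_pM (nrm_ge0 _) (nrm_ge0 _) (HK x z) (IH z y)) _.
  have -> : e * (wt x ^- s * wt z ^- s) * (e * 2^-1 ^+ m * (wt z ^- s * wt y ^- s)) =
    e * 2^-1 ^+ m * (wt x ^- s * wt y ^- s) * e * (wt z ^- s * wt z ^- s) by ring.
  rewrite ler_wpM2l//.
    by rewrite !mulr_ge0 ?wtXV_ge0 ?exprn_ge0 ?invr_ge0// ltW.
  by rewrite -invfM -exprD; apply: wtXV_le; lia.
have sg := @rsummable_geo R.
have aK x y m : absum (fun i => (K ^+ (m + i).+1 : tmx R) x y).
  apply: absum_le (rsummableZ (e * (wt x ^- s * wt y ^- s)) sg) => i.
  apply: le_trans (pw _ _ _) _; rewrite mulrAC ler_wpM2l//.
    by rewrite !mulr_ge0 ?wtXV_ge0// ltW.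
  rewrite exprD ler_piMl ?exprn_ge0 ?invr_ge0// exprn_ile1 ?invr_ge0//.
  by rewrite invf_le1// ler1n.
pose L0 : Z2 -> Z2 -> R[i] := fun x y => csum (fun i => (K ^+ i.+1 : tmx R) x y).
pose G := rsum (fun m : nat => (2^-1 : R) ^+ m).
have G0 : 0 <= G by apply: rsum_ge0 => m; rewrite exprn_ge0 ?invr_ge0.
have dL : decay s L0.
  exists (e * G) => x y; rewrite mulrAC.
  apply: nrm_csum_le (rsummableZ (e * (wt x ^- s * wt y ^- s)) sg) _.
    by move=> i; rewrite mulrAC; exact: pw.
  by rewrite rsumZ.
have tL : tame L0.
  move=> n.
  have [D [D0 HD]] := mordP 3 (mord_tmxX n oK).
  have [k [C [C0 HC]]] := tameP n (tmx_tame (\sum_(i < n) K ^+ i.+1 : tmx R)).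
  exists k, (C + D * e * sig3 R * G) => x y.
  have -> : L0 x y = (\sum_(i < n) K ^+ i.+1 : tmx R) x y + csum (fun i => (K ^+ (n + i).+1 : tmx R) x y).
    rewrite /L0 (csum_shift (f := fun i => (K ^+ i.+1 : tmx R) x y) (m := n))//.
      congr (_ + _); elim: (n) => [|m IH]; first by rewrite !big_ord0.
      by rewrite big_ord_recr IH [in RHS]big_ord_recr.
    exact: (aK x y 0%N).
  apply: le_trans (le_normcD _ _) _; rewrite 2!mulrDl lerD//.
  have tailb i : nrm ((K ^+ (n + i).+1 : tmx R) x y) <= D * e * sig3 R * wt x ^- n * 2^-1 ^+ i.
    rewrite -addnS exprD tmxME.
    have -> : D * e * sig3 R * wt x ^- n * 2^-1 ^+ i = D * e * wt x ^- n * 2^-1 ^+ i * sig3 R by ring.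
    apply: (@csum_wtB_bound x) => z; rewrite Normc.normcM.
    apply: le_trans (ler_pM (nrm_ge0 _) (nrm_ge0 _) (HD x z) (pw i z y)) _.
    rewrite mulN1r wtzN.
    have -> : D * (wt x ^- n * wt (x - z) ^- 3) * (e * 2^-1 ^+ i * (wt z ^- s * wt y ^- s)) =
      D * e * wt x ^- n * 2^-1 ^+ i * wt (x - z) ^- 3 * (wt z ^- s * wt y ^- s) by ring.
    rewrite ler_piMr// ?mulr_ge0 ?wtXV_ge0 ?exprn_ge0 ?invr_ge0 ?(ltW D0) ?(ltW e0)//.
    by apply: mulr_ile1; rewrite ?wtXV_ge0// invf_le1 ?exprn_gt0 ?wt_gt0// exprn_ege1// wt_ge1.
  apply: nrm_csum_le tailb (rsummableZ _ sg) _.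
  rewrite rsumZ// -/G; have -> : D * e * sig3 R * wt x ^- n * G = D * e * sig3 R * G * wt x ^- n by ring.
  rewrite ler_peMr// ?exprn_ege1 ?wt_ge1// !mulr_ge0 ?wtXV_ge0 ?sig3_ge0//; exact: ltW.
exists (TMx tL); split=> //; apply: tmxP => x y; rewrite tmxDE tmxME /= {1}/L0.
  rewrite (csum_shift (f := fun i => (K ^+ i.+1 : tmx R) x y) (m := 1))//; last exact: (aK x y 0%N).
  rewrite big_ord1 expr1; congr (_ + _).
  rewrite [RHS](_ : _ = csum (fun z => csum (fun i => K x z * (K ^+ i.+1 : tmx R) z y))); last first.
    by congr csum; apply/funext => z; rewrite csumZ//; exact: (aK z y 0%N).
  rewrite csum_exchange.
    by congr csum; apply/funext => i; rewrite add1n exprS tmxME.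
  apply: absum_le (rsummableZ (e * e) (rsummable_tensor _ _ (@rsummable_wt3 R) sg)) => [[z i] /=||].
  - rewrite Normc.normcM; apply: le_trans (ler_pM (nrm_ge0 _) (nrm_ge0 _) (HK x z) (pw i z y)) _.
    have -> : e * (wt x ^- s * wt z ^- s) * (e * 2^-1 ^+ i * (wt z ^- s * wt y ^- s)) =
      e * e * ((wt z ^- s * wt z ^- s) * 2^-1 ^+ i) * (wt x ^- s * wt y ^- s) by ring.
    rewrite -invfM -exprD; apply: (@le_trans _ _ (e * e * (wt z ^- (s + s) * 2^-1 ^+ i))).
      rewrite ler_piMr// ?mulr_ge0 ?wtXV_ge0 ?exprn_ge0 ?invr_ge0 ?(ltW e0)//.
      by apply: mulr_ile1; rewrite ?wtXV_ge0// invf_le1 ?exprn_gt0 ?wt_gt0// exprn_ege1// wt_ge1.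
    rewrite ler_wpM2l ?mulr_ge0 ?(ltW e0)// ler_wpM2r ?exprn_ge0 ?invr_ge0//.
    by apply: wtXV_le; lia.
  - by move=> z; exact: wtXV_ge0.
  - by move=> i; rewrite exprn_ge0 ?invr_ge0.
rewrite (csum_shift (f := fun i => (K ^+ i.+1 : tmx R) x y) (m := 1))//; last exact: (aK x y 0%N).
rewrite big_ord1 expr1; congr (_ + _).
rewrite [RHS](_ : _ = csum (fun z => csum (fun i => (K ^+ i.+1 : tmx R) x z * K z y))); last first.
  by congr csum; apply/funext => z; rewrite csumZr//; exact: (aK x z 0%N).
rewrite csum_exchange.
  by congr csum; apply/funext => i; rewrite add1n exprSr tmxME.
apply: absum_le (rsummableZ (e * e) (rsummable_tensor _ _ (@rsummable_wt3 R) sg)) => [[z i] /=||].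
- rewrite Normc.normcM; apply: le_trans (ler_pM (nrm_ge0 _) (nrm_ge0 _) (pw i x z) (HK z y)) _.
  have -> : e * 2^-1 ^+ i * (wt x ^- s * wt z ^- s) * (e * (wt z ^- s * wt y ^- s)) =
    e * e * ((wt z ^- s * wt z ^- s) * 2^-1 ^+ i) * (wt x ^- s * wt y ^- s) by ring.
  rewrite -invfM -exprD; apply: (@le_trans _ _ (e * e * (wt z ^- (s + s) * 2^-1 ^+ i))).
    rewrite ler_piMr// ?mulr_ge0 ?wtXV_ge0 ?exprn_ge0 ?invr_ge0 ?(ltW e0)//.
    by apply: mulr_ile1; rewrite ?wtXV_ge0// invf_le1 ?exprn_gt0 ?wt_gt0// exprn_ege1// wt_ge1.
  rewrite ler_wpM2l ?mulr_ge0 ?(ltW e0)// ler_wpM2r ?exprn_ge0 ?invr_ge0//.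
  by apply: wtXV_le; lia.
- by move=> z; exact: wtXV_ge0.
- by move=> i; rewrite exprn_ge0 ?invr_ge0.
Qed.

End Orders.

(** * The index of an operator invertible up to finite rank *)

Section QuotDim.
Variables (K : fieldType) (V : lmodType K).

Definition subspace (W : set V) : Prop :=
  W 0 /\ forall (c : K) u v, W u -> W v -> W (c *: u + v).

Definition linear_on (V' : lmodType K) (W : set V) (f : V -> V') : Prop :=
  forall (c : K) u v, W u -> W v -> f (c *: u + v) = c *: f u + f v.

Lemma subspaceD (W : set V) u v : subspace W -> W u -> W v -> W (u + v).
Proof. by move=> [_ sW] Wu Wv; rewrite -[u]scale1r; exact: sW. Qed.

Lemma subspaceZ (W : set V) c u : subspace W -> W u -> W (c *: u).
Proof. by move=> [W0 sW] Wu; rewrite -[_ *: u]addr0; exact: sW. Qed.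

Lemma subspaceN (W : set V) u : subspace W -> W u -> W (- u).
Proof. by move=> sW Wu; rewrite -scaleN1r; exact: subspaceZ. Qed.

Lemma subspaceB (W : set V) u v : subspace W -> W u -> W v -> W (u - v).
Proof. by move=> sW Wu Wv; apply: subspaceD => //; exact: subspaceN. Qed.

Lemma subspace_sum (W : set V) (I : Type) (s : seq I) (F : I -> V) :
  subspace W -> (forall i, W (F i)) -> W (\sum_(i <- s) F i).
Proof.
move=> sW WF; elim: s => [|a s IH]; first by rewrite big_nil; case: sW.
by rewrite big_cons; exact: subspaceD.
Qed.

Section LinearOn.
Variables (V' : lmodType K) (W : set V) (f : V -> V').
Hypotheses (sW : subspace W) (lf : linear_on W f).

Lemma linear_onD u v : W u -> W v -> f (u + v) = f u + f v.
Proof. by move=> Wu Wv; rewrite -[u in LHS]scale1r lf// scale1r. Qed.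

Lemma linear_on0 : f 0 = 0.
Proof.
have W0 := sW.1; have := linear_onD W0 W0; rewrite addr0 => /eqP.
by rewrite -subr_eq0 opprD addNKr oppr_eq0 => /eqP.
Qed.

Lemma linear_onZ c u : W u -> f (c *: u) = c *: f u.
Proof. by move=> Wu; rewrite -[_ *: u in LHS]addr0 lf ?linear_on0 ?addr0//; exact: sW.1. Qed.

Lemma linear_onN u : W u -> f (- u) = - f u.
Proof. by move=> Wu; rewrite -scaleN1r linear_onZ// scaleN1r. Qed.

Lemma linear_onB u v : W u -> W v -> f (u - v) = f u - f v.
Proof. by move=> Wu Wv; rewrite linear_onD ?linear_onN//; exact: subspaceN. Qed.

Lemma linear_on_sum (I : Type) (s : seq I) (F : I -> V) :
  (forall i, W (F i)) -> f (\sum_(i <- s) F i) = \sum_(i <- s) f (F i).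
Proof.
move=> WF; elim: s => [|a s IH]; first by rewrite !big_nil linear_on0.
by rewrite !big_cons linear_onD ?IH//; exact: subspace_sum.
Qed.
End LinearOn.

Definition comb n (e : 'I_n -> V) (c : 'rV[K]_n) : V := \sum_(i < n) c ord0 i *: e i.

Lemma comb_lin n (e : 'I_n -> V) a (c d : 'rV[K]_n) :
  comb e (a *: c + d) = a *: comb e c + comb e d.
Proof.
rewrite /comb scaler_sumr -big_split; apply: eq_bigr => i _ /=.
by rewrite !mxE scalerDl scalerA.
Qed.

Lemma combD n (e : 'I_n -> V) (c d : 'rV[K]_n) : comb e (c + d) = comb e c + comb e d.
Proof. by rewrite -[c in LHS]scale1r comb_lin scale1r. Qed.

Lemma comb0 n (e : 'I_n -> V) : comb e 0 = 0.
Proof. by rewrite /comb big1// => i _; rewrite mxE scale0r. Qed.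

Lemma combN n (e : 'I_n -> V) (c : 'rV[K]_n) : comb e (- c) = - comb e c.
Proof. by apply/eqP; rewrite -addr_eq0 -combD addNr comb0. Qed.

Lemma comb_delta n (e : 'I_n -> V) i : comb e (delta_mx 0 i) = e i.
Proof.
rewrite /comb (bigD1 i)//= big1 ?addr0; first by rewrite mxE !eqxx scale1r.
by move=> j ji; rewrite mxE (negbTE ji) andbF scale0r.
Qed.

Lemma comb_in (W : set V) n (e : 'I_n -> V) (c : 'rV[K]_n) :
  subspace W -> (forall i, W (e i)) -> W (comb e c).
Proof. by move=> sW We; apply: subspace_sum => // i; exact: subspaceZ. Qed.

Lemma comb_mul n m (e : 'I_m -> V) (c : 'rV[K]_n) (A : 'M[K]_(n, m)) :
  comb (fun i => comb e (row i A)) c = comb e (c *m A).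
Proof.
rewrite /comb; under eq_bigr do rewrite scaler_sumr.
rewrite exchange_big; apply: eq_bigr => j _ /=; rewrite mxE scaler_suml.
by apply: eq_bigr => i _; rewrite scalerA mxE.
Qed.

(** Each family is expressed by the other modulo [N]. Uniqueness of coordinates makes the product of
    the two transition matrices the identity of size [n], which forces [n <= m]. *)
Lemma quot_dim_le (W N : set V) n m : subspace N ->
  has_quot_dim W N n -> has_quot_dim W N m -> (n <= m)%N.
Proof.
move=> sN [e [We He]] [f [Wf Hf]].
have ex i : exists c, N (e i - comb f c) by have [c [Nc _]] := Hf _ (We i); exists c.
have fx i : exists c, N (f i - comb e c) by have [c [Nc _]] := He _ (Wf i); exists c.
pose A := \matrix_i projT1 (cid (ex i)) : 'M[K]_(n, m).
pose B := \matrix_i projT1 (cid (fx i)) : 'M[K]_(m, n).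
have NA i : N (e i - comb f (row i A)) by rewrite rowK; case: cid.
have NB i : N (f i - comb e (row i B)) by rewrite rowK; case: cid.
apply: (@mulmx1_min K n m A B); apply/row_matrixP => i; rewrite row_mul row1.
have [c [_ uc]] := He _ (We i).
have -> : row i A *m B = c.
  apply/esym/uc; rewrite -/(comb e _).
  have -> : e i - comb e (row i A *m B) =
     (e i - comb f (row i A)) + comb (fun j => f j - comb e (row j B)) (row i A).
    rewrite -comb_mul /comb; under [X in _ = _ + X]eq_bigr do rewrite scalerBr.
    by rewrite big_split /= sumrN addrA subrK.
  apply: subspaceD => //; exact: comb_in.
apply: uc; rewrite -/(comb e _) comb_delta subrr; exact: sN.1.
Qed.

Lemma quot_dimE (W N : set V) n : subspace N -> has_quot_dim W N n -> quot_dim W N = n.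
Proof.
move=> sN h; have hk : has_quot_dim W N (quot_dim W N).
  by apply: (xgetPex 0%N (P := [set k | has_quot_dim W N k])); exists n.
by apply/eqP; rewrite eqn_leq (quot_dim_le sN hk h) (quot_dim_le sN h hk).
Qed.

End QuotDim.

Section MatrixTrace.
Variable K : fieldType.

(** In a full-rank factorisation [N = C B] the hypothesis cancels down to [B C = 0], and [C B] and
    [B C] have the same trace. *)
Lemma mxtrace_sq0 n (N : 'M[K]_n) : N *m N = 0 -> \tr N = 0.
Proof.
move=> NN; have /row_fullP[L L1] := col_base_full N.
have /row_freeP[M M1] := row_base_free N.
have E := mulmx_base N; rewrite -E mxtrace_mulC.
suff -> : row_base N *m col_base N = 0 by rewrite mxtrace0.
rewrite -[LHS]mul1mx -L1 -[LHS]mulmx1 -M1.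
have NN' : (col_base N *m row_base N) *m (col_base N *m row_base N) = 0 by rewrite E.
by have := congr1 (fun X => L *m X *m M) NN'; rewrite mulmx0 mul0mx !mulmxA.
Qed.

(** In a full-rank factorisation [A = C B] idempotence cancels down to [B C = 1], whose size is the
    rank. *)
Lemma mxtrace_idem n (A : 'M[K]_n) : A *m A = A -> \tr A = (\rank A)%:R.
Proof.
move=> AA; have /row_fullP[L L1] := col_base_full A.
have /row_freeP[M M1] := row_base_free A.
have E := mulmx_base A; rewrite -{1}E mxtrace_mulC.
suff -> : row_base A *m col_base A = 1%:M by rewrite mxtrace1.
have AA' : (col_base A *m row_base A) *m (col_base A *m row_base A) =
  col_base A *m row_base A by rewrite E.
move: (\rank A) (col_base A) (row_base A) L L1 M M1 {E} AA' => r c b L L1 M M1 E.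
have := congr1 (fun X => L *m X *m M) E.
by rewrite !mulmxA L1 !mul1mx -!mulmxA M1 !mulmx1.
Qed.

(** [G^2] is idempotent and [G - G^2] has square zero, so it carries no trace. *)
Lemma mxtrace_cube n (G : 'M[K]_n) : G *m G *m G = G *m G ->
  \tr G = (\rank (G *m G))%:R.
Proof.
move=> G3; rewrite -mxtrace_idem; last by rewrite mulmxA G3 G3.
apply/eqP; rewrite -subr_eq0 -raddfB /=; apply/eqP/mxtrace_sq0.
by rewrite mulmxBl !mulmxBr !mulmxA G3 G3 subrr.
Qed.

Lemma row_linear_mx p q (f : 'rV[K]_p -> 'rV[K]_q) :
  (forall c u v, f (c *: u + v) = c *: f u + f v) ->
  exists M, forall v, f v = v *m M.
Proof.
move=> lf; exists (\matrix_i f (delta_mx 0 i)) => v.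
have f0 : f 0 = 0.
  have := lf 1 0 0; rewrite scaler0 scale1r addr0 => /eqP.
  by rewrite -subr_eq0 opprD addNKr oppr_eq0 => /eqP.
have fs (s : seq 'I_p) : f (\sum_(i <- s) v 0 i *: delta_mx 0 i) = \sum_(i <- s) v 0 i *: f (delta_mx 0 i).
  by elim: s => [|a s IH]; rewrite ?big_nil// !big_cons lf IH.
rewrite {1}[v]row_sum_delta fs mulmx_sum_row.
by apply: eq_bigr => i _; rewrite rowK.
Qed.

End MatrixTrace.

Section FiniteRankIndex.
Variables (K : fieldType) (V : lmodType K) (W : set V) (D Q : V -> V).
Variables (n m : nat) (phi : V -> 'rV[K]_n) (psi : V -> 'rV[K]_m).
Variables (e : 'I_n -> V) (f : 'I_m -> V).
Hypotheses (sW : subspace W) (lD : linear_on W D) (lQ : linear_on W Q).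
Hypotheses (WD : forall w, W w -> W (D w)) (WQ : forall w, W w -> W (Q w)).
Hypotheses (lphi : linear_on W phi) (lpsi : linear_on W psi).
Hypotheses (We : forall i, W (e i)) (Wf : forall i, W (f i)).
Hypotheses (QD : forall w, W w -> w - Q (D w) = comb e (phi w)).
Hypotheses (DQ : forall w, W w -> w - D (Q w) = comb f (psi w)).

(* The space Z of pairs (w, k) with D w + comb f k = 0 is finite dimensional,
   and its dimension exceeds the index by m. Phi embeds it into a space of row
   vectors, and E Phi is a projection onto it. *)
Local Notation N := (n + m + m)%N.
Let Phi (w : V) (k : 'rV[K]_m) : 'rV[K]_N := row_mx (row_mx (phi w) k) (psi (D w)).
Let Ew (v : 'rV[K]_N) : V := comb e (lsubmx (lsubmx v)) - Q (comb f (rsubmx (lsubmx v))).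
Let Ek (v : 'rV[K]_N) : 'rV[K]_m :=
  rsubmx (lsubmx v) - psi (comb f (rsubmx (lsubmx v))) - rsubmx v.
Let inZ (w : V) (k : 'rV[K]_m) := W w /\ D w + comb f k = 0.

Let We' k : W (comb e k). Proof. exact: comb_in. Qed.

Let Wf' k : W (comb f k). Proof. exact: comb_in. Qed.

Let WEw v : W (Ew v). Proof. by apply: subspaceB => //; exact: WQ. Qed.

Let Ew_lin c u v : Ew (c *: u + v) = c *: Ew u + Ew v.
Proof.
rewrite /Ew !linearP /= !comb_lin lQ// scalerBr -!addrA; congr (_ + _).
by rewrite opprD addrCA.
Qed.

Let Ek_lin c u v : Ek (c *: u + v) = c *: Ek u + Ek v.
Proof.
rewrite /Ek !linearP /= !comb_lin lpsi//.
set A := psi _; set B := psi _.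
rewrite !scalerBr; apply/rowP => i; rewrite !mxE; ring.
Qed.

Let Phi_lin c w k w' k' : W w -> W w' ->
  Phi (c *: w + w') (c *: k + k') = c *: Phi w k + Phi w' k'.
Proof.
move=> Ww Ww'; rewrite /Phi lphi// lD// lpsi ?WD//; try exact: WD.
by rewrite !scale_row_mx !add_row_mx.
Qed.

Let EPhi_inZ w k : W w -> inZ (Ew (Phi w k)) (Ek (Phi w k)).
Proof.
move=> Ww; split; first exact: WEw.
rewrite /Ew /Ek /Phi !(row_mxKl, row_mxKr) -QD//.
set y := comb f k.
have Wy : W y by exact: Wf'.
have WDw := WD Ww.
have e1 : k - psi y - psi (D w) = k - psi (D w + y).
  by rewrite (linear_onD lpsi)// opprD addrA addrAC.
rewrite e1 combD combN -/y -DQ; last exact: subspaceD.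
rewrite !(linear_onB sW lD)//; try (by apply: WQ); last first.
  by apply: subspaceB => //; exact: WQ.
rewrite (linear_onD lQ)// (linear_onD lD); [|exact: WQ..].
rewrite !opprD !opprK !addrA.
set a := D w; set b := D (Q a); set c := D (Q y).
rewrite [LHS](ACl ((1*5)*(2*7)*(3*8)*(4*6))%AC) /=.
by rewrite !subrr !addNr !addr0.
Qed.

Let EPhi_id w k : inZ w k -> Ew (Phi w k) = w /\ Ek (Phi w k) = k.
Proof.
move=> [Ww Z]; have Dw : D w = - comb f k by apply/eqP; rewrite -addr_eq0 Z.
rewrite /Ew /Ek /Phi !(row_mxKl, row_mxKr) -QD//.
have -> : Q (comb f k) = - Q (D w).
  by rewrite Dw (linear_onN sW lQ)// opprK.
have -> : psi (D w) = - psi (comb f k) by rewrite Dw (linear_onN sW lpsi).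
by rewrite !opprK !subrK.
Qed.

Let PhiE v := Phi (Ew v) (Ek v).

Let PhiE_mx : exists G, forall v, PhiE v = v *m G.
Proof.
apply: row_linear_mx => c u v; rewrite /PhiE Ew_lin Ek_lin Phi_lin//.
Qed.

(** The kernel of [D] is the part of [Z] with [k = 0]. The vectors [k] that occur in [Z] are those
    with [comb f k] in the range, and by [DQ] the map [comb f] is onto modulo the range; hence the
    index is [dim Z - m]. The dimension of [Z] is the trace of [Phi E], read off on basis vectors:
    the three blocks contribute the sum over [phi], then [m] minus the sum over [psi], then 0. *)
Lemma finite_rank_index : fredholm W D /\
  (fredholm_index W D)%:~R =
    \sum_(i < n) phi (e i) ord0 i - \sum_(j < m) psi (f j) ord0 j.
Proof.
have [G HG] := PhiE_mx.
(* [E Phi] maps into [Z] and is the identity there, so it is idempotent; for the product [Phi E] in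
   the other order this yields only [G^3 = G^2]. *)
have G3 : G *m G *m G = G *m G.
  apply/row_matrixP => i; rewrite !rowE !mulmxA -!HG.
  set v := delta_mx _ _; rewrite {1}/PhiE.
  have h := EPhi_inZ (Ek v) (WEw v); have [-> ->] := EPhi_id h.
  by [].
have trG : \tr G = \sum_(i < n) phi (e i) ord0 i + (m%:R - \sum_(j < m) psi (f j) ord0 j).
  have Gii i : G i i = PhiE (delta_mx 0 i) 0 i by rewrite HG -rowE mxE.
  rewrite /mxtrace; under eq_bigr do rewrite Gii.
  rewrite !big_split_ord /= -addrA; congr (_ + _).
    apply: eq_bigr => i _; rewrite /PhiE /Phi !row_mxEl /Ew.
    have -> : rsubmx (lsubmx (delta_mx 0 (lshift m (lshift m i)) : 'rV[K]_N)) = 0.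
      by apply/rowP => j; rewrite !mxE eqxx /= -!val_eqE /=; case: eqP => //= E; have := ltn_ord i; rewrite -E; lia.
    have -> : lsubmx (lsubmx (delta_mx 0 (lshift m (lshift m i)) : 'rV[K]_N)) = delta_mx 0 i.
      by apply/rowP => j; rewrite !mxE.
    by rewrite comb0 (linear_on0 sW lQ) subr0 comb_delta.
  rewrite [X in _ + X]big1 ?addr0.
    rewrite (eq_bigr (fun j => 1 - psi (f j) ord0 j)) => [|j _].
      by rewrite big_split /= sumr_const card_ord sumrN.
    rewrite /PhiE /Phi row_mxEl row_mxEr /Ek.
    have -> : rsubmx (lsubmx (delta_mx 0 (lshift m (rshift n j)) : 'rV[K]_N)) = delta_mx 0 j.
      by apply/rowP => i; rewrite !mxE !eqxx /= -!val_eqE /= eqn_add2l.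
    have -> : rsubmx (delta_mx 0 (lshift m (rshift n j)) : 'rV[K]_N) = 0.
      apply/rowP => i; rewrite !mxE eqxx /= -!val_eqE /=.
      by case: eqP => //= E; have := ltn_ord j; lia.
    by rewrite comb_delta subr0 !mxE !eqxx.
  move=> j _; rewrite /PhiE /Phi row_mxEr /Ew.
  have -> : rsubmx (lsubmx (delta_mx 0 (rshift (n + m) j) : 'rV[K]_N)) = 0.
    apply/rowP => i; rewrite !mxE eqxx /= -!val_eqE /=.
    by case: eqP => //= E; have := ltn_ord i; lia.
  have -> : lsubmx (lsubmx (delta_mx 0 (rshift (n + m) j) : 'rV[K]_N)) = 0.
    apply/rowP => i; rewrite !mxE eqxx /= -!val_eqE /=.
    by case: eqP => //= E; have := ltn_ord i; lia.
  by rewrite !comb0 (linear_on0 sW lQ) subr0 (linear_on0 sW lD) (linear_on0 sW lpsi) mxE.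
pose A := G *m G; pose d := \rank A.
have AG : A *m G = A by exact: G3.
pose B := row_base A : 'M[K]_(d, N).
have BG : B *m G = B.
  have /submxP[X BX] : (B <= A)%MS by rewrite eq_row_base.
  by rewrite BX -mulmxA AG.
have Bfree : row_free B := row_base_free A.
have ZB (b : 'rV_d) : inZ (Ew (b *m B)) (Ek (b *m B)).
  have h := EPhi_inZ (Ek (b *m B)) (WEw (b *m B)).
  by move: h; rewrite -/(PhiE (b *m B)) HG -mulmxA BG.
have PhiB (b : 'rV_d) : Phi (Ew (b *m B)) (Ek (b *m B)) = b *m B.
  by rewrite -/(PhiE _) HG -mulmxA BG.
have ZinB w k : inZ w k -> exists b : 'rV_d, [/\ w = Ew (b *m B), k = Ek (b *m B) & Phi w k = b *m B].
  move=> Zwk; have [e1 e2] := EPhi_id Zwk.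
  have : (Phi w k <= B)%MS.
    rewrite eq_row_base; apply/submxP; exists (Phi w k).
    by rewrite mulmxA -!HG /PhiE e1 e2 e1 e2.
  by case/submxP => b Eb; exists b; rewrite -Eb.
have [T HT] : exists T, forall v, Ek v = v *m T by apply: row_linear_mx => c u v; exact: Ek_lin.
pose M := B *m T : 'M[K]_(d, m); pose r := \rank M.
have kdim : \rank (kermx M) = (d - r)%N by rewrite mxrank_ker.
have sker : subspace (kernel_in W D).
  split; first by split; [exact: sW.1|exact: (linear_on0 sW lD)].
  move=> c u v [Wu Du] [Wv Dv]; split; first exact: sW.2.
  by rewrite lD// Du Dv scaler0 addr0.
have s0 : subspace [set 0 : V].
  by split => // c u v /= -> ->; rewrite scaler0 addr0.
have sran : subspace (D @` W).
  split; first by exists 0; [exact: sW.1|exact: (linear_on0 sW lD)].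
  move=> c _ _ [u Wu <-] [v Wv <-]; exists (c *: u + v); first exact: sW.2.
  exact: lD.
(* [b M] is the [k]-component of the element of [Z] with coordinates [b], so the kernel of [M]
   describes the kernel of [D]. *)
have kq : has_quot_dim (kernel_in W D) [set 0] (\rank (kermx M)).
  pose H := row_base (kermx M) *m B.
  have Hfree : row_free H.
    have /row_freeP[X1 E1] := row_base_free (kermx M).
    have /row_freeP[X2 E2] := Bfree.
    by apply/row_freeP; exists (X2 *m X1); rewrite mulmxA -(mulmxA _ B) E2 mulmx1.
  have EkH c : Ek (c *m H) = 0.
    rewrite HT /H mulmxA -[_ *m T]mulmxA -/M -mulmxA.
    suff -> : row_base (kermx M) *m M = 0 by rewrite mulmx0.
    by apply/sub_kermxP; rewrite eq_row_base.
  have lEw : forall c, Ew (c *m H) = comb (fun i => Ew (row i H)) c.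
    move=> c; rewrite mulmx_sum_row /comb.
    have Ew0 : Ew 0 = 0.
      have := Ew_lin 1 0 0; rewrite scaler0 scale1r addr0 => /eqP.
      by rewrite -subr_eq0 opprD addNKr oppr_eq0 => /eqP.
    have : forall s : seq 'I_(\rank (kermx M)), Ew (\sum_(i <- s) c 0 i *: row i H) = \sum_(i <- s) c 0 i *: Ew (row i H).
      by elim=> [|a s IH]; rewrite ?big_nil// !big_cons Ew_lin IH.
    exact.
  exists (fun i => Ew (row i H)); split.
    move=> i; split; first exact: WEw.
    have := ZB (row i (row_base (kermx M))); rewrite -row_mul -/H => -[_].
    by rewrite rowE EkH comb0 addr0.
  move=> w [Ww Dw0].
  have /ZinB[b [wb kb Pb]] : inZ w 0 by split => //; rewrite Dw0 comb0 addr0.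
  have : (b <= row_base (kermx M))%MS.
    by rewrite eq_row_base; apply/sub_kermxP; rewrite mulmxA -HT -kb.
  case/submxP => c bc; exists c; split.
    by rewrite /= -/(comb _ _) -lEw /H mulmxA -bc -wb subrr.
  move=> c' /= /eqP; rewrite -/(comb _ _) subr_eq0 -lEw => /eqP wc'.
  apply: (row_free_inj Hfree).
  have <- : Phi w 0 = c *m H by rewrite /H mulmxA -bc.
  by rewrite wc' -(EkH c') /H mulmxA PhiB.
(* The row space of [M] consists of the [k] with [comb f k] in the range; a complement of it
   therefore gives a basis of the cokernel. *)
have cq : has_quot_dim W (D @` W) (\rank (M^C)%MS).
  pose H := row_base (M^C)%MS.
  exists (fun i => comb f (row i H)); split; first by move=> i; exact: Wf'.
  have ranM k : (k <= M)%MS -> (D @` W) (comb f k).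
    case/submxP => b ->; rewrite /M mulmxA -HT.
    have [Wb /eqP] := ZB b; rewrite addr_eq0 => /eqP Db.
    exists (- Ew (b *m B)); first exact: subspaceN.
    by rewrite (linear_onN sW lD)// Db opprK.
  move=> w Ww; pose k := psi w.
  have : (k <= M + M^C)%MS.
    by apply: submx_full; apply: addsmx_compl_full.
  case/sub_addsmxP => -[u1 u2] /= kE.
  have /submxP[c cE] : (u2 *m (M^C)%MS <= H)%MS by rewrite eq_row_base submxMl.
  have base : (D @` W) (w - comb f (u2 *m (M^C)%MS)).
    have -> : w - comb f (u2 *m (M^C)%MS) = D (Q w) + comb f (u1 *m M).
      have := DQ Ww; rewrite -/k kE combD => E.
      by apply/eqP; rewrite subr_eq -addrA -E addrC subrK.
    apply: (subspaceD sran); first by exists (Q w) => //; exact: WQ.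
    by apply: ranM; exact: submxMl.
  exists c; split; first by rewrite /= -/(comb _ _) comb_mul -cE; exact: base.
  move=> c' /=; rewrite -/(comb _ _) comb_mul => R1.
  have R2 : (D @` W) (comb f ((c' - c) *m H)).
    have -> : comb f ((c' - c) *m H) =
        (w - comb f (u2 *m (M^C)%MS)) - (w - comb f (c' *m H)).
      by rewrite mulmxBl combD combN -cE opprB [RHS]addrC addrA subrK.
    by apply: (subspaceB sran).
  case: R2 => w0 Ww0 Dw0.
  have /ZinB[b [_ kb _]] : inZ (- w0) ((c' - c) *m H).
    split; first exact: subspaceN.
    by rewrite (linear_onN sW lD)// Dw0 addNr.
  have : ((c' - c) *m H <= M :&: M^C)%MS.
    rewrite sub_capmx; apply/andP; split.
      by rewrite kb HT -mulmxA -/M submxMl.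
    by apply: submx_trans (submxMl _ _) _; rewrite eq_row_base.
  rewrite capmx_compl submx0 mulmxBl subr_eq0 => /eqP E.
  exact/esym/(row_free_inj (row_base_free _)).
split; first by split; [exists (\rank (kermx M))|exists (\rank (M^C)%MS)].
rewrite /fredholm_index (quot_dimE s0 kq) (quot_dimE sran cq).
have -> : \sum_(i < n) phi (e i) ord0 i - \sum_(j < m) psi (f j) ord0 j = \tr G - m%:R.
  by rewrite trG -addrA; congr (_ + _); rewrite addrAC subrr add0r.
rewrite (mxtrace_cube G3) -/A -/d kdim mxrank_compl -/r.
have rd : (r <= d)%N := rank_leq_row M; have rm : (r <= m)%N := rank_leq_col M.
by rewrite -!subzn// opprB addrA subrK rmorphB /= -!pmulrn.
Qed.

End FiniteRankIndex.

(** * The index formula for operators represented by matrices *)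

Section Cutoff.
Variable R : realType.
Notation wt := (@wt R).

Lemma tame_ind (F : seq Z2) :
  tame (fun x y : Z2 => if x == y then (if x \in F then 1 else 0) else 0 : R[i]).
Proof.
apply: (@tame_diag R (fun x => if x \in F then 1 else 0) 1 0) => x.
by rewrite expr0 mulr1; case: ifP; rewrite ?Normc.normc1 ?Normc.normc0.
Qed.
Definition cut (F : seq Z2) : tmx R := TMx (@tame_ind F).

Lemma mul_cut (F : seq Z2) (M : tmx R) x y :
  (M * cut F) x y = if y \in F then M x y else 0.
Proof.
rewrite tmxME; have [|_ ->] := @csum_one R _ y (fun z => M x z * cut F z y).
  by move=> z; rewrite /= => /negbTE ->; rewrite mulr0.
by rewrite /= eqxx; case: ifP; rewrite ?mulr1 ?mulr0.
Qed.

Lemma mul_cut_mul (F : seq Z2) (M N : tmx R) x y : uniq F ->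
  (M * cut F * N) x y = \sum_(z <- F) M x z * N z y.
Proof.
move=> uF; rewrite tmxME.
have [|_ ->] := @csum_fsupp R _ F (fun z => (M * cut F) x z * N z y) uF.
  by move=> z /negbTE zF; rewrite mul_cut zF mul0r.
by rewrite big_seq [RHS]big_seq; apply: eq_bigr => z zF; rewrite mul_cut zF.
Qed.

Lemma tapp_cut (F : seq Z2) (M N : tmx R) v x : uniq F -> rapid v ->
  tapp (M * cut F * N) v x = \sum_(z <- F) M x z * tapp N v z.
Proof.
move=> uF rv; rewrite /tapp /rawapp.
under [X in csum X]eq_fun do rewrite mul_cut_mul// mulr_suml.
rewrite csum_sum; last first.
  move=> z; under eq_fun do rewrite -mulrA.
  by apply: absumZ; exact: absum_tapp.
apply: eq_bigr => z _; rewrite -csumZ; last exact: absum_tapp.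
by congr csum; apply/funext => y; rewrite mulrA.
Qed.

Lemma mtr_cut (F : seq Z2) (M N : tmx R) : uniq F ->
  absum (fun x => (M * cut F * N) x x) /\
  mtr (M * cut F * N : tmx R) = \sum_(z <- F) (N * M) z z.
Proof.
move=> uF; have h z : absum (fun x => M x z * N z x).
  by have := absum_tmxM N M z z; under eq_fun do rewrite mulrC.
rewrite /mtr; under [X in absum X]eq_fun do rewrite mul_cut_mul//.
under [X in csum X]eq_fun do rewrite mul_cut_mul//.
split; first exact: absum_sum.
rewrite csum_sum//; apply: eq_bigr => z _; rewrite tmxME.
by congr csum; apply/funext => y; rewrite mulrC.
Qed.

Lemma mord_cut F : mord 0 (cut F).
Proof.
move=> n; exists 1 => x y; rewrite /= mul1r expr0z mul1r; case: eqP => [->|_]; last first.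
  by rewrite Normc.normc0 wtXV_ge0.
rewrite subrr /wt /= !addr0 expr1n invr1.
by case: ifP; rewrite ?Normc.normc1 ?Normc.normc0.
Qed.

Lemma wt_ball (M : R) : exists2 F : seq Z2, uniq F & forall x, x \notin F -> M < wt x.
Proof.
pose n := (Num.truncn `|M|).+1; have Mn : M < n%:R.
  by apply: le_lt_trans (ler_norm _) _; exact: truncnS_gt.
exists [seq (a, b) | a <- zbox n, b <- zbox n].
  by rewrite allpairs_uniq ?zbox_uniq// => -[a b] [c d].
move=> [a b] abF; apply: (lt_le_trans Mn); rewrite /wt /=.
have : ~~ ((a \in zbox n) && (b \in zbox n)).
  apply: contra abF => /andP[h1 h2]; apply/allpairsP; exists (a, b); by split.
have h (c : int) : c \notin zbox n -> n%:R <= `|c|%:~R :> R.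
  rewrite mem_zbox -ltnNge => cn.
  by rewrite pmulrn ler_int; lia.
have a0 : 0 <= `|a|%:~R :> R by rewrite ler0z.
have b0 : 0 <= `|b|%:~R :> R by rewrite ler0z.
rewrite negb_and => /orP[/h|/h]; lra.
Qed.

(* The part of K outside finitely many columns is small, hence 1 - K is
   invertible up to finite rank. *)
Lemma neumann_cut (K : tmx R) : mord (- 10%:Z) K ->
  exists (F : seq Z2) (L : tmx R), [/\ uniq F, decay 4 L,
    L = K * (1 - cut F) + K * (1 - cut F) * L &
    L = K * (1 - cut F) + L * (K * (1 - cut F))].
Proof.
move=> oK; have [C [C0 HC]] := decayP (mord_decay (s := 5) oK).
(* Order -10 gives decay of rate 5. Outside the ball one power of the column weight is below
   [1 / M], which makes the constant small enough for [neumann]; rate 4 remains. *)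
pose M := 2 * C * (sig3 R + 1).
have S0 := sig3_ge0 R.
have M0 : 0 < M by rewrite !mulr_gt0//; lra.
have [F uF HF] := wt_ball M.
have [|||||L [L1 L2 L3]] := @neumann R 4 (C / M) (K * (1 - cut F)).
- by [].
- by rewrite divr_gt0.
- rewrite mulrAC ler_pdivrMr// /M.
  have : C * sig3 R <= C * (sig3 R + 1) by rewrite ler_wpM2l ?(ltW C0)//; lra.
  lra.
- move=> x y; rewrite mulrBr mulr1 tmxBE mul_cut; case: ifP => yF.
    by rewrite subrr Normc.normc0 !mulr_ge0 ?wtXV_ge0 ?invr_ge0 ?(ltW C0) ?(ltW M0).
  rewrite subr0; apply: le_trans (HC x y) _; rewrite -mulrA ler_wpM2l ?(ltW C0)//.
  rewrite mulrCA; apply: ler_pM; rewrite ?wtXV_ge0//; first exact: wtXV_le.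
  rewrite exprSr invfM mulrC ler_wpM2r ?wtXV_ge0// lef_pV2 ?posrE ?wt_gt0//.
  by apply/ltW/HF; rewrite yF.
- have -> : (-1 : int) = -1 + 0 by rewrite addr0.
  apply: mord_tmxM; first by apply: mord_le oK.
  by apply: mord_tmxB; [exact: mord_tmx1|exact: mord_cut].
by exists F, L.
Qed.

End Cutoff.

Section MatrixIndex.
Variable R : realType.
Variables (V : lmodType R[i]) (W : set V).
Variables (A : V -> (Z2 -> R[i]^o)) (S : (Z2 -> R[i]^o) -> V) (p : tmx R).
Hypotheses (sW : subspace W) (lA : linear_on W A).
Hypotheses (rA : forall w, W w -> rapid (A w)) (pA : forall w, W w -> tapp p (A w) = A w).
Hypotheses (WS : forall v, rapid v -> tapp p v = v -> W (S v)).
Hypotheses (AS : forall v, rapid v -> tapp p v = v -> A (S v) = v).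
Hypotheses (SA : forall w, W w -> S (A w) = w).
Hypothesis pp : p * p = p.

Lemma rep_inj w w' : W w -> W w' -> A w = A w' -> w = w'.
Proof. by move=> Ww Ww' E; rewrite -(SA Ww) -(SA Ww') E. Qed.

Lemma A_comb n (e : 'I_n -> V) (c : 'rV[R[i]]_n) x : (forall i, W (e i)) ->
  A (comb e c) x = \sum_(i < n) c ord0 i * A (e i) x.
Proof.
move=> We; rewrite /comb (linear_on_sum sW lA); last by move=> i; exact: subspaceZ.
rewrite fct_sumE; apply: eq_bigr => i _.
by rewrite (linear_onZ sW lA).
Qed.

Definition lift (M : tmx R) (w : V) : V := S (tapp M (A w)).

Lemma tapp_p (M : tmx R) w : W w -> p * M = M -> tapp p (tapp M (A w)) = tapp M (A w).
Proof. by move=> Ww pM; rewrite -tapp_mul ?pM//; exact: rA. Qed.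

Lemma W_lift (M : tmx R) w : W w -> p * M = M -> W (lift M w).
Proof.
move=> Ww pM; apply: WS; last exact: tapp_p.
by apply: tapp_rapid; exact: rA.
Qed.

Lemma A_lift (M : tmx R) w : W w -> p * M = M -> A (lift M w) = tapp M (A w).
Proof.
move=> Ww pM; apply: AS; last exact: tapp_p.
by apply: tapp_rapid; exact: rA.
Qed.

Lemma linear_lift (M : tmx R) : p * M = M -> linear_on W (lift M).
Proof.
move=> pM c u v Wu Wv; apply: rep_inj.
- by apply: W_lift => //; exact: sW.2.
- by apply: sW.2; exact: W_lift.
rewrite lA; [|exact: W_lift..]; rewrite !A_lift//; last exact: sW.2.
rewrite lA// -[LHS]/(tapp M (fun x => c * A u x + A v x)).
by rewrite tapp_lin; [|exact: rA..].
Qed.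

(** [K1] and [K2] need not have finite rank. A Neumann series on the left turns [Qm] into [Ql],
    whose two remainders do have finite rank, so [finite_rank_index] applies; the correction
    [L1 * Qm] changes both traces by the same amount. *)
Lemma matrix_index (D : V -> V) (Dm Qm K1 K2 : tmx R) :
  K1 = p - Qm * Dm -> K2 = p - Dm * Qm ->
  linear_on W D -> (forall w, W w -> W (D w)) ->
  (forall w, W w -> A (D w) = tapp Dm (A w)) ->
  p * Dm = Dm -> Dm * p = Dm -> p * Qm = Qm -> Qm * p = Qm ->
  mord 1 Dm -> mord 0 Qm ->
  mord (- 10%:Z) K1 -> mord (- 10%:Z) K2 ->
  fredholm W D /\ (fredholm_index W D)%:~R = mtr K1 - mtr K2.
Proof.
move=> EK1 EK2 lD WD AD pD Dp pQ Qp oD oQ oK1 oK2.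
have pK1 : p * K1 = K1 by rewrite EK1 mulrBr pp mulrA pQ.
have K1p : K1 * p = K1 by rewrite EK1 mulrBl pp -mulrA Dp.
have pK2 : p * K2 = K2 by rewrite EK2 mulrBr pp mulrA pD.
have K2p : K2 * p = K2 by rewrite EK2 mulrBl pp -mulrA Qp.
have QDm : Qm * Dm = p - K1 by rewrite EK1 opprB addrC subrK.
have DQm : Dm * Qm = p - K2 by rewrite EK2 opprB addrC subrK.
have [F1 [L1 [uF1 dL1 L1l L1r]]] := neumann_cut oK1.
have [F2 [L2 [uF2 dL2 L2l L2r]]] := neumann_cut oK2.
have pL1 : p * L1 = L1.
  have : p * (K1 * (1 - cut R F1) + K1 * (1 - cut R F1) * L1) =
      K1 * (1 - cut R F1) + K1 * (1 - cut R F1) * L1 by rewrite mulrDr !mulrA pK1.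
  by rewrite -L1l.
pose J1 := 1 + L1; pose J2 := 1 + L2.
have J1K : J1 * (1 - K1 * (1 - cut R F1)) = 1.
  rewrite /J1 mulrBr mulr1 mulrDl mul1r {1}L1r.
  by rewrite -addrA subrr addr0.
have K2J : (1 - K2 * (1 - cut R F2)) * J2 = 1.
  rewrite /J2 mulrBl mul1r mulrDr mulr1 {1}L2l.
  by rewrite -addrA subrr addr0.
pose Ql := J1 * Qm; pose Qr := Qm * J2 * p.
have pJ1 M : p * M = M -> p * (J1 * M) = J1 * M.
  by move=> pM; rewrite /J1 mulrDl mul1r mulrDr pM !mulrA pL1.
have pQl : p * Ql = Ql by exact: pJ1.
have split_cut (K : tmx R) F : 1 - K = 1 - K * (1 - cut R F) - K * cut R F.
  by rewrite -addrA -opprD -mulrDr subrK mulr1.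
(* [J1] inverts the part of [1 - K1] outside [F1], so only the finitely many columns in [F1] are
   left. *)
have eF1 : p - Ql * Dm = J1 * K1 * cut R F1 * p.
  have -> : Ql * Dm = J1 * ((1 - K1) * p) by rewrite mulrBl mul1r K1p -QDm mulrA.
  rewrite (split_cut K1 F1) mulrA mulrBr J1K mulrBl mul1r opprB addrC subrK.
  by rewrite !mulrA.
have eF2r : Dm * Qr = p - K2 * cut R F2 * J2 * p.
  have -> : Dm * Qr = p * (1 - K2) * J2 * p.
    by rewrite mulrBr mulr1 pK2 -DQm /Qr !mulrA.
  rewrite (split_cut K2 F2) -(mulrA p) [(_ - _ * cut _ _) * J2]mulrBl K2J.
  by rewrite mulrBr mulr1 mulrBl pp !mulrA pK2.
pose T := p - Dm * Ql.
have Tp : T * p = T.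
  by rewrite /T mulrBl pp /Ql -!mulrA Qp.
have pT : p * T = T by rewrite /T mulrBr pp mulrA pD.
(* [Ql] is made for the left side only. Its right remainder [T] is compared with the right
   parametrix [Qr]: [T * (Dm * Qr)] equals [Dm * (p - Ql * Dm) * Qr], of finite rank by [eF1], and
   the rest is of finite rank by [eF2r]. *)
have eF2 : T = (Dm * J1 * K1) * cut R F1 * (p * Qr) + (T * K2) * cut R F2 * (J2 * p).
  have e1 : T * (Dm * Qr) = (Dm * J1 * K1) * cut R F1 * (p * Qr).
    have -> : T * (Dm * Qr) = Dm * (p - Ql * Dm) * Qr.
      by rewrite /T mulrBl mulrBr mulrBl Dp !mulrA pD.
    by rewrite eF1 !mulrA.
  rewrite -e1 eF2r mulrBr Tp !mulrA.
  by rewrite addrNK.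
pose N0 : tmx R := J1 * K1; pose N1 : tmx R := Dm * J1 * K1.
pose N2 : tmx R := T * K2.
pose n := size F1; pose m := size F2.
pose y1 (i : 'I_n) := nth (0 : Z2) F1 i; pose y2 (i : 'I_m) := nth (0 : Z2) F2 i.
pose phi w : 'rV[R[i]]_n := \row_i A w (y1 i).
pose psi w : 'rV[R[i]]_(n + m) :=
  row_mx (\row_i tapp (p * Qr) (A w) (y1 i)) (\row_j tapp (J2 * p) (A w) (y2 j)).
pose e (i : 'I_n) := S (fun x => N0 x (y1 i)).
pose f (i : 'I_(n + m)) : V := match fintype.split i with
  | inl i => S (fun x => N1 x (y1 i))
  | inr j => S (fun x => N2 x (y2 j)) end.
have pcol (M : tmx R) y : p * M = M -> tapp p (fun x => M x y) = fun x => M x y.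
  by move=> pM; apply/funext => x; rewrite -{2}pM.
have rcol (M : tmx R) y : rapid (fun x => M x y) by apply: tame_col; exact: tmx_tame.
have pJK : p * N0 = N0 by exact: pJ1.
have pDJK : p * N1 = N1 by rewrite /N1 !mulrA pD.
have pTK : p * N2 = N2 by rewrite /N2 mulrA pT.
have We i : W (e i) by apply: WS; [exact: rcol|exact: pcol].
have Ae i : A (e i) = fun x => N0 x (y1 i) by apply: AS; [exact: rcol|exact: pcol].
have Wf i : W (f i) by rewrite /f; case: (fintype.split i) => j; apply: WS; (exact: rcol || exact: pcol).
have lphi : linear_on W phi.
  by move=> c u v Wu Wv; apply/rowP => i; rewrite !mxE lA.
have lpsi : linear_on W psi.
  move=> c u v Wu Wv; rewrite /psi scale_row_mx add_row_mx; congr row_mx;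
  apply/rowP => i; rewrite !mxE lA//.
  - by rewrite -[LHS]/(tapp (p * Qr) (fun x => c * A u x + A v x) _) tapp_lin//; exact: rA.
  - by rewrite -[LHS]/(tapp (J2 * p) (fun x => c * A u x + A v x) _) tapp_lin//; exact: rA.
have QlD w : W w -> w - lift Ql (D w) = comb e (phi w).
  move=> Ww; have WDw := WD _ Ww; apply: rep_inj.
  - by apply: subspaceB => //; exact: W_lift.
  - exact: comb_in.
  rewrite (linear_onB sW lA)//; last exact: W_lift.
  rewrite A_lift// AD// -tapp_mul; last exact: rA.
  rewrite -{1}(pA Ww) -tappB; last exact: rA.
  rewrite eF1; apply/funext => x; rewrite tapp_cut//; last exact: rA.
  rewrite A_comb// (big_nth 0) big_mkord; apply: eq_bigr => i _.
  by rewrite Ae pA// mxE mulrC.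
have DQl w : W w -> w - D (lift Ql w) = comb f (psi w).
  move=> Ww; have WQ := W_lift Ww pQl; have WDQ := WD _ WQ; apply: rep_inj.
  - exact: subspaceB.
  - exact: comb_in.
  rewrite (linear_onB sW lA)// AD// A_lift// -tapp_mul; last exact: rA.
  rewrite -{1}(pA Ww) -tappB; last exact: rA.
  rewrite -/T eF2 tappD; last exact: rA.
  apply/funext => x.
  rewrite -[LHS]/(tapp (N1 * cut R F1 * (p * Qr)) (A w) x + tapp (N2 * cut R F2 * (J2 * p)) (A w) x).
  rewrite (tapp_cut N1 (p * Qr) x uF1 (rA Ww)) (tapp_cut N2 (J2 * p) x uF2 (rA Ww)).
  rewrite A_comb// big_split_ord /=; congr (_ + _).
    rewrite (big_nth 0) big_mkord; apply: eq_bigr => i _.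
    rewrite /psi row_mxEl mxE mulrC /f (unsplitK (inl i)) AS//; exact: pcol.
  rewrite (big_nth 0) big_mkord; apply: eq_bigr => i _.
  rewrite /psi row_mxEr mxE mulrC /f (unsplitK (inr i)) AS//; exact: pcol.
have [fr ind] := finite_rank_index sW lD (linear_lift pQl) WD
  (fun w Ww => W_lift Ww pQl) lphi lpsi We Wf QlD DQl.
split=> //; rewrite ind.
have [s1 t1] := mtr_cut N0 p uF1.
have [s2 t2] := mtr_cut N1 (p * Qr) uF1.
have [s3 t3] := mtr_cut N2 (J2 * p) uF2.
have -> : \sum_(i < n) phi (e i) ord0 i = mtr (p - Ql * Dm : tmx R).
  rewrite eF1 t1 pJK (big_nth 0) big_mkord; apply: eq_bigr => i _.
  by rewrite mxE Ae.
have sT : absum (fun x => T x x).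
  rewrite eF2; exact: (absumD s2 s3).
have -> : \sum_(j < n + m) psi (f j) ord0 j = mtr T.
  rewrite eF2 (mtrD s2 s3) t2 t3 big_split_ord /=; congr (_ + _).
    rewrite (big_nth 0) big_mkord; apply: eq_bigr => i _.
    rewrite /psi row_mxEl mxE /f (unsplitK (inl i)) AS//; exact: pcol.
  rewrite (big_nth 0) big_mkord; apply: eq_bigr => i _.
  rewrite /psi row_mxEr mxE /f (unsplitK (inr i)) AS//; exact: pcol.
have sK1 : absum (fun x => K1 x x) by apply: mord_trace oK1.
have sK2 : absum (fun x => K2 x x) by apply: mord_trace oK2.
have e1 : p - Ql * Dm = K1 - (L1 * Qm) * Dm.
  by rewrite /Ql /J1 EK1 mulrDl mul1r mulrDl opprD addrA.
have e2 : T = K2 - Dm * (L1 * Qm).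
  by rewrite /T /Ql /J1 EK2 mulrDl mul1r mulrDr opprD addrA.
have s4 : absum (fun x => ((L1 * Qm) * Dm) x x).
  have -> : L1 * Qm * Dm = K1 - (p - Ql * Dm) by rewrite e1 opprB addrC subrK.
  rewrite eF1; under eq_fun do rewrite tmxBE; exact: (absumB sK1 s1).
have s5 : absum (fun x => (Dm * (L1 * Qm)) x x).
  have -> : Dm * (L1 * Qm) = K2 - T by rewrite e2 opprB addrC subrK.
  by under eq_fun do rewrite tmxBE; exact: (absumB sK2 sT).
(* Rate 4 against order 1 is just enough: the traces of [L1 * Qm * Dm] and [Dm * (L1 * Qm)] agree
   and cancel in the index. *)
have cyc := decay_cyc (s := 4) (M := L1 * Qm) (N := Dm) isT (decayMr dL1 oQ) oD.
by rewrite e1 e2 (mtrB sK1 s4) (mtrB sK2 s5) cyc opprB addrA subrK.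
Qed.

End MatrixIndex.

(** * Reduction of the index to a cubic trace *)

Section IntegerPolynomial.
Variable R : realType.

(** If the value at 1 exceeded that at 0, some value in between would be an integer plus one half;
    the polynomial [- q] gives the other inequality. *)
Lemma int_poly_const (q : {poly R}) :
  (forall t : R, exists n : int, q.[t] = n%:~R) -> q.[1] = q.[0].
Proof.
have H (r : {poly R}) : (forall t : R, exists n : int, r.[t] = n%:~R) -> r.[1] <= r.[0].
  move=> rint; rewrite leNgt; apply/negP => lt.
  have [n0 e0] := rint 0; have [n1 e1] := rint 1.
  have n01 : n0 + 1 <= n1 by move: lt; rewrite e0 e1 ltr_int lezD1.
  have n01' : n0%:~R + 1 <= n1%:~R :> R by move: n01; rewrite -(ler_int R) intrD.
  have [] := @poly_ivt R (r - (n0%:~R + 2^-1)%:P) 0 1 ler01.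
    by rewrite !hornerE e0 e1; apply/andP; split; lra.
  move=> x _; rewrite /root !hornerE subr_eq0 => /eqP E.
  have [k ek] := rint x; rewrite ek in E.
  have k1 : (k - n0)%:~R = 2^-1 :> R by rewrite intrB E; lra.
  have : (k - n0)%:~R < 1%:~R :> R by rewrite k1 mulr1z; lra.
  have : 0%:~R < (k - n0)%:~R :> R by rewrite k1 mulr0z; lra.
  by rewrite !ltr_int; lia.
move=> qint; apply/eqP; rewrite eq_le H//= -lerN2 -!hornerN.
by apply: H => t; have [n e] := qint t; exists (- n); rewrite hornerN e mulrNz.
Qed.

End IntegerPolynomial.

(** * Algebra of two idempotents *)

Section TwoIdempotents.
Variables (T : pzRingType) (p q : T).
Hypotheses (pp : p * p = p) (qq : q * q = q).
Local Notation d := (p - q).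

Lemma d2E : d * d = p + q - p * q - q * p.
Proof.
rewrite mulrBl !mulrBr pp qq opprB addrA.
by rewrite [LHS](ACl (1*3*2*4)%AC).
Qed.

Lemma pd2 : p * (d * d) = p - p * q * p.
Proof. by rewrite d2E !mulrBr !mulrDr !mulrA pp addrK. Qed.

Lemma d2p : d * d * p = p - p * q * p.
Proof.
rewrite d2E !mulrBl !mulrDl pp -!mulrA pp.
by rewrite addrAC addrK mulrA.
Qed.

Lemma qd2 : q * (d * d) = q - q * p * q.
Proof.
rewrite d2E !mulrBr !mulrDr !mulrA qq.
by rewrite [LHS](ACl ((1*4)*2*3)%AC) /= subrr add0r.
Qed.

Lemma d2q : d * d * q = q - q * p * q.
Proof.
rewrite d2E !mulrBl !mulrDl -!mulrA qq.
by rewrite [LHS](ACl ((1*3)*2*4)%AC) /= subrr add0r.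
Qed.

(** The square of [p - q] commutes with both idempotents although [p - q] need not. *)
Lemma comm_p_d2n n : GRing.comm p (d ^+ (2 * n)).
Proof. by rewrite exprM; apply: commrX; rewrite /GRing.comm expr2 pd2 d2p. Qed.

Lemma comm_q_d2n n : GRing.comm q (d ^+ (2 * n)).
Proof. by rewrite exprM; apply: commrX; rewrite /GRing.comm expr2 qd2 d2q. Qed.

Lemma idem_mulX (e c : T) n : e * e = e -> GRing.comm e c -> (e * c) ^+ n.+1 = e * c ^+ n.+1.
Proof.
move=> ee ec; rewrite exprMn_comm//; congr (_ * _).
by elim: n => [|n IH]; rewrite ?expr1// exprS IH.
Qed.

(** The left side is [p q p - q p q], formally of trace zero. The right side spells this out as a
    commutator and a term annihilated under the trace by [p * (p - 1) = 0], with a factor [q - p] in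
    each term so that an order is gained wherever cyclicity will be used. *)
Lemma d_minus_d3 : d - d ^+ 3 =
  (p * (q - p) * (q * p) - q * p * (p * (q - p))) + (p - 1) * (q - p) * p.
Proof.
have -> : d ^+ 3 = d - p * q * p + q * p * q.
  rewrite !exprS expr0 mulr1 mulrBl pd2 qd2 opprB addrA.
  by rewrite [LHS](ACl (1*4*2*3)%AC).
have -> : p * (q - p) * (q * p) = 0.
  rewrite mulrBr pp mulrBl -!mulrA (mulrA q q) qq !mulrA.
  by rewrite subrr.
have -> : q * p * (p * (q - p)) = q * p * q - q * p.
  by rewrite mulrBr pp mulrBr !mulrA -(mulrA q p p) pp.
have -> : (p - 1) * (q - p) * p = p * q * p - q * p.
  rewrite -mulrA [(q - p) * p]mulrBl pp mulrBl mul1r mulrBr pp mulrA.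
  by rewrite opprB addrA subrK.
move: (p - q) (p * q * p) (q * p * q) (q * p) => a b c e.
rewrite sub0r opprB opprD opprB addrA (addrCA a) subrr addr0.
by rewrite [RHS]addrC addrA subrK.
Qed.

Lemma d_minus_d3_comm (E : T) : GRing.comm p E -> GRing.comm q E ->
  (d - d ^+ 3) * E = (p * (q - p) * E * (q * p) - q * p * (p * (q - p) * E))
    + (p - 1) * (q - p) * E * p.
Proof.
move=> cp cq; rewrite d_minus_d3 mulrDl [X in X + _]mulrBl; congr (_ - _ + _).
- by rewrite -!mulrA cp (mulrA q E) cq !mulrA.
- by rewrite !mulrA.
- by rewrite -!mulrA cp.
Qed.

Lemma conj_idem_mulX (U V e c : T) n : V * U = 1 -> e * e = e -> GRing.comm e c ->
  (U * (e * c) * V) ^+ n.+1 = U * (e * c ^+ n.+1) * V.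
Proof.
move=> VU ee ec; rewrite -idem_mulX//; elim: n => [|n IH]; first by rewrite !expr1.
rewrite exprS IH [in RHS]exprS; move: ((e * c) ^+ n.+1) (e * c) => Y X.
rewrite -!mulrA.
by rewrite (mulrA V U) VU mul1r.
Qed.

End TwoIdempotents.

(** * Conjugation by a diagonal matrix of order one *)

Section DiagConj.
Variable R : realType.
Notation wt := (@wt R).
Variables (p : tmx R) (u : Z2 -> R[i]) (c C : R).
Hypotheses (pp : p * p = p) (op : mord 0 p).
Hypotheses (c0 : 0 < c) (uc : forall x, c * wt x <= nrm (u x)).
Hypothesis uC : forall x y, nrm (u x - u y) <= C * wt (x - y).

Lemma u_neq0 x : u x != 0.
Proof.
rewrite -nrm0P gt_eqF//; apply: lt_le_trans (uc x); rewrite mulr_gt0//; exact: wt_gt0.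
Qed.

Lemma C_ge0 : 0 <= C.
Proof.
have := uC 0 0; rewrite !subrr Normc.normc0 /wt /= normr0 !addr0 mulr1 => h.
exact: h.
Qed.

Lemma u_bound x : nrm (u x) <= (nrm (u 0) + C) * wt x.
Proof.
have -> : u x = u 0 + (u x - u 0) by rewrite addrCA subrr addr0.
apply: le_trans (le_normcD _ _) _; rewrite mulrDl lerD//.
  by rewrite ler_peMr ?nrm_ge0 ?wt_ge1.
by have := uC x 0; rewrite subr0.
Qed.

Lemma uV_bound x : nrm (u x)^-1 <= c^-1 * wt x ^- 1.
Proof.
rewrite Normc.normcV -invfM expr1 lef_pV2 ?posrE ?mulr_gt0 ?wt_gt0//.
by apply: lt_le_trans (uc x); rewrite mulr_gt0 ?wt_gt0.
Qed.

Lemma tame_u : tame (fun x y => if x == y then u x else 0).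
Proof. by apply: (@tame_diag R _ (nrm (u 0) + C) 1) => x; rewrite expr1 u_bound. Qed.

Lemma tame_uV : tame (fun x y => if x == y then (u x)^-1 else 0).
Proof.
apply: (@tame_diag R _ c^-1 0) => x; apply: le_trans (uV_bound x) _.
rewrite ler_wpM2l ?invr_ge0 ?(ltW c0)// expr0 expr1 invf_le1 ?wt_gt0//; exact: wt_ge1.
Qed.

Definition Ud : tmx R := TMx tame_u.
Definition Uv : tmx R := TMx tame_uV.

Lemma diag_mul (f : Z2 -> R[i]) (tf : tame (fun x y => if x == y then f x else 0)) (M : tmx R) x y :
  (TMx tf * M) x y = f x * M x y.
Proof.
rewrite tmxME; have [|_ ->] := @csum_one R _ x (fun z => (TMx tf) x z * M z y).
  by move=> z; rewrite /= eq_sym => /negbTE ->; rewrite mul0r.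
by rewrite /= eqxx.
Qed.

Lemma mul_diag (f : Z2 -> R[i]) (tf : tame (fun x y => if x == y then f x else 0)) (M : tmx R) x y :
  (M * TMx tf) x y = M x y * f y.
Proof.
rewrite tmxME; have [|_ ->] := @csum_one R _ y (fun z => M x z * (TMx tf) z y).
  by move=> z; rewrite /= => /negbTE ->; rewrite mulr0.
by rewrite /= eqxx.
Qed.

Lemma UdUv : Ud * Uv = 1.
Proof.
apply: tmxP => x y; rewrite diag_mul tmx1E /=; case: eqP => [_|_]; last by rewrite mulr0.
by rewrite divff// u_neq0.
Qed.

Lemma UvUd : Uv * Ud = 1.
Proof.
apply: tmxP => x y; rewrite diag_mul tmx1E /=; case: eqP => [_|_]; last by rewrite mulr0.
by rewrite mulVf// u_neq0.
Qed.

Definition qu : tmx R := Uv * p * Ud.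
Definition du : tmx R := p - qu.

(** This is where an order is gained: the difference of [u] is absorbed by the off-diagonal decay of
    [p], and the denominator stays. *)
Lemma duE x y : du x y = p x y * ((u x - u y) / u x).
Proof.
rewrite /du /qu tmxBE mul_diag diag_mul mulrBl divff ?u_neq0//.
by field; rewrite u_neq0.
Qed.

Lemma qu_idem : qu * qu = qu.
Proof. by rewrite /qu -!mulrA (mulrA Ud) UdUv mul1r (mulrA p p) pp. Qed.

Lemma mord_du : mord (-1) du.
Proof.
move=> n; have [D [D0 HD]] := mordP n.+1 op.
exists (D * C * c^-1) => x y; rewrite duE !Normc.normcM.
have w1 := wt_gt0 R (x - y); have w2 := wt_gt0 R x.
have h : nrm (u x - u y) * nrm (u x)^-1 <= C * wt (x - y) * (c^-1 * wt x ^- 1).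
  by apply: ler_pM; rewrite ?nrm_ge0 ?uC ?uV_bound.
apply: le_trans (ler_pM (nrm_ge0 _) _ (HD x y) h) _.
  by rewrite mulr_ge0 ?nrm_ge0.
rewrite expr0z mul1r (wtzN R x 1) exprS invfM.
rewrite le_eqVlt; apply/orP; left; apply/eqP; field.
by rewrite !expf_neq0 ?wt_neq0 ?gt_eqF.
Qed.

(** Here the denominator is [u y]; Peetre's inequality returns the weight to the row index. *)
Lemma mord_dup : mord (-1) (p - Ud * p * Uv : tmx R).
Proof.
move=> n; have [D [D0 HD]] := mordP n.+2 op.
exists (D * C * c^-1) => x y; rewrite tmxBE mul_diag diag_mul.
have -> : p x y - u x * p x y / u y = p x y * ((u y - u x) / u y).
  by rewrite mulrBl divff ?u_neq0// mulrBr mulr1 [u x * _]mulrC -mulrA.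
rewrite !Normc.normcM.
have w1 := wt_gt0 R (x - y); have w2 := wt_gt0 R x; have w3 := wt_gt0 R y.
have h : nrm (u y - u x) * nrm (u y)^-1 <= C * wt (x - y) * (c^-1 * wt y ^- 1).
  by apply: ler_pM; rewrite ?nrm_ge0// ?uV_bound// wtB uC.
apply: le_trans (ler_pM (nrm_ge0 _) _ (HD x y) h) _.
  by rewrite mulr_ge0 ?nrm_ge0.
have := wt_peetrez R x y (-1); rewrite (wtzN R y 1) (wtzN R x 1) abszN absz_nat !expr1 => h2.
rewrite expr0z mul1r !exprS !invfM.
have -> : D * ((wt (x - y))^-1 * ((wt (x - y))^-1 * wt (x - y) ^- n)) * (C * wt (x - y) * (c^-1 * (wt y)^-1))
  = D * C * c^-1 * ((wt (x - y))^-1 * wt (x - y) ^- n) * (wt y)^-1.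
  by field; rewrite !expf_neq0 ?wt_neq0 ?gt_eqF.
have -> : D * C * c^-1 * ((wt x)^-1 * wt (x - y) ^- n) =
  D * C * c^-1 * ((wt (x - y))^-1 * wt (x - y) ^- n) * ((wt x)^-1 * wt (x - y)).
  by field; rewrite !expf_neq0 ?wt_neq0 ?gt_eqF.
have K0 : 0 <= D * C * c^-1 * ((wt (x - y))^-1 * wt (x - y) ^- n).
  by rewrite !mulr_ge0 ?invr_ge0 ?exprn_ge0 ?C_ge0 ?(ltW D0) ?(ltW c0) ?(ltW w1).
exact: ler_wpM2l.
Qed.

Lemma mord_Uv : mord (-1) Uv.
Proof.
move=> n; exists c^-1 => x y /=; case: eqP => [->|_]; last first.
  by rewrite Normc.normc0 !mulr_ge0 ?wtz_ge0 ?wtXV_ge0 ?invr_ge0 ?(ltW c0).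
apply: le_trans (uV_bound y) _; rewrite subrr (_ : wt 0 = 1) ?expr1n ?invr1 ?mulr1.
  by rewrite (wtzN R y 1).
by rewrite /wt /= !addr0.
Qed.

Lemma mord_Ud : mord 1 Ud.
Proof.
move=> n; exists (nrm (u 0) + C) => x y /=; case: eqP => [->|_]; last first.
  by rewrite Normc.normc0 !mulr_ge0 ?wtz_ge0 ?wtXV_ge0// addr_ge0 ?nrm_ge0 ?C_ge0.
apply: le_trans (u_bound y) _; rewrite subrr (_ : wt 0 = 1) ?expr1n ?invr1 ?mulr1.
  by rewrite expr1z.
by rewrite /wt /= !addr0.
Qed.

Lemma mord_qu : mord 0 qu.
Proof.
have -> : qu = p - du by rewrite /du opprB addrCA subrr addr0.
by apply: mord_tmxB => //; apply: mord_le mord_du.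
Qed.

Lemma mord_du_n n : mord (- n%:Z) (du ^+ n).
Proof. by have := mord_tmxX n mord_du; rewrite mulN1r. Qed.

(** The difference of the powers is [(d - d^3) d^m] with [m] even and at least 2. By
    [d_minus_d3_comm] it is formally traceless, and [d^m] together with the factor [q - p] has order
    at most -3, as cyclicity requires. *)
Lemma mtr_du_step k : mtr (du ^+ (2 * k.+1).+1) = mtr (du ^+ (2 * k.+1 + 2).+1).
Proof.
have op3 : mord (- (2 * k.+1)%:Z) (du ^+ (2 * k.+1)) := mord_du_n _.
set m := (2 * k.+1)%N in op3 *; set E := du ^+ m in op3.
have cp : GRing.comm p E := comm_p_d2n pp qu_idem k.+1.
have cq : GRing.comm qu E := comm_q_d2n pp qu_idem k.+1.
have s n : (3 <= n)%N -> absum (fun x => (du ^+ n) x x).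
  by move=> n3; apply: mord_trace (mord_du_n n); lia.
apply/eqP; rewrite -subr_eq0 -mtrB; last 2 first.
- by apply: s; rewrite /m; lia.
- by apply: s; rewrite /m; lia.
have -> : du ^+ m.+1 - du ^+ (m + 2).+1 = (du - du ^+ 3) * E.
  by rewrite mulrBl -exprD -exprS; congr (_ - du ^+ _); lia.
rewrite (d_minus_d3_comm pp qu_idem cp cq).
have oqp : mord (-1) (qu - p).
  have -> : qu - p = - du by rewrite opprB.
  exact/mord_tmxN/mord_du.
have o1 : mord (- 3) (p * (qu - p) * E).
  apply: mord_le (mord_tmxM (mord_tmxM op oqp) op3); rewrite /m; lia.
have o2 : mord (- 3) ((p - 1) * (qu - p) * E).
  have op1 : mord 0 (p - 1 : tmx R) by apply: mord_tmxB => //; exact: mord_tmx1.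
  apply: mord_le (mord_tmxM (mord_tmxM op1 oqp) op3); rewrite /m; lia.
have oqup : mord 0 (qu * p).
  by have := mord_tmxM mord_qu op; rewrite addr0.
have o3 : mord (- 3) (p * (qu - p) * E * (qu * p)).
  by have := mord_tmxM o1 oqup; rewrite addr0.
have o4 : mord (- 3) (qu * p * (p * (qu - p) * E)).
  by have := mord_tmxM oqup o1; rewrite add0r.
have o5 : mord (- 3) ((p - 1) * (qu - p) * E * p).
  by have := mord_tmxM o2 op; rewrite addr0.
rewrite mtrD; [|exact: (mord_trace (lexx _) (mord_tmxB o3 o4))|exact: (mord_trace (lexx _) o5)].
rewrite mtrB; [|exact: (mord_trace (lexx _) o3)|exact: (mord_trace (lexx _) o4)].
rewrite (mord_cyc (M := p * (qu - p) * E) (N := qu * p) _ o1 oqup) ?addr0// subrr add0r.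
rewrite (mord_cyc (M := (p - 1) * (qu - p) * E) (N := p) _ o2 op) ?addr0//.
rewrite !mulrA [p * (p - 1)]mulrBr pp mulr1 subrr !mul0r.
by rewrite /mtr [X in X == _](_ : _ = 0)// -[RHS](csum0 R Z2).
Qed.

Lemma mtr_du_odd k : mtr (du ^+ (2 * k.+1).+1) = mtr (du ^+ 3).
Proof. by elim: k => [//|k IH]; rewrite -IH [RHS]mtr_du_step; congr (mtr (du ^+ _)); lia. Qed.

(** With [q = u^-1 p u] and [d = p - q] the remainders are [p d^2] and the conjugate of [q d^2] by
    [u]. Since [d^2] commutes with [p] and [q], powers pass to [d], and the difference of traces is
    that of an odd power of [d], which [mtr_du_odd] lowers to 3. *)
Lemma fedosov_du n : mtr ((p - p * Uv * p * Ud * p) ^+ n.+2 : tmx R) -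
  mtr ((p - p * Ud * p * Uv * p) ^+ n.+2 : tmx R) = mtr (du ^+ 3).
Proof.
have e1 : (p - p * Uv * p * Ud * p) ^+ n.+2 = p * du ^+ (2 * n.+2).
  have -> : p - p * Uv * p * Ud * p = p * du ^+ 2.
    by rewrite expr2 (pd2 pp qu_idem) /qu !mulrA.
  by rewrite idem_mulX// -?exprM//; exact: (comm_p_d2n pp qu_idem 1).
have e2 : (p - p * Ud * p * Uv * p) ^+ n.+2 = Ud * (qu * du ^+ (2 * n.+2)) * Uv.
  have -> : p - p * Ud * p * Uv * p = Ud * (qu * du ^+ 2) * Uv.
    have uq : Ud * qu = p * Ud by rewrite /qu !mulrA UdUv mul1r.
    have qv : qu * Uv = Uv * p by rewrite /qu -mulrA UdUv mulr1.
    rewrite expr2 (qd2 pp qu_idem) mulrBr mulrBl.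
    have -> : Ud * (qu * p * qu) * Uv = (Ud * qu) * p * (qu * Uv) by rewrite !mulrA.
    by rewrite uq qv -(mulrA p Ud Uv) UdUv mulr1 !mulrA.
  have h2 : GRing.comm qu (du ^+ 2) by have := comm_q_d2n pp qu_idem 1; rewrite muln1.
  by rewrite (@conj_idem_mulX (tmx R) Ud Uv qu (du ^+ 2) n.+1 UvUd qu_idem h2) -exprM.
rewrite e1 e2.
have o1 : mord (- 3) (p * du ^+ (2 * n.+2)).
  by apply: mord_le (mord_tmxM op (mord_du_n (2 * n.+2))); lia.
have o2 : mord (- 3) (qu * du ^+ (2 * n.+2)).
  by apply: mord_le (mord_tmxM mord_qu (mord_du_n (2 * n.+2))); lia.
have -> : mtr (Ud * (qu * du ^+ (2 * n.+2)) * Uv : tmx R) = mtr (qu * du ^+ (2 * n.+2) : tmx R).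
  congr csum; apply/funext => x; rewrite mul_diag diag_mul mulrAC divff ?mul1r//.
  exact: u_neq0.
rewrite -mtrB; [|exact: (mord_trace (lexx _) o1)|exact: (mord_trace (lexx _) o2)].
by rewrite -mulrBl -/du -exprS mtr_du_odd.
Qed.

End DiagConj.

(** * Iterated parametrices *)

Section Parametrix.
Variables (T : pzRingType) (p Q D R1 R2 : T).
Hypotheses (pp : p * p = p) (pQ : p * Q = Q) (Qp : Q * p = Q).
Hypotheses (pD : p * D = D) (Dp : D * p = D).
Hypotheses (e1 : R1 = p - Q * D) (e2 : R2 = p - D * Q).

(** A partial Neumann series for the right remainder. Both remainders become powers, so remainders
    of order -1 reach any negative order. *)
Definition iterQ n : T := Q * (\sum_(i < n.+1) R2 ^+ i) * p.

Lemma parametrix_left n : p - iterQ n * D = R1 ^+ n.+1.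
Proof.
have R1p : R1 * p = R1 by rewrite e1 mulrBl pp -mulrA Dp.
(* [Q] intertwines the two remainders, which is why a series in [R2] also improves the left
   remainder. *)
have comm i : Q * R2 ^+ i = R1 ^+ i * Q.
  elim: i => [|i IH]; first by rewrite !expr0 mulr1 mul1r.
  rewrite exprSr mulrA IH exprSr -!mulrA; congr (_ * _).
  by rewrite e1 e2 mulrBr mulrBl Qp pQ mulrA.
have QD : Q * D = p - R1 by rewrite e1 opprB addrC subrK.
rewrite /iterQ -mulrA pD mulr_sumr mulr_suml.
under eq_bigr do rewrite comm -mulrA QD mulrBr -exprSr.
elim: n => [|n IH]; first by rewrite big_ord1 expr0 mul1r opprB addrC subrK.
have R1n i : R1 ^+ i.+1 * p = R1 ^+ i.+1 by rewrite exprSr -mulrA R1p.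
by rewrite big_ord_recr /= opprD addrA IH R1n opprB addrC subrK.
Qed.

Lemma parametrix_right n : p - D * iterQ n = R2 ^+ n.+1.
Proof.
have R2p : R2 * p = R2 by rewrite e2 mulrBl pp -mulrA Qp.
have pR2 : p * R2 = R2 by rewrite e2 mulrBr pp mulrA pD.
have DQ : D * Q = p - R2 by rewrite e2 opprB addrC subrK.
rewrite /iterQ !mulrA DQ mulr_sumr mulr_suml.
elim: n => [|n IH].
  by rewrite big_ord1 expr0 mulr1 mulrBl pp R2p opprB addrC subrK.
rewrite big_ord_recr /= opprD addrA IH.
have Rp i : R2 ^+ i.+1 * p = R2 ^+ i.+1 by rewrite exprSr -mulrA R2p.
have pR i : p * R2 ^+ i.+1 = R2 ^+ i.+1 by rewrite exprS mulrA pR2.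
by rewrite mulrBl pR mulrBl Rp -exprS Rp opprB addrC subrK.
Qed.

Lemma p_iterQ n : p * iterQ n = iterQ n.
Proof. by rewrite /iterQ !mulrA pQ. Qed.

Lemma iterQ_p n : iterQ n * p = iterQ n.
Proof. by rewrite /iterQ -mulrA pp. Qed.

End Parametrix.

(** * Deforming away the bounded part *)

Section CubicIndex.
Variable R : realType.
Notation wt := (@wt R).

(** All values are integers, so real parts along the real axis decide and the real case applies. *)
Lemma int_cpoly_const (F : R[i] -> R[i]) n (q1 q2 : nat -> R[i]) :
  (forall t, F t = \sum_(k < n) t ^+ k * q1 k - \sum_(k < n) t ^+ k * q2 k) ->
  (forall t, exists m : int, F t = m%:~R) -> F 1 = F 0.
Proof.
move=> H Fint.
have FE t : F t = \sum_(k < n) t ^+ k * (q1 k - q2 k).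
  by rewrite H -sumrB; apply: eq_bigr => k _; rewrite mulrBr.
pose P : {poly R} := \poly_(k < n) cRe (q1 k - q2 k).
have PE (t : R) : P.[t] = cRe (F t%:C).
  rewrite FE cRe_sum horner_poly; apply: eq_bigr => k _.
  by rewrite cReM -rmorphXn /= mul0r subr0 mulrC.
have : P.[1] = P.[0].
  apply: int_poly_const => t; have [m Fm] := Fint t%:C; exists m.
  by rewrite PE Fm -(rmorph_int (real_complex R)).
rewrite !PE; have [n1 e1] := Fint 1; have [n0 e0] := Fint 0.
rewrite e1 -[RHS]/(cRe (F 0)) e0 -!(rmorph_int (real_complex R)) /=.
by move=> /eqP; rewrite eqr_int => /eqP ->.
Qed.

Lemma tmx_sumE (I : Type) (s : seq I) (F : I -> tmx R) x y :
  (\sum_(i <- s) F i) x y = \sum_(i <- s) F i x y.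
Proof. by elim: s => [|a s IH]; rewrite ?big_nil// !big_cons tmxDE IH. Qed.

(** [X] and [Y] need not commute, so there is no binomial formula; every coefficient is still a sum
    of words of length [n] and has order [-n]. *)
Lemma poly_power (X Y : tmx R) n : mord (-1) X -> mord (-1) Y ->
  exists c : nat -> tmx R, (forall k, mord (- n%:Z) (c k)) /\
  forall t : R[i], (X + t *: Y) ^+ n = \sum_(k < n.+1) t ^+ k *: c k.
Proof.
move=> oX oY; elim: n => [|n [c [oc Hc]]].
  exists (fun=> 1); split=> [k|t]; first exact: mord_tmx1.
  by rewrite big_ord1 !expr0 scale1r.
pose c1 k := if (k <= n)%N then X * c k else 0.
pose c2 k := if k is k'.+1 then Y * c k' else 0.
have oM (Z : tmx R) k : mord (-1) Z -> mord (- n.+1%:Z) (Z * c k).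
  move=> oZ; have -> : - n.+1%:Z = -1 + - n%:Z by rewrite intS opprD.
  exact: mord_tmxM.
exists (fun k => c1 k + c2 k); split=> [k|t].
  apply: mord_tmxD; rewrite /c1 /c2.
    by case: ifP => _; [exact: oM|exact: mord_tmx0].
  by case: k => [|k]; [exact: mord_tmx0|exact: oM].
rewrite exprS Hc mulrDl; under [RHS]eq_bigr do rewrite scalerDr.
rewrite big_split /=; congr (_ + _).
  rewrite [RHS]big_ord_recr /= {2}/c1 ltnn scaler0 addr0 mulr_sumr.
  by apply: eq_bigr => i _; rewrite /c1 -ltnS ltn_ord tmx_scaleAr.
rewrite [RHS]big_ord_recl /= scaler0 add0r mulr_sumr.
by apply: eq_bigr => i _; rewrite -tmx_scaleAr -tmx_scaleAl scalerA -exprSr.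
Qed.

Lemma mtr_power_poly (X Y : tmx R) n : (3 <= n)%N -> mord (-1) X -> mord (-1) Y ->
  exists q : nat -> R[i], forall t : R[i],
    mtr ((X + t *: Y) ^+ n) = \sum_(k < n.+1) t ^+ k * q k.
Proof.
move=> n3 oX oY; have [c [oc Hc]] := poly_power n oX oY.
exists (fun k => mtr (c k)) => t; rewrite Hc /mtr.
have sc k : absum (fun x => c k x x) by apply: mord_trace (oc k); lia.
under [X in csum X]eq_fun do rewrite tmx_sumE.
rewrite csum_sum => [|k]; last first.
  under eq_fun do rewrite tmxZE; exact: absumZ.
apply: eq_bigr => k _; rewrite -csumZ//.
Qed.

Variables (V : lmodType R[i]) (W : set V).
Variables (A : V -> (Z2 -> R[i]^o)) (S : (Z2 -> R[i]^o) -> V) (p : tmx R).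
Hypotheses (sW : subspace W) (lA : linear_on W A).
Hypotheses (rA : forall w, W w -> rapid (A w)) (pA : forall w, W w -> tapp p (A w) = A w).
Hypotheses (WS : forall v, rapid v -> tapp p v = v -> W (S v)).
Hypotheses (AS : forall v, rapid v -> tapp p v = v -> A (S v) = v).
Hypotheses (SA : forall w, W w -> S (A w) = w).
Hypotheses (pp : p * p = p) (op : mord 0 p).
Variables (u : Z2 -> R[i]) (c C : R).
Hypotheses (c0 : 0 < c) (uc : forall x, c * wt x <= nrm (u x)).
Hypothesis uC : forall x y, nrm (u x - u y) <= C * wt (x - y).

(** The family [p (U + t B) p] has the same parametrix [p U^-1 p] for all [t], and its remainders
    are affine in [t]. The index is then a polynomial in [t] with integer values, and at [t = 0]
    Fedosov's formula applies. *)
Lemma index_cubic (D : V -> V) (B : tmx R) : mord 0 B ->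
  linear_on W D -> (forall w, W w -> W (D w)) ->
  (forall w, W w -> A (D w) = tapp (p * (Ud uC + B) * p) (A w)) ->
  fredholm W D /\ (fredholm_index W D)%:~R = mtr (du p c0 uc uC ^+ 3).
Proof.
move=> oB lD WD AD.
set U := Ud uC; set V' := Uv c0 uc.
pose Dt (t : R[i]) : tmx R := p * (U + t *: B) * p.
pose Q : tmx R := p * V' * p.
have pDt t : p * Dt t = Dt t by rewrite /Dt !mulrA pp.
have Dtp t : Dt t * p = Dt t by rewrite /Dt -mulrA pp.
have pQ : p * Q = Q by rewrite /Q !mulrA pp.
have Qp : Q * p = Q by rewrite /Q -mulrA pp.
have oV := mord_Uv c0 uc : mord (-1) V'.
have oU := mord_Ud uC : mord 1 U.
have oQ1 : mord (-1) Q.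
  by have := mord_tmxM (mord_tmxM op oV) op; rewrite add0r addr0.
pose X1 : tmx R := p - p * V' * p * U * p.
pose X2 : tmx R := p - p * U * p * V' * p.
pose Y1 : tmx R := - (p * V' * p * B * p).
pose Y2 : tmx R := - (p * B * p * V' * p).
have E1 t : p - Q * Dt t = X1 + t *: Y1.
  rewrite /Q /Dt /X1 /Y1 mulrDr mulrDl mulrDr opprD addrA scalerN; congr (_ - _ - _).
    by rewrite !mulrA -(mulrA _ p p) pp.
  by rewrite -tmx_scaleAr -tmx_scaleAl -tmx_scaleAr !mulrA -(mulrA _ p p) pp.
have E2 t : p - Dt t * Q = X2 + t *: Y2.
  rewrite /Q /Dt /X2 /Y2 mulrDr mulrDl mulrDl opprD addrA scalerN; congr (_ - _ - _).
    by rewrite !mulrA -(mulrA _ p p) pp.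
  by rewrite -tmx_scaleAr -tmx_scaleAl -tmx_scaleAl !mulrA -(mulrA _ p p) pp.
have oX1 : mord (-1) X1.
  have -> : X1 = p * du p c0 uc uC * p.
    by rewrite /X1 /du /qu mulrBr mulrBl pp pp !mulrA.
  by have := mord_tmxM (mord_tmxM op (mord_du op c0 uc uC)) op; rewrite add0r addr0.
have oX2 : mord (-1) X2.
  have -> : X2 = p * (p - U * p * V') * p by rewrite /X2 mulrBr mulrBl pp pp !mulrA.
  by have := mord_tmxM (mord_tmxM op (mord_dup op c0 uc uC)) op; rewrite add0r addr0.
have oY1 : mord (-1) Y1.
  apply: mord_tmxN; have := mord_tmxM (mord_tmxM oQ1 oB) op.
  by rewrite !addr0.
have oY2 : mord (-1) Y2.
  apply: mord_tmxN; have := mord_tmxM (mord_tmxM op oB) oQ1.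
  by rewrite !add0r /Q !mulrA.
have oX t : mord (-1) (X1 + t *: Y1) by apply: mord_tmxD => //; exact: mord_tmxZ.
have oX' t : mord (-1) (X2 + t *: Y2) by apply: mord_tmxD => //; exact: mord_tmxZ.
(* Tenth powers, because [matrix_index] asks for remainders of order -10. *)
pose F t := mtr ((X1 + t *: Y1) ^+ 10) - mtr ((X2 + t *: Y2) ^+ 10).
have ind t (D' : V -> V) : linear_on W D' -> (forall w, W w -> W (D' w)) ->
    (forall w, W w -> A (D' w) = tapp (Dt t) (A w)) ->
    fredholm W D' /\ (fredholm_index W D')%:~R = F t.
  move=> lD' WD' AD'.
  have l1 := parametrix_left pp pQ Qp (pDt t) (Dtp t) (esym (E1 t)) (esym (E2 t)) 9.
  have l2 := parametrix_right pp Qp (pDt t) (esym (E2 t)) 9.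
  set Qn := iterQ p Q (X2 + t *: Y2) 9 in l1 l2.
  apply: (matrix_index sW lA rA pA WS AS SA pp (esym l1) (esym l2) lD' WD' AD' (pDt t) (Dtp t)).
  - exact: p_iterQ.
  - exact: iterQ_p.
  - have h : mord 1 (U + t *: B : tmx R).
      by apply: mord_tmxD => //; apply: mord_tmxZ; exact: mord_le oB.
    by have := mord_tmxM (mord_tmxM op h) op; rewrite add0r addr0.
  - have h : mord 0 (\sum_(i < 10) (X2 + t *: Y2) ^+ i : tmx R).
      apply: mord_tmx_sum => i; apply: mord_le (mord_tmxX i (oX' t)); lia.
    have oQ0 : mord 0 Q by exact: mord_le oQ1.
    by have := mord_tmxM (mord_tmxM oQ0 h) op; rewrite !addr0.
  - by have := mord_tmxX 10 (oX t); rewrite mulN1r.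
  - by have := mord_tmxX 10 (oX' t); rewrite mulN1r.
have D1E : Dt 1 = p * (U + B) * p by rewrite /Dt scale1r.
have AD1 w : W w -> A (D w) = tapp (Dt 1) (A w) by move=> Ww; rewrite D1E; exact: AD.
have [fr ->] := ind 1 D lD WD AD1.
split=> //; rewrite -(fedosov_du pp op c0 uc uC 8).
have [q1 H1] := mtr_power_poly (isT : 3 <= 10)%N oX1 oY1.
have [q2 H2] := mtr_power_poly (isT : 3 <= 10)%N oX2 oY2.
(* For general [t] no operator is given; [lift] manufactures one from the matrix, only to know that
   [F t] is an index. *)
have Fint t : exists n : int, F t = n%:~R.
  have pDt' := pDt t; exists (fredholm_index W (lift A S (Dt t))).
  have l := linear_lift sW lA rA WS AS SA (pDt t).
  have w W1 (h : W W1) := W_lift rA WS h (pDt t).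
  have a W1 (h : W W1) := A_lift rA AS h (pDt t).
  by have [_ ->] := ind t _ l w a.
have F0 : F 0 = mtr (X1 ^+ 10) - mtr (X2 ^+ 10) by rewrite /F !scale0r !addr0.
have FE t : F t = \sum_(k < 11) t ^+ k * q1 k - \sum_(k < 11) t ^+ k * q2 k.
  exact: (f_equal2 (fun a b => a - b) (H1 t) (H2 t)).
have E := int_cpoly_const FE Fint.
by move: E F0; rewrite /X1 /X2 => -> ->.
Qed.

End CubicIndex.

(** * The triangle sum over the lattice *)

Section Triangle.
Variable R : realType.
Notation wt := (@wt R).
Variables (al be : R).
Hypotheses (al0 : 0 < al) (be0 : 0 < be).

Definition lin (g : Z2) : R[i] := (al * g.1%:~R) +i* (be * g.2%:~R).

(* The shift by 1/2 keeps the lattice points away from the pole. *)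
Definition ul (g : Z2) : R[i] := lin g - (al / 2)%:C.

Lemma linD g h : lin (g + h) = lin g + lin h.
Proof. by rewrite /lin /= !intrD; congr Complex; ring. Qed.

Lemma ulD g h : ul (g + h) = ul g + lin h.
Proof. by rewrite /ul linD; ring. Qed.

Lemma lin_bound g : nrm (lin g) <= (al + be) * wt g.
Proof.
apply: le_trans (nrm_le_ReIm _) _; rewrite /lin /= !normrM.
rewrite (gtr0_norm al0) (gtr0_norm be0) -!intr_norm mulrDl /wt.
have a0 : 0 <= `|g.1|%:~R :> R by rewrite ler0z.
have b0 : 0 <= `|g.2|%:~R :> R by rewrite ler0z.
by apply: lerD; apply: ler_wpM2l; rewrite ?ltW//; lra.
Qed.

(** The real part is at least [al * (1 + |g.1|) / 4] and the imaginary part is [be * |g.2|] in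
    absolute value; half of each bound is used. *)
Definition ulc : R := Num.min (al / 8) (be / 2).

Lemma ulc_gt0 : 0 < ulc.
Proof. by rewrite /ulc lt_min !divr_gt0. Qed.

Lemma ul_bound g : ulc * wt g <= nrm (ul g).
Proof.
have h1 := nrm_Re (ul g); have h2 := nrm_Im (ul g).
have c1 : ulc <= al / 8 by rewrite /ulc ge_min lexx.
have c2 : ulc <= be / 2 by rewrite /ulc ge_min lexx orbT.
have e1 : `|cRe (ul g)| = al * `|g.1%:~R - 2^-1|.
  rewrite /ul /lin /= (_ : _ - _ = al * (g.1%:~R - 2^-1)); last by field.
  by rewrite normrM (gtr0_norm al0).
have e2 : `|cIm (ul g)| = be * `|g.2|%:~R.
  by rewrite /ul /lin /= oppr0 addr0 normrM (gtr0_norm be0) -intr_norm.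
have e3 : (1 + `|g.1|%:~R) / 4 <= `|g.1%:~R - 2^-1| :> R.
  case: (g.1) => n.
    case: n => [|n]; first by rewrite normr0 sub0r normrN ger0_norm ?invr_ge0//; lra.
    have n1 : 1 <= n.+1%:R :> R by rewrite ler1n.
    by rewrite ger0_norm// -!pmulrn ger0_norm; lra.
  rewrite NegzE normrN ger0_norm// mulrNz -!pmulrn.
  have n1 : 1 <= n.+1%:R :> R by rewrite ler1n.
  by rewrite ler0_norm; lra.
rewrite e1 in h1; rewrite e2 in h2.
have a0 : 0 <= `|g.1|%:~R :> R by rewrite ler0z.
have b0 : 0 <= `|g.2|%:~R :> R by rewrite ler0z.
have h3 : al * ((1 + `|g.1|%:~R) / 4) <= nrm (ul g).
  by apply: le_trans h1; rewrite ler_wpM2l// ltW.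
have h4 : ulc * (1 + `|g.1|%:~R) <= al / 8 * (1 + `|g.1|%:~R).
  by apply: ler_wpM2r => //; lra.
have h5 : ulc * `|g.2|%:~R <= be / 2 * `|g.2|%:~R by exact: ler_wpM2r.
by rewrite /wt mulrDr; lra.
Qed.

Lemma ul_neq0 g : ul g != 0.
Proof.
by rewrite -nrm0P gt_eqF//; apply: lt_le_trans (ul_bound g); rewrite mulr_gt0 ?ulc_gt0 ?wt_gt0.
Qed.

Definition fl (g : Z2) : R[i] := (ul g)^-1.

Lemma fl_bound g h : nrm (fl (g + h)) <= ulc^-1 * wt h * wt g ^- 1.
Proof.
rewrite /fl Normc.normcV; apply: (@le_trans _ _ (ulc * wt (g + h))^-1).
  rewrite lef_pV2 ?posrE ?mulr_gt0 ?ulc_gt0 ?wt_gt0 ?ul_bound//.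
  by apply: lt_le_trans (ul_bound _); rewrite mulr_gt0 ?ulc_gt0 ?wt_gt0.
rewrite invfM -mulrA ler_wpM2l ?invr_ge0 ?(ltW ulc_gt0)// expr1.
rewrite ler_pdivlMr ?wt_gt0// mulrC ler_pdivrMr ?wt_gt0//.
by have := wt_peetre R g (g + h); rewrite opprD addNKr wtN mulrC.
Qed.

(** The scalar that [duE] attaches to a closed triangle of indices. *)
Definition phi3 (a b c : Z2) : R[i] :=
  (ul a - ul b) / ul a * ((ul b - ul c) / ul b) * ((ul c - ul a) / ul c).

Definition tri (y w g : Z2) : R[i] := phi3 g (g + y) (g + w).

(** Partial fractions: the differences of [ul] do not depend on [g], so the product becomes a
    combination of differences of [fl], which can telescope. *)
Lemma triE y w g :
  tri y w g = lin y * (fl (g + w) - fl g) - lin w * (fl (g + y) - fl g).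
Proof.
rewrite /tri /phi3 /fl.
have n1 := ul_neq0 g; have n2 := ul_neq0 (g + y); have n3 := ul_neq0 (g + w).
rewrite !ulD in n2 n3 *; move: (ul g) (lin y) (lin w) n1 n2 n3 => a b c n1 n2 n3.
by field; rewrite n1 n2 n3.
Qed.

(** The product form shows the cubic decay in [g] that the differences in [triE] hide. *)
Lemma tri_prod y w g : tri y w g =
  lin y * lin w * (lin w - lin y) * (fl (g + 0) * fl (g + y) * fl (g + w)).
Proof.
rewrite /tri /phi3 /fl addr0.
have n1 := ul_neq0 g; have n2 := ul_neq0 (g + y); have n3 := ul_neq0 (g + w).
rewrite !ulD in n2 n3 *; move: (ul g) (lin y) (lin w) n1 n2 n3 => a b c n1 n2 n3.
by field; rewrite n1 n2 n3.
Qed.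

Lemma absum_tri y w : absum (tri y w).
Proof.
pose K := nrm (lin y * lin w * (lin w - lin y)) *
  ((ulc^-1 * wt 0) * (ulc^-1 * wt y) * (ulc^-1 * wt w)).
apply: absum_le (rsummableZ K (@rsummable_wt3 R)) => g.
rewrite tri_prod Normc.normcM /K -[leRHS]mulrA ler_wpM2l ?nrm_ge0// !Normc.normcM.
have -> : ulc^-1 * wt 0 * (ulc^-1 * wt y) * (ulc^-1 * wt w) * wt g ^- 3 =
  (ulc^-1 * wt 0 * wt g ^- 1) * (ulc^-1 * wt y * wt g ^- 1) * (ulc^-1 * wt w * wt g ^- 1).
  by field; rewrite wt_neq0 gt_eqF ?ulc_gt0.
by apply: ler_pM; rewrite ?mulr_ge0 ?nrm_ge0 ?fl_bound//; apply: ler_pM; rewrite ?nrm_ge0 ?fl_bound.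
Qed.

Definition Ssum (y w : Z2) : R[i] := csum (tri y w).

Lemma tri_anti y w g : tri y w g = - tri w y g.
Proof. by rewrite !triE; ring. Qed.

Lemma Ssum_anti y w : Ssum y w = - Ssum w y.
Proof.
rewrite /Ssum -csumN; last exact: absum_tri.
by congr csum; apply/funext => g; exact: tri_anti.
Qed.

Lemma pairDE (a b c d : int) : ((a, b) : Z2) + (c, d) = (a + c, b + d).
Proof. by []. Qed.

Lemma row_telescope (H : int -> R[i]) (K : R) :
  absum (fun n : int => H (n + 1) - H n) ->
  (forall n, nrm (H n) <= K * (1 + `|n|%:~R) ^- 1) ->
  csum (fun n : int => H (n + 1) - H n) = 0.
Proof.
move=> sH HK; rewrite (csum_telescope (lp := 0) (lm := 0)) ?subr0// => e e0.
exists (Num.truncn (`|K| / e)).+1 => N NN.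
have h (n : int) : absz n = N -> nrm (H n - 0) <= e.
  move=> nN; rewrite subr0; apply: le_trans (HK n) _; rewrite expr1.
  have n0 : 0 <= `|n|%:~R :> R by rewrite ler0z.
  rewrite ler_pdivrMr; last by lra.
  apply: le_trans (ler_norm K) _; rewrite mulrC -ler_pdivrMr//.
  have : `|K| / e < (Num.truncn (`|K| / e)).+1%:R by exact: truncnS_gt.
  have : (Num.truncn (`|K| / e)).+1%:R <= `|n|%:~R :> R.
    by rewrite (_ : `|n| = N%:Z) -?pmulrn ?ler_nat//; lia.
  lra.
by split; apply: h; lia.
Qed.

(** [H] itself is far from summable, but its difference along [e] is. Fubini then permits summing
    first along the lines in direction [e], and on each of them the sum telescopes to zero. *)
Lemma lattice_telescope (H : Z2 -> R[i]) (K : R) (e : Z2) :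
  e = (1, 0) \/ e = (0, 1) -> absum (fun g : Z2 => H (g + e) - H g) ->
  (forall g, nrm (H g) <= K * wt g ^- 1) ->
  csum (fun g : Z2 => H (g + e) - H g) = 0.
Proof.
move=> ee sH HK; have K0 : 0 <= K.
  have := HK 0; rewrite /wt /= !normr0 !addr0 expr1 invr1 mulr1.
  by apply: le_trans; exact: nrm_ge0.
have wle (a b : int) : wt (a, b) ^- 1 <= (1 + `|a|%:~R) ^- 1 /\
    wt (a, b) ^- 1 <= (1 + `|b|%:~R) ^- 1.
  have a0 : 0 <= `|a|%:~R :> R by rewrite ler0z.
  have b0 : 0 <= `|b|%:~R :> R by rewrite ler0z.
  by split; rewrite !expr1 lef_pV2 ?posrE /wt /=; lra.
case: ee sH => -> sH.
  have sw := absum_swap sH.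
  rewrite -(reindex_csum _ (@bij_swap int int)) (csum_pair sw).
  rewrite -[RHS](csum0 R int); congr csum; apply/funext => b /=.
  have := (absum_pair sw).1 b => /= sb.
  apply: etrans (row_telescope (H := fun a => H (a, b)) (K := K) _ _).
  - by congr csum; apply/funext => a; congr (H _ - _); rewrite pairDE addr0.
  - move: sb; congr absum; apply/funext => a; congr (H _ - _).
    by rewrite pairDE addr0.
  - by move=> a; apply: le_trans (HK _) _; rewrite ler_wpM2l// (wle a b).1.
rewrite (csum_pair sH) -[RHS](csum0 R int); congr csum; apply/funext => a.
have := (absum_pair sH).1 a => /= sb.
apply: etrans (row_telescope (H := fun b => H (a, b)) (K := K) _ _).
- by congr csum; apply/funext => b; congr (H _ - _); rewrite pairDE addr0.
- move: sb; congr absum; apply/funext => b; congr (H _ - _).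
  by rewrite pairDE addr0.
- by move=> b; apply: le_trans (HK _) _; rewrite ler_wpM2l// (wle a b).2.
Qed.

(** By [triE] the defect of additivity is a total difference in the direction [e], so its lattice
    sum vanishes. *)
Lemma Ssum_step y w (e : Z2) : e = (1, 0) \/ e = (0, 1) ->
  Ssum (y + e) w = Ssum y w + Ssum e w.
Proof.
move=> ee; pose H g := - lin w * (fl (g + y) - fl g).
have E g : tri (y + e) w g - (tri y w g + tri e w g) = H (g + e) - H g.
  rewrite !triE linD /H addrAC -(addrA g) [e + y]addrC; ring.
have s1 := absum_tri (y + e) w.
have s2 := absumD (absum_tri y w) (absum_tri e w).
have s3 : absum (fun g : Z2 => H (g + e) - H g).
  by under eq_fun do rewrite -E; exact: absumB.
apply/eqP; rewrite -subr_eq0 /Ssum -(csumD (absum_tri y w) (absum_tri e w)) -csumB//.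
under [X in csum X]eq_fun do rewrite E.
rewrite (lattice_telescope (K := nrm (lin w) * (ulc^-1 * wt y + ulc^-1 * wt 0)) ee s3)//.
move=> g; rewrite /H Normc.normcM normcN -mulrA ler_wpM2l ?nrm_ge0// mulrDl.
by apply: le_trans (nrmB _ _) _; rewrite lerD ?fl_bound// -{1}[g]addr0 fl_bound.
Qed.

Lemma lattice_additive (F : Z2 -> R[i]) :
  (forall y e : Z2, e = (1, 0) \/ e = (0, 1) -> F (y + e) = F y + F e) ->
  forall y, F y = F (1, 0) * y.1%:~R + F (0, 1) * y.2%:~R.
Proof.
move=> HF.
have H1 (e : Z2) : e = (1, 0) \/ e = (0, 1) -> forall y (n : nat),
    F (y + e *+ n) = F y + F e * n%:R.
  move=> ee y; elim=> [|n IH]; first by rewrite mulr0n mulr0 !addr0.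
  by rewrite mulrSr addrA HF// IH -natr1 mulrDr mulr1 addrA.
have H2 (e : Z2) : e = (1, 0) \/ e = (0, 1) -> forall y (n : int),
    F (y + e *~ n) = F y + F e * n%:~R.
  move=> ee y [n|n]; first by rewrite -!pmulrn H1.
  have := H1 e ee (y - e *+ n.+1) n.+1; rewrite subrK => E.
  by rewrite NegzE !mulrNz -!pmulrn E mulrN addrK.
have F0 : F 0 = 0.
  have := HF 0 (1, 0) (or_introl erefl); rewrite add0r -{1}[F (1, 0)]add0r.
  by move=> /addIr.
have e2 (n : int) : ((0, 1) : Z2) *~ n = (0, n).
  have h (k : nat) : ((0, 1) : Z2) *+ k = (0, k%:Z).
    by elim: k => [|k IH]//; rewrite mulrSr IH pairDE addr0; congr pair; lia.
  case: n => n; first by rewrite -pmulrn h.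
  by rewrite NegzE mulrNz -pmulrn h.
have e1 (n : int) : ((1, 0) : Z2) *~ n = (n, 0).
  have h (k : nat) : ((1, 0) : Z2) *+ k = (k%:Z, 0).
    by elim: k => [|k IH]//; rewrite mulrSr IH pairDE addr0; congr pair; lia.
  case: n => n; first by rewrite -pmulrn h.
  by rewrite NegzE mulrNz -pmulrn h.
case=> a b /=; have -> : ((a, b) : Z2) = 0 + (1, 0) *~ a + (0, 1) *~ b.
  by rewrite e1 e2 add0r pairDE addr0 add0r.
rewrite H2; last by right.
by rewrite H2 ?F0 ?add0r//; left.
Qed.

(** The one unknown number. For [al = theta] and [be = 2 pi] the lemma [calibration] shows that it
    is [-2 pi i]. *)
Definition kap : R[i] := Ssum (1, 0) (0, 1).

Definition det2 (y w : Z2) : R[i] := y.1%:~R * w.2%:~R - y.2%:~R * w.1%:~R.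

Lemma Ssum_det y w : Ssum y w = kap * det2 y w.
Proof.
have add1 z v := lattice_additive (F := fun t => Ssum t v)
   (fun t e ee => Ssum_step t v ee) z.
have z y' : Ssum y' y' = 0.
  by have := Ssum_anti y' y' => /eqP; rewrite -addr_eq0 -mulr2n mulrn_eq0 => /eqP.
rewrite add1 (Ssum_anti (1, 0) w) (Ssum_anti (0, 1) w) !(add1 w) !z.
rewrite (Ssum_anti (0, 1) (1, 0)) -/kap /det2; ring.
Qed.

End Triangle.

(** * The cubic trace as a trace per unit cell *)

Section CubicTrace.
Variable R : realType.
Notation wt := (@wt R).
Variables (al be : R).
Hypotheses (al0 : 0 < al) (be0 : 0 < be).

(* The index (m, k) stands for the window m modulo 3 in the cell (m div 3, k). *)
Definition cell (x : Z2) : Z2 := ((x.1 %/ 3)%Z, x.2).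
Definition base (i : 'I_3) : Z2 := ((i : nat)%:Z, 0).
Definition shift3 (g : Z2) : Z2 := (g.1 * 3, g.2).
Definition u3 (x : Z2) : R[i] := ul al be (cell x).

Lemma cell_shift x g : cell (x + shift3 g) = cell x + g.
Proof. clear al0 be0.
case: x g => a b [c d]; rewrite /cell /shift3 !pairDE /=; congr pair.
by rewrite divzDr ?dvdz_mull// mulzK.
Qed.

Lemma cell_base i : cell (base i) = 0.
Proof.
rewrite /cell /base /=; congr pair; case: i => -[|[|[|//]]] /= _; by [].
Qed.

Lemma base_shift_bij : bijective (fun q : 'I_3 * Z2 => base q.1 + shift3 q.2).
Proof. clear al0 be0.
exists (fun x : Z2 => (inord (absz (x.1 %% 3)%Z), cell x)).
  case=> i g; rewrite cell_shift cell_base add0r; congr pair.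
  apply: val_inj => /=; rewrite inordK.
    by case: i g => i i3 [a b] /=; rewrite /base /shift3 /=; lia.
  by case: i g => i i3 [a b] /=; rewrite /base /shift3 /=; lia.
case=> a b; rewrite /base /shift3 /cell pairDE /= add0r; congr pair.
rewrite inordK; last by lia.
lia.
Qed.

Lemma u3_lower x : ulc al be / 3 * wt x <= nrm (u3 x).
Proof.
apply: le_trans (ul_bound al0 be0 (cell x)).
rewrite -mulrA ler_wpM2l ?(ltW (ulc_gt0 al0 be0))// ler_pdivrMl//.
rewrite /wt /cell /=.
have : `|x.1| <= 3 * `|(x.1 %/ 3)%Z| + 2 by lia.
rewrite -(ler_int R) !(rmorphD, rmorphM) /= => h.
have b0 : 0 <= `|x.2|%:~R :> R by rewrite ler0z.
lra.
Qed.

Lemma u3_lip x y : nrm (u3 x - u3 y) <= 2 * (al + be) * wt (x - y).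
Proof.
have -> : u3 x - u3 y = lin al be (cell x - cell y).
  have -> : u3 x = u3 y + lin al be (cell x - cell y) by rewrite /u3 -ulD addrC subrK.
  by rewrite addrAC subrr add0r.
apply: le_trans (lin_bound al0 be0 _) _.
have -> : 2 * (al + be) * wt (x - y) = (al + be) * (2 * wt (x - y)) by ring.
rewrite ler_wpM2l ?addr_ge0 ?(ltW al0) ?(ltW be0)//.
rewrite /wt /cell /=.
have : `|(x.1 %/ 3)%Z - (y.1 %/ 3)%Z| <= `|x.1 - y.1| + 1 by lia.
rewrite -(ler_int R) !(rmorphD) /= => h.
have a0 : 0 <= `|x.1 - y.1|%:~R :> R by rewrite ler0z.
have b0 : 0 <= `|x.2 - y.2|%:~R :> R by rewrite ler0z.
lra.
Qed.

Lemma u3_c_gt0 : 0 < ulc al be / 3.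
Proof. by rewrite divr_gt0 ?ulc_gt0. Qed.

Lemma tame_cell1 : tame (fun x y : Z2 => if x == y then ((cell x).1)%:~R else 0 : R[i]).
Proof. clear al0 be0.
apply: (@tame_diag R (fun x => ((cell x).1)%:~R) 1 1) => x.
rewrite mul1r expr1 -(rmorph_int (real_complex R)) nrm_real -intr_norm /wt /cell /=.
have : `|(x.1 %/ 3)%Z| <= `|x.1| + 1 by lia.
rewrite -(ler_int R) !(rmorphD) /= => h.
have b0 : 0 <= `|x.2|%:~R :> R by rewrite ler0z.
lra.
Qed.

Lemma tame_cell2 : tame (fun x y : Z2 => if x == y then ((cell x).2)%:~R else 0 : R[i]).
Proof. clear al0 be0.
apply: (@tame_diag R (fun x => ((cell x).2)%:~R) 1 1) => x.
rewrite mul1r expr1 -(rmorph_int (real_complex R)) nrm_real -intr_norm /wt /cell /=.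
have a0 : 0 <= `|x.1|%:~R :> R by rewrite ler0z.
lra.
Qed.

Definition X1d : tmx R := TMx tame_cell1.
Definition X2d : tmx R := TMx tame_cell2.

(** Trace per unit cell: the three diagonal entries of the cell at the origin. *)
Definition ctr (M : Z2 -> Z2 -> R[i]) : R[i] := \sum_(i < 3) M (base i) (base i).

Definition comm (M N : tmx R) : tmx R := M * N - N * M.

Lemma comm_diagE (f : Z2 -> R[i]) (tf : tame (fun x y => if x == y then f x else 0)) (M : tmx R) x y :
  comm (TMx tf) M x y = (f x - f y) * M x y.
Proof. by rewrite tmxBE diag_mul mul_diag mulrBl [M x y * _]mulrC. Qed.

Variable p : tmx R.
Hypotheses (pp : p * p = p) (op : mord 0 p).

(** Entries of [p] are invariant under cell shifts only up to a phase; around a closed triangle the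
    phases cancel, and nothing more is needed for a cubic trace. *)
Definition inv_triple (M : Z2 -> Z2 -> R[i]) : Prop := forall g x y z,
  M (x + shift3 g) (y + shift3 g) * M (y + shift3 g) (z + shift3 g)
    * M (z + shift3 g) (x + shift3 g) = M x y * M y z * M z x.

Hypothesis cov : inv_triple p.

Local Notation d := (du p u3_c_gt0 u3_lower u3_lip).

Lemma absum_triple :
  absum (fun q : Z2 * (Z2 * Z2) => d q.1 q.2.1 * d q.2.1 q.2.2 * d q.2.2 q.1).
Proof.
(* The weights at [y] and [z] are moved to [x] to collect the exponent -3 there. This costs two
   powers of [x - y] and one of [y - z]; of six powers at least three remain for the sums. *)
have [C [C0 HC]] := mordP 6 (mord_du op u3_c_gt0 u3_lower u3_lip).
have w1 x y : wt y ^- 1 <= wt x ^- 1 * wt (x - y).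
  by have := wt_peetrez R x y (-1); rewrite (wtzN R y 1) (wtzN R x 1) abszN absz_nat expr1.
have s3 := @rsummable_wt3 R.
have b x y z : nrm (d x y * d y z * d z x) <= C ^+ 3 * wt x ^- 3 * (wt (x - y) ^- 3 * wt (y - z) ^- 3).
  have bd a b' : nrm (d a b') <= C * (wt a ^- 1 * wt (a - b') ^- 6).
    by have := HC a b'; rewrite (wtzN R a 1).
  rewrite !Normc.normcM.
  have b3 : nrm (d z x) <= C * (wt x ^- 1 * wt (x - y) * wt (y - z)).
    apply: le_trans (bd z x) _; rewrite ler_wpM2l ?(ltW C0)//.
    apply: (@le_trans _ _ (wt z ^- 1)).
      by rewrite ler_piMr ?wtXV_ge0// invf_le1 ?exprn_gt0 ?wt_gt0// exprn_ege1// wt_ge1.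
    apply: le_trans (w1 x z) _; rewrite -mulrA ler_wpM2l ?wtXV_ge0//.
    by rewrite (_ : x - z = (x - y) + (y - z)) ?wt_triangle// addrA subrK.
  have b2 : nrm (d y z) <= C * (wt x ^- 1 * wt (x - y) * wt (y - z) ^- 6).
    apply: le_trans (bd y z) _; rewrite ler_wpM2l ?(ltW C0)//.
    by rewrite ler_wpM2r ?wtXV_ge0.
  apply: le_trans (ler_pM _ (nrm_ge0 _) (ler_pM (nrm_ge0 _) (nrm_ge0 _) (bd x y) b2) b3) _.
    by rewrite mulr_ge0 ?nrm_ge0.
  have e1 : wt (x - y) ^- 4 <= wt (x - y) ^- 3 by exact: wtXV_le.
  have e2 : wt (y - z) ^- 5 <= wt (y - z) ^- 3 by exact: wtXV_le.
  have -> : C * (wt x ^- 1 * wt (x - y) ^- 6) * (C * (wt x ^- 1 * wt (x - y) * wt (y - z) ^- 6))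
     * (C * (wt x ^- 1 * wt (x - y) * wt (y - z))) =
    C ^+ 3 * wt x ^- 3 * (wt (x - y) ^- 4 * wt (y - z) ^- 5).
    by field; rewrite !wt_neq0.
  rewrite ler_wpM2l ?mulr_ge0 ?exprn_ge0 ?wtXV_ge0 ?(ltW C0)//.
  by apply: ler_pM; rewrite ?wtXV_ge0.
have s2 x : rsummable (fun q : Z2 * Z2 => wt (x - q.1) ^- 3 * wt (q.1 - q.2) ^- 3) /\
    rsum (fun q : Z2 * Z2 => wt (x - q.1) ^- 3 * wt (q.1 - q.2) ^- 3) = sig3 R * sig3 R.
  have sy y := @rsummable_wtB R y 3 isT.
  have s : rsummable (fun q : Z2 * Z2 => wt (x - q.1) ^- 3 * wt (q.1 - q.2) ^- 3).
    apply: (rsummable_prod (k := fun y : Z2 => sig3 R * wt (x - y) ^- 3)) => [q|y|y|] /=.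
    - by rewrite mulr_ge0 ?wtXV_ge0.
    - by apply: rsummableZ; exact: sy.
    - by rewrite rsumZ// rsum_wtB mulrC.
    - by apply: rsummableZ; exact: sy.
  split=> //; rewrite (rsum_pair s) /=.
  have -> : (fun y : Z2 => rsum (fun z : Z2 => wt (x - y) ^- 3 * wt (y - z) ^- 3)) =
      (fun y : Z2 => sig3 R * wt (x - y) ^- 3).
    by apply/funext => y; rewrite rsumZ// rsum_wtB mulrC.
  by rewrite rsumZ// rsum_wtB.
apply: (absum_prod (k := fun x : Z2 => C ^+ 3 * (sig3 R * sig3 R) * wt x ^- 3)) => [x|x|] /=.
- apply: absum_le (rsummableZ (C ^+ 3 * wt x ^- 3) (s2 x).1) => q; exact: b.
- apply: (@le_trans _ _ (rsum (fun q : Z2 * Z2 => C ^+ 3 * wt x ^- 3 * (wt (x - q.1) ^- 3 * wt (q.1 - q.2) ^- 3)))).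
    apply: ler_rsum; last by move=> q; exact: b.
      by apply: absum_le (rsummableZ (C ^+ 3 * wt x ^- 3) (s2 x).1) => q; exact: b.
    exact: rsummableZ (s2 x).1.
  by rewrite rsumZ ?(s2 x).2; [rewrite mulrAC|exact: (s2 x).1].
- exact: rsummableZ.
Qed.

Lemma mtr_du3 : mtr (d ^+ 3) =
  csum (fun q : Z2 * (Z2 * Z2) => d q.1 q.2.1 * d q.2.1 q.2.2 * d q.2.2 q.1).
Proof.
have sT := absum_triple; rewrite (csum_pair sT); congr csum; apply/funext => x.
have sx := (absum_pair sT).1 x; rewrite (csum_pair sx) exprS expr2 tmxME.
congr csum; apply/funext => y; rewrite tmxME -csumZ; last exact: absum_tmxM.
by congr csum; apply/funext => z; rewrite mulrA.
Qed.

(** A triangle is a translation, namely the cell of its first vertex, together with a triangle that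
    starts in the cell at the origin. *)
Lemma triple_bij : bijective (fun q : 'I_3 * (Z2 * Z2 * Z2) =>
  (base q.1 + shift3 q.2.2, (q.2.1.1 + shift3 q.2.2, q.2.1.2 + shift3 q.2.2))).
Proof.
have [k kK hK] := base_shift_bij.
exists (fun t : Z2 * (Z2 * Z2) => ((k t.1).1,
   ((t.2.1 - shift3 (k t.1).2, t.2.2 - shift3 (k t.1).2), (k t.1).2))).
  by move=> [i [[x y] g]] /=; rewrite (kK (i, g)) /= !addrK.
move=> [x [y z]] /=; rewrite !subrK.
by have := hK x; case: (k x) => i g /= ->.
Qed.

Lemma d_triple i x y g :
  d (base i + shift3 g) (x + shift3 g) * d (x + shift3 g) (y + shift3 g)
    * d (y + shift3 g) (base i + shift3 g) =
  p (base i) x * p x y * p y (base i) * tri al be (cell x) (cell y) g.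
Proof.
rewrite !duE /u3 !cell_shift cell_base add0r -(cov g).
by rewrite /tri /phi3 [cell x + g]addrC [cell y + g]addrC; ring.
Qed.

(** Entries of [comm X1d p] carry differences of cell coordinates. As the first vertex lies in the
    cell 0, the determinant of the cells of [x] and [y] equals that of [x - y] and [y], which is the
    combination the two products of commutators form. *)
Lemma cubic_trace : mtr (d ^+ 3) =
  kap al be * ctr (p * (comm X1d p * comm X2d p - comm X2d p * comm X1d p)).
Proof.
rewrite mtr_du3 -(reindex_csum _ triple_bij).
have s1 := (reindex_absum (fun q : Z2 * (Z2 * Z2) =>
  d q.1 q.2.1 * d q.2.1 q.2.2 * d q.2.2 q.1) triple_bij).2 absum_triple.
rewrite (csum_pair s1) (csum_fsupp (s := enum 'I_3) _ _).2; last 2 first.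
- exact: enum_uniq.
- by move=> i; rewrite mem_enum.
rewrite big_enum /ctr mulr_sumr; apply: eq_bigr => i _.
have s2 := (absum_pair s1).1 i; rewrite (csum_pair s2).
transitivity (csum (fun q : Z2 * Z2 => csum (fun g : Z2 =>
     p (base i) q.1 * p q.1 q.2 * p q.2 (base i) * tri al be (cell q.1) (cell q.2) g))).
  by congr csum; apply/funext => q; congr csum; apply/funext => g; exact: d_triple.
(* The product of entries of [p] is free of [g], so only the scalar [tri] is summed over
   translations, and [Ssum_det] evaluates that sum. *)
have -> : csum (fun q : Z2 * Z2 => csum (fun g : Z2 =>
     p (base i) q.1 * p q.1 q.2 * p q.2 (base i) * tri al be (cell q.1) (cell q.2) g)) =
   csum (fun q : Z2 * Z2 => kap al be * (p (base i) q.1 * p q.1 q.2 * p q.2 (base i) * det2 R (cell q.1) (cell q.2))).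
  congr csum; apply/funext => -[x y] /=; rewrite csumZ; last exact: absum_tri.
  by rewrite -/(Ssum _ _ _ _) Ssum_det//; ring.
pose f1 (q : Z2 * Z2) := p (base i) q.1 * (comm X1d p q.1 q.2 * comm X2d p q.2 (base i)).
pose f2 (q : Z2 * Z2) := p (base i) q.1 * (comm X2d p q.1 q.2 * comm X1d p q.2 (base i)).
have sf (M N : tmx R) : absum (fun q : Z2 * Z2 => p (base i) q.1 * (M q.1 q.2 * N q.2 (base i))).
  have [m1 [C1 [C10 H1]]] := tame_row (base i) (tmx_tame p).
  have [m2 [C2 [C20 H2]]] := tameP (m1 + 3) (tmx_tame M).
  have [D [D0 vD]] := rapidP (m2 + 3) (tame_col (base i) (tmx_tame N)).
  apply: absum_le (rsummableZ (C1 * C2 * D) (@rsummable_wt33 R)) => -[y z] /=.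
  rewrite mulrA !Normc.normcM.
  apply: le_trans (ler_pM _ (nrm_ge0 _) (ler_pM (nrm_ge0 _) (nrm_ge0 _) (H1 y) (H2 y z)) (vD z)) _.
    by rewrite mulr_ge0 ?nrm_ge0.
  rewrite !exprD !invfM le_eqVlt; apply/orP; left; apply/eqP.
  by field; rewrite ?expf_neq0 ?wt_neq0.
have sE (M N : tmx R) : (p * (M * N)) (base i) (base i) =
    csum (fun q : Z2 * Z2 => p (base i) q.1 * (M q.1 q.2 * N q.2 (base i))).
  rewrite (csum_pair (sf M N)) tmxME; congr csum; apply/funext => x.
  by rewrite tmxME -csumZ//; exact: absum_tmxM.
have E : (p * (comm X1d p * comm X2d p - comm X2d p * comm X1d p)) (base i) (base i) =
    csum (fun q : Z2 * Z2 => p (base i) q.1 * p q.1 q.2 * p q.2 (base i) * det2 R (cell q.1) (cell q.2)).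
  rewrite mulrBr tmxBE !sE -csumB//; congr csum; apply/funext => q.
  by rewrite !comm_diagE cell_base /det2 /=; ring.
rewrite E -csumZ//.
have -> : (fun q : Z2 * Z2 => p (base i) q.1 * p q.1 q.2 * p q.2 (base i) * det2 R (cell q.1) (cell q.2)) =
   fun q => f1 q - f2 q.
  by apply/funext => q; rewrite /f1 /f2 !comm_diagE cell_base /det2 /=; ring.
exact: (absumB (sf (comm X1d p) (comm X2d p)) (sf (comm X2d p) (comm X1d p))).
Qed.

End CubicTrace.

(** * Differential calculus of complex-valued functions *)
Section RealDerivative.
Variable R : realType.
Implicit Types (f g : R -> R) (x : R).

Lemma is_derive_continuous f x d : is_derive x 1 f d -> {for x, continuous f}.
Proof. by move=> [/derivable1_diffP/differentiable_continuous]. Qed.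

Lemma is_derive1E f x d : is_derive x 1 f d -> derive1 f x = d.
Proof. by move=> df; rewrite derive1E; case: df. Qed.

Lemma derivable_is_derive f x : derivable f x 1 -> is_derive x 1 f (derive1 f x).
Proof. by move=> df; split => //; rewrite derive1E. Qed.

(** A bound with one constant for all increments survives summation of series, and it also yields
    the derivative of a flat function at 0. *)
Lemma quadratic_is_derive f x d (C : R) :
  (forall t, `|f (x + t) - f x - t * d| <= C * t ^+ 2) -> is_derive x 1 f d.
Proof.
move=> H.
have C0 : 0 <= C by have := le_trans (normr_ge0 _) (H 1); rewrite expr1n mulr1.
apply/is_derive1_caratheodory.
exists (fun z => if z == x then d else (f z - f x) / (z - x)); split; last by rewrite eqxx.
  move=> z; case: eqP => [->|/eqP]; first by rewrite !subrr mulr0.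
  by rewrite -subr_eq0 => /divfK->.
apply/cvgrPdist_le => e e0; rewrite eqxx; near=> z.
case: eqP => [_|/eqP zx]; first by rewrite subrr normr0 ltW.
have zx0 : z - x != 0 by rewrite subr_eq0.
have -> : d - (f z - f x) / (z - x) = - (f (x + (z - x)) - f x - (z - x) * d) / (z - x).
  by rewrite [x + _]addrC subrK; field.
rewrite normrM normrN normfV ler_pdivrMr ?normr_gt0//.
apply: le_trans (H _) _; rewrite -real_normK ?num_real// expr2 mulrA ler_wpM2r//.
apply: (@le_trans _ _ ((C + 1) * `|z - x|)); first by rewrite ler_wpM2r// lerDl.
rewrite mulrC -ler_pdivlMr ?ltr_wpDl//.
near: z; have h : 0 < e / (C + 1) by rewrite divr_gt0// ltr_wpDl.
by apply: filterS (nbhsx_ballx x _ h) => z /=; rewrite /ball /= distrC => /ltW.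
Unshelve. all: by end_near. Qed.

Lemma mean_value f (df : R -> R) (x y : R) : (forall z : R, is_derive z 1 f (df z)) ->
  exists2 z, `|z - x| <= `|y - x| & f y - f x = df z * (y - x).
Proof.
move=> H.
have cf a b : {within `[a, b], continuous f}.
  by apply: continuous_subspaceT => z; exact: is_derive_continuous (H z).
case: (leP x y) => xy.
  have [c] := MVT_segment xy (fun z _ => H z) (cf _ _).
  rewrite in_itv /= => /andP[xc cy] E; exists c => //.
  by rewrite !ger0_norm ?subr_ge0// lerB.
have [c] := MVT_segment (ltW xy) (fun z _ => H z) (cf _ _).
rewrite in_itv /= => /andP[yc cx] E; exists c; last by rewrite -opprB E; ring.
by rewrite distrC [leRHS]distrC !ger0_norm ?subr_ge0 ?(ltW xy)// lerB.
Qed.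

Lemma taylor2 f (df ddf : R -> R) (K x t : R) : (forall z : R, is_derive z 1 f (df z)) ->
  (forall z : R, is_derive z 1 df (ddf z)) -> (forall z, `|ddf z| <= K) ->
  `|f (x + t) - f x - t * df x| <= K * t ^+ 2.
Proof.
move=> H1 H2 HK.
have [z zt ->] := @mean_value f df x (x + t) H1.
have [w _ E] := @mean_value df ddf x z H2.
have tE : x + t - x = t by rewrite addrAC subrr add0r.
rewrite tE in zt *.
have -> : df z * t - t * df x = ddf w * (z - x) * t by rewrite -E; ring.
rewrite !normrM -mulrA -[t ^+ 2]real_normK ?num_real// expr2.
by rewrite ler_pM ?mulr_ge0// ler_wpM2r.
Qed.

End RealDerivative.

Section ComplexDerivative.
Variable R : realType.
Implicit Types (f g : R -> R[i]) (x : R).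

(** Differentiability and the value together; [cderive] alone also returns a value where no
    derivative exists. *)
Definition cis f x (d : R[i]) :=
  is_derive x 1 (fun t => cRe (f t)) (cRe d) /\ is_derive x 1 (fun t => cIm (f t)) (cIm d).

Definition cdiff f := forall x, cis f x (cderive f x).

Lemma cis_derive f x d : cis f x d -> cderive f x = d.
Proof. by move=> [d1 d2]; rewrite /cderive (is_derive1E d1) (is_derive1E d2); case: d {d1 d2}. Qed.

Lemma cis_cdiff f (df : R -> R[i]) : (forall x, cis f x (df x)) -> cderive f = df.
Proof. by move=> H; apply/funext => x; exact: cis_derive. Qed.

Lemma cdiff_cis f x d : cis f x d -> cis f x (cderive f x).
Proof. by move=> H; rewrite (cis_derive H). Qed.

Lemma derivable_cis f x : derivable (fun t => cRe (f t)) x 1 /\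
  derivable (fun t => cIm (f t)) x 1 <-> cis f x (cderive f x).
Proof. split=> -[h1 h2]; last by split; [case: h1|case: h2].
by split; exact: derivable_is_derive. Qed.

Lemma cisD f g x d e : cis f x d -> cis g x e -> cis (fun t => f t + g t) x (d + e).
Proof.
move=> [f1 f2] [g1 g2]; split.
  under eq_fun do rewrite cReD; rewrite cReD; exact: is_deriveD.
by under eq_fun do rewrite cImD; rewrite cImD; exact: is_deriveD.
Qed.

Lemma cisM f g x d e : cis f x d -> cis g x e ->
  cis (fun t => f t * g t) x (f x * e + d * g x).
Proof.
move=> [f1 f2] [g1 g2]; split.
  under eq_fun do rewrite cReM; rewrite cReD !cReM.
  apply: is_derive_eq (is_deriveB (is_deriveM f1 g1) (is_deriveM f2 g2)) _.
  by rewrite /GRing.scale /=; ring.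
under eq_fun do rewrite cImM; rewrite cImD !cImM.
apply: is_derive_eq (is_deriveD (is_deriveM f1 g2) (is_deriveM f2 g1)) _.
by rewrite /GRing.scale /=; ring.
Qed.

Lemma cis_cst (c : R[i]) x : cis (fun=> c) x 0.
Proof. by split; exact: is_derive_cst. Qed.

Lemma cisZ c f x d : cis f x d -> cis (fun t => c * f t) x (c * d).
Proof.
by move=> h; have := cisM (cis_cst c x) h; rewrite mul0r addr0.
Qed.

Lemma cis_real (f : R -> R) x d : is_derive x 1 f d -> cis (fun t => (f t)%:C) x d%:C.
Proof. by move=> h; split => //=; exact: is_derive_cst. Qed.

Lemma cis_id x : cis (fun t => t%:C) x 1.
Proof. exact: (cis_real (is_derive_id x 1)). Qed.

Lemma is_derive_affine (a b x : R) : is_derive x 1 (fun t => a * t + b) a.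
Proof.
apply: is_derive_eq (is_deriveD (is_deriveZ a (is_derive_id x 1)) (is_derive_cst b x 1)) _.
by rewrite addr0 /GRing.scale /= mulr1.
Qed.

Lemma cis_affine f (a b x : R) d : cis f (a * x + b) d ->
  cis (fun t => f (a * t + b)) x (a%:C * d).
Proof.
have E : a%:C * d = (cRe d * a) +i* (cIm d * a).
  by case: d => d1 d2; rewrite mulrC; simpc.
move=> [f1 f2]; rewrite E; split => /=.
  exact: (@is_derive1_comp _ (fun t => cRe (f t)) (fun t : R => a * t + b) x _ _ f1 (is_derive_affine a b x)).
exact: (@is_derive1_comp _ (fun t => cIm (f t)) (fun t : R => a * t + b) x _ _ f2 (is_derive_affine a b x)).
Qed.

Lemma cis_shift f (b x : R) d : cis f (x + b) d -> cis (fun t => f (t + b)) x d.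
Proof.
move=> h; have := @cis_affine f 1 b x d; rewrite mul1r mul1r => /(_ h).
by under eq_fun do rewrite mul1r.
Qed.

Lemma cis_expi (s x : R) :
  cis (fun t => expi (s * t)) x ('i%C * s%:C * expi (s * x)).
Proof.
have a := is_derive_affine s 0 x.
have -> : (fun t : R => expi (s * t)) = (fun t => expi (s * t + 0)).
  by apply/funext => t; rewrite addr0.
have -> : 'i%C * s%:C * expi (s * x) = (- sin (s * x + 0) * s) +i* (cos (s * x + 0) * s).
  by rewrite addr0 /expi; simpc; congr (_ +i* _); ring.
split => /=.
  exact: (is_derive1_comp (is_derive_cos _) a).
exact: (is_derive1_comp (is_derive_sin _) a).
Qed.

Lemma cis_sum (I : Type) (s : seq I) (F : I -> R -> R[i]) (D : I -> R[i]) x :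
  (forall i, cis (F i) x (D i)) -> cis (fun t => \sum_(i <- s) F i t) x (\sum_(i <- s) D i).
Proof.
move=> H; elim: s => [|a s IH].
  by under eq_fun do rewrite big_nil; rewrite big_nil; exact: cis_cst.
by under eq_fun do rewrite big_cons; rewrite big_cons; exact: cisD.
Qed.

Lemma cdiff_cst_eq0 f x y : (forall t, cis f t 0) -> f x = f y.
Proof.
move=> H; apply/eqP; rewrite eq_complex; apply/andP; split; apply/eqP.
  by apply: (@is_derive_0_is_cst _ (fun t => cRe (f t))) => t; have [] := H t.
by apply: (@is_derive_0_is_cst _ (fun t => cIm (f t))) => t; have [] := H t.
Qed.

Lemma quadratic_cis f x d (C : R) :
  (forall t, nrm (f (x + t) - f x - t%:C * d) <= C * t ^+ 2) -> cis f x d.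
Proof.
move=> H; split.
  apply: (@quadratic_is_derive _ _ _ _ C) => t; apply: le_trans (H t).
  by apply: le_trans (nrm_Re _); rewrite !cReD !cReN cReM /= mul0r subr0.
apply: (@quadratic_is_derive _ _ _ _ C) => t; apply: le_trans (H t).
by apply: le_trans (nrm_Im _); rewrite !cImD !cImN cImM /= mul0r addr0.
Qed.

Lemma taylor2_complex f (df ddf : R -> R[i]) (K x t : R) :
  (forall z, cis f z (df z)) -> (forall z, cis df z (ddf z)) ->
  (forall z, nrm (ddf z) <= K) ->
  nrm (f (x + t) - f x - t%:C * df x) <= 2 * K * t ^+ 2.
Proof.
move=> H1 H2 HK; apply: le_trans (nrm_le_ReIm _) _.
rewrite -mulrA mulr_natl mulr2n; apply: lerD.
  rewrite !cReD !cReN cReM /= mul0r subr0.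
  apply: (@taylor2 _ (fun z => cRe (f z)) (fun z => cRe (df z)) (fun z => cRe (ddf z))).
  - by move=> z; have [] := H1 z.
  - by move=> z; have [] := H2 z.
  - by move=> z; apply: le_trans (nrm_Re _) (HK z).
rewrite !cImD !cImN cImM /= mul0r addr0.
apply: (@taylor2 _ (fun z => cIm (f z)) (fun z => cIm (df z)) (fun z => cIm (ddf z))).
- by move=> z; have [] := H1 z.
- by move=> z; have [] := H2 z.
- by move=> z; apply: le_trans (nrm_Im _) (HK z).
Qed.

(** Term-by-term differentiation from summable bounds on the second derivatives: Taylor's quadratic
    errors are added up, and no uniform convergence is invoked. *)
Lemma csum_cis (I : choiceType) (c : I -> R[i]) (F dF ddF : I -> R -> R[i]) (K : I -> R) x :
  (forall i z, cis (F i) z (dF i z)) -> (forall i z, cis (dF i) z (ddF i z)) ->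
  (forall i z, nrm (ddF i z) <= K i) ->
  rsummable (fun i => nrm (c i) * K i) ->
  (forall z, absum (fun i => c i * F i z)) -> absum (fun i => c i * dF i x) ->
  cis (fun z => csum (fun i => c i * F i z)) x (csum (fun i => c i * dF i x)).
Proof.
move=> H1 H2 HK sK sF sdF.
apply: (@quadratic_cis _ _ _ (2 * rsum (fun i => nrm (c i) * K i))) => t.
rewrite -csumB// -csumZ// -csumB; [|exact: absumB|exact: absumZ].
have b i : nrm (c i * F i (x + t) - c i * F i x - t%:C * (c i * dF i x)) <=
    2 * t ^+ 2 * (nrm (c i) * K i).
  have -> : c i * F i (x + t) - c i * F i x - t%:C * (c i * dF i x) =
    c i * (F i (x + t) - F i x - t%:C * dF i x) by ring.
  rewrite Normc.normcM.
  apply: le_trans (ler_wpM2l (nrm_ge0 _) (@taylor2_complex (F i) (dF i) (ddF i) (K i) x t (H1 i) (H2 i) (HK i))) _.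
  by rewrite le_eqVlt; apply/orP; left; apply/eqP; ring.
apply: (nrm_csum_le b (rsummableZ _ sK)).
by rewrite rsumZ// mulrAC.
Qed.

End ComplexDerivative.

(** * Schwartz functions *)
Section SchwartzBasics.
Variable R : realType.
Implicit Types (f g : R -> R[i]) (x : R).

Notation wt := (@wt R).

(** Smoothness concerns all iterates of [cderive]. It is enough to exhibit a class of differentiable
    functions that is stable under [cderive]; the Schwartz property is treated in the same way
    below. *)
Lemma csmooth_coind (Q : set (R -> R[i])) :
  (forall f, Q f -> cdiff f) -> (forall f, Q f -> Q (cderive f)) ->
  forall f, Q f -> csmooth f.
Proof.
move=> H1 H2 f Qf n x.
have Qn k : Q (iter k (@cderive R) f) by elim: k => //= k; exact: H2.
exact: (derivable_cis _ x).2 (H1 _ (Qn n) x).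
Qed.

Lemma csmooth_cdiff f : csmooth f -> cdiff f.
Proof. by move=> H x; apply/derivable_cis; exact: (H 0%N x). Qed.

Lemma csmooth_cderive f : csmooth f -> csmooth (cderive f).
Proof. by move=> H n x; rewrite -iterSr; exact: (H n.+1 x). Qed.

Lemma weight_pow_le (a : R) m : 0 <= a -> (1 + a) ^+ m <= 2 ^+ m * (1 + a ^+ m).
Proof.
move=> a0; have [a1|a1] := leP a 1.
  apply: (@le_trans _ _ (2 ^+ m)).
    by rewrite lerXn2r ?nnegrE ?addr_ge0//; lra.
  by rewrite ler_peMr ?exprn_ge0// lerDl exprn_ge0.
apply: (@le_trans _ _ ((2 * a) ^+ m)).
  by rewrite lerXn2r ?nnegrE ?addr_ge0 ?mulr_ge0//; lra.
by rewrite exprMn ler_wpM2l ?exprn_ge0// lerDr.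
Qed.

Definition decays f := forall m, exists C, 0 <= C /\ forall x, (1 + `|x|) ^+ m * nrm (f x) <= C.

Lemma schwartz_coind (Q : set (R -> R[i])) :
  (forall f, Q f -> cdiff f) -> (forall f, Q f -> Q (cderive f)) ->
  (forall f, Q f -> decays f) ->
  Q `<=` @schwartz R.
Proof.
move=> H1 H2 H3 f Qf; split; first exact: csmooth_coind Qf.
move=> m n.
have Qn k : Q (iter k (@cderive R) f) by elim: k => //= k; exact: H2.
have [C [_ HC]] := H3 _ (Qn n) m; exists C => x; apply: le_trans (HC x).
by rewrite ler_wpM2r ?nrm_ge0// lerXn2r ?nnegrE ?addr_ge0// lerDr.
Qed.

Lemma schwartz_cdiff f : schwartz f -> cdiff f.
Proof. by move=> [/csmooth_cdiff]. Qed.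

Lemma schwartz_cderive f : schwartz f -> schwartz (cderive f).
Proof.
move=> [s b]; split; first exact: csmooth_cderive.
by move=> m n; have [C H] := b m n.+1; exists C => x; rewrite -iterSr.
Qed.

Lemma schwartz_decays f : schwartz f -> decays f.
Proof.
move=> [_ H] m; have [C0 /= H0] := H 0%N 0%N; have [C1 /= H1] := H m 0%N.
exists (2 ^+ m * (C0 + C1)).
have b0 := le_trans (mulr_ge0 (exprn_ge0 _ (normr_ge0 _)) (nrm_ge0 _)) (H0 0).
have b1 := le_trans (mulr_ge0 (exprn_ge0 _ (normr_ge0 _)) (nrm_ge0 _)) (H1 0).
split; first by rewrite mulr_ge0 ?addr_ge0 ?exprn_ge0.
move=> x; apply: le_trans (ler_wpM2r (nrm_ge0 (f x)) (weight_pow_le m (normr_ge0 x))) _.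
rewrite -mulrA ler_wpM2l ?exprn_ge0// mulrDl lerD//.
by have := H0 x; rewrite expr0.
Qed.

Lemma decaysD f g : decays f -> decays g -> decays (fun x => f x + g x).
Proof.
move=> hf hg m; have [C [C0 HC]] := hf m; have [D [D0 HD]] := hg m.
exists (C + D); split; first exact: addr_ge0.
move=> x; apply: le_trans (lerD (HC x) (HD x)).
by rewrite -mulrDr ler_wpM2l ?exprn_ge0 ?addr_ge0// le_normcD.
Qed.

Lemma decaysZ (c : R[i]) f : decays f -> decays (fun x => c * f x).
Proof.
move=> hf m; have [C [C0 HC]] := hf m.
exists (nrm c * C); split; first by rewrite mulr_ge0 ?nrm_ge0.
by move=> x; rewrite Normc.normcM mulrCA ler_wpM2l ?nrm_ge0.
Qed.

Lemma decays_mulx f : decays f -> decays (fun x => x%:C * f x).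
Proof.
move=> hf m; have [C [C0 HC]] := hf m.+1; exists C; split => // x.
apply: le_trans (HC x); rewrite Normc.normcM nrm_real mulrA exprSr.
by rewrite ler_wpM2r ?nrm_ge0// ler_wpM2l ?exprn_ge0 ?addr_ge0// lerDr.
Qed.

Lemma schwartzD f g : schwartz f -> schwartz g -> schwartz (fun x => f x + g x).
Proof.
pose Q := [set h | exists f g, [/\ schwartz f, schwartz g & h = fun x : R => f x + g x]].
move=> sf sg; apply: (@schwartz_coind Q); last by exists f, g.
- move=> _ [a [b [sa sb ->]]] x; apply: cdiff_cis.
  exact: cisD (schwartz_cdiff sa x) (schwartz_cdiff sb x).
- move=> _ [a [b [sa sb ->]]]; exists (cderive a), (cderive b).
  split; [exact: schwartz_cderive..|]; apply: cis_cdiff => x.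
  exact: cisD (schwartz_cdiff sa x) (schwartz_cdiff sb x).
- by move=> _ [a [b [sa sb ->]]]; apply: decaysD; exact: schwartz_decays.
Qed.

Lemma schwartzZ (c : R[i]) f : schwartz f -> schwartz (fun x => c * f x).
Proof.
pose Q := [set h | exists2 f, schwartz f & h = fun x : R => c * f x].
move=> sf; apply: (@schwartz_coind Q); last by exists f.
- by move=> _ [a sa ->] x; apply: cdiff_cis; exact: cisZ (schwartz_cdiff sa x).
- move=> _ [a sa ->]; exists (cderive a); first exact: schwartz_cderive.
  by apply: cis_cdiff => x; exact: cisZ (schwartz_cdiff sa x).
- by move=> _ [a sa ->]; apply: decaysZ; exact: schwartz_decays.
Qed.

Lemma schwartz_mulx f : schwartz f -> schwartz (fun x => x%:C * f x).
Proof.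
(* The summand [g] makes the class stable: the derivative of [x f + g] is [x f' + (f + g')]. *)
pose Q := [set h | exists f g, [/\ schwartz f, schwartz g & h = fun x : R => x%:C * f x + g x]].
move=> sf; have s0 : schwartz (fun _ : R => 0 : R[i]).
  by have := schwartzZ 0 sf; under eq_fun do rewrite mul0r.
have D a b x : schwartz a -> schwartz b ->
    cis (fun x : R => x%:C * a x + b x) x (x%:C * cderive a x + (a x + cderive b x)).
  move=> sa sb; have := cisD (cisM (cis_id x) (schwartz_cdiff sa x)) (schwartz_cdiff sb x).
  by rewrite mul1r addrA.
apply: (@schwartz_coind Q); last first.
- by exists f, (fun=> 0); split => //; apply/funext => x; rewrite addr0.
- move=> _ [a [b [sa sb ->]]]; apply: decaysD; last exact: schwartz_decays.
  by apply: decays_mulx; exact: schwartz_decays.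
- move=> _ [a [b [sa sb ->]]]; exists (cderive a), (fun x => a x + cderive b x).
  by split; [exact: schwartz_cderive|apply: schwartzD => //; exact: schwartz_cderive|
    apply: cis_cdiff => x; exact: D].
- by move=> _ [a [b [sa sb ->]]] x; apply: cdiff_cis; exact: D.
Qed.

End SchwartzBasics.

(** * Series of time-frequency shifts *)

Section TimeFrequencyFamily.
Variables (R : realType) (tr fr : Z2 -> R) (L : R).

Notation wt := (@wt R).

Hypotheses (trL : forall i, `|tr i| <= L * wt i) (frL : forall i, `|fr i| <= L * wt i).

Definition moderate (s : Z2 -> R[i]) :=
  exists C M, 0 <= C /\ forall i, nrm (s i) <= C * wt i ^+ M.

Definition growth (F : Z2 -> R -> R[i]) := forall m, exists C M,
  0 <= C /\ forall i x, (1 + `|x|) ^+ m * nrm (F i x) <= C * wt i ^+ M.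

(** The least class of families stable under differentiation in [x]: differentiating a modulated
    translate brings down the factor [fr i], which has polynomial growth and is absorbed by rapidly
    decaying coefficients. *)
Inductive tfam : (Z2 -> R -> R[i]) -> Prop :=
| tfam_base f : schwartz f -> tfam (fun i x => expi (fr i * x) * f (x + tr i))
| tfam_add F G : tfam F -> tfam G -> tfam (fun i x => F i x + G i x)
| tfam_scale s F : moderate s -> tfam F -> tfam (fun i x => s i * F i x).

Lemma nrm_expi (t : R) : nrm (expi t) = 1.
Proof. by rewrite /expi /= cos2Dsin2 sqrtr1. Qed.

Lemma tfam_cis F : tfam F -> exists2 G, tfam G & forall i x, cis (F i) x (G i x).
Proof.
have L0 : 0 <= L by have := le_trans (normr_ge0 _) (trL 0); rewrite pmulr_lge0// wt_gt0.
elim=> {F} [f sf|F G _ [F' tF HF] _ [G' tG HG]|s F ms _ [F' tF HF]].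
- exists (fun i x => expi (fr i * x) * cderive f (x + tr i) +
    ('i%C * (fr i)%:C) * (expi (fr i * x) * f (x + tr i))).
    apply: tfam_add; first exact: (tfam_base (schwartz_cderive sf)).
    apply: (@tfam_scale (fun i => 'i%C * (fr i)%:C)); last exact: tfam_base.
    exists L, 1%N; split=> // i.
    by rewrite Normc.normcM nrm_real -[X in X * _](_ : 1 = _) ?mul1r ?expr1//= expr0n expr1n add0r sqrtr1.
  move=> i x; rewrite mulrA; apply: cisM; first exact: cis_expi.
  by apply: cis_shift; exact: schwartz_cdiff.
- by exists (fun i x => F' i x + G' i x); [exact: tfam_add|move=> i x; exact: cisD].
- by exists (fun i x => s i * F' i x); [exact: tfam_scale|move=> i x; exact: cisZ].
Qed.

Lemma tfam_growth F : tfam F -> growth F.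
Proof.
have L0 : 0 <= L by have := le_trans (normr_ge0 _) (trL 0); rewrite pmulr_lge0// wt_gt0.
elim=> {F} [f sf|F G _ HF _ HG|s F [C [M [C0 HC]]] _ HF] m.
- have [C [C0 HC]] := schwartz_decays sf m.
  exists ((1 + L) ^+ m * C), m; split; first by rewrite mulr_ge0 ?exprn_ge0 ?addr_ge0.
  move=> i x; rewrite Normc.normcM nrm_expi mul1r mulrAC -exprMn.
  apply: le_trans (ler_wpM2l _ (HC (x + tr i))); last by rewrite exprn_ge0// mulr_ge0 ?wt_ge0 ?addr_ge0.
  rewrite mulrA -exprMn ler_wpM2r ?nrm_ge0//.
  rewrite lerXn2r ?nnegrE ?mulr_ge0 ?addr_ge0 ?wt_ge0//.
  apply: (@le_trans _ _ ((1 + `|tr i|) * (1 + `|x + tr i|))).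
    have : `|x| <= `|x + tr i| + `|tr i|.
      by have := ler_normB (x + tr i) (tr i); rewrite addrK.
    by have := normr_ge0 (tr i); have := normr_ge0 (x + tr i); nra.
  rewrite ler_wpM2r ?addr_ge0//.
  by have := trL i; have := wt_ge1 R i; lra.
- have [C [M [C0 HC]]] := HF m; have [D [N [D0 HD]]] := HG m.
  exists (C + D), (M + N)%N; split; first exact: addr_ge0.
  move=> i x; apply: (@le_trans _ _ (C * wt i ^+ M + D * wt i ^+ N)).
    apply: le_trans (lerD (HC i x) (HD i x)).
    by rewrite -mulrDr ler_wpM2l ?exprn_ge0 ?addr_ge0// le_normcD.
  by rewrite mulrDl lerD// ler_wpM2l// ler_weXn2l ?wt_ge1// (leq_addr, leq_addl).
- have [D [N [D0 HD]]] := HF m.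
  exists (C * D), (M + N)%N; split; first exact: mulr_ge0.
  move=> i x; rewrite Normc.normcM mulrCA exprD.
  have := ler_pM (nrm_ge0 _) (mulr_ge0 (exprn_ge0 _ _) (nrm_ge0 _)) (HC i) (HD i x).
  by rewrite addr_ge0// => /(_ isT) /le_trans; apply; rewrite mulrACA.
Qed.

Variables (c : Z2 -> R[i]) (rc : rapid c).

Lemma growth_csum F : growth F ->
  (forall x, absum (fun i => c i * F i x)) /\ decays (fun x => csum (fun i => c i * F i x)).
Proof.
move=> gF; have H m : exists D, 0 <= D /\ forall i x,
    (1 + `|x|) ^+ m * nrm (c i * F i x) <= D * wt i ^- 3.
  have [C [M [C0 HC]]] := gF m; have [D [D0 HD]] := rapidP (M + 3) rc.
  exists (D * C); split=> [|i x]; first by rewrite mulr_ge0 ?(ltW D0).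
  rewrite Normc.normcM mulrCA.
  have := ler_pM (nrm_ge0 _) (mulr_ge0 (exprn_ge0 _ _) (nrm_ge0 _)) (HD i) (HC i x).
  rewrite addr_ge0// => /(_ isT) /le_trans; apply.
  rewrite exprD invfM le_eqVlt; apply/orP; left; apply/eqP.
  by field; rewrite ?expf_neq0 ?wt_neq0.
have sF x : absum (fun i => c i * F i x).
  have [D [D0 HD]] := H 0%N; apply: absum_le (rsummableZ D (@rsummable_wt3 R)) => i.
  by have := HD i x; rewrite expr0 mul1r.
split=> // m; have [D [D0 HD]] := H m.
have s3 := rsummableZ D (@rsummable_wt3 R).
exists (rsum (fun i => D * wt i ^- 3)); split.
  by apply: rsum_ge0 => i; rewrite mulr_ge0 ?wtXV_ge0.
move=> x.
have -> : (1 + `|x|) ^+ m * nrm (csum (fun i => c i * F i x)) =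
   nrm (csum (fun i => ((1 + `|x|) ^+ m)%:C * (c i * F i x))).
  by rewrite csumZ// Normc.normcM nrm_real [`|_ ^+ m|]ger0_norm ?exprn_ge0 ?addr_ge0.
apply: (nrm_csum_le _ s3 (lexx _)) => i.
by rewrite Normc.normcM nrm_real [`|_ ^+ m|]ger0_norm ?exprn_ge0 ?addr_ge0// HD.
Qed.

Lemma tfam_csum_cis F G : tfam F -> tfam G -> (forall i x, cis (F i) x (G i x)) ->
  forall x, cis (fun x => csum (fun i => c i * F i x)) x (csum (fun i => c i * G i x)).
Proof.
move=> tF tG HF x; have [G' tG' HG] := tfam_cis tG.
have [C [M [C0 HC]]] := tfam_growth tG' 0.
apply: (@csum_cis _ _ c F G G' (fun i => C * wt i ^+ M) x HF HG).
- by move=> i z; have := HC i z; rewrite expr0 mul1r.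
- have [D [D0 HD]] := rapidP (M + 3) rc.
  apply: rsummable_le (rsummableZ (D * C) (@rsummable_wt3 R)) => i.
  rewrite ger0_norm ?mulr_ge0 ?nrm_ge0 ?exprn_ge0 ?wt_ge0//.
  apply: le_trans (ler_wpM2r _ (HD i)) _; first by rewrite mulr_ge0 ?exprn_ge0 ?wt_ge0.
  rewrite exprD invfM le_eqVlt; apply/orP; left; apply/eqP.
  by field; rewrite ?expf_neq0 ?wt_neq0.
- by move=> z; exact: (growth_csum (tfam_growth tF)).1.
- exact: (growth_csum (tfam_growth tG)).1.
Qed.

Lemma schwartz_tfam F : tfam F -> schwartz (fun x => csum (fun i => c i * F i x)).
Proof.
pose Q := [set h | exists2 F, tfam F & h = fun x : R => csum (fun i => c i * F i x)].
move=> tF; apply: (@schwartz_coind _ Q); last by exists F.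
- move=> _ [a ta ->] x; have [b tb H] := tfam_cis ta.
  by apply: cdiff_cis; exact: tfam_csum_cis ta tb H x.
- move=> _ [a ta ->]; have [b tb H] := tfam_cis ta; exists b => //.
  by apply: cis_cdiff => x; exact: tfam_csum_cis ta tb H x.
- by move=> _ [a ta ->]; exact: (growth_csum (tfam_growth ta)).2.
Qed.

End TimeFrequencyFamily.

Lemma schwartz_tf (R : realType) (s t : R) (f : R -> R[i]) :
  schwartz f -> schwartz (fun x => expi (s * x) * f (x + t)).
Proof.
(* A single shift is treated as a series with one nonzero coefficient, so that [schwartz_tfam]
   covers it. *)
move=> sf; pose c (i : Z2) : R[i] := if i == 0 then 1 else 0.
have rc : rapid c.
  move=> n; exists 1 => i; rewrite /c mul1r; case: eqP => [->|_].
    by rewrite -[nrm 1](_ : 1 = _) /=; rewrite ?expr0n ?expr1n ?addr0 ?sqrtr1// /wt !normr0 !addr0 expr1n invr1.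
  have /eqP -> : nrm (0 : R[i]) == 0 by rewrite nrm0P.
  exact: wtXV_ge0.
have lt : forall i : Z2, `|t| <= (`|s| + `|t|) * @wt R i.
  by move=> i; have := wt_ge1 R i; have := normr_ge0 s; have := normr_ge0 t; nra.
have ls : forall i : Z2, `|s| <= (`|s| + `|t|) * @wt R i.
  by move=> i; have := wt_ge1 R i; have := normr_ge0 s; have := normr_ge0 t; nra.
have := @schwartz_tfam R (fun=> t) (fun=> s) _ lt ls c rc _ (@tfam_base R (fun=> t) (fun=> s) f sf).
congr schwartz; apply/funext => x.
have h (i : Z2) : i != 0 -> c i * (expi (s * x) * f (x + t)) = 0.
  by rewrite /c => /negbTE ->; rewrite mul0r.
by rewrite (csum_one h).2 /c eqxx mul1r.
Qed.

(** * Integrals of complex-valued functions *)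
Section ComplexIntegral.
Variable R : realType.
Notation mu := (@lebesgue_measure R).
Implicit Types (f g : R -> R[i]) (a b : R).

Definition cintg a b f := mu.-integrable `[a, b] (EFin \o (fun x => cRe (f x))) /\
  mu.-integrable `[a, b] (EFin \o (fun x => cIm (f x))).

Definition ccont f := continuous (fun x => cRe (f x)) /\ continuous (fun x => cIm (f x)).

Lemma cdiff_ccont f (df : R -> R[i]) : (forall x, cis f x (df x)) -> ccont f.
Proof. by move=> H; split => x; have [h1 h2] := H x; [exact: is_derive_continuous h1|exact: is_derive_continuous h2]. Qed.

Lemma continuous_integrable a b (h : R -> R) : {within `[a, b], continuous h} ->
  mu.-integrable `[a, b] (EFin \o h).
Proof. by move=> ch; apply: continuous_compact_integrable => //; exact: segment_compact. Qed.

Lemma ccont_cintg a b f : ccont f -> cintg a b f.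
Proof. by move=> [h1 h2]; split; apply: continuous_integrable; exact: continuous_subspaceT. Qed.

Lemma cintgD a b f g : cintg a b f -> cintg a b g -> cintg a b (fun x => f x + g x).
Proof.
move=> [f1 f2] [g1 g2]; split.
  rewrite (_ : EFin \o _ = (EFin \o (fun x => cRe (f x))) \+ (EFin \o (fun x => cRe (g x))))%E.
    exact: integrableD.
  by apply/funext => x /=; rewrite cReD.
rewrite (_ : EFin \o _ = (EFin \o (fun x => cIm (f x))) \+ (EFin \o (fun x => cIm (g x))))%E.
  exact: integrableD.
by apply/funext => x /=; rewrite cImD.
Qed.

Lemma cintegralD a b f g : cintg a b f -> cintg a b g ->
  cintegral a b (fun x => f x + g x) = cintegral a b f + cintegral a b g.
Proof.
move=> [f1 f2] [g1 g2]; rewrite /cintegral.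
under eq_Rintegral do rewrite cReD; rewrite RintegralD//.
by under [X in _ +i* X]eq_Rintegral do rewrite cImD; rewrite RintegralD.
Qed.

Lemma integrable_scale a b (h : R -> R) (c : R) : mu.-integrable `[a, b] (EFin \o h) ->
  mu.-integrable `[a, b] (EFin \o (fun x => c * h x)).
Proof.
move=> ih; rewrite (_ : EFin \o _ = fun x => c%:E * (EFin \o h) x)%E; first exact: integrableZl.
by apply/funext => x /=; rewrite EFinM.
Qed.

Lemma integrable_lin a b (h k : R -> R) (c d : R) : mu.-integrable `[a, b] (EFin \o h) ->
  mu.-integrable `[a, b] (EFin \o k) -> mu.-integrable `[a, b] (EFin \o (fun x => c * h x + d * k x)).
Proof.
move=> ih ik.
rewrite (_ : EFin \o _ = (EFin \o (fun x => c * h x)%R) \+ (EFin \o (fun x => d * k x)%R))%E.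
  by apply: integrableD => //; exact: integrable_scale.
by apply/funext => x /=; rewrite EFinD.
Qed.

Lemma Rintegral_lin a b (h k : R -> R) (c d : R) : mu.-integrable `[a, b] (EFin \o h) ->
  mu.-integrable `[a, b] (EFin \o k) ->
  (\int[mu]_(x in `[a, b]) (c * h x + d * k x)) =
  c * (\int[mu]_(x in `[a, b]) h x) + d * (\int[mu]_(x in `[a, b]) k x).
Proof.
move=> ih ik; rewrite RintegralD//; first by rewrite !RintegralZl.
  exact: integrable_scale.
exact: integrable_scale.
Qed.

Lemma cintgZ a b (c : R[i]) f : cintg a b f -> cintg a b (fun x => c * f x).
Proof.
move=> [f1 f2]; split.
  have := integrable_lin (cRe c) (- cIm c) f1 f2; congr (mu.-integrable _ _).
  by apply/funext => x /=; rewrite cReM mulNr.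
have := integrable_lin (cRe c) (cIm c) f2 f1; congr (mu.-integrable _ _).
by apply/funext => x /=; rewrite cImM.
Qed.

Lemma cintegralZ a b (c : R[i]) f : cintg a b f ->
  cintegral a b (fun x => c * f x) = c * cintegral a b f.
Proof.
move=> [f1 f2]; rewrite /cintegral.
have -> : (fun x => cRe (c * f x)) = fun x => cRe c * cRe (f x) + (- cIm c) * cIm (f x).
  by apply/funext => x; rewrite cReM mulNr.
have -> : (fun x => cIm (c * f x)) = fun x => cRe c * cIm (f x) + cIm c * cRe (f x).
  by apply/funext => x; rewrite cImM.
rewrite !Rintegral_lin//; case: c => c1 c2; rewrite mulNr.
by apply/eqP; rewrite eq_complex /=; apply/andP; split; apply/eqP; ring.
Qed.

Lemma cintg_sum a b (I : Type) (s : seq I) (F : I -> R -> R[i]) :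
  (forall i, cintg a b (F i)) -> cintg a b (fun x => \sum_(i <- s) F i x).
Proof.
move=> H; elim: s => [|i s IH].
  under eq_fun do rewrite big_nil; apply: ccont_cintg.
  by apply: (@cdiff_ccont _ (fun=> 0)) => x; exact: cis_cst.
by under eq_fun do rewrite big_cons; exact: cintgD.
Qed.

Lemma cintegral_sum a b (I : Type) (s : seq I) (F : I -> R -> R[i]) :
  (forall i, cintg a b (F i)) ->
  cintegral a b (fun x => \sum_(i <- s) F i x) = \sum_(i <- s) cintegral a b (F i).
Proof.
move=> H; elim: s => [|i s IH].
  under eq_fun do rewrite big_nil; rewrite big_nil.
  have h : cintg a b (fun=> 0) by apply: ccont_cintg; apply: (@cdiff_ccont _ (fun=> 0)) => x; exact: cis_cst.
  by have := cintegralZ 0 h; rewrite mulr0 mul0r.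
by under eq_fun do rewrite big_cons; rewrite big_cons -IH cintegralD//; exact: cintg_sum.
Qed.

Lemma cintgB a b f g : cintg a b f -> cintg a b g -> cintg a b (fun x => f x - g x).
Proof.
move=> hf hg; have := cintgD hf (cintgZ (-1) hg).
by under eq_fun do rewrite mulN1r.
Qed.

Lemma cintegralB a b f g : cintg a b f -> cintg a b g ->
  cintegral a b (fun x => f x - g x) = cintegral a b f - cintegral a b g.
Proof.
move=> hf hg; have := cintegralD hf (cintgZ (-1) hg).
rewrite cintegralZ// mulN1r => <-.
by congr cintegral; apply/funext => x; rewrite mulN1r.
Qed.

Lemma eq_cintegral a b f g : (forall x, a <= x <= b -> f x = g x) ->
  cintegral a b f = cintegral a b g.
Proof.
by move=> H; congr (_ +i* _); apply: eq_Rintegral => x; rewrite inE /= in_itv /= => /H ->.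
Qed.

Lemma FTC2_real a b (F f : R -> R) : a < b -> (forall x : R, is_derive x 1 F (f x)) ->
  continuous f -> \int[mu]_(x in `[a, b]) f x = F b - F a.
Proof.
move=> ab dF cf; rewrite /Rintegral (@continuous_FTC2 _ f F)//.
- exact: continuous_subspaceT.
- have cF x : {for x, continuous F} by exact: is_derive_continuous (dF x).
  split => [x _||]; first by have [] := dF x.
    exact: (cvg_at_right_filter (cF a)).
  exact: (cvg_at_left_filter (cF b)).
- by move=> x _; rewrite (is_derive1E (dF x)).
Qed.

Lemma nrm_cintegral a b f (K : R) : a <= b -> cintg a b f ->
  (forall x, a <= x <= b -> nrm (f x) <= K) -> nrm (cintegral a b f) <= 2 * (b - a) * K.
Proof.
move=> ab [f1 f2] H.
have B (h : R -> R) : mu.-integrable `[a, b] (EFin \o h) ->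
   (forall x, a <= x <= b -> `|h x| <= K) -> `|\int[mu]_(x in `[a, b]) h x| <= (b - a) * K.
  move=> ih hK; apply: le_trans (le_normr_Rintegral _ ih) _ => //.
  have mb : \int[mu]_(x in `[a, b]) (cst K x) = (b - a) * K.
    move: ab; rewrite le_eqVlt => /predU1P[->|ab].
      by rewrite set_itv1 Rintegral_set1 subrr mul0r.
    have ca : continuous (cst K : R -> R) by move=> x; exact: cvg_cst.
    by rewrite (FTC2_real ab (is_derive_affine K 0) ca); ring.
  rewrite -mb; apply: le_Rintegral => //.
  - exact: (integrable_norm ih).
  - by apply: continuous_integrable; apply: continuous_subspaceT => x; exact: cvg_cst.
apply: le_trans (nrm_le_ReIm _) _; rewrite -mulrA mulr_natl mulr2n /=; apply: lerD.
  by apply: B => // x xab; apply: le_trans (nrm_Re _) (H _ xab).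
by apply: B => // x xab; apply: le_trans (nrm_Im _) (H _ xab).
Qed.

Lemma cintegral_FTC2 a b F f : a < b -> (forall x, cis F x (f x)) -> ccont f ->
  cintegral a b f = F b - F a.
Proof.
move=> ab dF [c1 c2]; rewrite /cintegral.
have d1 (x : R) : is_derive x 1 (fun x => cRe (F x)) (cRe (f x)) by have [] := dF x.
have d2 (x : R) : is_derive x 1 (fun x => cIm (F x)) (cIm (f x)) by have [] := dF x.
rewrite (FTC2_real ab d1 c1) (FTC2_real ab d2 c2).
by apply/eqP; rewrite eq_complex !cReD !cImD !cReN !cImN /= !eqxx.
Qed.

(** One finite set of indices approximates both the sum of the integrals and, through the summable
    majorant [w], the integrand uniformly on the interval. *)
Lemma cintegral_csum (I : choiceType) a b (f : R -> R[i]) (F : I -> R -> R[i]) (w : I -> R) :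
  a <= b -> cintg a b f -> (forall i, cintg a b (F i)) -> rsummable w ->
  (forall i x, a <= x <= b -> nrm (F i x) <= w i) ->
  (forall x, a <= x <= b -> f x = csum (fun i => F i x)) ->
  absum (fun i => cintegral a b (F i)) /\ cintegral a b f = csum (fun i => cintegral a b (F i)).
Proof.
move=> ab hf hF sw Fw fE.
have w0 i : 0 <= w i by have := Fw i a; rewrite lexx ab => /(_ isT); apply: le_trans (nrm_ge0 _).
have sI : absum (fun i => cintegral a b (F i)).
  apply: absum_le (rsummableZ (2 * (b - a)) sw) => i.
  by apply: nrm_cintegral => // x; exact: Fw.
split=> //; apply/eqP; rewrite -subr_eq0; apply/eqP; apply: nrm_le_eps => e e0.
(* Two errors occur: [d] from the sum, and at most [2 (b - a) d] from integrating the uniform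
   error. *)
set d := e / (2 * (b - a) + 1).
have ba0 : 0 < 2 * (b - a) + 1 by rewrite ltr_wpDl// mulr_ge0// subr_ge0.
have d0 : 0 < d by rewrite divr_gt0.
have [s1 us1 h1] := csum_approx sI d0.
have [s2 us2 h2] := rsum_approx w0 sw d0.
pose s := undup (s1 ++ s2); have us : uniq s by exact: undup_uniq.
have ss1 : {subset s1 <= s} by move=> i; rewrite mem_undup mem_cat => ->.
have ss2 : {subset s2 <= s} by move=> i; rewrite mem_undup mem_cat orbC => ->.
have tail : rsum w - \sum_(i <- s) w i <= d.
  have : \sum_(i <- s2) w i <= \sum_(i <- s) w i.
    have E (t : seq I) : uniq t -> \sum_(i <- t) w i = rsum (fun i => if i \in t then w i else 0).
      move=> ut; have [_ ->] := @rsum_fsupp _ _ t (fun i => if i \in t then w i else 0) ut (fun i => fun h => ifN _ _ h).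
      by apply: eq_big_seq => i ->.
    have sE (t : seq I) : rsummable (fun i => if i \in t then w i else 0).
      by apply: rsummable_le sw => i; case: ifP => _; rewrite ?normr0// ger0_norm.
    rewrite !E//; apply: ler_rsum => // i.
    by case: ifP => [/ss2 ->|_]//; case: ifP.
  by move: h2; lra.
have pw x : a <= x <= b -> nrm (f x - \sum_(i <- s) F i x) <= d.
  move=> xab; rewrite fE//.
  have sx : absum (fun i => F i x) by apply: absum_le sw => i; exact: Fw.
  have [sF EF] := @csum_fsupp _ _ s (fun i => if i \in s then F i x else 0) us (fun i => fun h => ifN _ _ h).
  have [sW EW] := @rsum_fsupp _ _ s (fun i => if i \in s then w i else 0) us (fun i => fun h => ifN _ _ h).
  have -> : \sum_(i <- s) F i x = csum (fun i => if i \in s then F i x else 0).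
    by rewrite EF; apply: eq_big_seq => i ->.
  rewrite -csumB//; apply: le_trans tail.
  have -> : \sum_(i <- s) w i = rsum (fun i => if i \in s then w i else 0).
    by rewrite EW; apply: eq_big_seq => i ->.
  have sN : rsummable (fun i => - (if i \in s then w i else 0)).
    by apply: rsummable_le sW => i; rewrite normrN ger0_norm//; case: ifP.
  rewrite -rsumN// -rsumD//.
  apply: (@nrm_csum_le _ _ _ (fun i => w i + - (if i \in s then w i else 0))) => // [i|].
    case: ifP => _; first by rewrite !subrr (eqP (_ : nrm (0 : R[i]) == 0)) ?nrm0P.
    by rewrite !subr0; exact: Fw.
  exact: rsummableD.
have E : cintegral a b f - csum (fun i => cintegral a b (F i)) =
   cintegral a b (fun x => f x - \sum_(i <- s) F i x) -
   (csum (fun i => cintegral a b (F i)) - \sum_(i <- s) cintegral a b (F i)).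
  by rewrite cintegralB// ?cintegral_sum//; [ring|exact: cintg_sum].
rewrite E; apply: le_trans (nrmB _ _) _.
apply: (@le_trans _ _ (2 * (b - a) * d + d)); last by rewrite -[X in _ + X]mul1r -mulrDl mulrC divfK ?gt_eqF.
apply: lerD; last exact: h1.
apply: nrm_cintegral => //; apply: cintgB => //; exact: cintg_sum.
Qed.

(** The fundamental theorem is applied to the right of a base point. Normalising the integral to
    vanish at 0 removes the dependence on the base point, which can then be moved to the left of any
    given [x]. *)
Lemma primitive_exists (k : R -> R) : continuous k ->
  exists F : R -> R, forall x : R, is_derive x 1 F (k x).
Proof.
move=> ck.
pose Psi a x : R := (\int[mu]_(t in `[a, x]) k t) - \int[mu]_(t in `[a, 0]) k t.
have ik a b : mu.-integrable `[a, b] (EFin \o k).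
  by apply: continuous_integrable; exact: continuous_subspaceT.
have dPsi a x : a < x -> is_derive x 1 (Psi a) (k x).
  move=> ax; have xx1 : x < x + 1 by rewrite ltrDl.
  have [d1 d2] := continuous_FTC1_closed xx1 (ik a (x + 1)) ax (ck x).
  apply: is_derive_eq (is_deriveB (derivable_is_derive d1) (is_derive_cst _ _ _)) _.
  by rewrite subr0.
have ab_ind a b x : b <= a -> a <= x -> a <= 0 -> Psi a x = Psi b x.
  move=> ba ax a0; rewrite /Psi.
  have S y : a <= y -> \int[mu]_(t in `[b, y]) k t - \int[mu]_(t in `[b, a]) k t = \int[mu]_(t in `[a, y]) k t.
    move=> ay; rewrite -[RHS]Rintegral_itv_obnd_cbnd; first by apply: Rintegral_itvB; rewrite ?bnd_simp//.
    apply: integrableS (ik a y) => //; exact: subset_itv_oc_cc.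
  by rewrite -!S//; ring.
exists (fun x => Psi (- (`|x| + 1)) x) => x.
pose n := - (`|x| + 2).
have nx : n < x by rewrite /n; have := ler_norm (- x); rewrite normrN; lra.
apply: (@near_eq_is_derive _ _ _ (Psi n)); last exact: dPsi.
near=> y; have yx : `|y| <= `|x| + 1.
  have : `|x - y| < 1 by near: y; exact: (nbhsx_ballx x _ ltr01).
  by have := ler_normB x (x - y); rewrite subKr; lra.
have := normr_ge0 y; have := ler_norm (- y); rewrite normrN => h1 h2.
by apply/esym/ab_ind; rewrite ?/n; lra.
Unshelve. all: by end_near. Qed.

End ComplexIntegral.

(** * Smooth windows *)
Section SmoothReal.
Variable R : realType.
Implicit Types (f g : R -> R) (x : R).

(** [flat 0] is the function exp(-1/x) extended by 0; the negative powers of [x] make the family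
    stable under differentiation. *)
Definition flat n x : R := if 0 < x then x^-1 ^+ n * expR (- x^-1) else 0.

Lemma flat_eq0 n x : x <= 0 -> flat n x = 0.
Proof. by rewrite /flat leNgt => /negbTE ->. Qed.

Lemma flat0_ge0 x : 0 <= flat 0 x.
Proof. by rewrite /flat; case: ifP => // _; rewrite mul1r expR_ge0. Qed.

Lemma flat0_gt0 x : 0 < x -> 0 < flat 0 x.
Proof. by rewrite /flat => ->; rewrite mul1r expR_gt0. Qed.

Lemma pow_expRN_le (y : R) n : 0 <= y -> y ^+ n * expR (- y) <= (n.+1%:R) ^+ n.
Proof.
move=> y0; have n0 : (0 : R) < n.+1%:R by rewrite ltr0n.
have y1 : y / n.+1%:R <= expR (y / n.+1%:R).
  by apply: le_trans (expR_ge1Dx _); rewrite lerDr.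
have e1 : 1 <= expR (y / n.+1%:R).
  by apply: le_trans (expR_ge1Dx _); rewrite lerDl divr_ge0.
have : (y / n.+1%:R) ^+ n <= expR y.
  apply: (@le_trans _ _ (expR (y / n.+1%:R) ^+ n)).
    by rewrite lerXn2r ?nnegrE ?divr_ge0 ?expR_ge0.
  apply: (@le_trans _ _ (expR (y / n.+1%:R) ^+ n.+1)); first by rewrite exprS ler_peMl ?exprn_ge0 ?expR_ge0.
  by rewrite -expRM_natl mulrC divfK ?gt_eqF.
rewrite expr_div_n ler_pdivrMr ?exprn_gt0// => H.
by rewrite expRN ler_pdivrMr ?expR_gt0// mulrC.
Qed.

(** With [y = 1 / x] this says that [y^(n+2) e^(-y)] is bounded. A quadratic bound is what
    [quadratic_is_derive] needs at the point 0. *)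
Lemma flat_quad n : exists C : R, forall x, `|flat n x| <= C * x ^+ 2.
Proof.
exists ((n + 2).+1%:R ^+ (n + 2)) => x; rewrite /flat; case: ltP => [x0|x0]; last first.
  by rewrite normr0 mulr_ge0 ?sqr_ge0// exprn_ge0.
have y0 : 0 <= x^-1 by rewrite invr_ge0 ltW.
rewrite ger0_norm ?mulr_ge0 ?exprn_ge0 ?expR_ge0//.
apply: le_trans (ler_wpM2r (sqr_ge0 x) (pow_expRN_le (n + 2) y0)).
rewrite exprD mulrAC -[_ * x ^+ 2]mulrA [_ * x ^+ 2]mulrC -mulrA mulrCA.
by rewrite -exprMn divff ?gt_eqF// expr1n mul1r.
Qed.

Lemma is_derive_flat n x :
  is_derive x 1 (flat n) (- n%:R * flat n.+1 x + flat n.+2 x).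
Proof.
have [x0|x0|->] := ltgtP x 0.
- rewrite !flat_eq0 ?ltW// mulr0 addr0.
  apply: (@near_eq_is_derive _ _ _ (cst 0) _ x 1 0 _ (is_derive_cst 0 x 1)).
  by near=> y; rewrite flat_eq0// ltW//; near: y; exact: lt_nbhsl.
- have D m : is_derive x 1 (fun y : R => y^-1 ^+ m * expR (- y^-1))
      (- m%:R * (x^-1 ^+ m.+1 * expR (- x^-1)) + x^-1 ^+ m.+2 * expR (- x^-1)).
    have dV : is_derive x 1 (fun y : R => y^-1) (- x ^- 2).
      have := @is_deriveV _ id x 1 1 (lt0r_neq0 x0) (is_derive_id x 1).
      by rewrite /GRing.scale /= mulr1.
    elim: m => [|m IH].
      have H := @is_derive1_comp _ expR (fun y : R => - y^-1) x _ _ (is_derive_expR _) (is_deriveN dV).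
      under eq_fun do rewrite expr0 mul1r.
      by apply: is_derive_eq H _; rewrite opprK -exprVn; ring.
    have := is_deriveM dV IH; rewrite /GRing.scale /= => H.
    have E : (fun y : R => y^-1 ^+ m.+1 * expR (- y^-1)) =
        (fun y : R => y^-1) * (fun y : R => y^-1 ^+ m * expR (- y^-1)).
      by apply/funext => y; rewrite [RHS]/GRing.mul /= mulrA -exprS.
    rewrite E; apply: is_derive_eq H _.
    by rewrite -exprVn -natr1 !exprS expr0; ring.
  rewrite /flat x0; apply: (@near_eq_is_derive _ _ _ _ _ _ _ _ _ (D n)).
  by near=> y; rewrite /flat ifT//; near: y; exact: lt_nbhsr.
- rewrite !flat_eq0// mulr0 addr0; have [C HC] := flat_quad n.
  apply: (@quadratic_is_derive _ _ _ _ C) => t.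
  by rewrite mulr0 add0r [flat n 0]flat_eq0// !subr0.
Unshelve. all: by end_near. Qed.

(** Closed under the operations that build the windows and under differentiation, so one induction
    makes all of them smooth. *)
Inductive rsm : (R -> R) -> Prop :=
| rsm_flat n : rsm (flat n)
| rsm_cst c : rsm (fun=> c)
| rsm_add f g : rsm f -> rsm g -> rsm (fun x => f x + g x)
| rsm_mul f g : rsm f -> rsm g -> rsm (fun x => f x * g x)
| rsm_inv f : (forall x, f x != 0) -> rsm f -> rsm (fun x => (f x)^-1)
| rsm_aff f a b : rsm f -> rsm (fun x => f (a * x + b)).

Lemma rsm_derive f : rsm f -> exists2 g, rsm g & forall x, is_derive x 1 f (g x).
Proof.
elim=> {f} [n|c|f g sf [f' sf' df] sg [g' sg' dg]|f g sf [f' sf' df] sg [g' sg' dg]|f f0 sf [f' sf' df]|f a b sf [f' sf' df]].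
- exists (fun x => (- n%:R) * flat n.+1 x + flat n.+2 x); last exact: is_derive_flat.
  by apply: rsm_add (rsm_flat _); apply: rsm_mul (rsm_cst _) (rsm_flat _).
- by exists (fun=> 0); [exact: rsm_cst|move=> x; exact: is_derive_cst].
- by exists (fun x => f' x + g' x); [exact: rsm_add|move=> x; exact: is_deriveD].
- exists (fun x => f x * g' x + g x * f' x); first by apply: rsm_add; exact: rsm_mul.
  by move=> x; have := is_deriveM (df x) (dg x).
- exists (fun x => -1 * ((f x)^-1 * (f x)^-1) * f' x).
    by apply: rsm_mul => //; apply: rsm_mul (rsm_cst _) _; apply: rsm_mul; exact: rsm_inv.
  move=> x; apply: is_derive_eq (is_deriveV (f0 x) (df x)) _.
  by rewrite /GRing.scale /= expr2 invfM; ring.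
- exists (fun x => f' (a * x + b) * a); first by apply: rsm_mul (rsm_cst _); exact: rsm_aff.
  by move=> x; exact: (@is_derive1_comp _ f (fun t : R => a * t + b) x _ _ (df _) (is_derive_affine a b x)).
Qed.

Lemma rsm_compact_schwartz f (a b : R) : a <= b -> rsm f ->
  (forall x, x < a \/ b < x -> f x = 0) -> schwartz (fun x => (f x)%:C).
Proof.
pose Q := [set h : R -> R[i] | exists f, [/\ rsm f, forall x, x < a \/ b < x -> f x = 0 &
   h = fun x => (f x)%:C]].
move=> ab sf f0; apply: (@schwartz_coind _ Q); last by exists f.
- move=> _ [h [sh _ ->]] x; have [h' _ dh] := rsm_derive sh.
  exact: cdiff_cis (cis_real (dh x)).
- move=> _ [h [sh h0 ->]]; have [h' sh' dh] := rsm_derive sh; exists h'; split => //.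
    move=> x xab; have : is_derive x 1 h 0.
      apply: (@near_eq_is_derive _ _ _ (cst 0) _ x 1 0 _ (is_derive_cst 0 x 1)).
      case: xab => xab; near=> y; rewrite /cst h0//; [left|right]; near: y.
        exact: lt_nbhsl.
      exact: lt_nbhsr.
    by move=> [_ <-]; have [_ <-] := dh x.
  by apply: cis_cdiff => x; exact: cis_real (dh x).
- move=> _ [h [sh h0 ->]] m; have [h' _ dh] := rsm_derive sh.
  have ch : {within `[a, b], continuous h}.
    by apply: continuous_subspaceT => x; exact: is_derive_continuous (dh x).
  have [c _ Hc] := EVT_max ab ch; have [d _ Hd] := EVT_min ab ch.
  exists ((1 + `|a| + `|b|) ^+ m * (`|h c| + `|h d|)).
  split; first by rewrite mulr_ge0 ?addr_ge0// exprn_ge0 ?addr_ge0.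
  move=> x; rewrite nrm_real; have [xa|xa] := ltP x a.
    by rewrite h0; [rewrite normr0 mulr0 mulr_ge0 ?addr_ge0// exprn_ge0 ?addr_ge0|left].
  have [xb|xb] := ltP b x.
    by rewrite h0; [rewrite normr0 mulr0 mulr_ge0 ?addr_ge0// exprn_ge0 ?addr_ge0|right].
  have xab : x \in `[a, b]%R by rewrite in_itv /= xa.
  have := Hc _ xab; have := Hd _ xab.
  have := ler_norm (h c); have := ler_norm (- h d); rewrite normrN => h1 h2 h3 h4.
  apply: (ler_pM (exprn_ge0 _ (addr_ge0 ler01 (normr_ge0 x))) (normr_ge0 _)).
    rewrite lerXn2r ?nnegrE ?addr_ge0// -addrA lerD2l ler_norml.
    have := ler_norm b; have := ler_norm (- a); rewrite normrN.
    by have := normr_ge0 a; have := normr_ge0 b; move=> *; apply/andP; split; lra.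
  rewrite ler_norml; have := normr_ge0 (h c); have := normr_ge0 (h d).
  by move=> *; apply/andP; split; lra.
Unshelve. all: by end_near. Qed.

Definition step x : R := flat 0 x / (flat 0 x + flat 0 (-1 * x + 1)).

Lemma step_den_neq0 x : flat 0 x + flat 0 (-1 * x + 1) != 0.
Proof.
apply: lt0r_neq0; have [x0|x0] := ltP 0 x.
  by rewrite ltr_pwDl ?flat0_gt0 ?flat0_ge0.
by rewrite ltr_wpDl ?flat0_ge0// flat0_gt0//; lra.
Qed.

Lemma rsm_step : rsm step.
Proof.
apply: rsm_mul (rsm_flat 0) _; apply: rsm_inv; first exact: step_den_neq0.
by apply: rsm_add (rsm_flat 0) _; exact: (rsm_aff (-1) 1 (rsm_flat 0)).
Qed.

Lemma step_eq0 x : x <= 0 -> step x = 0.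
Proof. by move=> x0; rewrite /step flat_eq0// mul0r. Qed.

Lemma step_eq1 x : 1 <= x -> step x = 1.
Proof.
move=> x1; have := step_den_neq0 x; rewrite /step [flat 0 (_ + _)]flat_eq0 ?addr0; last by lra.
by move=> h; rewrite divff.
Qed.

Variable h : R.
Hypothesis h0 : 0 < h.

(** [chi] analyses and [plateau] synthesises. [chi] is a difference of neighbouring translates of
    one step, so its translates by [h] telescope to 1; its support [h/2, 5h/2] lies where [plateau]
    equals 1, and [plateau] vanishes outside [0, 3h]. *)
Definition chi x : R := step (h^-1 * x + - 2^-1) + -1 * step (h^-1 * x + - (3 / 2)).

Definition plateau x : R := step ((2 / h) * x + 0) * step (- (2 / h) * x + 6).

Lemma rsm_chi : rsm chi.
Proof.
apply: rsm_add; first exact: rsm_aff rsm_step.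
by apply: rsm_mul (rsm_cst _) _; exact: rsm_aff rsm_step.
Qed.

Lemma rsm_plateau : rsm plateau.
Proof. by apply: rsm_mul; exact: rsm_aff rsm_step. Qed.

Lemma chi_eq0 x : x <= h / 2 \/ 5 * h / 2 <= x -> chi x = 0.
Proof.
have E : x = h * (h^-1 * x) by rewrite mulVKf ?gt_eqF.
set y := h^-1 * x in E; rewrite /chi -/y => -[H|H].
  have : y <= 1 / 2 by rewrite -(ler_pM2l h0) -E; lra.
  by move=> yl; rewrite !step_eq0; lra.
have : 5 / 2 <= y by rewrite -(ler_pM2l h0) -E; lra.
by move=> yl; rewrite !step_eq1; lra.
Qed.

Lemma plateau_eq0 x : x <= 0 \/ 3 * h <= x -> plateau x = 0.
Proof.
have E : x = h * (h^-1 * x) by rewrite mulVKf ?gt_eqF.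
have -> : plateau x = step (2 * (h^-1 * x)) * step (6 - 2 * (h^-1 * x)).
  by rewrite /plateau; congr (step _ * step _); ring.
set y := h^-1 * x in E *; move=> [H|H].
  have : y <= 0 by rewrite -(ler_pM2l h0) -E; lra.
  by move=> yl; rewrite step_eq0 ?mul0r//; lra.
have : 3 <= y by rewrite -(ler_pM2l h0) -E; lra.
by move=> yl; rewrite [step (6 - _)]step_eq0 ?mulr0//; lra.
Qed.

Lemma plateau_eq1 x : h / 2 <= x <= 5 * h / 2 -> plateau x = 1.
Proof.
have E : x = h * (h^-1 * x) by rewrite mulVKf ?gt_eqF.
have -> : plateau x = step (2 * (h^-1 * x)) * step (6 - 2 * (h^-1 * x)).
  by rewrite /plateau; congr (step _ * step _); ring.
set y := h^-1 * x in E *; move=> /andP[H1 H2].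
have y1 : 1 / 2 <= y by rewrite -(ler_pM2l h0) -E; lra.
have y2 : y <= 5 / 2 by rewrite -(ler_pM2l h0) -E; lra.
by rewrite !step_eq1 ?mul1r//; lra.
Qed.

Lemma plateau_chi x : plateau x * chi x = chi x.
Proof.
have [H|H] := leP x (h / 2); first by rewrite chi_eq0 ?mulr0//; left.
have [H'|H'] := leP (5 * h / 2) x; first by rewrite chi_eq0 ?mulr0//; right.
by rewrite plateau_eq1 ?mul1r// !ltW.
Qed.

Lemma chi_partition x : absum (fun m : int => (chi (x - h * m%:~R))%:C) /\
  csum (fun m : int => (chi (x - h * m%:~R))%:C) = 1.
Proof.
(* The translates of [chi] are the differences of [H], which is -1 far to the left and 0 far to the
   right. *)
pose H (m : int) : R[i] := (- step (h^-1 * x - m%:~R - 2^-1))%:C.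
have E : (fun m : int => (chi (x - h * m%:~R))%:C) = fun m => H (m + 1) - H m.
  apply/funext => m; rewrite /H -rmorphB /= /chi; congr (_%:C).
  rewrite opprK mulN1r [LHS]addrC; congr (- step _ + step _).
    by rewrite intrD mulrBr mulKf ?gt_eqF//; field; rewrite gt_eqF.
  by rewrite mulrBr mulKf ?gt_eqF.
pose n0 := Num.Def.archi_bound `|h^-1 * x|.
have n0P : `|h^-1 * x| < n0%:R by rewrite archi_boundP.
have hx1 : h^-1 * x <= `|h^-1 * x| by exact: ler_norm.
have hx2 : - (h^-1 * x) <= `|h^-1 * x| by rewrite -normrN; exact: ler_norm.
have Hp (m : int) : (n0%:Z <= m)%R -> H m = 0.
  rewrite -(ler_int R) => nm; rewrite /H step_eq0 ?oppr0//.
  by move: nm; rewrite -[n0%:~R]/(n0%:R); lra.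
have Hm (m : int) : (m <= - (n0%:Z + 2))%R -> H m = -1.
  rewrite -(ler_int R) rmorphN rmorphD /= => nm; rewrite /H step_eq1 ?rmorphN//.
  by move: nm; rewrite -[n0%:~R]/(n0%:R); lra.
have sH : absum (fun m : int => H (m + 1) - H m).
  have [|m /= hm|] // := @csum_fsupp R int (zbox (n0 + 3)) (fun m => H (m + 1) - H m).
    exact: zbox_uniq.
  move: hm; rewrite mem_zbox -ltnNge => hm.
  have [m0|m0] := leP 0 m; first by rewrite !Hp ?subrr//; lia.
  by rewrite !Hm ?subrr//; lia.
rewrite E; split=> //; rewrite (@csum_telescope _ H 0 (-1))//; first by rewrite sub0r opprK.
move=> e e0; exists (n0 + 2)%N => N nN; rewrite Hp; last by lia.
rewrite Hm; last by lia.
by rewrite !subrr (eqP (_ : nrm (0 : R[i]) == 0)) ?nrm0P// ltW.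
Qed.

End SmoothReal.

(** * Fourier series on [0, 1] *)
Section Expi.
Variable R : realType.
Implicit Types (s t x : R) (n : int).

Lemma expiD s t : expi (s + t) = expi s * expi t :> R[i].
Proof. by rewrite /expi cosD sinD; simpc; congr (_ +i* _); ring. Qed.

Lemma expi0 : expi (0 : R) = 1.
Proof. by rewrite /expi cos0 sin0. Qed.

Lemma expiN t : expi (- t) = (expi t)^*%C.
Proof. by rewrite /expi cosN sinN. Qed.

Lemma expiNK t : expi t * expi (- t) = 1 :> R[i].
Proof. by rewrite -expiD subrr expi0. Qed.

Lemma expi_2pi n : expi (2 * pi * n%:~R) = 1 :> R[i].
Proof.
have N (m : nat) : expi (2 * pi * m%:R) = 1 :> R[i].
  elim: m => [|m IH]; first by rewrite mulr0 expi0.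
  rewrite -[m.+1%:R]natr1 mulrDr mulr1 expiD IH mul1r /expi.
  by rewrite mulr_natl cos2pi sin2pi.
case: n => m; first exact: N.
by rewrite NegzE rmorphN mulrN expiN N conjc1.
Qed.

Lemma cint_cst (L : R) (c : R[i]) : 0 < L -> cintegral 0 L (fun=> c) = L%:C * c.
Proof.
move=> L0; rewrite (@cintegral_FTC2 _ 0 L (fun x => x%:C * c) (fun=> c))//.
- by rewrite mul0r subr0.
- by move=> x; have := cisM (cis_id x) (cis_cst c x); rewrite mulr0 add0r mul1r.
- by apply: (@cdiff_ccont _ _ (fun=> 0)) => x; exact: cis_cst.
Qed.

Lemma ccont_expi s : ccont (fun t => expi (s * t)).
Proof. by apply: cdiff_ccont => x; exact: cis_expi. Qed.

Lemma int_expi (L : R) n : 0 < L ->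
  cintegral 0 L (fun t => expi (2 * pi * n%:~R / L * t)) = if n == 0 then L%:C else 0.
Proof.
move=> L0; case: eqP => [->|/eqP n0].
  rewrite (_ : (fun t => _) = fun=> 1).
    by rewrite cint_cst// mulr1.
  by apply/funext => t; rewrite mulr0 !mul0r expi0.
set s := 2 * pi * n%:~R / L.
have s0 : s != 0.
  by rewrite /s !mulf_neq0 ?invr_eq0 ?intr_eq0// gt_eqF ?pi_gt0.
have c0 : 'i%C * s%:C != 0 by rewrite mulf_neq0 ?fmorph_eq0// eq_complex /= oner_eq0 andbF.
rewrite (@cintegral_FTC2 _ 0 L (fun x => ('i%C * s%:C)^-1 * expi (s * x)))//.
- rewrite mulr0 expi0 /s divfK ?gt_eqF// expi_2pi subrr //.
- by move=> x; have := cisZ ('i%C * s%:C)^-1 (cis_expi s x); rewrite mulrA mulVf// mul1r.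
- exact: ccont_expi.
Qed.

End Expi.

Section FourierInversion.
Variable R : realType.
Implicit Types (F G : R -> R[i]) (t x : R).

(** Continuity within [0, 1] only: the quotient used for the inversion theorem is shown to be
    continuous there, while its denominator also vanishes at distance 1 from the base point. *)
Definition wcont F := {within `[0, 1], continuous (fun x => cRe (F x))} /\
  {within `[0, 1], continuous (fun x => cIm (F x))}.

Lemma wcont_cintg F : wcont F -> cintg 0 1 F.
Proof. by move=> [h1 h2]; split; exact: continuous_integrable. Qed.

Lemma ccont_wcont F : ccont F -> wcont F.
Proof. by move=> [h1 h2]; split; exact: continuous_subspaceT. Qed.

Lemma wcontM F G : wcont F -> wcont G -> wcont (fun x => F x * G x).
Proof.
move=> [f1 f2] [g1 g2]; split.
  have -> : (fun x => cRe (F x * G x)) = fun x => cRe (F x) * cRe (G x) - cIm (F x) * cIm (G x) by apply/funext => x; rewrite cReM.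
  by move=> x; apply: cvgB; apply: cvgM; [exact: f1|exact: g1|exact: f2|exact: g2].
have -> : (fun x => cIm (F x * G x)) = fun x => cRe (F x) * cIm (G x) + cIm (F x) * cRe (G x) by apply/funext => x; rewrite cImM.
by move=> x; apply: cvgD; apply: cvgM; [exact: f1|exact: g2|exact: f2|exact: g1].
Qed.

Lemma wcontD F G : wcont F -> wcont G -> wcont (fun x => F x + G x).
Proof.
move=> [f1 f2] [g1 g2]; split.
  have -> : (fun x => cRe (F x + G x)) = fun x => cRe (F x) + cRe (G x) by apply/funext => x; rewrite cReD.
  by move=> x; apply: cvgD; [exact: f1|exact: g1].
have -> : (fun x => cIm (F x + G x)) = fun x => cIm (F x) + cIm (G x) by apply/funext => x; rewrite cImD.
by move=> x; apply: cvgD; [exact: f2|exact: g2].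
Qed.

Lemma wcont_conj F : wcont F -> wcont (fun x => (F x)^*%C).
Proof.
move=> [f1 f2]; split.
  by rewrite (_ : (fun x => _) = fun x => cRe (F x)) //; apply/funext => x; case: (F x).
rewrite (_ : (fun x => _) = fun x => - cIm (F x)); last by apply/funext => x; case: (F x).
by move=> x; apply: cvgN; exact: f2.
Qed.

Lemma wcont_cst (c : R[i]) : wcont (fun=> c).
Proof. by apply/ccont_wcont/(@cdiff_ccont _ _ (fun=> 0)) => x; exact: cis_cst. Qed.

Lemma wcont_sum (I : Type) (s : seq I) (F : I -> R -> R[i]) :
  (forall i, wcont (F i)) -> wcont (fun x => \sum_(i <- s) F i x).
Proof.
move=> H; elim: s => [|i s IH].
  by under eq_fun do rewrite big_nil; exact: wcont_cst.
by under eq_fun do rewrite big_cons; exact: wcontD.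
Qed.

Lemma cintegral_conj F : wcont F -> cintegral 0 1 (fun x => (F x)^*%C) = (cintegral 0 1 F)^*%C.
Proof.
move=> /wcont_cintg[f1 f2]; rewrite /cintegral /=; congr (_ +i* _).
  by apply: eq_Rintegral => x _; case: (F x).
rewrite -mulN1r -RintegralZl//; apply: eq_Rintegral => x _.
by rewrite mulN1r; case: (F x).
Qed.

Definition fmode (t0 : R) (k : int) (t : R) : R[i] := expi (2 * pi * k%:~R * (t - t0)).

Lemma wcont_fmode t0 k : wcont (fmode t0 k).
Proof.
apply: ccont_wcont; rewrite /fmode.
rewrite (_ : (fun t => _) = fun t => expi (- (2 * pi * k%:~R * t0)) * expi (2 * pi * k%:~R * t)).
  by apply: cdiff_ccont => x; apply: cisZ; exact: cis_expi.
by apply/funext => t; rewrite -expiD; congr expi; ring.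
Qed.

Lemma fmodeN t0 k t : fmode t0 (- k) t = (fmode t0 k t)^*%C.
Proof. by rewrite /fmode -expiN; congr expi; rewrite rmorphN /=; ring. Qed.

Lemma fmodeD t0 k l t : fmode t0 (k + l) t = fmode t0 k t * fmode t0 l t.
Proof. by rewrite /fmode -expiD; congr expi; rewrite rmorphD /=; ring. Qed.

Lemma int_fmode t0 k : cintegral 0 1 (fmode t0 k) = if k == 0 then 1 else 0.
Proof.
rewrite /fmode (_ : (fun t => _) = fun t => expi (- (2 * pi * k%:~R * t0)) * expi (2 * pi * k%:~R / 1 * t)).
  rewrite cintegralZ ?int_expi//; last by apply: ccont_cintg; exact: ccont_expi.
  by case: eqP => [->|_]; rewrite ?mulr0// mul0r oppr0 expi0 mul1r.
by apply/funext => t; rewrite -expiD; congr expi; rewrite divr1; ring.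
Qed.

Variables (t0 : R) (H : R -> R[i]).
Hypothesis cH : wcont H.
Notation e := (fmode t0).

Definition fcoef k := cintegral 0 1 (fun t => H t * e (- k) t).

(** The residual [D] of the finite Fourier sum is orthogonal to the modes in [s], and its squared
    norm is nonnegative. *)
Lemma bessel (s : seq int) : uniq s ->
  \sum_(k <- s) nrm (fcoef k) ^+ 2 <= cRe (cintegral 0 1 (fun t => H t * (H t)^*%C)).
Proof.
move=> us; pose S t := \sum_(k <- s) fcoef k * e k t.
have cS : wcont S by apply: wcont_sum => k; apply: wcontM (wcont_cst _) (wcont_fmode _ _).
pose D t := H t + (-1) * S t.
have cD : wcont D by apply: wcontD => //; apply: wcontM (wcont_cst _) cS.
have orth k : k \in s -> cintegral 0 1 (fun t => D t * e (- k) t) = 0.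
  move=> ks; rewrite (_ : (fun t => _) = fun t => H t * e (- k) t -
      \sum_(l <- s) fcoef l * e (l - k) t); last first.
    apply/funext => t; rewrite /D mulrDl mulN1r mulNr; congr (_ - _).
    by rewrite mulr_suml; apply: eq_bigr => l _; rewrite fmodeD mulrA.
  rewrite cintegralB; last 2 first.
  - by apply: wcont_cintg; apply: wcontM cH (wcont_fmode _ _).
  - by apply: wcont_cintg; apply: wcont_sum => l; apply: wcontM (wcont_cst _) (wcont_fmode _ _).
  rewrite cintegral_sum; last first.
    by move=> l; apply: wcont_cintg; apply: wcontM (wcont_cst _) (wcont_fmode _ _).
  rewrite (bigD1_seq k)//= big1 ?addr0.
    rewrite cintegralZ; last exact: wcont_cintg (wcont_fmode _ _).
    by rewrite subrr int_fmode eqxx mulr1 subrr.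
  move=> l lk; rewrite cintegralZ; last exact: wcont_cintg (wcont_fmode _ _).
  by rewrite int_fmode subr_eq0 (negbTE lk) mulr0.
have E : cintegral 0 1 (fun t => D t * (D t)^*%C) =
   cintegral 0 1 (fun t => H t * (H t)^*%C) - \sum_(k <- s) fcoef k * (fcoef k)^*%C.
  have DS : cintegral 0 1 (fun t => D t * (S t)^*%C) = 0.
    rewrite (_ : (fun t => _) = fun t => \sum_(k <- s) (fcoef k)^*%C * (D t * e (- k) t)); last first.
      apply/funext => t; rewrite /S rmorph_sum mulr_sumr; apply: eq_bigr => k _.
      by rewrite rmorphM /= fmodeN mulrCA.
    rewrite cintegral_sum; last first.
      by move=> l; apply: wcont_cintg; apply: wcontM (wcont_cst _) (wcontM cD (wcont_fmode _ _)).
    apply: big1_seq => k /andP[_ ks]; rewrite cintegralZ ?orth ?mulr0//.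
    exact: wcont_cintg (wcontM cD (wcont_fmode _ _)).
  have -> : (fun t => D t * (D t)^*%C) = fun t => D t * (H t)^*%C - D t * (S t)^*%C.
    by apply/funext => t; rewrite /D rmorphD rmorphM rmorphN1 /=; ring.
  rewrite cintegralB; last 2 first.
  - exact: wcont_cintg (wcontM cD (wcont_conj cH)).
  - exact: wcont_cintg (wcontM cD (wcont_conj cS)).
  rewrite DS subr0.
  have -> : (fun t => D t * (H t)^*%C) = fun t => H t * (H t)^*%C - S t * (H t)^*%C.
    by apply/funext => t; rewrite /D; ring.
  rewrite cintegralB; last 2 first.
  - exact: wcont_cintg (wcontM cH (wcont_conj cH)).
  - exact: wcont_cintg (wcontM cS (wcont_conj cH)).
  congr (_ - _).
  have -> : (fun t => S t * (H t)^*%C) = fun t => \sum_(k <- s) fcoef k * (H t * e (- k) t)^*%C.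
    apply/funext => t; rewrite /S mulr_suml; apply: eq_bigr => k _.
    have cM (a b : R[i]) : (a * b)^*%C = a^*%C * b^*%C by exact: rmorphM.
    have cK (a : R[i]) : a^*%C^*%C = a by case: a => a1 a2 /=; rewrite opprK.
    rewrite cM fmodeN cK.
    by ring.
  rewrite cintegral_sum; last first.
    by move=> l; apply: wcont_cintg; apply: wcontM (wcont_cst _) (wcont_conj (wcontM cH (wcont_fmode _ _))).
  apply: eq_bigr => k _; rewrite cintegralZ; last first.
    exact: wcont_cintg (wcont_conj (wcontM cH (wcont_fmode _ _))).
  by rewrite cintegral_conj//; exact: wcontM cH (wcont_fmode _ _).
have sq (z : R[i]) : cRe (z * z^*%C) = nrm z ^+ 2.
  by case: z => a b /=; rewrite sqr_sqrtr ?addr_ge0 ?sqr_ge0//; ring.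
have : 0 <= cRe (cintegral 0 1 (fun t => D t * (D t)^*%C)).
  by rewrite /cintegral /=; apply: Rintegral_ge0 => t _; rewrite sq sqr_ge0.
rewrite E cReD cReN cRe_sum subr_ge0; apply: le_trans; rewrite le_eqVlt; apply/orP; left; apply/eqP.
by apply: eq_bigr => k _; rewrite sq.
Qed.

(** The Riemann-Lebesgue lemma for a continuous function, from summability of the squares. *)
Lemma fcoef_cvg (d : R) : 0 < d -> exists N0, forall N : nat, (N0 <= N)%N ->
  nrm (fcoef N%:Z) <= d /\ nrm (fcoef (- N%:Z)) <= d.
Proof.
move=> d0; pose g k := nrm (fcoef k) ^+ 2.
have g0 k : 0 <= g k by exact: sqr_ge0.
have sg : rsummable g.
  apply: (@rsummable_zbox _ g (cRe (cintegral 0 1 (fun t => H t * (H t)^*%C))) g0 _).1 => N.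
  by rewrite -(@sum_zbox _ N g); apply: bessel; exact: zbox_uniq.
have [s us hs] := rsum_approx g0 sg (exprn_gt0 2 d0).
have [N0 HN0] := seq_sub_zbox s.
have key k : k \notin s -> nrm (fcoef k) <= d.
  move=> ks; rewrite -ler_sqr ?nnegrE ?nrm_ge0 ?ltW//.
  have := @fsum_le_rsum _ _ g (k :: s) g0 sg; rewrite /= ks us => /(_ isT).
  by rewrite big_cons; move: hs; rewrite -/(g k); lra.
exists N0.+1 => N N0N; split; apply: key; apply/negP => /(HN0 N0 (leqnn _)).
  by rewrite mem_zbox; lia.
by rewrite mem_zbox; lia.
Qed.

End FourierInversion.

(** * Pointwise Fourier inversion after Chernoff *)

Section Chernoff.
Variable R : realType.

(** The difference quotient with the derivative filled in at the base point, as in Caratheodory's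
    form of differentiability. *)
Definition slope (f : R -> R) (x a t : R) : R := if t == x then a else (f t - f x) / (t - x).

Lemma slopeE f (x a t : R) : slope f x a t * (t - x) = f t - f x.
Proof.
rewrite /slope; case: eqP => [->|/eqP]; first by rewrite !subrr mulr0.
by rewrite -subr_eq0 => /divfK ->.
Qed.

Lemma slope_continuous f (x a : R) : continuous f -> is_derive x 1 f a ->
  continuous (slope f x a).
Proof.
move=> cf df t; have [->|tx] := eqVneq t x.
  have [g [gE cg gx]] := (is_derive1_caratheodory f x a).1 df.
  have -> : slope f x a = g; last exact: cg.
  apply/funext => z; rewrite /slope; case: eqP => [->|/eqP zx]; first by rewrite gx.
  by rewrite gE mulfK// subr_eq0.
have : {for t, continuous (fun z => (f z - f x) / (z - x))}.
  apply: cvgM; first by apply: cvgB; [exact: cf|exact: cvg_cst].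
  by apply: cvgV; [rewrite subr_eq0|apply: cvgB; [exact: cvg_id|exact: cvg_cst]].
rewrite /continuous_at /slope (negbTE tx); apply: cvg_trans; apply: near_eq_cvg.
near=> z; rewrite ifF//; apply/negbTE; near: z.
have : 0 < `|t - x| by rewrite normr_gt0 subr_eq0.
move=> h; apply: filterS (nbhsx_ballx t _ h) => z /=; rewrite /ball /=.
by apply: contraTneq => ->; rewrite ltxx.
Unshelve. all: by end_near. Qed.

Variables (t0 : R) (F : R -> R[i]) (d : R[i]).
Hypotheses (t01 : 0 < t0 < 1) (cF : ccont F) (dF : cis F t0 d).

Let sn (t : R) := sin (pi * t + - (pi * t0)).
Let cs (t : R) := cos (pi * t + - (pi * t0)).
Let Qr (f : R -> R) a t := slope f t0 a t * cs t / slope sn t0 pi t.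

Let dsn (x : R) : is_derive x 1 sn (cs x * pi).
Proof. exact: (@is_derive1_comp _ sin (fun t : R => pi * t + - (pi * t0)) x _ _ (is_derive_sin _) (is_derive_affine _ _ _)). Qed.

Let dcs (x : R) : is_derive x 1 cs (- sn x * pi).
Proof. exact: (@is_derive1_comp _ cos (fun t : R => pi * t + - (pi * t0)) x _ _ (is_derive_cos _) (is_derive_affine _ _ _)). Qed.

Let sn_t0 : sn t0 = 0. Proof. by rewrite /sn subrr sin0. Qed.

Let slope_sn_neq0 t : 0 <= t <= 1 -> slope sn t0 pi t != 0.
Proof.
move=> t1; rewrite /slope; have [_|tt0] := eqVneq t t0; first by rewrite gt_eqF ?pi_gt0.
rewrite sn_t0 subr0 mulf_neq0 ?invr_eq0 ?subr_eq0// /sn -mulrBr.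
have up (y : R) : 0 < y < 1 -> sin (pi * y) != 0.
  move=> /andP[y0 y1]; rewrite gt_eqF// sin_gt0_pi// mulr_gt0 ?pi_gt0//= -subr_gt0.
  have -> : pi - pi * y = pi * (1 - y) by ring.
  by rewrite mulr_gt0 ?pi_gt0 ?subr_gt0.
have /andP[a0 a1] := t01; have /andP[b0 b1] := t1.
have [h|h] := ltP t0 t; first by apply: up; apply/andP; split; lra.
rewrite -opprB mulrN sinN oppr_eq0; apply: up.
have h' : t < t0 by rewrite lt_neqAle tt0.
by apply/andP; split; lra.
Qed.

Let Qr_wcont f a : continuous f -> is_derive t0 1 f a -> {within `[0, 1], continuous (Qr f a)}.
Proof.
move=> cf df; apply: continuous_in_subspaceT => t; rewrite inE /= in_itv /= => t1.
apply: cvgM.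
  apply: cvgM; first exact: slope_continuous.
  exact: is_derive_continuous (dcs t).
apply: cvgV; first exact: slope_sn_neq0.
apply: slope_continuous; first by move=> x; exact: is_derive_continuous (dsn x).
apply: is_derive_eq (dsn t0) _.
by rewrite /cs subrr cos0 mul1r.
Qed.

Let QrE f a t : 0 <= t <= 1 -> Qr f a t * sn t = (f t - f t0) * cs t.
Proof.
move=> t1; have s0 := slope_sn_neq0 t1.
have := slopeE sn t0 pi t; rewrite sn_t0 subr0 => <-; rewrite -(slopeE f t0 a t) /Qr.
by field.
Qed.

(** With [s = pi (t - t0)] one has 1 / (e^(2 i s) - 1) = -1/2 - (i/2) cot s. So [Q] is
    [(F - F t0) cot s], written as a ratio of slopes to be continuous at [t0], and [H] is the
    quotient of [F - F t0] by [e - 1], where [e] is the first mode. *)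
Let Q t := Qr (fun t => cRe (F t)) (cRe d) t +i* Qr (fun t => cIm (F t)) (cIm d) t.
Let H t := - 2^-1 * (F t + - 1 * F t0) + (- 'i%C / 2) * Q t.

Let cH : wcont H.
Proof.
have [c1 c2] := cF; have [d1 d2] := dF.
have cQ : wcont Q by split; exact: Qr_wcont.
apply: wcontD; apply: wcontM (wcont_cst _) _ => //.
by apply: wcontD (ccont_wcont cF) _; exact: wcont_cst.
Qed.

Let HE t : 0 <= t <= 1 -> H t * (fmode t0 1 t - 1) = F t - F t0.
Proof.
move=> t1.
have Em : fmode t0 1 t - 1 = 2 * 'i%C * (sn t)%:C * ((cs t)%:C + 'i%C * (sn t)%:C).
  have -> : fmode t0 1 t = expi (pi * (t - t0)) * expi (pi * (t - t0)).
    by rewrite -expiD; congr expi; ring.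
  have -> : expi (pi * (t - t0)) = (cs t)%:C + 'i%C * (sn t)%:C.
    by rewrite /expi /cs /sn mulrBr; simpc.
  have := sqr_i R; have : (cs t)%:C ^+ 2 + (sn t)%:C ^+ 2 = 1 :> R[i].
    by rewrite -!rmorphXn -rmorphD /= /cs /sn cos2Dsin2.
  move: ((cs t)%:C) ((sn t)%:C) ('i%C) => c s i cs1 i2.
  apply/eqP; rewrite -subr_eq0; apply/eqP.
  rewrite (_ : _ - _ = (c ^+ 2 + s ^+ 2 - 1) - (i ^+ 2 + 1) * s ^+ 2); last by ring.
  by rewrite cs1 i2; ring.
have QE : Q t * (sn t)%:C = (F t - F t0) * (cs t)%:C.
  have -> : Q t * (sn t)%:C = (Qr (fun t => cRe (F t)) (cRe d) t * sn t) +i* (Qr (fun t => cIm (F t)) (cIm d) t * sn t).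
    by rewrite /Q; simpc.
  by rewrite !QrE//; case: (F t) => a b; case: (F t0) => a' b'; simpc.
have cs1 : (cs t)%:C ^+ 2 + (sn t)%:C ^+ 2 = 1.
  by rewrite -!rmorphXn -rmorphD /= /cs /sn cos2Dsin2.
rewrite Em /H; move: QE cs1; have := sqr_i R.
move: (F t) (F t0) (Q t) ((cs t)%:C) ((sn t)%:C) ('i%C) => f f0 q c s i i2 QE cs1.
transitivity (- i * (f - f0) * s * (c + i * s) - i ^+ 2 * (q * s) * (c + i * s)).
  by field.
rewrite QE i2.
transitivity ((f - f0) * (c ^+ 2 - i ^+ 2 * s ^+ 2)); first by rewrite i2; ring: i2.
by rewrite i2 mulN1r opprK cs1 mulr1.
Qed.

(** Since [F - F t0 = H (e - 1)], the coefficients of [F - F t0] are differences of consecutive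
    coefficients of [H]. The series telescopes, and its ends vanish by [fcoef_cvg]. *)
Lemma fourier_inversion :
  absum (fun k => cintegral 0 1 (fun t => F t * expi (- (2 * pi * k%:~R * t)))) ->
  csum (fun k => cintegral 0 1 (fun t => F t * expi (- (2 * pi * k%:~R * t))) *
     expi (2 * pi * k%:~R * t0)) = F t0.
Proof.
move=> sF.
pose c k := cintegral 0 1 (fun t => F t * expi (- (2 * pi * k%:~R * t))).
pose T k := - fcoef t0 H (k - 1).
have wm k : wcont (fun t => expi (- (2 * pi * k%:~R * t)) : R[i]).
  by apply: ccont_wcont; under eq_fun do rewrite -mulNr; exact: ccont_expi.
have E k : c k * expi (2 * pi * k%:~R * t0) = (if k == 0 then F t0 else 0) + (T (k + 1) - T k).
  rewrite /T addrK opprK -[c k]/(cintegral _ _ _) mulrC -cintegralZ; last first.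
    by apply: wcont_cintg; exact: wcontM (ccont_wcont cF) (wm k).
  have -> : (fun t => expi (2 * pi * k%:~R * t0) * (F t * expi (- (2 * pi * k%:~R * t)))) =
      fun t => F t * fmode t0 (- k) t.
    apply/funext => t; rewrite mulrCA -expiD; congr (_ * expi _).
    by rewrite rmorphN /=; ring.
  have -> : cintegral 0 1 (fun t => F t * fmode t0 (- k) t) =
     cintegral 0 1 (fun t => F t0 * fmode t0 (- k) t + (H t * fmode t0 (- (k - 1)) t - H t * fmode t0 (- k) t)).
    apply: eq_cintegral => t t1.
    rewrite opprB [1 - k]addrC fmodeD -[F t](subrK (F t0)) -HE//; ring.
  have w1 : wcont (fun t => F t0 * fmode t0 (- k) t) by apply: wcontM (wcont_cst _) (wcont_fmode _ _).
  have w2 l : wcont (fun t => H t * fmode t0 (- l) t) by apply: wcontM cH (wcont_fmode _ _).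
  rewrite cintegralD; last 2 first.
  - exact: wcont_cintg.
  - by apply: cintgB; exact: wcont_cintg.
  rewrite cintegralZ; last exact: wcont_cintg (wcont_fmode _ _).
  rewrite cintegralB; last 2 first.
  - exact: wcont_cintg.
  - exact: wcont_cintg.
  rewrite int_fmode oppr_eq0 -/(fcoef t0 H (k - 1)) -/(fcoef t0 H k) [- fcoef _ _ _ + _]addrC; congr (_ + _).
  by case: eqP; rewrite ?mulr1 ?mulr0.
have s1 : absum (fun k => c k * expi (2 * pi * k%:~R * t0)).
  by apply: absum_le sF => k; rewrite Normc.normcM nrm_expi mulr1.
have [s2 e2] := @csum_one R int 0 (fun k => if k == 0 then F t0 else 0) (fun k => fun h => ifN_eq _ _ h).
have s3 : absum (fun k => T (k + 1) - T k).
  rewrite (_ : (fun k => _) = fun k => c k * expi (2 * pi * k%:~R * t0) - (if k == 0 then F t0 else 0)).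
    exact: absumB.
  by apply/funext => k; rewrite E addrAC subrr add0r.
have T0 : csum (fun k => T (k + 1) - T k) = 0.
  rewrite (@csum_telescope _ T 0 0 s3) ?subrr// => e e0.
  have [N0 HN0] := fcoef_cvg t0 cH e0; exists N0.+1 => N NN; rewrite !subr0 /T !normcN.
  split.
    have -> : N%:Z - 1 = (N.-1)%:Z by lia.
    by apply: (HN0 _ _).1; lia.
  have -> : - N%:Z - 1 = - (N.+1)%:Z by lia.
  by apply: (HN0 _ _).2; lia.
rewrite -[LHS](_ : csum (fun k => (if k == 0 then F t0 else 0) + (T (k + 1) - T k)) = _).
  by rewrite csumD// e2 T0 addr0.
by congr csum; apply/funext => k; rewrite -E.
Qed.

End Chernoff.

(** * A Gabor frame for the Schwartz space *)
Section Frame.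
Variables (R : realType) (h : R).
Hypotheses (h0 : 0 < h) (h1 : 3 * h <= 1).
Implicit Types (f w : R -> R[i]) (i : Z2).
Notation wt := (@wt R).

Definition window w := schwartz w /\ forall x, x < h / 2 \/ 5 * h / 2 < x -> w x = 0.

(** The window is a parameter because integration by parts and multiplication by [x] lead to the
    windows [w'] and [x w]. *)
Definition wA w f i : R[i] := cintegral 0 1 (fun t => w t *
  (f (t + h * i.1%:~R) * expi (- (2 * pi * i.2%:~R) * (t + h * i.1%:~R)))).

Definition chic (x : R) : R[i] := (chi h x)%:C.
Definition platc (x : R) : R[i] := (plateau h x)%:C.

Lemma window_chic : window chic.
Proof.
split; last by move=> x H; rewrite /chic chi_eq0// -?(rwP orP); case: H => /ltW; [left|right].
have ab : h / 2 <= 5 * h / 2 by move: h0; lra.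
apply: (rsm_compact_schwartz ab).
  exact: rsm_chi.
by move=> x H; apply: chi_eq0 => //; case: H => /ltW; [left|right].
Qed.

Lemma schwartz_platc : schwartz platc.
Proof.
have ab : 0 <= 3 * h by move: h0; lra.
apply: (rsm_compact_schwartz ab).
  exact: rsm_plateau.
by move=> x H; apply: plateau_eq0 => //; case: H => /ltW; [left|right].
Qed.

Lemma window_cderive w : window w -> window (cderive w).
Proof.
move=> [sw w0]; split; first exact: schwartz_cderive.
move=> x H; apply: cis_derive; split => /=.
  apply: (@near_eq_is_derive _ _ _ (cst 0) _ x 1 0 _ (is_derive_cst 0 x 1)).
  by case: H => H; near=> y; rewrite w0//; [left|right]; near: y; [exact: lt_nbhsl|exact: lt_nbhsr].
apply: (@near_eq_is_derive _ _ _ (cst 0) _ x 1 0 _ (is_derive_cst 0 x 1)).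
by case: H => H; near=> y; rewrite w0//; [left|right]; near: y; [exact: lt_nbhsl|exact: lt_nbhsr].
Unshelve. all: by end_near. Qed.

Lemma window_mulx w : window w -> window (fun x => x%:C * w x).
Proof. by move=> [sw w0]; split => [|x /w0 ->]; [exact: schwartz_mulx|rewrite mulr0]. Qed.

Lemma schwartz_bounded f : schwartz f -> exists2 C, 0 <= C & forall x, nrm (f x) <= C.
Proof.
by move=> /schwartz_decays/(_ 0%N)[C [C0 H]]; exists C => // x; have := H x; rewrite expr0 mul1r.
Qed.

Lemma cis_modulated f (b s x : R) d : cis f (x + b) d ->
  cis (fun t => f (t + b) * expi (s * (t + b))) x
    (f (x + b) * ('i%C * s%:C * expi (s * (x + b))) + d * expi (s * (x + b))).
Proof.
move=> df; apply: (@cis_shift _ (fun y => f y * expi (s * y))).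
by apply: cisM => //; exact: cis_expi.
Qed.

Lemma ccontM f w : ccont f -> ccont w -> ccont (fun x => f x * w x).
Proof.
move=> [f1 f2] [g1 g2]; split.
  have -> : (fun x => cRe (f x * w x)) = fun x => cRe (f x) * cRe (w x) - cIm (f x) * cIm (w x).
    by apply/funext => x; rewrite cReM.
  by move=> x; apply: cvgB; apply: cvgM; [exact: f1|exact: g1|exact: f2|exact: g2].
have -> : (fun x => cIm (f x * w x)) = fun x => cRe (f x) * cIm (w x) + cIm (f x) * cRe (w x).
  by apply/funext => x; rewrite cImM.
by move=> x; apply: cvgD; apply: cvgM; [exact: f1|exact: g2|exact: f2|exact: g1].
Qed.

Lemma ccontD f w : ccont f -> ccont w -> ccont (fun x => f x + w x).
Proof.
move=> [f1 f2] [g1 g2]; split.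
  have -> : (fun x => cRe (f x + w x)) = fun x => cRe (f x) + cRe (w x).
    by apply/funext => x; rewrite cReD.
  by move=> x; apply: cvgD; [exact: f1|exact: g1].
have -> : (fun x => cIm (f x + w x)) = fun x => cIm (f x) + cIm (w x).
  by apply/funext => x; rewrite cImD.
by move=> x; apply: cvgD; [exact: f2|exact: g2].
Qed.

Lemma ccont_shift f (b : R) : ccont f -> ccont (fun x => f (x + b)).
Proof.
move=> [f1 f2]; have ca x : {for x, continuous (fun y : R => y + b)}.
  by apply: cvgD; [exact: cvg_id|exact: cvg_cst].
split=> x.
  exact: (@continuous_comp _ _ _ (fun y : R => y + b) (fun y => cRe (f y)) x (ca x) (f1 _)).
exact: (@continuous_comp _ _ _ (fun y : R => y + b) (fun y => cIm (f y)) x (ca x) (f2 _)).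
Qed.

Lemma schwartz_ccont f : schwartz f -> ccont f.
Proof. by move=> sf; apply: cdiff_ccont; exact: schwartz_cdiff. Qed.

Lemma wA_ccont w f i : ccont w -> ccont f -> ccont (fun t => w t *
  (f (t + h * i.1%:~R) * expi (- (2 * pi * i.2%:~R) * (t + h * i.1%:~R)))).
Proof.
move=> cw cf; apply: ccontM => //; apply: ccontM; first exact: ccont_shift.
exact: (@ccont_shift (fun y => expi (- (2 * pi * i.2%:~R) * y)) _ (ccont_expi _)).
Qed.

Lemma wA_cintg w f i : ccont w -> ccont f -> cintg 0 1 (fun t => w t *
  (f (t + h * i.1%:~R) * expi (- (2 * pi * i.2%:~R) * (t + h * i.1%:~R)))).
Proof. by move=> cw cf; apply/ccont_cintg/wA_ccont. Qed.

Lemma wA_bound w f i (C D : R) : ccont w -> ccont f -> 0 <= C ->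
  (forall x, nrm (w x) <= C) -> (forall x, nrm (f x) <= D) ->
  nrm (wA w f i) <= 2 * (C * D).
Proof.
move=> cw cf C0 HC HD; have := @nrm_cintegral R 0 1 _ (C * D) ler01 (wA_cintg i cw cf).
rewrite subr0 mulr1; apply => x _; rewrite !Normc.normcM nrm_expi mulr1.
by apply: ler_pM; rewrite ?nrm_ge0.
Qed.

(** Integration by parts; the window vanishes at 0 and, since [5 h / 2 < 1], also at 1. *)
Lemma wA_diff w f i : window w -> schwartz f ->
  (2 * pi * i.2%:~R)%:C * 'i%C * wA w f i = wA (cderive w) f i + wA w (cderive f) i.
Proof.
move=> ww sf; have [sw w0] := ww; set b := h * i.1%:~R; pose s : R := - (2 * pi * i.2%:~R).
pose E t : R[i] := expi (s * (t + b)).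
pose F t := w t * (f (t + b) * E t).
pose dF t := w t * (f (t + b) * ('i%C * s%:C * E t) + cderive f (t + b) * E t) +
  cderive w t * (f (t + b) * E t).
have HF t : cis F t (dF t).
  by apply: cisM (schwartz_cdiff sw t) (cis_modulated s (schwartz_cdiff sf _)).
have I1 : cintg 0 1 (fun t => w t * (f (t + b) * E t)) by apply: wA_cintg; exact: schwartz_ccont.
have I2 : cintg 0 1 (fun t => w t * (cderive f (t + b) * E t)).
  by apply: wA_cintg; apply: schwartz_ccont => //; exact: schwartz_cderive.
have I3 : cintg 0 1 (fun t => cderive w t * (f (t + b) * E t)).
  by apply: wA_cintg; apply: schwartz_ccont => //; exact: schwartz_cderive.
have dFE : dF = fun t => ('i%C * s%:C) * (w t * (f (t + b) * E t)) +
    (w t * (cderive f (t + b) * E t) + cderive w t * (f (t + b) * E t)).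
  by apply/funext => t; rewrite /dF; ring.
have cdF : ccont dF.
  have cE : ccont E by exact: (@ccont_shift (fun y => expi (s * y)) _ (ccont_expi _)).
  have S u : schwartz u -> ccont (fun t => u (t + b)) by move=> su; exact/ccont_shift/schwartz_ccont.
  have cc (c : R[i]) : ccont (fun=> c) by apply: (@cdiff_ccont _ _ (fun=> 0)) => x; exact: cis_cst.
  rewrite dFE; apply: ccontD.
    by apply: ccontM (cc _) _; apply: wA_ccont; exact: schwartz_ccont.
  apply: ccontD; apply: wA_ccont; apply: schwartz_ccont => //; exact: schwartz_cderive.
have := cintegral_FTC2 ltr01 HF cdF.
have -> : F 1 - F 0 = 0.
  rewrite /F !w0 ?mul0r ?subrr//; first by left; rewrite divr_gt0.
  by right; move: h1; lra.
rewrite dFE cintegralD; last 2 first.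
- exact: cintgZ.
- exact: cintgD.
rewrite cintegralZ// cintegralD//.
rewrite -/(wA w f i) -/(wA w (cderive f) i) -/(wA (cderive w) f i) => /eqP.
rewrite addr_eq0 => /eqP H; rewrite [RHS]addrC -[RHS]opprK -H /s rmorphN /=; ring.
Qed.

Lemma wA_mulx w f i : window w -> schwartz f ->
  (h * i.1%:~R)%:C * wA w f i = wA w (fun x => x%:C * f x) i - wA (fun x => x%:C * w x) f i.
Proof.
move=> ww sf; have sxf := schwartz_mulx sf; have [sxw _] := window_mulx ww.
have cf := schwartz_ccont sf; have cw := schwartz_ccont ww.1.
rewrite /wA -cintegralZ -?cintegralB; last 3 first.
- exact: (@wA_cintg w (fun x => x%:C * f x) i cw (schwartz_ccont sxf)).
- exact: (@wA_cintg (fun x => x%:C * w x) f i (schwartz_ccont sxw) cf).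
- exact: wA_cintg.
by congr cintegral; apply/funext => t; rewrite !rmorphD !rmorphM /=; ring.
Qed.

(** Each further power of the weight costs one integration by parts or one multiplication by [x],
    which alters the window or the function; the induction therefore runs over all pairs at once. *)
Lemma rapid_wA w f : window w -> schwartz f -> rapid (wA w f).
Proof.
move=> ww sf n.
suff [C HC] : exists C, forall i, wt i ^+ n * nrm (wA w f i) <= C.
  by exists C => i; rewrite ler_pdivlMr ?exprn_gt0 ?wt_gt0// mulrC.
elim: n w f ww sf => [|n IH] w f ww sf.
  have [C C0 HC] := schwartz_bounded ww.1; have [D D0 HD] := schwartz_bounded sf.
  exists (2 * (C * D)) => i; rewrite expr0 mul1r; apply: wA_bound => //.
    exact: schwartz_ccont ww.1.
  exact: schwartz_ccont.
have [C0 H0] := IH _ _ ww sf.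
have [C1 H1] := IH _ _ (window_cderive ww) sf.
have [C2 H2] := IH _ _ ww (schwartz_cderive sf).
have [C3 H3] := IH _ _ ww (schwartz_mulx sf).
have [C4 H4] := IH _ _ (window_mulx ww) sf.
exists (C0 + h^-1 * (C3 + C4) + (2 * pi)^-1 * (C1 + C2)) => i.
have k1 : `|i.1%:~R| * nrm (wA w f i) <= h^-1 * (nrm (wA w (fun x => x%:C * f x) i) + nrm (wA (fun x => x%:C * w x) f i)).
  rewrite ler_pdivlMl// mulrA; apply: le_trans (nrmB _ _); rewrite -wA_mulx//.
  by rewrite Normc.normcM nrm_real normrM (gtr0_norm h0).
have p0 : 0 < 2 * pi :> R by rewrite mulr_gt0 ?pi_gt0.
have k2 : `|i.2%:~R| * nrm (wA w f i) <= (2 * pi)^-1 * (nrm (wA (cderive w) f i) + nrm (wA w (cderive f) i)).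
  rewrite ler_pdivlMl// mulrA; apply: le_trans (le_normcD _ _); rewrite -wA_diff//.
  rewrite !Normc.normcM nrm_real normrM (gtr0_norm p0).
  by rewrite [nrm 'i%C](_ : _ = 1) ?mulr1//= expr0n expr1n add0r sqrtr1.
have w0 : 0 <= wt i ^+ n by rewrite exprn_ge0 ?wt_ge0.
have -> : wt i ^+ n.+1 * nrm (wA w f i) = wt i ^+ n * nrm (wA w f i) +
    wt i ^+ n * (`|i.1|%:~R * nrm (wA w f i)) + wt i ^+ n * (`|i.2|%:~R * nrm (wA w f i)).
  by rewrite exprSr {2}/wt; ring.
apply: lerD; first apply: lerD => //.
  rewrite intr_norm; apply: le_trans (ler_wpM2l w0 k1) _.
  rewrite mulrCA ler_wpM2l ?invr_ge0 ?(ltW h0)// mulrDr; exact: lerD.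
rewrite intr_norm; apply: le_trans (ler_wpM2l w0 k2) _.
by rewrite mulrCA ler_wpM2l ?invr_ge0 ?(ltW p0)// mulrDr; exact: lerD.
Qed.

Definition gab i (x : R) : R[i] := expi (2 * pi * i.2%:~R * x) * platc (x + - (h * i.1%:~R)).

Definition Sy (c : Z2 -> R[i]) (x : R) : R[i] := csum (fun i => c i * gab i x).

Let gtr i : R := - (h * i.1%:~R).
Let gfr i : R := 2 * pi * i.2%:~R.

Let gtrL i : `|gtr i| <= (1 + 2 * pi) * wt i.
Proof.
rewrite /gtr normrN normrM (gtr0_norm h0) /wt.
rewrite !intr_norm; set a := `|_| in |- *; set b := `|i.2%:~R|.
have a0 : 0 <= a by exact: normr_ge0.
have b0 : 0 <= b by exact: normr_ge0.
have ha : h * a <= a by rewrite ler_piMl//; move: h0 h1; lra.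
have pa : 0 <= pi * a by rewrite mulr_ge0 ?pi_ge0.
have pb : 0 <= pi * b by rewrite mulr_ge0 ?pi_ge0.
have := pi_ge0 R; lra.
Qed.

Let gfrL i : `|gfr i| <= (1 + 2 * pi) * wt i.
Proof.
rewrite /gfr normrM ger0_norm ?mulr_ge0 ?pi_ge0// /wt.
have := normr_ge0 (i.1%:~R : R); have := normr_ge0 (i.2%:~R : R); have := pi_gt0 R.
rewrite !intr_norm; nra.
Qed.

Let gtfam : tfam gtr gfr gab.
Proof. exact: (tfam_base gtr gfr schwartz_platc). Qed.

Lemma schwartz_gab i : schwartz (gab i).
Proof. exact: (schwartz_tf (2 * pi * i.2%:~R) (- (h * i.1%:~R)) schwartz_platc). Qed.

Lemma schwartz_Sy c : rapid c -> schwartz (Sy c).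
Proof. by move=> rc; exact: (schwartz_tfam gtrL gfrL rc gtfam). Qed.

Lemma absum_gab c x : rapid c -> absum (fun i => c i * gab i x).
Proof. by move=> rc; have [+ _] := @growth_csum R c rc gab (tfam_growth gtrL gtfam); apply. Qed.

Lemma gab_bounded : exists2 C, 0 <= C & forall i x, nrm (gab i x) <= C.
Proof.
have [C C0 HC] := schwartz_bounded schwartz_platc; exists C => // i x.
by rewrite Normc.normcM nrm_expi mul1r.
Qed.

Notation A := (wA chic).

(** Where the plateau does not vanish, [y] lies in (0, 1) and Fourier inversion returns [chi f];
    elsewhere the plateau removes the periodic copies, and [chi] vanishes as well. *)
Lemma gab_expand_row f (x : R) (m : int) : schwartz f ->
  csum (fun k : int => A f (m, k) * gab (m, k) x) =
  (chi h (x - h * m%:~R))%:C * f x.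
Proof.
move=> sf; have rA := rapid_wA window_chic sf.
have sA k : (A f (m, k)) * gab (m, k) x = platc (x - h * m%:~R) * (A f (m, k) * expi (2 * pi * k%:~R * x)).
  by rewrite /gab /=; ring.
have sumA : absum (fun k : int => A f (m, k)).
  have [D [D0 HD]] := rapidP 3 rA.
  have s3 : absum (fun i => A f i).
    by apply: absum_le (rsummableZ D (@rsummable_wt3 R)) => i.
  exact: (absum_pair (g := fun i => A f i) s3).1.
have sumE : absum (fun k : int => A f (m, k) * expi (2 * pi * k%:~R * x)).
  by apply: absum_le sumA => k; rewrite Normc.normcM nrm_expi mulr1.
rewrite (_ : (fun k => _) = fun k => platc (x - h * m%:~R) * (A f (m, k) * expi (2 * pi * k%:~R * x))); last exact/funext.
rewrite csumZ//; set y := x - h * m%:~R.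
have xE : x = y + h * m%:~R by rewrite /y subrK.
have [y0|y0] := leP y 0.
  by rewrite /platc plateau_eq0 ?mul0r ?chi_eq0 ?mul0r//; left => //; move: h0; lra.
have [y1|y1] := leP (3 * h) y.
  by rewrite /platc plateau_eq0 ?mul0r ?chi_eq0 ?mul0r//; right => //; move: h0; lra.
have y01 : 0 < y < 1 by rewrite y0 (lt_le_trans y1).
pose F t := chic t * f (t + h * m%:~R).
have sw := window_chic.1.
have dF t : cis F t (chic t * cderive f (t + h * m%:~R) + cderive chic t * f (t + h * m%:~R)).
  by apply: cisM; [exact: schwartz_cdiff|apply: cis_shift; exact: schwartz_cdiff].
have cF : ccont F by exact: cdiff_ccont dF.
have AE k : A f (m, k) = expi (- (2 * pi * k%:~R * (h * m%:~R))) *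
    cintegral 0 1 (fun t => F t * expi (- (2 * pi * k%:~R * t))).
  rewrite -cintegralZ; last first.
    apply: ccont_cintg; apply: ccontM => //.
    by under eq_fun do rewrite -mulNr; exact: ccont_expi.
  rewrite /wA; congr cintegral; apply/funext => t; rewrite /= /F mulNr.
  have -> : - (2 * pi * k%:~R * (t + h * m%:~R)) = - (2 * pi * k%:~R * (h * m%:~R)) + - (2 * pi * k%:~R * t) :> R by ring.
  by rewrite expiD; ring.
have sF : absum (fun k : int => cintegral 0 1 (fun t => F t * expi (- (2 * pi * k%:~R * t)))).
  apply: absum_le sumA => k; rewrite AE Normc.normcM nrm_expi mul1r; exact: lexx.
have := fourier_inversion y01 cF (dF y) sF.
have -> : (fun k : int => A f (m, k) * expi (2 * pi * k%:~R * x)) =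
   fun k => cintegral 0 1 (fun t => F t * expi (- (2 * pi * k%:~R * t))) * expi (2 * pi * k%:~R * y).
  apply/funext => k; rewrite AE mulrAC -expiD mulrC; congr (_ * expi _).
  by rewrite xE; ring.
move=> ->; rewrite /F -xE /chic /platc mulrA -rmorphM plateau_chi//.
Qed.

Lemma Sy_A f : schwartz f -> Sy (A f) = f.
Proof.
move=> sf; apply/funext => x; have rA := rapid_wA window_chic sf.
rewrite /Sy (csum_pair (absum_gab x rA)).
rewrite (_ : (fun m : int => _) = fun m : int => (chi h (x - h * m%:~R))%:C * f x); last first.
  by apply/funext => m; exact: gab_expand_row.
have [s e] := chi_partition h0 x.
by rewrite csumZr// e mul1r.
Qed.

Lemma wA_csum w (c : Z2 -> R[i]) (F : Z2 -> R -> R[i]) (C : R) i : ccont w -> (forall l, ccont (F l)) ->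
  ccont (fun x => csum (fun l => c l * F l x)) ->
  (forall l x, nrm (F l x) <= C) -> absum c -> (exists D, forall x, nrm (w x) <= D) ->
  wA w (fun x => csum (fun l => c l * F l x)) i = csum (fun l => c l * wA w (F l) i).
Proof.
move=> cw cF cS HC sc [D HD].
have D0 : 0 <= D by apply: le_trans (HD 0); exact: nrm_ge0.
have C0 : 0 <= C by apply: le_trans (HC 0 0); exact: nrm_ge0.
pose E t : R[i] := expi (- (2 * pi * i.2%:~R) * (t + h * i.1%:~R)).
rewrite -[LHS]/(cintegral 0 1 (fun t => w t * (csum (fun l => c l * F l (t + h * i.1%:~R)) * E t))).
rewrite (@cintegral_csum R Z2 0 1 (fun t => w t * (csum (fun l => c l * F l (t + h * i.1%:~R)) * E t))
   (fun l t => c l * (w t * (F l (t + h * i.1%:~R) * E t))) (fun l => nrm (c l) * (D * C)) ler01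
   (wA_cintg i cw cS) (fun l => cintgZ (c l) (wA_cintg i cw (cF l))) _ _ _).2.
- by congr csum; apply/funext => l; rewrite cintegralZ//; exact: wA_cintg.
- by have := rsummableZ (D * C) sc; under eq_fun do rewrite mulrC.
- move=> l x _; rewrite !Normc.normcM nrm_expi mulr1 ler_wpM2l ?nrm_ge0//.
  by apply: ler_pM; rewrite ?nrm_ge0.
- move=> x _; have sx : absum (fun l => c l * F l (x + h * i.1%:~R)).
    apply: absum_le (rsummableZ C sc) => l; rewrite Normc.normcM mulrC.
    by rewrite ler_wpM2r ?nrm_ge0.
  rewrite mulrC -mulrA -csumZr//.
  by congr csum; apply/funext => l; ring.
Qed.

End Frame.

(** * The algebra of rapidly decaying sums *)
Section SmoothTorus.
Variables (R : realType) (theta : R).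
Hypothesis th0 : 0 < theta.
Implicit Types (f : R -> R[i]) (a b : Z2 -> R[i]) (z : Z2) (x : R).
Notation wt := (@wt R).

Definition TF z f x : R[i] := Upow z.1 (Vpow theta z.2 f) x.

Definition op a f x : R[i] := csum (fun z => a z * TF z f x).

Lemma TFE z f x : TF z f x = expi (- (2 * pi * z.2%:~R * (x + z.1%:~R) / theta)) * f (x + z.1%:~R).
Proof. by []. Qed.

Let tr z : R := z.1%:~R.
Let fr z : R := - (2 * pi * z.2%:~R / theta).
Let ph z : R[i] := expi (- (2 * pi * z.2%:~R * z.1%:~R / theta)).

Lemma TF_phase z f x : TF z f x = ph z * (expi (fr z * x) * f (x + tr z)).
Proof. by rewrite TFE mulrA -expiD; congr (expi _ * _); rewrite /fr; ring. Qed.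

Let L : R := 1 + 2 * pi / theta.

Let L0 : 0 <= 2 * pi / theta.
Proof. by rewrite !mulr_ge0 ?pi_ge0 ?invr_ge0 ?ltW. Qed.

Let trL z : `|tr z| <= L * wt z.
Proof.
rewrite /tr /L /wt -intr_norm.
have a0 : 0 <= `|z.1|%:~R :> R by rewrite ler0z.
have b0 : 0 <= `|z.2|%:~R :> R by rewrite ler0z.
by have := L0; nra.
Qed.

Let frL z : `|fr z| <= L * wt z.
Proof.
have -> : fr z = - (2 * pi / theta) * z.2%:~R by rewrite /fr; ring.
rewrite normrM normrN (ger0_norm L0) /L /wt -intr_norm.
have a0 : 0 <= `|z.1|%:~R :> R by rewrite ler0z.
have b0 : 0 <= `|z.2|%:~R :> R by rewrite ler0z.
by have := L0; nra.
Qed.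

Lemma moderate_nrm1 (s : Z2 -> R[i]) : (forall z, nrm (s z) = 1) -> moderate s.
Proof. by move=> s1; exists 1, 0%N; split=> // z; rewrite s1 expr0 mulr1. Qed.

Lemma moderate_index (c : R[i]) (s : Z2 -> int) : (forall z, `|s z|%:~R <= wt z) ->
  moderate (fun z => c * (s z)%:~R).
Proof.
move=> H; exists (nrm c), 1%N; split; first exact: nrm_ge0.
move=> z; rewrite Normc.normcM expr1 ler_wpM2l ?nrm_ge0//.
by rewrite -(rmorph_int (real_complex R)) nrm_real -intr_norm.
Qed.

Lemma wt_le1 z : `|z.1|%:~R <= wt z.
Proof.
have a0 : 0 <= `|z.1|%:~R :> R by rewrite ler0z.
have b0 : 0 <= `|z.2|%:~R :> R by rewrite ler0z.
by rewrite /wt; lra.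
Qed.

Lemma wt_le2 z : `|z.2|%:~R <= wt z.
Proof.
have a0 : 0 <= `|z.1|%:~R :> R by rewrite ler0z.
have b0 : 0 <= `|z.2|%:~R :> R by rewrite ler0z.
by rewrite /wt; lra.
Qed.

Lemma rapid_moderate (s : Z2 -> R[i]) a : moderate s -> rapid a -> rapid (fun z => s z * a z).
Proof.
move=> [C [M [C0 HC]]] ra n; have [D [D0 HD]] := rapidP (n + M) ra.
exists (C * D) => z; rewrite Normc.normcM.
apply: le_trans (ler_pM (nrm_ge0 _) (nrm_ge0 _) (HC z) (HD z)) _.
rewrite exprD invfM le_eqVlt; apply/orP; left; apply/eqP.
by field; rewrite ?expf_neq0 ?wt_neq0.
Qed.

Lemma tfam_TF f : schwartz f -> tfam tr fr (fun z => TF z f).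
Proof.
move=> sf.
have -> : (fun z => TF z f) = fun z x => ph z * (expi (fr z * x) * f (x + tr z)).
  by apply/funext => z; apply/funext => x; exact: TF_phase.
by apply: tfam_scale (tfam_base tr fr sf); apply: moderate_nrm1 => z; exact: nrm_expi.
Qed.

Lemma schwartz_op a f : rapid a -> schwartz f -> schwartz (op a f).
Proof. by move=> ra sf; exact: (schwartz_tfam trL frL ra (tfam_TF sf)). Qed.

Lemma nrm_TF z f x : nrm (TF z f x) = nrm (f (x + z.1%:~R)).
Proof. by rewrite TFE Normc.normcM nrm_expi mul1r. Qed.

Lemma nrm_mulTF (c : R[i]) z f x : nrm (c * TF z f x) = nrm c * nrm (f (x + z.1%:~R)).
Proof. by rewrite Normc.normcM nrm_TF. Qed.

Lemma rapid_absum1 a : rapid a -> absum a.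
Proof.
move=> ra; have [D [D0 HD]] := rapidP 3 ra.
exact: absum_le HD (rsummableZ D (@rsummable_wt3 R)).
Qed.

Lemma absum_op a f x (C : R) : absum a -> (forall y, nrm (f y) <= C) ->
  absum (fun z => a z * TF z f x).
Proof.
move=> sa HC; apply: absum_le (rsummableZ C sa) => z.
by rewrite nrm_mulTF mulrC ler_wpM2r ?nrm_ge0.
Qed.

Lemma op_bounded a f (C : R) : absum a -> (forall y, nrm (f y) <= C) ->
  forall x, nrm (op a f x) <= C * rsum (fun z => nrm (a z)).
Proof.
move=> sa HC x; rewrite -rsumZ//; apply: (nrm_csum_le _ (rsummableZ C sa) (lexx _)) => z.
by rewrite nrm_mulTF mulrC ler_wpM2r ?nrm_ge0.
Qed.

Lemma op_csum a (c : Z2 -> R[i]) (F : Z2 -> R -> R[i]) (C : R) x : absum a -> absum c ->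
  (forall i y, nrm (F i y) <= C) ->
  op a (fun y => csum (fun i => c i * F i y)) x = csum (fun i => c i * op a (F i) x).
Proof.
move=> sa sc HC.
have sF y : absum (fun i => c i * F i y).
  apply: absum_le (rsummableZ C sc) => i.
  by rewrite Normc.normcM mulrC ler_wpM2r ?nrm_ge0.
have C0 : 0 <= C by apply: le_trans (HC 0 0); exact: nrm_ge0.
have E z : a z * TF z (fun y => csum (fun i => c i * F i y)) x =
    csum (fun i => a z * (c i * TF z (F i) x)).
  rewrite TFE -csumZ// -csumZ; last by apply: absum_le (sF (x + z.1%:~R)) => i;
    rewrite Normc.normcM nrm_expi mul1r.
  by congr csum; apply/funext => i; rewrite TFE; ring.
rewrite {1}/op; under eq_fun do rewrite E.
rewrite (csum_exchange (g := fun z i => a z * (c i * TF z (F i) x))).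
  congr csum; apply/funext => i; rewrite /op -csumZ; last exact: absum_op (HC i).
  by congr csum; apply/funext => z; ring.
have row z : absum (fun i => a z * (c i * TF z (F i) x)).
  by apply: absumZ; apply: absum_le (rsummableZ C sc) => i;
     rewrite nrm_mulTF mulrC ler_wpM2r ?nrm_ge0.
apply: (@absum_prod R _ _ _ (fun z => C * rsum (fun i => nrm (c i)) * nrm (a z)) row).
  move=> z; apply: (@le_trans _ _ (rsum (fun i => (C * nrm (a z)) * nrm (c i)))).
    apply: ler_rsum; [exact: row|exact: rsummableZ|move=> i /=].
    rewrite Normc.normcM nrm_mulTF [C * _]mulrC -mulrA ler_wpM2l ?nrm_ge0// mulrC.
    by rewrite ler_wpM2r ?nrm_ge0.
  by rewrite rsumZ// mulrAC.
exact: rsummableZ.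
Qed.

Lemma op_subl a b f x (C : R) : absum a -> absum b -> (forall y, nrm (f y) <= C) ->
  op (fun z => a z - b z) f x = op a f x - op b f x.
Proof.
move=> sa sb HC; rewrite /op -csumB; [|exact: absum_op HC..].
by congr csum; apply/funext => z; rewrite mulrBl.
Qed.

Lemma op_mulx a f x : rapid a -> schwartz f ->
  x%:C * op a f x - op a (fun y => y%:C * f y) x = op (fun z => (-1 * (z.1)%:~R) * a z) f x.
Proof.
move=> ra sf; have [C C0 HC] := schwartz_bounded sf.
have [D D0 HD] := schwartz_bounded (schwartz_mulx sf); have sa := rapid_absum1 ra.
rewrite /op -csumZ -?csumB; [|exact: absumZ (absum_op x sa HC)|exact: absum_op HD|exact: absum_op HC].
congr csum; apply/funext => z; rewrite !TFE rmorphD /= -[in RHS](rmorph_int (real_complex R)) /=.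
ring.
Qed.

(** Coefficients of the derivative in phi. By [op_cderive] they are also those of the commutator
    with d/dx, and this is how the derivative enters the matrix calculus. *)
Definition dcoef a z : R[i] := ((- (2 * pi / theta))%:C * 'i%C * (z.2)%:~R) * a z.

Definition xcoef a z : R[i] := (-1 * (z.1)%:~R) * a z.

Lemma rapid_dcoef a : rapid a -> rapid (dcoef a).
Proof. by move=> ra; apply: rapid_moderate => //; apply: moderate_index; exact: wt_le2. Qed.

Lemma rapid_xcoef a : rapid a -> rapid (xcoef a).
Proof. by move=> ra; apply: rapid_moderate => //; apply: moderate_index; exact: wt_le1. Qed.

Lemma op_cderive a f x : rapid a -> schwartz f ->
  cderive (op a f) x - op a (cderive f) x = op (dcoef a) f x.
Proof.
move=> ra sf; have sf' := schwartz_cderive sf.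
have t1 := tfam_TF sf; have t2 := tfam_TF sf'.
pose s z : R[i] := (- (2 * pi / theta))%:C * 'i%C * (z.2)%:~R.
have ms : moderate s by apply: moderate_index; exact: wt_le2.
have t3 := tfam_add t2 (tfam_scale ms t1).
have D z y : cis (TF z f) y (TF z (cderive f) y + s z * TF z f y).
  rewrite (_ : TF z f = fun y => ph z * (expi (fr z * y) * f (y + tr z))); last first.
    by apply/funext => u; exact: TF_phase.
  have -> : TF z (cderive f) y + s z * (ph z * (expi (fr z * y) * f (y + tr z))) =
     ph z * (expi (fr z * y) * cderive f (y + tr z) + ('i%C * (fr z)%:C * expi (fr z * y)) * f (y + tr z)).
    rewrite TF_phase /s /fr -[in LHS](rmorph_int (real_complex R)) /= !rmorphN !rmorphM /=; ring.
  apply: cisZ; apply: cisM; first exact: cis_expi.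
  by apply: cis_shift; exact: schwartz_cdiff.
have [C C0 HC] := schwartz_bounded sf; have [C' _ HC'] := schwartz_bounded sf'.
have sa := rapid_absum1 ra; have sd := rapid_absum1 (rapid_dcoef ra).
rewrite (cis_derive (tfam_csum_cis trL frL ra t1 t3 D x)).
rewrite /op -csumB; last exact: absum_op HC'.
  congr csum; apply/funext => z; rewrite mulrDr addrAC subrr add0r /dcoef -/(s z); ring.
exact: (growth_csum ra (tfam_growth trL t3)).1.
Qed.

(** Twisted convolution: the phase comes from [V^k U^j = e^(2 pi i k j / theta) U^j V^k]. Written as
    a matrix applied to [b], it inherits rapid decay from [rapid_rawapp]. *)
Definition conv a b : Z2 -> R[i] :=
  rawapp (fun w z => a (w - z) * expi (2 * pi * (w - z).2%:~R * z.1%:~R / theta)) b.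

Lemma rapid_conv a b : rapid a -> rapid b -> rapid (conv a b).
Proof.
move=> ra rb; apply: rapid_rawapp => //; apply: (@mord_tame _ 0%N) => n.
have [C [C0 HC]] := rapidP n ra; exists C => w z.
by rewrite Normc.normcM nrm_expi mulr1 expr0z mul1r.
Qed.

Lemma op_mul a b f x : rapid a -> rapid b -> schwartz f -> op a (op b f) x = op (conv a b) f x.
Proof.
move=> ra rb sf; have [C C0 HC] := schwartz_bounded sf.
have sa := rapid_absum1 ra; have sb := rapid_absum1 rb.
pose om (y z : Z2) : R[i] := expi (2 * pi * y.2%:~R * z.1%:~R / theta).
pose g (q : Z2 * Z2) : R[i] := a q.1 * (b q.2 * (om q.1 q.2 * TF (q.1 + q.2) f x)).
have E y : a y * TF y (op b f) x = csum (fun z => g (y, z)).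
  rewrite TFE -csumZ; last exact: absum_op HC.
  rewrite -csumZ; last by apply: absumZ; exact: absum_op HC.
  congr csum; apply/funext => z; rewrite /g /= !TFE /om /=.
  have -> : x + (y + z).1%:~R = x + y.1%:~R + z.1%:~R :> R by rewrite /= rmorphD addrA.
  have ee : expi (- (2 * pi * y.2%:~R * (x + y.1%:~R) / theta)) *
      expi (- (2 * pi * z.2%:~R * (x + y.1%:~R + z.1%:~R) / theta)) =
      expi (2 * pi * y.2%:~R * z.1%:~R / theta) *
      expi (- (2 * pi * (y.2 + z.2)%:~R * (x + y.1%:~R + z.1%:~R) / theta)) :> R[i].
    by rewrite -!expiD; congr expi; rewrite rmorphD /=; ring.
  transitivity (a y * (b z * ((expi (- (2 * pi * y.2%:~R * (x + y.1%:~R) / theta)) *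
      expi (- (2 * pi * z.2%:~R * (x + y.1%:~R + z.1%:~R) / theta))) * f (x + y.1%:~R + z.1%:~R)))).
    by ring.
  by rewrite ee; ring.
have ng q : nrm (g q) <= nrm (a q.1) * (C * nrm (b q.2)).
  rewrite /g Normc.normcM [nrm (b _ * _)]Normc.normcM nrm_mulTF nrm_expi mul1r ler_wpM2l ?nrm_ge0// mulrC.
  by rewrite ler_wpM2r ?nrm_ge0.
have row y : absum (fun z => g (y, z)).
  have := rsummableZ (nrm (a y)) (rsummableZ C sb).
  by apply: absum_le => z; exact: ng.
have sg : absum g.
  apply: (@absum_prod R _ _ _ (fun y => (C * rsum (fun z => nrm (b z))) * nrm (a y)) row); last exact: rsummableZ.
  move=> y; apply: (@le_trans _ _ (rsum (fun z => (nrm (a y) * C) * nrm (b z)))).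
    by apply: ler_rsum; [exact: row|exact: rsummableZ|move=> z; rewrite -mulrA; exact: ng].
  by rewrite rsumZ// le_eqVlt; apply/orP; left; apply/eqP; ring.
rewrite {1}/op; under eq_fun do rewrite E.
rewrite -(csum_pair sg).
have bij : bijective (fun q : Z2 * Z2 => (q.1 - q.2, q.2)).
  by exists (fun q => (q.1 + q.2, q.2)) => -[y z] /=; rewrite ?subrK ?addrK.
rewrite -(reindex_csum g bij) (csum_pair ((reindex_absum g bij).2 sg)).
congr csum; apply/funext => w; rewrite /g /conv /rawapp -csumZr; last first.
  apply: absum_le (rsummableZ (rsum (fun z => nrm (a z))) sb) => z.
  rewrite !Normc.normcM nrm_expi mulr1 ler_wpM2r ?nrm_ge0//.
  have := @fsum_le_rsum _ _ (fun z => nrm (a z)) [:: w - z] (fun z => nrm_ge0 _) sa isT.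
  by rewrite big_seq1.
by congr csum; apply/funext => z; rewrite /= subrK /om; ring.
Qed.

Lemma op_has_coef (T : operator R) a : rapid a -> (forall f, schwartz f -> T f = op a f) ->
  has_coef theta T (fun j k => a (j, k)).
Proof.
move=> ra HT; split; first by move=> l; have [C HC] := ra l; exists C => j k; exact: (HC (j, k)).
move=> f sf; rewrite HT//; apply/funext => x; have [C _ HC] := schwartz_bounded sf.
have s := absum_op x (rapid_absum1 ra) HC.
rewrite /op (csum_pair s) zsum_csum; last first.
  rewrite (_ : (fun j => _) = fun j => csum (fun k => a (j, k) * TF (j, k) f x)); first exact: (absum_pair s).2.
  by apply/funext => j; rewrite zsum_csum//; exact: ((absum_pair s).1 j).
by congr csum; apply/funext => j; rewrite zsum_csum//; exact: ((absum_pair s).1 j).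
Qed.

Lemma has_coef_op (T : operator R) (a : int -> int -> R[i]) : has_coef theta T a ->
  rapid (fun z => a z.1 z.2) /\ forall f, schwartz f -> T f = op (fun z => a z.1 z.2) f.
Proof.
move=> [ra HT].
have ra' : rapid (fun z => a z.1 z.2) by move=> l; have [C HC] := ra l; exists C => z; exact: HC.
split=> // f sf; have [_ H] := @op_has_coef (op (fun z => a z.1 z.2)) _ ra' (fun _ _ => erefl).
by rewrite HT// (H f sf).
Qed.

Definition trig a (j : int) x : R[i] := csum (fun k : int => a (j, k) * expi (- (2 * pi * k%:~R * x / theta))).

Lemma absum_row a (j : int) : rapid a -> absum (fun k : int => a (j, k)).
Proof. by move=> /rapid_absum1 s; exact: (absum_pair s).1 j. Qed.

Lemma trig_cis a (j : int) x : rapid a -> cis (trig a j) x (trig (dcoef a) j x).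
Proof.
move=> ra; pose s (k : int) : R := - (2 * pi * k%:~R / theta).
have E k y : expi (- (2 * pi * k%:~R * y / theta)) = expi (s k * y) :> R[i].
  by congr expi; rewrite /s; ring.
have sE k : s k = - (2 * pi / theta) * k%:~R by rewrite /s; ring.
have dE k : dcoef a (j, k) = 'i%C * (s k)%:C * a (j, k).
  by rewrite /dcoef /= sE -[in LHS](rmorph_int (real_complex R)) !rmorphM /=; ring.
have H := @csum_cis R int (fun k => a (j, k)) (fun k y => expi (s k * y))
   (fun k y => 'i%C * (s k)%:C * expi (s k * y)) (fun k y => ('i%C * (s k)%:C) * ('i%C * (s k)%:C * expi (s k * y)))
   (fun k => (s k) ^+ 2) x (fun k y => cis_expi (s k) y) (fun k y => cisZ _ (cis_expi (s k) y)).
have -> : trig a j = fun y => csum (fun k : int => a (j, k) * expi (s k * y)).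
  by apply/funext => y; congr csum; apply/funext => k; rewrite E.
have -> : trig (dcoef a) j x = csum (fun k => a (j, k) * ('i%C * (s k)%:C * expi (s k * x))).
  by congr csum; apply/funext => k; rewrite E dE; ring.
have n1 : nrm ('i%C : R[i]) = 1 by rewrite /= expr0n expr1n add0r sqrtr1.
apply: H.
- by move=> k y; rewrite !Normc.normcM n1 nrm_expi !nrm_real mulr1 !mul1r -expr2 real_normK ?num_real.
- have sd := absum_row j (rapid_dcoef (rapid_dcoef ra)).
  apply: rsummable_le sd => k; rewrite normrM normrX (ger0_norm (nrm_ge0 _)).
  rewrite {1}/dcoef -/(dcoef a (j, k)) /=.
  have -> : (- (2 * pi / theta))%:C * 'i%C * k%:~R = 'i%C * (s k)%:C :> R[i].
    by rewrite sE -[in LHS](rmorph_int (real_complex R)) !rmorphM /=; ring.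
  by rewrite dE !Normc.normcM n1 nrm_real !mul1r mulrA mulrC -expr2.
- move=> y; apply: absum_le (absum_row j ra) => k.
  by rewrite Normc.normcM nrm_expi mulr1.
- apply: absum_le (absum_row j (rapid_dcoef ra)) => k.
  by rewrite dE !Normc.normcM nrm_expi mulr1 mulrC.
Qed.

Lemma trig_coef a (j l : int) : rapid a ->
  cintegral 0 theta (fun x => trig a j x * expi (2 * pi * l%:~R * x / theta)) = theta%:C * a (j, l).
Proof.
move=> ra; have sb := absum_row j ra.
have ce (s : R) : ccont (fun x => expi (s * x) : R[i]) by exact: ccont_expi.
have E1 (k : int) x : expi (- (2 * pi * k%:~R * x / theta)) * expi (2 * pi * l%:~R * x / theta) =
    expi (2 * pi * (l - k)%:~R / theta * x) :> R[i].
  by rewrite -expiD; congr expi; rewrite rmorphB /=; ring.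
have E x : trig a j x * expi (2 * pi * l%:~R * x / theta) =
    csum (fun k : int => a (j, k) * expi (2 * pi * (l - k)%:~R / theta * x)).
  rewrite /trig -csumZr; last by apply: absum_le sb => k; rewrite Normc.normcM nrm_expi mulr1.
  by congr csum; apply/funext => k; rewrite -mulrA E1.
have cont : cintg 0 theta (fun x => trig a j x * expi (2 * pi * l%:~R * x / theta)).
  apply: ccont_cintg; apply: ccontM; first by apply: cdiff_ccont => x; exact: trig_cis.
  rewrite (_ : (fun x => _) = fun x => expi ((2 * pi * l%:~R / theta) * x)); first exact: ce.
  by apply/funext => x; congr expi; ring.
rewrite (@cintegral_csum R int 0 theta _ (fun k x => a (j, k) * expi (2 * pi * (l - k)%:~R / theta * x))
   (fun k => nrm (a (j, k))) (ltW th0) cont (fun k => cintgZ _ (ccont_cintg _ _ (ce _))) sb _ (fun x _ => E x)).2.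
  have H k : k != l -> cintegral 0 theta (fun x => a (j, k) * expi (2 * pi * (l - k)%:~R / theta * x)) = 0.
    move=> kl; rewrite cintegralZ ?int_expi// ?subr_eq0; last exact: ccont_cintg.
    by rewrite eq_sym (negbTE kl) mulr0.
  rewrite (csum_one H).2 cintegralZ; last exact: ccont_cintg.
  by rewrite int_expi// subrr /=; exact: mulrC.
by move=> k x _; rewrite Normc.normcM nrm_expi mulr1.
Qed.

Lemma trig0 a (j : int) : rapid a -> cintegral 0 theta (trig a j) = theta%:C * a (j, 0).
Proof.
move=> ra; rewrite -trig_coef//; congr cintegral; apply/funext => x.
by rewrite mulr0 !mul0r expi0 mulr1.
Qed.

Lemma rapidB a b : rapid a -> rapid b -> rapid (fun z => a z - b z).
Proof.
move=> ra rb; rewrite (_ : (fun z => a z - b z) = a + (fun z => -1 * b z)).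
  exact: rapidD ra (rapidZ (-1) rb).
by apply/funext => z; rewrite [RHS]/GRing.add /= mulN1r.
Qed.

(** A bump of width [theta <= 1] around [y] vanishes at [y + m] for every nonzero integer [m].
    Evaluated at [y - j], the operator applied to it leaves only [b_j] at [y], whose Fourier
    coefficients are the [a (j, l)]. *)
Lemma op_inj a : theta <= 1 -> rapid a -> (forall f, schwartz f -> op a f = fun=> 0) -> forall z, a z = 0.
Proof.
move=> th1 ra H [j l].
suff T0 y : trig a j y = 0.
  have := trig_coef j l ra.
  rewrite (_ : (fun x => _) = fun=> 0); last by apply/funext => x; rewrite T0 mul0r.
  rewrite cint_cst// mulr0 => /esym/eqP; rewrite mulf_eq0 => /orP[|/eqP//].
  by rewrite fmorph_eq0 gt_eqF.
pose h := theta / 3.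
have h0 : 0 < h by rewrite divr_gt0.
have h1 : 3 * h <= 1 by rewrite /h mulrC divfK ?pnatr_eq0.
pose f x : R[i] := expi (0 * x) * platc h (x + (3 * h / 2 - y)).
have sf : schwartz f by exact: schwartz_tf (schwartz_platc h0).
have f1 : f y = 1.
  rewrite /f mul0r expi0 mul1r /platc addrC subrK plateau_eq1//.
  by apply/andP; split; lra.
have f0 (m : int) : m != 0 -> f (y + m%:~R) = 0.
  move=> m0; rewrite /f /platc plateau_eq0 ?mulr0//.
  have [mp|mn] := leP 0 m.
    right; have : (1 : int) <= m by lia.
    by rewrite -(ler_int R) => m1; lra.
  left; have : m <= (-1 : int) by lia.
  by rewrite -(ler_int R) rmorphN1 => m1; lra.
have := congr1 (fun u => u (y - j%:~R)) (H f sf); rewrite /op.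
have [C _ HC] := schwartz_bounded sf.
rewrite (csum_pair (absum_op _ (rapid_absum1 ra) HC)).
have H2 : forall j' : int, j' != j -> csum (fun k : int => a (j', k) * TF (j', k) f (y - j%:~R)) = 0.
  move=> j' j'j; have -> : (fun k : int => a (j', k) * TF (j', k) f (y - j%:~R)) = fun=> 0.
    apply/funext => k; rewrite TFE /=.
    have -> : y - j%:~R + j'%:~R = y + (j' - j)%:~R by rewrite rmorphB /=; ring.
    by rewrite f0 ?subr_eq0// !mulr0.
  exact: csum0.
rewrite (csum_one H2).2 => <-; rewrite /trig; congr csum; apply/funext => k; rewrite TFE /= subrK f1 mulr1 //.
Qed.

(** [coef] is a choice among coefficient families; [op_inj] leaves only one. *)
Lemma coefE (T : operator R) a : theta <= 1 -> rapid a -> (forall f, schwartz f -> T f = op a f) ->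
  coef theta T = fun j k => a (j, k).
Proof.
move=> th1 ra HT; have hc := op_has_coef ra HT.
have [ra' HT'] : rapid (fun z => coef theta T z.1 z.2) /\ forall f, schwartz f -> T f = op (fun z => coef theta T z.1 z.2) f.
  by apply: has_coef_op; rewrite /coef; case: xgetP => [b -> //|/(_ (fun j k => a (j, k)))[]].
have rd := rapidB ra' ra.
apply/funext => j; apply/funext => k; apply/eqP; rewrite -subr_eq0; apply/eqP.
suff H f : schwartz f -> op (fun z => coef theta T z.1 z.2 - a z) f = fun=> 0.
  exact: (op_inj th1 rd H (j, k)).
move=> sf; apply/funext => x.
have [C _ HC] := schwartz_bounded sf.
by rewrite (op_subl x (rapid_absum1 ra') (rapid_absum1 ra) HC) -HT'// -HT// subrr.
Qed.

Lemma zcoefE (T : operator R) a (j : int) : theta <= 1 -> rapid a -> (forall f, schwartz f -> T f = op a f) ->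
  zcoef theta T j = trig a j.
Proof.
move=> th1 ra HT; apply/funext => x; rewrite /zcoef (coefE th1 ra HT) zsum_csum.
  by congr csum; apply/funext => k; rewrite /Vpow mulr1.
apply: absum_le (absum_row j ra) => k.
by rewrite /Vpow mulr1 Normc.normcM nrm_expi mulr1.
Qed.

Lemma dphi_op (T : operator R) a : theta <= 1 -> rapid a -> (forall f, schwartz f -> T f = op a f) ->
  forall f, schwartz f -> dphi theta T f = op (dcoef a) f.
Proof.
move=> th1 ra HT f sf; apply/funext => x; rewrite /dphi.
have [C _ HC] := schwartz_bounded sf.
have s := absum_op x (rapid_absum1 (rapid_dcoef ra)) HC.
have E (j : int) : Upow j (fun y => cderive (zcoef theta T j) y * f y) x =
    csum (fun k : int => dcoef a (j, k) * TF (j, k) f x).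
  rewrite /Upow (zcoefE j th1 ra HT) (cis_derive (trig_cis j _ ra)) /trig -csumZr; last first.
    apply: absum_le (absum_row j (rapid_dcoef ra)) => k.
    by rewrite Normc.normcM nrm_expi mulr1.
  by congr csum; apply/funext => k; rewrite TFE mulrA.
rewrite zsum_csum /op ?(csum_pair s); first by congr csum; apply/funext.
rewrite (_ : (fun j => _) = fun j : int => csum (fun k : int => dcoef a (j, k) * TF (j, k) f x)); last exact/funext.
exact: (absum_pair s).2.
Qed.

(** Coefficients of the operator P - P [[phi, P], dP/dphi]. *)
Definition omega a : Z2 -> R[i] :=
  fun z => a z - conv a (fun y => conv (xcoef a) (dcoef a) y - conv (dcoef a) (xcoef a) y) z.

Lemma rapid_omega a : rapid a -> rapid (omega a).
Proof.
move=> ra; apply: rapidB => //; apply: rapid_conv => //.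
by apply: rapidB; apply: rapid_conv; rewrite ?rapid_xcoef ?rapid_dcoef//; [exact: rapid_xcoef|exact: rapid_dcoef|exact: rapid_dcoef|exact: rapid_xcoef].
Qed.

Lemma op_commutator a b f : rapid a -> rapid b -> schwartz f ->
  (fun x => op a (op b f) x - op b (op a f) x) = op (fun z => conv a b z - conv b a z) f.
Proof.
move=> ra rb sf; apply/funext => x; have [C _ HC] := schwartz_bounded sf.
by rewrite !op_mul// (op_subl x (rapid_absum1 _) (rapid_absum1 _) HC)//; exact: rapid_conv.
Qed.

Lemma index_integrand_op (T : operator R) a : theta <= 1 -> rapid a -> (forall f, schwartz f -> T f = op a f) ->
  forall f, schwartz f -> index_integrand theta T f = op (omega a) f.
Proof.
move=> th1 ra HT f sf; have D := dphi_op th1 ra HT.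
have X g : schwartz g -> op_comm (@phi_mul R) T g = op (xcoef a) g.
  move=> sg; rewrite /op_comm /phi_mul; apply/funext => x.
  by rewrite /= HT// HT; [exact: op_mulx|exact: schwartz_mulx].
have rx := rapid_xcoef ra; have rd := rapid_dcoef ra.
have C : op_comm (op_comm (@phi_mul R) T) (dphi theta T) f =
   op (fun z => conv (xcoef a) (dcoef a) z - conv (dcoef a) (xcoef a) z) f.
  rewrite -op_commutator//; apply/funext => x.
  have opE (S T' : operator R) g y : op_comm S T' g y = S (T' g) y - T' (S g) y by [].
  by rewrite [LHS]opE (D f sf) (X f sf) (X _ (schwartz_op rd sf)) (D _ (schwartz_op rx sf)).
have rc : rapid (fun z => conv (xcoef a) (dcoef a) z - conv (dcoef a) (xcoef a) z).
  by apply: rapidB; exact: rapid_conv.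
rewrite /index_integrand C !HT//; last exact: schwartz_op.
apply/funext => x; have [K _ HK] := schwartz_bounded sf.
rewrite (op_subl x (rapid_absum1 ra) (rapid_absum1 (rapid_conv ra rc)) HK) -op_mul//.
Qed.

End SmoothTorus.

(** * Covariant matrices and their trace per unit cell *)
Section Covariant.
Variables (R : realType) (theta : R).
Notation wt := (@wt R).
Implicit Types (x y z g : Z2).

Let cell_bij := base_shift_bij.

(** Shifting a frame index by a cell is a time-frequency shift of the frame element up to a phase;
    the phases at the two indices leave this factor. *)
Definition covar (M : Z2 -> Z2 -> R[i]) := forall g x y,
  M (x + shift3 g) (y + shift3 g) =
  expi (2 * pi * theta * g.1%:~R * (y.2%:~R - x.2%:~R)) * M x y.

Lemma covar_pair M N g x y : covar M -> covar N ->
  M (x + shift3 g) (y + shift3 g) * N (y + shift3 g) (x + shift3 g) = M x y * N y x.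
Proof.
move=> cM cN; rewrite cM cN.
set a : R := _ * (_ - _); set b : R := _ * (_ - _).
have -> : b = - a by rewrite /a /b; ring.
have := expiNK a; move: (expi a) (expi (- a)) => u v uv.
by rewrite -[RHS]mul1r -uv; ring.
Qed.

Lemma covar_inv_triple M : covar M -> inv_triple M.
Proof.
move=> cM g x y z; rewrite !cM.
set a : R := _ * (y.2%:~R - _); set b : R := _ * (z.2%:~R - _); set c : R := _ * (x.2%:~R - _).
have : expi a * expi b * expi c = 1 :> R[i].
  by rewrite -!expiD -[RHS]expi0; congr expi; rewrite /a /b /c; ring.
move: (expi a) (expi b) (expi c) => u v w uvw.
by rewrite -[RHS]mul1r -uvw; ring.
Qed.

Lemma shift3N g : shift3 (- g) = - shift3 g.
Proof. by rewrite /shift3 /= mulNr. Qed.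

Implicit Types M N : tmx R.

Lemma covarD M N : covar M -> covar N -> covar (M + N : tmx R).
Proof. move=> cM cN g x y; rewrite tmxDE cM cN -mulrDr; exact: erefl. Qed.

Lemma covarN M : covar M -> covar (- M : tmx R).
Proof. by move=> cM g x y; rewrite !tmxNE cM mulrN. Qed.

Lemma covarM M N : covar M -> covar N -> covar (M * N : tmx R).
Proof.
move=> cM cN g x y; rewrite !tmxME.
rewrite -(reindex_csum (fun z => M (x + shift3 g) z * N z (y + shift3 g)) (addr_bij (shift3 g))).
rewrite -csumZ; last exact: absum_tmxM.
congr csum; apply/funext => z; rewrite [shift3 g + z]addrC cM cN.
rewrite mulrACA -expiD; congr (expi _ * _); ring.
Qed.

Lemma covar_diag (f : Z2 -> R[i]) (tf : tame (fun x y => if x == y then f x else 0)) :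
  (forall g x, f (x + shift3 g) = f x) -> covar (TMx tf).
Proof.
move=> Hf g x y /=; rewrite (inj_eq (addIr _)); case: eqP => [->|_]; last by rewrite mulr0.
by rewrite Hf subrr mulr0 expi0 mul1r.
Qed.

Lemma covar_comm_diag (f : Z2 -> R[i]) (tf : tame (fun x y => if x == y then f x else 0)) M :
  (forall g x y, f (x + shift3 g) - f (y + shift3 g) = f x - f y) -> covar M ->
  covar (comm (TMx tf) M).
Proof. by move=> Hf cM g x y; rewrite !comm_diagE Hf cM mulrCA. Qed.

Lemma mord_diag (f : Z2 -> R[i]) (tf : tame (fun x y => if x == y then f x else 0)) (C : R) :
  (forall x, nrm (f x) <= C) -> mord 0 (TMx tf).
Proof.
move=> Hf n; exists C => x y /=; have C0 := le_trans (nrm_ge0 _) (Hf 0).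
rewrite expr0z mul1r; case: eqP => [->|_].
  by rewrite subrr /wt !normr0 !addr0 expr1n invr1 mulr1.
by rewrite Normc.normc0 mulr_ge0 ?wtXV_ge0.
Qed.

Lemma wt_base (i : 'I_3) : wt (base i) <= 3.
Proof.
rewrite /wt /base /= normr0 addr0 -[`|_|%:~R]/((nat_of_ord i)%:R).
have : ((nat_of_ord i)%:R : R) <= 2 by rewrite ler_nat -ltnS ltn_ord.
by lra.
Qed.

(** Covariance moves any column to one of three without changing moduli, so the decay of these three
    columns is uniform over all. *)
Lemma mord_covar (M : Z2 -> Z2 -> R[i]) : covar M -> (forall i : 'I_3, rapid (fun x => M x (base i))) ->
  mord 0 M.
Proof.
move=> cM rM n.
have [D [D0 HD]] : exists D : R, 0 <= D /\ forall i x, nrm (M x (base i)) <= D * wt x ^- n.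
  have [D HD] := choice (fun i => rapidP n (rM i)).
  exists (\sum_i D i); split; first by apply: sumr_ge0 => i _; have [/ltW] := HD i.
  move=> i x; have [_ /(_ x) h] := HD i; apply: le_trans h _.
  rewrite ler_wpM2r ?wtXV_ge0// (bigD1 i)//= lerDl; apply: sumr_ge0 => j _.
  by have [/ltW] := HD j.
exists (D * 3 ^+ n) => x y; rewrite expr0z mul1r.
have [k _ hK] := cell_bij; rewrite -(hK y); move: (k y) => [i g] /=.
have -> : nrm (M x (base i + shift3 g)) = nrm (M (x - shift3 g) (base i)).
  by rewrite -{1}(subrK (shift3 g) x) cM Normc.normcM nrm_expi mul1r.
apply: le_trans (HD _ _) _; rewrite -mulrA ler_wpM2l//.
have w : wt (x - (base i + shift3 g)) <= 3 * wt (x - shift3 g).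
  rewrite (_ : x - _ = - base i + (x - shift3 g)); last by rewrite opprD addrCA.
  apply: le_trans (wt_triangle _ _ _) _.
  by rewrite wtN ler_wpM2r ?wt_ge0// wt_base.
rewrite -ler_pdivrMl ?exprn_gt0// -invfM -exprMn lef_pV2 ?posrE ?exprn_gt0 ?mulr_gt0 ?wt_gt0//.
by rewrite lerXn2r ?nnegrE ?mulr_ge0 ?wt_ge0.
Qed.

Lemma ctrD M N : ctr (M + N : tmx R) = ctr M + ctr N.
Proof. by rewrite /ctr -big_split. Qed.

Lemma ctrZ (c : R[i]) M : ctr (c *: M : tmx R) = c * ctr M.
Proof. by rewrite /ctr mulr_sumr. Qed.

Lemma ctrN M : ctr (- M : tmx R) = - ctr M.
Proof. by rewrite /ctr -sumrN; apply: eq_bigr => i _; rewrite tmxNE. Qed.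

Lemma ctrB M N : ctr (M - N : tmx R) = ctr M - ctr N.
Proof. by rewrite ctrD ctrN. Qed.

Lemma csum_cells (f : Z2 -> R[i]) : absum f ->
  csum f = \sum_(j < 3) csum (fun g => f (base j + shift3 g)).
Proof.
move=> sf; have s := (reindex_absum f cell_bij).2 sf.
rewrite -(reindex_csum f cell_bij) (csum_pair s).
rewrite (csum_fsupp (s := enum 'I_3) _ _).2 ?big_enum//; first exact: enum_uniq.
by move=> i; rewrite mem_enum.
Qed.

(** Moving the summed index back to the cell at the origin replaces [g] by [- g]; the phases of the
    two factors cancel. *)
Lemma ctr_cyc M N : covar M -> covar N -> ctr (M * N : tmx R) = ctr (N * M : tmx R).
Proof.
move=> cM cN; rewrite /ctr.
have E (K K' : tmx R) (i : 'I_3) : (K * K' : tmx R) (base i) (base i) = \sum_(j < 3)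
   csum (fun g => K (base i) (base j + shift3 g) * K' (base j + shift3 g) (base i)).
  by rewrite tmxME csum_cells//; exact: absum_tmxM.
under eq_bigr => i _ do rewrite E.
under [RHS]eq_bigr => i _ do rewrite E.
rewrite exchange_big; apply: eq_bigr => j _; apply: eq_bigr => i _.
rewrite -(reindex_csum _ (subr_bij (0 : Z2))); congr csum; apply/funext => g.
rewrite sub0r shift3N -(covar_pair g _ _ cM cN) subrK mulrC //.
Qed.

Lemma ctr_comm M N : covar M -> covar N -> ctr (comm M N) = 0.
Proof. by move=> cM cN; rewrite /comm ctrB ctr_cyc// subrr. Qed.

Lemma ctr_comm_diag (f : Z2 -> R[i]) (tf : tame (fun x y => if x == y then f x else 0)) M :
  ctr (comm (TMx tf) M) = 0.
Proof. by rewrite /ctr big1// => i _; rewrite comm_diagE subrr mul0r. Qed.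

End Covariant.

(** * Commutators of compressed operators *)

Section IdempotentAlgebra.
Variable A : pzRingType.
Implicit Types (p e X Y b : A).

Lemma compressed_commutator_scalar p X Y : p * p = p -> X * Y = Y * X ->
  p * ((X * p - p * X) * (Y * p - p * Y) - (Y * p - p * Y) * (X * p - p * X)) =
  (p * X * p) * (p * Y * p) - (p * Y * p) * (p * X * p).
Proof.
move=> pp XY.
have H U V : p * ((U * p - p * U) * (V * p - p * V)) = (p * U * p) * (p * V * p) - p * (U * V) * p.
  rewrite mulrA [p * (_ - _)]mulrBr !mulrA pp mulrBl !mulrBr !mulrA.
  rewrite -[p * U * p * V * p]/(p * U * p * V * p) -!mulrA [p * (p * _)]mulrA pp !mulrA.
  by rewrite -[p * U * p * p]mulrA pp opprB addrA subrK.
by rewrite mulrBr !H XY opprB addrA subrK.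
Qed.

(** The same curvature identity in the presence of the Heisenberg relation. [e] stands for the
    matrix of the identity operator; [X] and [Y] represent x and d/dx only on the range of [e].
    Their commutator [e] is the source of the extra term [p] in the index formula. *)
Lemma compressed_commutator p e X Y : p * p = p -> e * p = p -> p * e = p ->
  e * (X * e) = X * e -> e * (Y * e) = Y * e -> Y * (X * e) - X * (Y * e) = e ->
  p - p * ((X * p - p * X * e) * (Y * p - p * Y * e) - (Y * p - p * Y * e) * (X * p - p * X * e)) =
  (p * Y * p) * (p * X * p) - (p * X * p) * (p * Y * p).
Proof.
move=> pp ep pe eX eY YX.
have H U V : e * (V * e) = V * e -> p * ((U * p - p * U * e) * (V * p - p * V * e)) =
    (p * U * p) * (p * V * p) - p * (U * (V * e)) * p.
  move=> eV; have eVp : e * (V * p) = V * p by rewrite -{1}ep 2!mulrA -[e * V * e]mulrA eV -mulrA ep.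
  have -> : p * (U * (V * e)) * p = p * U * (V * p) by rewrite -!mulrA ep.
  rewrite mulrA [p * (_ - _)]mulrBr !mulrA pp mulrBl !mulrBr.
  have -> : p * U * e * (V * p) = p * U * (V * p) by rewrite -mulrA eVp.
  have -> : p * U * e * (p * V * e) = p * U * p * (V * e) by rewrite -!mulrA [e * (p * _)]mulrA ep.
  have -> : p * U * p * (p * V * e) = p * U * p * (V * e) by rewrite -!mulrA [p * (p * _)]mulrA pp.
  by rewrite -[p * U * p * p]mulrA pp opprB addrA subrK !mulrA.
rewrite mulrBr !H// opprB addrA.
have pE : p * (Y * (X * e)) * p - p * (X * (Y * e)) * p = p.
  by rewrite -mulrBl -mulrBr YX pe pp.
rewrite -{1}pE.
move: ((p * X * p) * (p * Y * p)) ((p * Y * p) * (p * X * p)) => S T.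
move: (p * (Y * (X * e)) * p) (p * (X * (Y * e)) * p) => u v.
rewrite opprB !addrA [LHS](ACl (3*6*(1*4)*(5*2))%AC) /=.
by rewrite !subrr !addr0.
Qed.

End IdempotentAlgebra.

(** * Matrices of the operators in the Gabor frame *)
Section FrameMatrices.
Variables (R : realType) (theta : R).
Hypotheses (th0 : 0 < theta) (th1 : theta <= 1).
Implicit Types (f w : R -> R[i]) (a b c : Z2 -> R[i]) (g l m : Z2) (x : R).
Notation h := (theta / 3).
Notation op := (op theta).
Notation TF := (TF theta).
Notation A := (wA h (chic h)).

Let h0 : 0 < h. Proof. by rewrite divr_gt0. Qed.
Let h1 : 3 * h <= 1. Proof. by rewrite mulrC divfK ?pnatr_eq0. Qed.

Definition delta0 (z : Z2) : R[i] := if z == 0 then 1 else 0.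

Lemma rapid_delta0 : rapid delta0.
Proof.
move=> n; exists 1 => z; rewrite mul1r /delta0; case: eqP => [->|_].
  rewrite -[X in nrm X](rmorph1 (real_complex R)) nrm_real normr1.
  by rewrite /wt !normr0 !addr0 expr1n invr1.
by rewrite Normc.normc0 wtXV_ge0.
Qed.

(** The time-frequency shifts that commute with [U] and [V]: translation by multiples of theta,
    modulation by multiples of 2 pi. *)
Definition Tau g f x : R[i] := expi (2 * pi * g.2%:~R * x) * f (x + - (theta * g.1%:~R)).

Lemma gab_shift g m :
  gab h (m + shift3 g) = fun x => expi (2 * pi * theta * g.1%:~R * m.2%:~R) * Tau g (gab h m) x.
Proof.
apply/funext => x; rewrite /Tau /gab 2!mulrA -!expiD; congr (expi _ * platc h _).
  by rewrite /= rmorphD /=; ring.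
by rewrite /= rmorphD rmorphM /=; field.
Qed.

Lemma TF_Tau z g f x : TF z (Tau g f) x = expi (2 * pi * g.2%:~R * x) * TF z f (x + - (theta * g.1%:~R)).
Proof.
rewrite !TFE /Tau mulrA -expiD [RHS]mulrA -expiD.
have -> : x + z.1%:~R + - (theta * g.1%:~R) = x + - (theta * g.1%:~R) + z.1%:~R by rewrite addrAC.
congr (_ * _).
(* The phases of the two orders differ by 2 pi times an integer, which is the reason for this
   lattice of shifts. *)
rewrite -[RHS]mul1r -(expi_2pi R (g.2 * z.1 - z.2 * g.1)) -expiD; congr expi.
by rewrite rmorphB !rmorphM /=; field; rewrite gt_eqF.
Qed.

Lemma op_Tau a g f : rapid a -> schwartz f -> op a (Tau g f) = Tau g (op a f).
Proof.
move=> ra sf; apply/funext => x; have [C _ HC] := schwartz_bounded sf.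
rewrite /Tau /op -csumZ; last exact: absum_op (rapid_absum1 ra) HC.
by congr csum; apply/funext => z; rewrite -/(Tau g f) TF_Tau mulrCA.
Qed.

Lemma schwartz_Tau g f : schwartz f -> schwartz (Tau g f).
Proof. exact: schwartz_tf. Qed.

Lemma wA_Tau w g f l : ccont w -> ccont f ->
  wA h w (Tau g f) (l + shift3 g) = expi (- (2 * pi * theta * g.1%:~R * l.2%:~R)) * wA h w f l.
Proof.
move=> cw cf; rewrite /wA -cintegralZ; last exact: wA_cintg.
congr cintegral; apply/funext => t.
have -> : h * (l + shift3 g).1%:~R = h * l.1%:~R + theta * g.1%:~R.
  by rewrite /= rmorphD rmorphM /=; field.
have ee : expi (2 * pi * g.2%:~R * (t + (h * l.1%:~R + theta * g.1%:~R))) *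
   expi (- (2 * pi * (l + shift3 g).2%:~R) * (t + (h * l.1%:~R + theta * g.1%:~R))) =
   expi (- (2 * pi * theta * g.1%:~R * l.2%:~R)) * expi (- (2 * pi * l.2%:~R) * (t + h * l.1%:~R)) :> R[i].
  by rewrite -!expiD; congr expi; rewrite /= rmorphD /=; ring.
have -> : Tau g f (t + (h * l.1%:~R + theta * g.1%:~R)) =
    expi (2 * pi * g.2%:~R * (t + (h * l.1%:~R + theta * g.1%:~R))) * f (t + h * l.1%:~R).
  by rewrite /Tau; congr (_ * f _); ring.
move: ee; move: (expi _) (expi _) (expi _) (expi _) => e1 e2 e3 e4 ee.
transitivity (w t * (f (t + h * l.1%:~R) * (e4 * e3))); first by ring.
by rewrite ee; ring.
Qed.

Lemma op_scale a (k : R[i]) f : rapid a -> schwartz f -> op a (fun x => k * f x) = fun x => k * op a f x.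
Proof.
move=> ra sf; apply/funext => x; have [C _ HC] := schwartz_bounded sf.
rewrite /op -csumZ; last exact: absum_op (rapid_absum1 ra) HC.
by congr csum; apply/funext => z; rewrite !TFE; ring.
Qed.

Lemma wA_scale w (k : R[i]) f l : ccont w -> ccont f -> wA h w (fun x => k * f x) l = k * wA h w f l.
Proof.
move=> cw cf; rewrite /wA -cintegralZ; last exact: wA_cintg.
by congr cintegral; apply/funext => t; ring.
Qed.

Lemma wA_add w f f' l : ccont w -> ccont f -> ccont f' ->
  wA h w (fun x => f x + f' x) l = wA h w f l + wA h w f' l.
Proof.
move=> cw cf cf'; rewrite /wA -cintegralD; [|exact: wA_cintg..].
by congr cintegral; apply/funext => t; ring.
Qed.

Lemma wA_sub w f f' l : ccont w -> ccont f -> ccont f' ->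
  wA h w (fun x => f x - f' x) l = wA h w f l - wA h w f' l.
Proof.
move=> cw cf cf'; rewrite /wA -cintegralB; [|exact: wA_cintg..].
by congr cintegral; apply/funext => t; ring.
Qed.

(** The window on the analysing side is left free: the matrices of x and d/dx contain blocks with
    the windows [x w] and [w']. *)
Definition opm w a l m := wA h w (op a (gab h m)) l.

Lemma opm_covar w a : window h w -> rapid a -> covar theta (opm w a).
Proof.
move=> [sw _] ra g l m; have sg := schwartz_gab h0 m; have so := schwartz_op th0 ra sg.
rewrite /opm gab_shift op_scale//; last exact: schwartz_Tau.
rewrite wA_scale; [|exact: schwartz_ccont|]; last first.
  by rewrite op_Tau//; exact/schwartz_ccont/schwartz_Tau.
rewrite op_Tau// wA_Tau; [|exact: schwartz_ccont..].
by rewrite mulrA -expiD; congr (expi _ * _); ring.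
Qed.

Lemma opm_mord w a : window h w -> rapid a -> mord 0 (opm w a).
Proof.
move=> ww ra; apply: (mord_covar (opm_covar ww ra)) => i.
by apply: (rapid_wA h0 h1 ww); apply: schwartz_op => //; exact: schwartz_gab.
Qed.

Definition Mw w a (ww : window h w) (ra : rapid a) : tmx R := TMx (mord_tame (opm_mord ww ra)).

Lemma opm_repr w a c (ww : window h w) (ra : rapid a) : rapid c ->
  wA h w (op a (Sy h c)) = tapp (Mw ww ra) c.
Proof.
move=> rc; have [C C0 HC] := gab_bounded h0; have sc := rapid_absum1 rc; have sa := rapid_absum1 ra.
have E : op a (Sy h c) = fun x => csum (fun i => c i * op a (gab h i) x).
  by apply/funext => x; exact: (op_csum theta x sa sc HC).
have so : schwartz (op a (Sy h c)) by apply: schwartz_op => //; exact: schwartz_Sy.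
apply/funext => l; rewrite E (@wA_csum R h w c _ (C * rsum (fun z => nrm (a z))) l).
- by congr csum; apply/funext => m; rewrite mulrC.
- exact: schwartz_ccont ww.1.
- by move=> m; apply: schwartz_ccont; apply: schwartz_op => //; exact: schwartz_gab.
- by rewrite -E; exact: schwartz_ccont.
- by move=> m x; exact: op_bounded.
- exact: sc.
- by have [D _ HD] := schwartz_bounded ww.1; exists D.
Qed.

Lemma Mw_repr w a f (ww : window h w) (ra : rapid a) : schwartz f ->
  wA h w (op a f) = tapp (Mw ww ra) (A f).
Proof.
move=> sf; rewrite -opm_repr ?Sy_A//; exact: (rapid_wA h0 h1 (window_chic h0) sf).
Qed.

Let wc := window_chic h0.
Let cc : ccont (chic h). Proof. exact: schwartz_ccont wc.1. Qed.

Definition Ma a (ra : rapid a) : tmx R := Mw wc ra.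

Lemma rapid_A f : schwartz f -> rapid (A f).
Proof. exact: (rapid_wA h0 h1 wc). Qed.

Lemma Ma_repr a f (ra : rapid a) : schwartz f -> A (op a f) = tapp (Ma ra) (A f).
Proof. exact: Mw_repr. Qed.

Lemma Ma_col a (ra : rapid a) l m : Ma ra l m = A (op a (gab h m)) l.
Proof. by []. Qed.

Lemma mul_Ma_col (M : tmx R) a (ra : rapid a) l m : (M * Ma ra) l m = tapp M (A (op a (gab h m))) l.
Proof. by []. Qed.

Lemma op_delta f : op delta0 f = f.
Proof.
apply/funext => x.
have H (z : Z2) : z != 0 -> delta0 z * TF z f x = 0 by rewrite /delta0 => /negbTE ->; rewrite mul0r.
by rewrite /op (csum_one H).2 /delta0 eqxx mul1r TFE /= mulr0 !mul0r oppr0 expi0 mul1r addr0.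
Qed.

(** The matrix of the identity operator: an idempotent, with the redundancy of the frame standing
    between it and 1. *)
Definition Me : tmx R := Ma rapid_delta0.

Lemma Me_repr f : schwartz f -> tapp Me (A f) = A f.
Proof. by move=> sf; rewrite -Ma_repr// op_delta. Qed.

Lemma schwartz_opgab a m : rapid a -> schwartz (op a (gab h m)).
Proof. by move=> ra; apply: schwartz_op => //; exact: schwartz_gab. Qed.

Lemma Me_mul a (ra : rapid a) : Me * Ma ra = Ma ra.
Proof. by apply: tmxP => l m; rewrite mul_Ma_col Me_repr//; exact: schwartz_opgab. Qed.

Lemma mul_Me a (ra : rapid a) : Ma ra * Me = Ma ra.
Proof. by apply: tmxP => l m; rewrite mul_Ma_col -Ma_repr ?op_delta//; exact: schwartz_gab. Qed.

Lemma Ma_mul a b (ra : rapid a) (rb : rapid b) (rab : rapid (conv theta a b)) :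
  Ma rab = Ma ra * Ma rb.
Proof.
apply: tmxP => l m; rewrite mul_Ma_col -Ma_repr; last exact: schwartz_opgab.
rewrite Ma_col; congr (wA _ _ _ l); apply/funext => x; rewrite op_mul//; exact: schwartz_gab.
Qed.

Lemma Ma_sub a b (ra : rapid a) (rb : rapid b) (rab : rapid (fun z => a z - b z)) :
  Ma rab = Ma ra - Ma rb.
Proof.
apply: tmxP => l m; rewrite tmxBE !Ma_col -wA_sub//; last 2 first.
- exact/schwartz_ccont/schwartz_opgab.
- exact/schwartz_ccont/schwartz_opgab.
congr (wA _ _ _ l); apply/funext => x; have [C _ HC] := schwartz_bounded (schwartz_gab h0 m).
exact: op_subl (rapid_absum1 ra) (rapid_absum1 rb) HC.
Qed.

Notation X1 := (X1d R).
Notation X2 := (X2d R).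

(** The position [h * l.1] is theta times the cell number plus [h] times the number of the window
    within the cell; this is the second, bounded part. *)
Let rmod (z : Z2) : R[i] := (h * (z.1 %% 3)%Z%:~R)%:C.

Let rmod_bound z : nrm (rmod z) <= theta.
Proof.
rewrite /rmod nrm_real ger0_norm; last by rewrite mulr_ge0 ?(ltW h0)// ler0z; lia.
have : ((z.1 %% 3)%Z%:~R : R) <= 3 by rewrite -[leRHS]/((3%:Z)%:~R) ler_int; lia.
by move=> H; have := ler_wpM2l (ltW h0) H; rewrite divfK ?pnatr_eq0.
Qed.

Let tame_rmod : tame (fun x y : Z2 => if x == y then rmod x else 0).
Proof. by apply: (@tame_diag R rmod theta 0) => x; rewrite expr0 mulr1; exact: rmod_bound. Qed.

Let wx := window_mulx wc.
Let wd := window_cderive wc.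

(** [B1] and [B2] are the order-0 remainders left when x and d/dx are replaced by the cell
    coordinates: the position inside the cell and the window [x w] for x, the derivative of the
    window for d/dx. *)
Definition B1 : tmx R := TMx tame_rmod + Mw wx rapid_delta0.
Definition B2 : tmx R := - Mw wd rapid_delta0.
Definition be : R[i] := (2 * pi)%:C * 'i%C.
Definition Y1 : tmx R := theta%:C *: X1 + B1.
Definition Y2 : tmx R := be *: X2 + B2.

Lemma tapp_diag (d : Z2 -> R[i]) (td : tame (fun x y : Z2 => if x == y then d x else 0)) v l :
  tapp (TMx td) v l = d l * v l.
Proof.
rewrite /tapp /rawapp /=.
have H (z : Z2) : z != l -> (if l == z then d l else 0) * v z = 0.
  by rewrite eq_sym => /negbTE ->; rewrite mul0r.
by rewrite (csum_one H).2 eqxx.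
Qed.

Lemma Y1_repr f : schwartz f -> A (fun x => x%:C * f x) = tapp Y1 (A f).
Proof.
move=> sf; have rA := rapid_A sf; apply/funext => l.
rewrite /Y1 /B1 !tappD// tappZ// -Mw_repr// op_delta.
rewrite [RHS]/GRing.add /= [X in _ + X]/GRing.add /= !tapp_diag.
have -> : A (fun x => x%:C * f x) l = (h * l.1%:~R)%:C * A f l + wA h (fun x => x%:C * chic h x) f l.
  by rewrite (wA_mulx l wc sf) subrK.
rewrite addrA; congr (_ + _); rewrite mulrA -mulrDl; congr (_ * _).
rewrite /rmod -[in RHS](rmorph_int (real_complex R)) /= -rmorphM -rmorphD /=; congr (_%:C).
by rewrite {1}(divz_eq l.1 3) rmorphD rmorphM /=; field.
Qed.

Lemma Y2_repr f : schwartz f -> A (cderive f) = tapp Y2 (A f).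
Proof.
move=> sf; have rA := rapid_A sf; apply/funext => l.
rewrite /Y2 /B2 tappD// tappZ// tappN// -Mw_repr// op_delta.
rewrite [RHS]/GRing.add /= [X in _ + X]/GRing.opp /= tapp_diag.
have H := wA_diff h0 h1 l wc sf.
have -> : A (cderive f) l = (2 * pi * l.2%:~R)%:C * 'i%C * A f l - wA h (cderive (chic h)) f l.
  by rewrite H addrAC subrr add0r.
congr (_ - _); rewrite mulrA; congr (_ * _).
by rewrite /be -[in RHS](rmorph_int (real_complex R)) /= rmorphM /=; ring.
Qed.

Lemma mul_col (M N : tmx R) (v : Z2 -> R[i]) l m : (forall z, N z m = v z) ->
  (M * N) l m = tapp M v l.
Proof. by move=> H; rewrite tmxME /tapp /rawapp; congr csum; apply/funext => z; rewrite H. Qed.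

Lemma Y1_col a (ra : rapid a) l m : (Y1 * Ma ra) l m = A (fun x => x%:C * op a (gab h m) x) l.
Proof. by rewrite (@mul_col _ _ (A (op a (gab h m))))// -Y1_repr//; exact: schwartz_opgab. Qed.

Lemma Y2_col a (ra : rapid a) l m : (Y2 * Ma ra) l m = A (cderive (op a (gab h m))) l.
Proof. by rewrite (@mul_col _ _ (A (op a (gab h m))))// -Y2_repr//; exact: schwartz_opgab. Qed.

Lemma Y1_Me_col l m : (Y1 * Me) l m = A (fun x => x%:C * gab h m x) l.
Proof. by rewrite (Y1_col rapid_delta0) op_delta. Qed.

Lemma Y2_Me_col l m : (Y2 * Me) l m = A (cderive (gab h m)) l.
Proof. by rewrite (Y2_col rapid_delta0) op_delta. Qed.

Lemma Me_Y1 : Me * (Y1 * Me) = Y1 * Me.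
Proof.
apply: tmxP => l m; rewrite (mul_col _ _ (fun z => Y1_Me_col z m)) Y1_Me_col.
by rewrite Me_repr//; exact/schwartz_mulx/schwartz_gab.
Qed.

Lemma Me_Y2 : Me * (Y2 * Me) = Y2 * Me.
Proof.
apply: tmxP => l m; rewrite (mul_col _ _ (fun z => Y2_Me_col z m)) Y2_Me_col.
by rewrite Me_repr//; exact/schwartz_cderive/schwartz_gab.
Qed.

Lemma Y21_comm : Y2 * (Y1 * Me) - Y1 * (Y2 * Me) = Me.
Proof.
apply: tmxP => l m; have sg := schwartz_gab h0 m; have sx := schwartz_mulx sg; have sd := schwartz_cderive sg.
rewrite tmxBE (mul_col _ _ (fun z => Y1_Me_col z m)) (mul_col _ _ (fun z => Y2_Me_col z m)).
rewrite -Y2_repr// -Y1_repr// -wA_sub//; last 2 first.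
- exact/schwartz_ccont/schwartz_cderive.
- exact/schwartz_ccont/schwartz_mulx.
rewrite Ma_col op_delta; congr (wA _ _ _ l); apply/funext => x.
by rewrite (cis_derive (cisM (cis_id x) (schwartz_cdiff sg x))) mul1r addrAC subrr add0r.
Qed.

(** [Y1] represents multiplication by x only on vectors of frame coefficients, hence the factor [Me]
    on the right. *)
Lemma Ma_xcoef a (ra : rapid a) (rx : rapid (xcoef a)) : Ma rx = Y1 * Ma ra - Ma ra * Y1 * Me.
Proof.
rewrite -[Ma ra * Y1 * Me]mulrA.
apply: tmxP => l m; have sg := schwartz_gab h0 m; have so := schwartz_opgab m ra.
rewrite tmxBE (mul_col _ _ (fun z => Y1_Me_col z m)) Y1_col -Ma_repr; last exact: schwartz_mulx.
rewrite -wA_sub//; last 2 first.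
- exact/schwartz_ccont/schwartz_mulx.
- by apply/schwartz_ccont/schwartz_op => //; exact: schwartz_mulx.
by rewrite Ma_col; congr (wA _ _ _ l); apply/funext => x; rewrite op_mulx.
Qed.

Lemma Ma_dcoef a (ra : rapid a) (rd : rapid (dcoef theta a)) : Ma rd = Y2 * Ma ra - Ma ra * Y2 * Me.
Proof.
rewrite -[Ma ra * Y2 * Me]mulrA.
apply: tmxP => l m; have sg := schwartz_gab h0 m; have so := schwartz_opgab m ra.
rewrite tmxBE (mul_col _ _ (fun z => Y2_Me_col z m)) Y2_col -Ma_repr; last exact: schwartz_cderive.
rewrite -wA_sub//; last 2 first.
- exact/schwartz_ccont/schwartz_cderive.
- by apply/schwartz_ccont/schwartz_op => //; exact: schwartz_cderive.
by rewrite Ma_col; congr (wA _ _ _ l); apply/funext => x; rewrite op_cderive.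
Qed.

Lemma mord_B1 : mord 0 B1.
Proof.
rewrite /B1; apply: mord_tmxD; first exact: (mord_diag tame_rmod rmod_bound).
exact: (opm_mord wx rapid_delta0).
Qed.

Lemma mord_B2 : mord 0 B2.
Proof. by rewrite /B2; apply: mord_tmxN; exact: (opm_mord wd rapid_delta0). Qed.

Lemma covar_B1 : covar theta B1.
Proof.
rewrite /B1; apply: covarD; last exact: (opm_covar wx rapid_delta0).
apply: covar_diag => g x; rewrite /rmod /=.
by have -> : ((x.1 + g.1 * 3) %% 3)%Z = (x.1 %% 3)%Z by lia.
Qed.

Lemma covar_B2 : covar theta B2.
Proof. by rewrite /B2; apply: covarN; exact: (opm_covar wd rapid_delta0). Qed.

Lemma covar_Ma a (ra : rapid a) : covar theta (Ma ra).
Proof. exact: (opm_covar wc ra). Qed.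

Lemma mord_Ma a (ra : rapid a) : mord 0 (Ma ra).
Proof. exact: (opm_mord wc ra). Qed.

End FrameMatrices.

(** * The curvature pairing *)
Section CompressedTrace.
Variables (R : realType) (theta : R).

(** Trades the compressed [X] for [X] itself and its commutator with [p], which are the two pieces
    whose traces per cell are under control. *)
Lemma compressed_bracket (A : pzRingType) (p X b : A) : p * b = b -> b * p = b ->
  (p * X * p) * b - b * (p * X * p) =
  (X * b - b * X) - ((X * p - p * X) * b + b * (X * p - p * X)).
Proof.
move=> pb bp.
have -> : p * X * p * b = p * X * b by rewrite -!mulrA pb.
have -> : b * (p * X * p) = b * X * p by rewrite !mulrA bp.
rewrite mulrBl mulrBr -[X * p * b]mulrA pb ![b * (p * X)]mulrA bp mulrA.
rewrite -[b * X * p]mulrA.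
move: (X * b) (b * (X * p)) (p * X * b) (b * X) => u v w z.
by rewrite opprD !opprB !addrA [RHS](ACl (3*6*(1*4)*(5*2))%AC) /= !subrr !addr0.
Qed.

Lemma compressed_bracket0 (A : pzRingType) (p X : A) : p * p = p -> p * (X * p - p * X) * p = 0.
Proof. by move=> pp; rewrite mulrBr mulrBl -!mulrA pp [p * (p * _)]mulrA pp subrr. Qed.

Lemma comm_linl (c : R[i]) (M N P : tmx R) : comm (c *: M + N) P = c *: comm M P + comm N P.
Proof.
rewrite /comm mulrDl mulrDr -tmx_scaleAl -tmx_scaleAr scalerBr opprD addrACA //.
Qed.

Lemma comm_linr (c : R[i]) (M N P : tmx R) : comm P (c *: M + N) = c *: comm P M + comm P N.
Proof.
rewrite /comm mulrDl mulrDr -tmx_scaleAl -tmx_scaleAr scalerBr opprD addrACA //.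
Qed.

Lemma commN (M N : tmx R) : comm N M = - comm M N.
Proof. by rewrite /comm opprB. Qed.

(** The diagonal matrix is not covariant, so cyclicity does not apply to it directly. By
    [compressed_bracket] there remain a commutator with a diagonal matrix, whose diagonal is zero,
    and products with [comm X p]. The latter is covariant and off-diagonal for [p], so these
    products have trace zero. *)
Lemma ctr_comm_compressed (f : Z2 -> R[i]) (tf : tame (fun x y => if x == y then f x else 0)) (p B : tmx R) :
  (forall g x y, f (x + shift3 g) - f (y + shift3 g) = f x - f y) ->
  p * p = p -> covar theta p -> covar theta B ->
  ctr (comm (p * TMx tf * p) (p * B * p)) = 0.
Proof.
move=> Hf pp cp cB; set X := TMx tf; set b := p * B * p.
have pb : p * b = b by rewrite /b !mulrA pp.
have bp : b * p = b by rewrite /b -mulrA pp.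
have cb : covar theta b by apply: covarM => //; apply: covarM.
have cK : covar theta (comm X p) by exact: covar_comm_diag.
have pKp : p * comm X p * p = 0 by exact: (compressed_bracket0 X pp).
have Kb0 : ctr (comm X p * b) = 0.
  have -> : comm X p * b = comm X p * (p * B) * p by rewrite /b !mulrA.
  rewrite (ctr_cyc (theta := theta)) //; last by apply: covarM => //; apply: covarM.
  have -> : p * (comm X p * (p * B)) = p * comm X p * p * B by rewrite !mulrA.
  by rewrite pKp mul0r /ctr big1.
have -> : comm (p * X * p) b = comm X b - (comm X p * b + b * comm X p).
  exact: (compressed_bracket X pb bp).
rewrite (ctrB (comm X b)) (ctrD (comm X p * b)) (ctr_cyc cb cK) Kb0 addr0 subr0.
exact: (ctr_comm_diag tf b).
Qed.

Lemma ctr_comm_bilin (a b : R[i]) (x1 c1 x2 c2 : tmx R) :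
  ctr (comm (a *: x1 + c1) (b *: x2 + c2)) = a * b * ctr (comm x1 x2) +
  a * ctr (comm x1 c2) + (b * ctr (comm c1 x2) + ctr (comm c1 c2)).
Proof.
rewrite comm_linl ctrD ctrZ !comm_linr.
rewrite (ctrD (b *: comm x1 x2)) (ctrD (b *: comm c1 x2)) (ctrZ b (comm x1 x2)) (ctrZ b (comm c1 x2)).
by rewrite mulrDr mulrA.
Qed.

Lemma ctr_comm_bilin0 (a b : R[i]) (x1 c1 x2 c2 : tmx R) :
  ctr (comm x1 c2) = 0 -> ctr (comm c1 x2) = 0 -> ctr (comm c1 c2) = 0 ->
  ctr (comm (a *: x1 + c1) (b *: x2 + c2)) = a * b * ctr (comm x1 x2).
Proof. by move=> z1 z2 z3; rewrite ctr_comm_bilin z1 z2 z3 !mulr0 !addr0. Qed.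

Lemma ctr_commC0 (M N : tmx R) : ctr (comm M N) = 0 -> ctr (comm N M) = 0.
Proof. by move=> z; rewrite commN ctrN z oppr0. Qed.

(** By bilinearity every term that contains a bounded part has trace zero, so x and d/dx may be
    replaced by the commuting cell coordinates. *)
Lemma ctr_compressed_commutator (f1 f2 : Z2 -> R[i])
    (t1 : tame (fun x y => if x == y then f1 x else 0))
    (t2 : tame (fun x y => if x == y then f2 x else 0)) (p B1 B2 : tmx R) (a b : R[i]) :
  (forall g x y, f1 (x + shift3 g) - f1 (y + shift3 g) = f1 x - f1 y) ->
  (forall g x y, f2 (x + shift3 g) - f2 (y + shift3 g) = f2 x - f2 y) ->
  p * p = p -> covar theta p -> covar theta B1 -> covar theta B2 ->
  ctr (comm (p * (a *: TMx t1 + B1) * p) (p * (b *: TMx t2 + B2) * p)) =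
  a * b * ctr (comm (p * TMx t1 * p) (p * TMx t2 * p)).
Proof.
move=> H1 H2 pp cp c1 c2.
have E (c : R[i]) (X B : tmx R) : p * (c *: X + B) * p = c *: (p * X * p) + p * B * p.
  by rewrite mulrDr mulrDl -tmx_scaleAr -tmx_scaleAl.
have cc1 : covar theta (p * B1 * p) by apply: covarM => //; apply: covarM.
have cc2 : covar theta (p * B2 * p) by apply: covarM => //; apply: covarM.
rewrite (E a) (E b); apply: ctr_comm_bilin0.
- exact: (ctr_comm_compressed t1 H1 pp cp c2).
- by apply: ctr_commC0; exact: (ctr_comm_compressed t2 H2 pp cp c1).
- exact: (ctr_comm cc1 cc2).
Qed.

End CompressedTrace.

(** * Trace per unit cell of an element of the algebra *)

Section WexlerRaz.
Variables (R : realType) (theta : R).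
Hypotheses (th0 : 0 < theta) (th1 : theta <= 1).
Notation h := (theta / 3).

Let h0 : 0 < h. Proof. by rewrite divr_gt0. Qed.
Let h1 : 3 * h <= 1. Proof. by rewrite mulrC divfK ?pnatr_eq0. Qed.

Lemma cprimitive_exists (k : R -> R[i]) : ccont k -> exists F, forall x, cis F x (k x).
Proof.
move=> [c1 c2]; have [F1 H1] := primitive_exists c1; have [F2 H2] := primitive_exists c2.
by exists (fun x => F1 x +i* F2 x) => x; split => /=.
Qed.

Lemma cintegral_eq0 (a b : R) : a < b -> cintegral a b (fun=> 0) = 0.
Proof.
move=> ab; rewrite (@cintegral_FTC2 _ a b (fun=> 0) (fun=> 0)) ?subrr//.
  by move=> x; exact: cis_cst.
by apply: (@cdiff_ccont _ _ (fun=> 0)) => x; exact: cis_cst.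
Qed.

(** [chi] is a step minus its translate by [h]. As [T] has period [h], the integral telescopes to
    boundary terms of a primitive. *)
Lemma window_average (T : R -> R[i]) : ccont T -> (forall t, T (t + h) = T t) ->
  cintegral 0 1 (fun t => (chi h t)%:C * T t) = cintegral 0 h T.
Proof.
move=> cT Th.
pose s (t : R) : R[i] := (step (h^-1 * t + - 2^-1))%:C.
have [s' _ ds] := rsm_derive (rsm_aff h^-1 (- 2^-1) (rsm_step R)).
have cs : ccont s by apply: cdiff_ccont => x; exact: cis_real (ds x).
have csT : ccont (fun t => s t * T t) by exact: ccontM.
have [Psi dPsi] := cprimitive_exists csT; have [Phi dPhi] := cprimitive_exists cT.
have chiE t : (chi h t)%:C = s t - s (t + - h).
  rewrite /chi /s -rmorphB mulN1r; congr (_ - step _)%:C.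
  by field; rewrite gt_eqF.
have Th' t : T (t + - h) = T t by rewrite -Th subrK.
have E : (fun t => (chi h t)%:C * T t) = fun t => s t * T t - s (t + - h) * T (t + - h).
  by apply/funext => t; rewrite chiE Th' mulrBl.
have dD t : cis (fun t => Psi t + -1 * Psi (t + - h)) t (s t * T t - s (t + - h) * T (t + - h)).
  by have := cisD (dPsi t) (cisZ (-1) (cis_shift (dPsi (t + - h)))); rewrite mulN1r.
rewrite E (@cintegral_FTC2 _ 0 1 _ _ ltr01 dD); last first.
  rewrite -E; apply: ccontM => //; have [c' _ dc] := rsm_derive (rsm_chi h).
  by apply: cdiff_ccont => x; exact: cis_real (dc x).
have lh : 1 + - h < 1 by rewrite gtrDl oppr_lt0.
have l0 : 0 + - h < 0 by rewrite add0r oppr_lt0.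
(* The step is 1 on the last interval of length [h] before 1 because [3 * h <= 1]; on the interval
   before 0 it is 0. *)
have A1 : Psi 1 - Psi (1 + - h) = Phi 1 - Phi (1 + - h).
  rewrite -(cintegral_FTC2 lh dPsi csT) -(cintegral_FTC2 lh dPhi cT).
  apply: eq_cintegral => x /andP[x1 _]; rewrite /s step_eq1 ?mul1r//.
  have : 3 / 2 * h <= x by move: h1 h0 x1; lra.
  move=> hx; have : h^-1 * (3 / 2 * h) <= h^-1 * x by rewrite ler_pM2l ?invr_gt0.
  by rewrite mulrCA mulVf ?gt_eqF// mulr1; lra.
have A2 : Psi 0 - Psi (0 + - h) = 0.
  rewrite -(cintegral_FTC2 l0 dPsi csT) -[RHS](cintegral_eq0 l0).
  apply: eq_cintegral => x /andP[_ x0]; rewrite /s step_eq0 ?mul0r//.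
  have : h^-1 * x <= 0 by rewrite pmulr_rle0 ?invr_gt0.
  by lra.
have A3 : Phi 1 - Phi (1 + - h) = Phi h - Phi 0.
  have D0 t : cis (fun t => Phi t + -1 * Phi (t + - h)) t 0.
    have := cisD (dPhi t) (cisZ (-1) (cis_shift (dPhi (t + - h)))).
    by rewrite Th' mulN1r subrr.
  by have := cdiff_cst_eq0 1 h D0; rewrite !mulN1r subrr.
rewrite (cintegral_FTC2 h0 dPhi cT) -A3 -A1.
by rewrite !mulN1r A2 subr0.
Qed.

Lemma sum3_shift (f : R -> R[i]) t : (forall x, f (x + theta) = f x) ->
  \sum_(i < 3) f (t + h + h * (i : nat)%:R) = \sum_(i < 3) f (t + h * (i : nat)%:R).
Proof.
move=> per; rewrite !big_ord_recl !big_ord0 /= !addr0 /bump /= !mulr0 !addr0.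
have -> : t + h + h * (1 + 1)%:R = t + theta by field.
rewrite per.
have -> : t + h + h * (1 + 0)%:R = t + h * (1 + 1)%:R by ring.
have -> : t + h * (1 + 0)%:R = t + h by ring.
by rewrite addrA addrC.
Qed.

(** Where [chi] is nonzero, a translate of the plateau by a nonzero integer vanishes, so only [b_0]
    enters the diagonal. The three windows of the cell then average it over one period of length
    theta, which gives the zeroth Fourier coefficient. *)
Lemma ctr_Ma a (ra : rapid a) : ctr (Ma th0 th1 ra) = theta%:C * a (0, 0).
Proof.
pose T t := \sum_(i < 3) trig theta a 0 (t + h * (i : nat)%:R).
have dT x : cis (trig theta a 0) x (trig theta (dcoef theta a) 0 x) by exact: trig_cis.
have ct : ccont (trig theta a 0) by exact: cdiff_ccont dT.
have cT : ccont T.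
  apply: (@cdiff_ccont _ _ (fun t => \sum_(i < 3) trig theta (dcoef theta a) 0 (t + h * (i : nat)%:R))) => x.
  by apply: cis_sum => i; exact: cis_shift.
have per x : trig theta a 0 (x + theta) = trig theta a 0 x.
  rewrite /trig; congr csum; apply/funext => k; congr (_ * _).
  have -> : - (2 * pi * k%:~R * (x + theta) / theta) = - (2 * pi * k%:~R * x / theta) + 2 * pi * (- k)%:~R.
    by rewrite rmorphN /=; field; rewrite gt_eqF.
  by rewrite expiD expi_2pi mulr1.
have Th t : T (t + h) = T t.
  exact: sum3_shift.
have cchi : ccont (chic h) by apply/schwartz_ccont; exact: (window_chic h0).1.
have diagE (i : 'I_3) : Ma th0 th1 ra (base i) (base i) =
   cintegral 0 1 (fun t => (chi h t)%:C * trig theta a 0 (t + h * (i : nat)%:R)).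
  rewrite Ma_col /wA; apply: eq_cintegral => t t1.
  have [/eqP c0|c0] := boolP (chi h t == 0); first by rewrite /chic c0 !mul0r.
  have tl : h / 2 < t by rewrite ltNge; apply/negP => H; move/negP: c0; apply; rewrite chi_eq0//; left.
  have tr : t < 5 * h / 2 by rewrite ltNge; apply/negP => H; move/negP: c0; apply; rewrite chi_eq0//; right.
  rewrite /chic; congr (_ * _).
  have -> : (base i).1%:~R = (i : nat)%:R :> R by [].
  rewrite /= mulr0 oppr0 mul0r expi0 mulr1.
  have [C _ HC] := schwartz_bounded (schwartz_gab h0 (base i)).
  rewrite /op (csum_pair (absum_op theta _ (rapid_absum1 ra) HC)).
  have H (j : int) : j != 0 -> csum (fun k : int => a (j, k) * TF theta (j, k) (gab h (base i)) (t + h * (i : nat)%:R)) = 0.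
    move=> j0; rewrite (_ : (fun k => _) = fun=> 0) ?csum0//; apply/funext => k.
    rewrite TFE /gab /= /platc plateau_eq0 ?mulr0//.
    have -> : t + h * (i : nat)%:R + j%:~R + - (h * (i : nat)%:~R) = t + j%:~R by rewrite -[(i : nat)%:~R]/((i : nat)%:R); ring.
    have [jp|jn] := leP 0 j.
      have j1 : (1 : R) <= j%:~R by rewrite -[1]/((1%:Z)%:~R) ler_int; lia.
      by right; move: h1 h0; lra.
    have j1 : j%:~R <= (-1 : R) by rewrite -[-1]/((-1%:Z)%:~R) ler_int; lia.
    by left; move: h1 h0; lra.
  rewrite (csum_one H).2 /trig; congr csum; apply/funext => k; congr (_ * _).
  rewrite TFE /= addr0 /gab /= mulr0 mul0r expi0 mul1r /platc plateau_eq1 ?mulr1//.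
  have -> : t + h * (i : nat)%:R + - (h * (i : nat)%:~R) = t by rewrite -[(i : nat)%:~R]/((i : nat)%:R); ring.
  by apply/andP; split; apply: ltW.
have cti (i : 'I_3) : ccont (fun t => trig theta a 0 (t + h * (i : nat)%:R)) by exact: ccont_shift.
have -> : ctr (Ma th0 th1 ra) = cintegral 0 1 (fun t => (chi h t)%:C * T t).
  rewrite /ctr; under eq_bigr => i _ do rewrite diagE.
  rewrite -(@cintegral_sum R 0 1 'I_3 _ (fun (i : 'I_3) t => (chi h t)%:C * trig theta a 0 (t + h * (i : nat)%:R))).
    by congr cintegral; apply/funext => t; rewrite /T mulr_sumr.
  by move=> i; apply: ccont_cintg; apply: ccontM.
rewrite window_average//.
have [Phi dPhi] := cprimitive_exists ct.
rewrite -trig0// (cintegral_FTC2 th0 dPhi ct) /T.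
rewrite (@cintegral_sum R 0 h 'I_3 _ (fun (i : 'I_3) t => trig theta a 0 (t + h * (i : nat)%:R))); last first.
  by move=> i; exact: ccont_cintg.
have E (i : 'I_3) : cintegral 0 h (fun t => trig theta a 0 (t + h * (i : nat)%:R)) =
    Phi (h * (i.+1)%:R) - Phi (h * (i : nat)%:R).
  rewrite (cintegral_FTC2 h0 (fun x => cis_shift (dPhi _)) (cti i)) add0r; congr (Phi _ - _).
  by rewrite -natr1; ring.
under eq_bigr => i _ do rewrite E.
rewrite !big_ord_recl big_ord0 /= addr0 /bump /= mulr0 mulr1.
have -> : h * (1 + 1).+1%:R = theta by rewrite -[(1 + 1).+1%:R]/(3%:R); field.
have -> : (1 + (1 + 0))%N = (1 + 0).+1 by [].
by ring.
Qed.

End WexlerRaz.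

(** * The index up to a universal constant *)
Section IndexFormula.
Variables (R : realType) (theta : R).
Hypotheses (th0 : 0 < theta) (th1 : theta <= 1).
Notation h := (theta / 3).
Notation X1 := (X1d R).
Notation X2 := (X2d R).
Notation Y1 := (Y1 th0 th1).
Notation Y2 := (Y2 th0 th1).
Notation A := (wA h (chic h)).
Notation V := (R -> R[i]^o).

Let h0 : 0 < h. Proof. by rewrite divr_gt0. Qed.
Let h1 : 3 * h <= 1. Proof. by rewrite mulrC divfK ?pnatr_eq0. Qed.
Let pi2 : 0 < 2 * pi :> R. Proof. by rewrite mulr_gt0 ?pi_gt0. Qed.

Let uC := u3_lip th0 pi2.

(** The summand [theta / 2] undoes the half shift in [ul]. *)
Definition Bt : tmx R := B1 th0 th1 + B2 th0 th1 + (theta / 2)%:C *: (1 : tmx R).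

Lemma Y12_E : Y1 + Y2 = Ud uC + Bt.
Proof.
apply: tmxP => l m.
have -> : (Y1 + Y2) l m = (theta%:C * X1 l m + B1 th0 th1 l m) + (be R * X2 l m + B2 th0 th1 l m) by [].
have -> : (Ud uC + Bt) l m = Ud uC l m + (B1 th0 th1 l m + B2 th0 th1 l m +
    (theta / 2)%:C * (if l == m then 1 else 0)) by [].
move: (B1 th0 th1 l m) (B2 th0 th1 l m) => b1 b2; rewrite /= /u3 /ul /lin /be.
case: (l == m); last by rewrite !mulr0; ring.
have -> : (theta * (cell l).1%:~R) +i* (2 * pi * (cell l).2%:~R) =
    theta%:C * (cell l).1%:~R + (2 * pi)%:C * 'i%C * (cell l).2%:~R :> R[i].
  by rewrite -!(rmorph_int (real_complex R)) /=; simpc.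
by rewrite mulr1; ring.
Qed.

Lemma mord_Bt : mord 0 Bt.
Proof.
rewrite /Bt; apply: mord_tmxD; first by apply: mord_tmxD; [exact: mord_B1|exact: mord_B2].
by apply: mord_tmxZ; exact: mord_tmx1.
Qed.

Variables (P : operator R) (a : Z2 -> R[i]) (ra : rapid a).
Hypothesis HP : forall f, schwartz f -> P f = op theta a f.
Hypothesis PP : forall f, schwartz f -> P (P f) = P f.

Let p := Ma th0 th1 ra.
Let W : set V := P @` @schwartz R.

Lemma schwartz_P f : schwartz f -> schwartz (P f).
Proof. by move=> sf; rewrite HP//; exact: schwartz_op. Qed.

Lemma range_schwartz w : W w -> schwartz w /\ P w = w.
Proof. by move=> [f sf <-]; split; [exact: schwartz_P|exact: PP]. Qed.

Lemma P_repr f : schwartz f -> A (P f) = tapp p (A f).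
Proof. by move=> sf; rewrite HP// /p Ma_repr. Qed.

Lemma P_lin (c : R[i]) f g : schwartz f -> schwartz g ->
  P (fun x => c * f x + g x) = fun x => c * P f x + P g x.
Proof.
move=> sf sg; have scf := schwartzZ c sf; rewrite !HP//; last exact: schwartzD.
apply/funext => x; have [C _ HC] := schwartz_bounded sf; have [D _ HD] := schwartz_bounded sg.
rewrite /op -csumZ -?csumD; [|exact: absumZ (absum_op theta x (rapid_absum1 ra) HC)|
  exact: absum_op (rapid_absum1 ra) HD|exact: absum_op (rapid_absum1 ra) HC].
by congr csum; apply/funext => z; rewrite !TFE; ring.
Qed.

Lemma subspace_range : subspace W.
Proof.
split.
  have s0 : schwartz (fun _ : R => 0 : R[i]).
    by have := schwartzZ 0 (schwartz_gab h0 0); under eq_fun do rewrite mul0r.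
  exists (fun=> 0) => //; have := P_lin (-1) s0 s0.
  have -> : (fun x : R => -1 * (0 : R[i]) + 0) = fun=> 0 by apply/funext => x; rewrite mulr0 addr0.
  by move=> ->; apply/funext => x; rewrite mulN1r addNr.
move=> c u v [f sf <-] [g sg <-]; exists (fun x => c * f x + g x).
  by apply: schwartzD => //; exact: schwartzZ.
by rewrite P_lin.
Qed.

Lemma linear_A : linear_on (V' := (Z2 -> R[i]^o)) W A.
Proof.
move=> c u v /range_schwartz[su _] /range_schwartz[sv _]; apply/funext => l.
have cu := schwartz_ccont su; have cv := schwartz_ccont sv.
have cc : ccont (chic h) := schwartz_ccont (window_chic h0).1.
have cz : ccont (fun x => c * u x) := schwartz_ccont (schwartzZ c su).
rewrite -[c *: u + v]/(fun x => c * u x + v x) wA_add// wA_scale//.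
Qed.

Lemma pp : p * p = p.
Proof.
apply: tmxP => l m; rewrite /p mul_Ma_col -Ma_repr; last exact: schwartz_opgab.
rewrite Ma_col; congr (wA _ _ _ l); have sg := schwartz_gab h0 m.
by rewrite -(HP sg) -(HP (schwartz_P sg)) PP.
Qed.

Definition Dop : V -> V := compressed P.

Lemma D_range w : W w -> Dop w = P (fun x => x%:C * w x + cderive w x).
Proof. by move=> /range_schwartz[_ Pw]; rewrite /Dop /compressed Pw. Qed.

Lemma schwartz_Dw (w : R -> R[i]) : schwartz w -> schwartz (fun x => x%:C * w x + cderive w x).
Proof. by move=> sw; apply: schwartzD; [exact: schwartz_mulx|exact: schwartz_cderive]. Qed.

Lemma D_stable w : W w -> W (Dop w).
Proof.
move=> Ww; rewrite D_range//; have [sw _] := range_schwartz Ww.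
by exists (fun x => x%:C * w x + cderive w x) => //; exact: schwartz_Dw.
Qed.

Lemma linear_D : linear_on W Dop.
Proof.
move=> c u v Wu Wv; have [su _] := range_schwartz Wu; have [sv _] := range_schwartz Wv.
have Wuv : W (c *: u + v) by have [_] := subspace_range; apply.
rewrite !D_range// -[RHS]/(fun x => c * P (fun x => x%:C * u x + cderive u x) x + P (fun x => x%:C * v x + cderive v x) x).
rewrite -P_lin; [|exact: schwartz_Dw..]; congr P; apply/funext => x.
have := cis_derive (cisD (cisZ c (schwartz_cdiff su x)) (schwartz_cdiff sv x)).
rewrite -[(fun t => c * u t + v t)]/(c *: u + v) => ->.
rewrite -[(c *: u + v) x]/(c * u x + v x); ring.
Qed.

Lemma D_matrix w : W w -> A (Dop w) = tapp (p * (Ud uC + Bt) * p) (A w).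
Proof.
move=> Ww; have [sw Pw] := range_schwartz Ww; have rA := rapid_A th0 th1 sw.
have pA : tapp p (A w) = A w by rewrite -P_repr ?Pw.
rewrite D_range// P_repr; last exact: schwartz_Dw.
rewrite tapp_mul// tapp_mul; last exact: tapp_rapid.
rewrite pA -Y12_E tappD// -(Y1_repr th0 th1 sw) -(Y2_repr th0 th1 sw); congr tapp.
have cc : ccont (chic h) := schwartz_ccont (window_chic h0).1.
apply/funext => l; rewrite wA_add//.
  exact: schwartz_ccont (schwartz_mulx sw).
exact: schwartz_ccont (schwartz_cderive sw).
Qed.

(** The matrix of the integrand is the commutator of the compressions of d/dx and x; up to the
    factor [theta * be] its trace per cell is that of the compressed cell coordinates. The [theta]
    cancels against the one in [ctr_Ma]. *)
Lemma ctr_omega : ctr (p * (comm X1 p * comm X2 p - comm X2 p * comm X1 p)) =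
  - (be R)^-1 * omega theta a (0, 0).
Proof.
have be0 : be R != 0.
  have i0 : 'i%C != 0 :> R[i] by rewrite eq_complex /= oner_eq0 andbF.
  by rewrite /be mulf_neq0// fmorph_eq0 gt_eqF.
have t0 : theta%:C != 0 :> R[i] by rewrite fmorph_eq0 gt_eqF.
have XX : X1 * X2 = X2 * X1.
  apply: tmxP => x y; rewrite !diag_mul /=; case: eqP => [->|_]; last by rewrite !mulr0.
  exact: mulrC.
have rx := rapid_xcoef ra; have rd := rapid_dcoef theta ra.
have r1 := rapid_conv theta rx rd; have r2 := rapid_conv theta rd rx.
have r3 := rapidB r1 r2; have r4 := rapid_conv theta ra r3; have r5 := rapidB ra r4.
have Eo : Ma th0 th1 r5 = (p * Y2 * p) * (p * Y1 * p) - (p * Y1 * p) * (p * Y2 * p).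
  rewrite (Ma_sub th0 th1 ra r4 r5) (Ma_mul th0 th1 ra r3 r4) (Ma_sub th0 th1 r1 r2 r3).
  rewrite (Ma_mul th0 th1 rx rd r1) (Ma_mul th0 th1 rd rx r2) (Ma_xcoef th0 th1 ra rx) (Ma_dcoef th0 th1 ra rd).
  exact: (compressed_commutator pp (Me_mul th0 th1 ra) (mul_Me th0 th1 ra) (Me_Y1 th0 th1) (Me_Y2 th0 th1) (Y21_comm th0 th1)).
have := ctr_Ma th0 th1 r5.
have -> : ctr (Ma th0 th1 r5) = - ctr (comm (p * Y1 * p) (p * Y2 * p)).
  transitivity (ctr (comm (p * Y2 * p) (p * Y1 * p))); first by rewrite Eo.
  by rewrite (commN (p * Y1 * p) (p * Y2 * p)); exact: (ctrN (comm (p * Y1 * p) (p * Y2 * p))).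
have cell1 g x y : ((cell (x + shift3 g)).1%:~R - (cell (y + shift3 g)).1%:~R : R[i]) = (cell x).1%:~R - (cell y).1%:~R.
  by rewrite !cell_shift /= !rmorphD /=; ring.
have cell2 g x y : ((cell (x + shift3 g)).2%:~R - (cell (y + shift3 g)).2%:~R : R[i]) = (cell x).2%:~R - (cell y).2%:~R.
  by rewrite !cell_shift /= !rmorphD /=; ring.
have -> : ctr (comm (p * Y1 * p) (p * Y2 * p)) = theta%:C * be R * ctr (comm (p * X1 * p) (p * X2 * p)).
  exact: (ctr_compressed_commutator (tame_cell1 R) (tame_cell2 R) theta%:C (be R) cell1 cell2 pp (covar_Ma th0 th1 ra) (covar_B1 th0 th1) (covar_B2 th0 th1)).
have -> : p * (comm X1 p * comm X2 p - comm X2 p * comm X1 p) = comm (p * X1 * p) (p * X2 * p).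
  exact: (compressed_commutator_scalar pp XX).
rewrite -[a (0, 0) - _]/(omega theta a (0, 0)).
move: (ctr _) (omega theta a (0, 0)) => c o.
move=> E; have {}E : theta%:C * (- (be R * c)) = theta%:C * o by rewrite -E mulrN mulrA.
by rewrite -(mulfI t0 E) mulrN mulNr opprK mulKf.
Qed.

Lemma index_omega : fredholm W Dop /\
  (fredholm_index W Dop)%:~R = - kap theta (2 * pi) * (be R)^-1 * omega theta a (0, 0).
Proof.
pose S : (Z2 -> R[i]^o) -> V := fun v => P (Sy h v).
have rA w : W w -> rapid (A w) by move=> /range_schwartz[sw _]; exact: rapid_A.
have pA w : W w -> tapp p (A w) = A w by move=> /range_schwartz[sw Pw]; rewrite -P_repr ?Pw.
have WS v : rapid v -> tapp p v = v -> W (S v).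
  by move=> rv _; exists (Sy h v) => //; exact: schwartz_Sy.
have AS v : rapid v -> tapp p v = v -> A (S v) = v.
  move=> rv pv; rewrite /S HP; last exact: schwartz_Sy.
  by rewrite (opm_repr th0 th1 (window_chic h0) ra rv).
have SA w : W w -> S (A w) = w.
  by move=> /range_schwartz[sw Pw]; rewrite /S (Sy_A h0 h1 sw).
have cov : inv_triple p := covar_inv_triple (covar_Ma th0 th1 ra).
have op0 := mord_Ma th0 th1 ra.
have [Fr ->] := index_cubic subspace_range linear_A rA pA WS AS SA pp op0 (u3_c_gt0 th0 pi2)
   (u3_lower th0 pi2) (uC := uC) mord_Bt linear_D D_stable D_matrix.
split=> //; rewrite (cubic_trace th0 pi2 op0 cov) ctr_omega; ring.
Qed.

End IndexFormula.

(** * Calibration on the harmonic oscillator *)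
Section Gaussian.
Variable R : realType.
Implicit Types (x : R).

Lemma nondecreasing_from0 (H dH : R -> R) : (forall x, is_derive x 1 H (dH x)) ->
  (forall x, 0 <= x -> 0 <= dH x) -> forall x, 0 <= x -> H 0 <= H x.
Proof.
move=> dHx dH0 x; rewrite le_eqVlt => /predU1P[<-//|x0].
have cH : {within `[0, x], continuous H}.
  by apply: continuous_subspaceT => y; exact: is_derive_continuous (dHx y).
have [c] := @MVT _ H dH 0 x x0 (fun y _ => dHx y) cH.
rewrite in_itv /= => /andP[c0 _] E.
by rewrite -subr_ge0 E subr0 mulr_ge0 ?dH0 ?ltW.
Qed.

Lemma derivative_comparison (E dE W dW : R -> R) : (forall x, is_derive x 1 E (dE x)) ->
  (forall x, is_derive x 1 W (dW x)) -> (forall x, 0 <= x -> `|dE x| <= dW x) ->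
  `|E 0| <= W 0 -> forall x, 0 <= x -> `|E x| <= W x.
Proof.
move=> hE hW H; rewrite ler_norml => /andP[H1 H2] x x0.
have hD (t : R) : is_derive t 1 (W + E) (dW t + dE t) by exact: is_deriveD.
have hB (t : R) : is_derive t 1 (W - E) (dW t - dE t) by exact: is_deriveB.
have := nondecreasing_from0 hD _ x0; have := nondecreasing_from0 hB _ x0.
have sg t : 0 <= t -> 0 <= dW t - dE t /\ 0 <= dW t + dE t.
  by move=> /H; rewrite ler_norml => /andP[? ?]; split; lra.
move=> /(_ (fun t t0 => (sg t t0).1)) A /(_ (fun t t0 => (sg t t0).2)) B.
have {}A : W 0 - E 0 <= W x - E x by exact: A.
have {}B : W 0 + E 0 <= W x + E x by exact: B.
by rewrite ler_norml; apply/andP; split; lra.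
Qed.

Lemma is_derive_congr (f : R -> R) x d d' : is_derive x 1 f d -> d = d' -> is_derive x 1 f d'.
Proof. by move=> H <-. Qed.

Lemma is_derive_mul (f g : R -> R) x df dg : is_derive x 1 f df -> is_derive x 1 g dg ->
  is_derive x 1 (fun t => f t * g t) (f x * dg + df * g x).
Proof.
move=> hf hg; apply: (is_derive_congr (is_deriveM hf hg)).
by rewrite /GRing.scale /= [g x * _]mulrC.
Qed.

Lemma is_derive_pow (f : R -> R) x df n : is_derive x 1 f df ->
  is_derive x 1 (fun t => f t ^+ n.+1) (n.+1%:R * f x ^+ n * df).
Proof.
move=> hf; elim: n => [|n IH].
  by under eq_fun do rewrite expr1; rewrite expr0 !mul1r.
under eq_fun do rewrite exprS.
apply: (is_derive_congr (is_derive_mul hf IH)).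
by rewrite -[in RHS]natr1 !exprS; ring.
Qed.

(** The integrating factor of the equation f' + x f = g. *)
Definition egauss x : R := expR (x ^+ 2 / 2).

Lemma egauss_gt0 x : 0 < egauss x. Proof. exact: expR_gt0. Qed.

Lemma is_derive_egauss x : is_derive x 1 egauss (egauss x * x).
Proof.
have d2 : is_derive x 1 (fun t : R => t ^+ 2 / 2) x.
  have := is_derive_mul (is_derive_affine 1 0 x) (is_derive_affine 2^-1 0 x).
  under eq_fun do rewrite mul1r !addr0 mulrCA mulrC -expr2.
  by move=> d; apply: (is_derive_congr d); field.
have := @is_derive1_comp _ expR _ x _ _ (is_derive_expR _) d2; exact.
Qed.

Section Weight.
Variable n : nat.
Let N : R := n.+1%:R.
Let N1 : 1 <= N. Proof. by rewrite /N ler1n. Qed.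
Let NN : 1 <= N ^+ 2. Proof. exact: exprn_ege1. Qed.

(** Denominator of the barrier [wgauss], whose logarithmic derivative is [x - 2 N (x - 1) / v].
    Centring at 1 keeps this positive at 0, with value [cgauss]; the constant [4 N^2] keeps the
    subtracted term below 1/2 for [x >= 1]. *)
Definition vpoly x : R := 4 * N ^+ 2 + (x - 1) ^+ 2.

Lemma vpoly_gt0 x : 0 < vpoly x.
Proof. by rewrite /vpoly; have := sqr_ge0 (x - 1); have := NN; have := N1; lra. Qed.

Lemma is_derive_vpoly x : is_derive x 1 vpoly (2 * (x - 1)).
Proof.
have d1 := is_derive_affine 1 (-1) x.
have := is_derive_pow 1 d1; under eq_fun do rewrite mul1r.
move=> d2; apply: (is_derive_congr (is_deriveD (is_derive_cst (4 * N ^+ 2) x 1) d2)).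
by rewrite add0r expr1; ring.
Qed.

Definition wgauss x : R := egauss x * (vpoly x ^+ n.+1)^-1.
Definition dwgauss x : R := wgauss x * (x - 2 * N * (x - 1) / vpoly x).

Lemma is_derive_wgauss x : is_derive x 1 wgauss (dwgauss x).
Proof.
have v0 := gt_eqF (vpoly_gt0 x); have vn : vpoly x ^+ n.+1 != 0 by rewrite expf_neq0// v0.
have dv := is_derive_vpoly x; have dE := is_derive_egauss x.
have dX := is_derive_pow n dv.
have dV := @is_deriveV _ (fun t => vpoly t ^+ n.+1) x _ 1 vn dX.
apply: (is_derive_congr (is_derive_mul dE dV)).
rewrite /dwgauss /wgauss /GRing.scale /= exprS.
have v0' : vpoly x != 0 by rewrite v0.
have vn' : vpoly x ^+ n != 0 by rewrite expf_neq0.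
rewrite expr1 !exprS /N; move: (vpoly x ^+ n) vn' => w w0; field.
by rewrite v0' w0.
Qed.

Definition cgauss : R := 2 * N / (4 * N ^+ 2 + 1).

Lemma cgauss_gt0 : 0 < cgauss.
Proof. by rewrite divr_gt0//; have := NN; have := N1; lra. Qed.

Lemma dwgauss_ge x : 0 <= x -> cgauss * wgauss x <= dwgauss x.
Proof.
move=> x0; rewrite /dwgauss mulrC ler_wpM2l//.
  by rewrite mulr_ge0 ?invr_ge0 ?exprn_ge0 ?ltW ?egauss_gt0 ?vpoly_gt0.
have c0 := cgauss_gt0; have v0 := vpoly_gt0 x.
have NN' := NN.
have K0 : 0 < 4 * N ^+ 2 + 1 by lra.
have c2 : cgauss <= 1 / 2.
  by rewrite /cgauss ler_pdivrMr//; have := sqr_ge0 (2 * N - 1); lra.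
case: (leP 1 x) => x1.
  suff : 2 * N * (x - 1) / vpoly x <= 1 / 2 by lra.
  rewrite ler_pdivrMr// /vpoly; have := sqr_ge0 (2 * N - (x - 1)).
  by move: (x - 1) => u; lra.
have u2 : (x - 1) ^+ 2 <= 1 by nra.
have H : cgauss * (1 - x) <= 2 * N * (1 - x) / vpoly x.
  rewrite /cgauss mulrAC ler_wpM2l//; first by apply: mulr_ge0; have := N1; lra.
  by rewrite lef_pV2 ?posrE// /vpoly lerD2l.
have -> : 2 * N * (x - 1) / vpoly x = - (2 * N * (1 - x) / vpoly x) by rewrite -mulNr -mulrN opprB.
rewrite opprK; have : cgauss * x <= x by rewrite ler_piMl//; lra.
lra.
Qed.

Lemma weight_le_vpoly x : 0 <= x -> 1 + x <= vpoly x.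
Proof.
move=> x0; rewrite /vpoly; have NN' := NN.
by have := sqr_ge0 (x - 2); have := sqr_ge0 (x - 1); lra.
Qed.

Lemma vpoly_le x : 0 <= x -> vpoly x <= (4 * N ^+ 2 + 1) * (1 + x) ^+ 2.
Proof.
move=> x0; rewrite /vpoly; have NN' := NN.
have : (x - 1) ^+ 2 <= (1 + x) ^+ 2 by nra.
have : 1 <= (1 + x) ^+ 2 by nra.
by move: ((1 + x) ^+ 2) ((x - 1) ^+ 2) => y z; nra.
Qed.

(** [E] is compared with a multiple of the barrier [wgauss], and dividing by [egauss] leaves a power
    of [1 / vpoly]. Since [vpoly] lies between [1 + x] and a multiple of its square, half of the
    decay of [g] is lost. *)
Lemma gauss_decay_half (E g : R -> R) (C : R) : (forall x, is_derive x 1 E (egauss x * g x)) ->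
  (forall x, 0 <= x -> (1 + x) ^+ (2 * n.+1) * `|g x| <= C) ->
  exists K, 0 <= K /\ forall x, 0 <= x -> (1 + x) ^+ n.+1 * `|(egauss x)^-1 * E x| <= K.
Proof.
move=> dE Hg.
pose L := (4 * N ^+ 2 + 1) ^+ n.+1 * C.
have L0 : 0 <= L.
  rewrite mulr_ge0 ?exprn_ge0//; first by have := sqr_ge0 N; lra.
  apply: le_trans (Hg 0 (lexx _)); rewrite addr0 expr1n mul1r; exact: normr_ge0.
have c0 := cgauss_gt0.
(* The first summand lets the barrier grow at least as fast as [E], the second lets it start above
   [|E 0|]. *)
pose K := L / cgauss + `|E 0| / wgauss 0.
have w0 x : 0 < wgauss x by rewrite mulr_gt0 ?invr_gt0 ?exprn_gt0 ?egauss_gt0 ?vpoly_gt0.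
have K1 : 0 <= L / cgauss by rewrite divr_ge0// ltW.
have K2 : 0 <= `|E 0| / wgauss 0 by rewrite divr_ge0// ltW.
exists K; split; first by rewrite addr_ge0.
have dKw x : is_derive x 1 (K *: wgauss : R -> R) (K * dwgauss x).
  by have dw := is_derive_wgauss x; exact: is_deriveZ.
have B x : 0 <= x -> `|E x| <= K * wgauss x.
  apply: (derivative_comparison dE dKw).
    move=> t t0; rewrite normrM (gtr0_norm (egauss_gt0 t)).
    apply: (@le_trans _ _ (L / cgauss * (cgauss * wgauss t))).
      rewrite mulrA divfK ?gt_eqF// /wgauss [L * _]mulrCA; apply: (ler_wpM2l (ltW (egauss_gt0 t))).
      rewrite ler_pdivlMr ?exprn_gt0 ?vpoly_gt0//.
      apply: (@le_trans _ _ (`|g t| * ((4 * N ^+ 2 + 1) * (1 + t) ^+ 2) ^+ n.+1)).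
        have v0 := ltW (vpoly_gt0 t); have vl := vpoly_le t0.
        by rewrite ler_wpM2l// lerXn2r ?nnegrE//; exact: le_trans v0 vl.
      rewrite exprMn -exprM mulrCA ler_wpM2l ?exprn_ge0//; first by have := sqr_ge0 N; lra.
      by rewrite mulrC Hg.
    apply: (@le_trans _ _ (L / cgauss * dwgauss t)); first by rewrite ler_wpM2l ?dwgauss_ge.
    rewrite ler_wpM2r ?lerDl//; apply: le_trans (dwgauss_ge t0).
    by rewrite mulr_ge0 ?ltW.
  have -> : (K *: wgauss : R -> R) 0 = L / cgauss * wgauss 0 + `|E 0|.
    by rewrite -[LHS]/((L / cgauss + `|E 0| / wgauss 0) * wgauss 0) mulrDl divfK// gt_eqF.
  by rewrite lerDr mulr_ge0// ltW.
move=> x x0; rewrite normrM normfV (gtr0_norm (egauss_gt0 x)).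
apply: (@le_trans _ _ ((1 + x) ^+ n.+1 * ((egauss x)^-1 * (K * wgauss x)))).
  rewrite ler_wpM2l ?exprn_ge0 ?addr_ge0// ler_wpM2l ?invr_ge0 ?B// ltW// egauss_gt0//.
rewrite /wgauss [K * _]mulrCA mulKf ?gt_eqF ?egauss_gt0// mulrCA ler_piMr ?addr_ge0//.
rewrite ler_pdivrMr ?exprn_gt0 ?vpoly_gt0// mul1r; have v0 := ltW (vpoly_gt0 x).
by rewrite lerXn2r ?nnegrE//; [exact: addr_ge0|exact: weight_le_vpoly].
Qed.

End Weight.

(** The negative half-line is reduced to the positive one by reflecting [E]. *)
Lemma gauss_decay_real (E g : R -> R) : (forall x, is_derive x 1 E (egauss x * g x)) ->
  (forall m, exists C, forall x, (1 + `|x|) ^+ m * `|g x| <= C) ->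
  forall m, exists C, 0 <= C /\ forall x, (1 + `|x|) ^+ m * `|(egauss x)^-1 * E x| <= C.
Proof.
move=> dE Hg m; have [C HC] := Hg (2 * m.+1)%N.
have [K [K0 HK]] : exists K, 0 <= K /\ forall x, 0 <= x -> (1 + x) ^+ m.+1 * `|(egauss x)^-1 * E x| <= K.
  apply: gauss_decay_half dE _ => x x0; have := HC x; rewrite ger0_norm//; exact.
have dE' x : is_derive x 1 (fun t => E (- t)) (egauss x * - g (- x)).
  have dn : is_derive x 1 (-%R : R -> R) (-1) by apply: is_derive_eq.
  have dEx := dE (- x).
  apply: (is_derive_congr (@is_derive1_comp _ E -%R x _ _ dEx dn)).
  by rewrite /egauss sqrrN; ring.
have [K' [K'0 HK']] : exists K, 0 <= K /\ forall x, 0 <= x -> (1 + x) ^+ m.+1 * `|(egauss x)^-1 * E (- x)| <= K.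
  apply: gauss_decay_half dE' _ => x x0; have := HC (- x); rewrite normrN ger0_norm// normrN; exact.
exists (K + K'); split; first exact: addr_ge0.
move=> x; apply: (@le_trans _ _ ((1 + `|x|) ^+ m.+1 * `|(egauss x)^-1 * E x|)).
  by rewrite ler_wpM2r// ler_weXn2l ?lerDl.
case: (leP 0 x) => x0.
  by rewrite ger0_norm//; apply: le_trans (HK x x0) _; rewrite lerDl.
rewrite ltr0_norm//; have := HK' (- x); rewrite opprK oppr_ge0 => /(_ (ltW x0)) H.
by apply: le_trans (le_trans H _); rewrite ?lerDr// /egauss sqrrN.
Qed.

Implicit Types (f g : R -> R[i]).

Lemma gauss_decays (E g : R -> R[i]) : (forall x, cis E x ((egauss x)%:C * g x)) -> decays g ->
  decays (fun x => ((egauss x)^-1)%:C * E x).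
Proof.
move=> dE dg m.
have gRe k : exists C, forall x, (1 + `|x|) ^+ k * `|cRe (g x)| <= C.
  have [C [_ HC]] := dg k; exists C => x; apply: le_trans (HC x).
  by rewrite ler_wpM2l ?exprn_ge0 ?addr_ge0// nrm_Re.
have gIm k : exists C, forall x, (1 + `|x|) ^+ k * `|cIm (g x)| <= C.
  have [C [_ HC]] := dg k; exists C => x; apply: le_trans (HC x).
  by rewrite ler_wpM2l ?exprn_ge0 ?addr_ge0// nrm_Im.
have ReM (r : R) z : cRe (r%:C * z) = r * cRe z by rewrite cReM /= mul0r subr0.
have ImM (r : R) z : cIm (r%:C * z) = r * cIm z by case: z => z1 z2 /=; rewrite mul0r addr0.
have dR x : is_derive x 1 (fun t => cRe (E t)) (egauss x * cRe (g x)).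
  by rewrite -ReM; exact: (dE x).1.
have dI x : is_derive x 1 (fun t => cIm (E t)) (egauss x * cIm (g x)).
  by rewrite -ImM; exact: (dE x).2.
have [C1 [C10 H1]] := gauss_decay_real dR gRe m; have [C2 [C20 H2]] := gauss_decay_real dI gIm m.
exists (C1 + C2); split; first exact: addr_ge0.
move=> x; apply: le_trans (lerD (H1 x) (H2 x)).
rewrite -mulrDr ler_wpM2l ?exprn_ge0 ?addr_ge0// -ReM -ImM.
exact: nrm_le_ReIm.
Qed.

(** Stable under differentiation because f' = g - x f; Schwartz decay of [f] itself is then enough
    for all derivatives. *)
Inductive ode_closure f : (R -> R[i]) -> Prop :=
| ode_self : ode_closure f f
| ode_schwartz g : schwartz g -> ode_closure f g
| ode_add g h : ode_closure f g -> ode_closure f h -> ode_closure f (fun x => g x + h x)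
| ode_opp g : ode_closure f g -> ode_closure f (fun x => -1 * g x)
| ode_mulx g : ode_closure f g -> ode_closure f (fun x => x%:C * g x).

Lemma schwartz_ode f g : schwartz g -> (forall x, cis f x (g x - x%:C * f x)) -> decays f ->
  schwartz f.
Proof.
move=> sg df ff.
have H h : ode_closure f h -> exists2 h', ode_closure f h' & forall x, cis h x (h' x).
  elim=> {h} [|h sh|a b _ [a' oa Ha] _ [b' ob Hb]|a _ [a' oa Ha]|a oa [a' oa' Ha]].
  - exists (fun x => g x + -1 * (x%:C * f x)) => [|x]; last by rewrite mulN1r.
    by apply: ode_add; [exact: ode_schwartz|apply: ode_opp; apply: ode_mulx; exact: ode_self].
  - by exists (cderive h); [apply: ode_schwartz; exact: schwartz_cderive|exact: schwartz_cdiff].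
  - by exists (fun x => a' x + b' x); [exact: ode_add|move=> x; exact: cisD].
  - by exists (fun x => -1 * a' x); [exact: ode_opp|move=> x; exact: cisZ].
  - exists (fun x => x%:C * a' x + a x) => [|x]; first by apply: ode_add => //; exact: ode_mulx.
    by have := cisM (cis_id x) (Ha x); rewrite mul1r.
apply: (@schwartz_coind _ [set h | ode_closure f h]); last exact: ode_self.
- by move=> h /H[h' _ Hh] x; exact: cdiff_cis (Hh x).
- by move=> h /H[h' oh Hh] /=; rewrite (cis_cdiff Hh).
- move=> h; elim=> {h} [//|h sh|a b _ da _ db|a _ da|a _ da].
  + exact: schwartz_decays.
  + exact: decaysD.
  + exact: decaysZ.
  + exact: decays_mulx.
Qed.

Lemma cis_egauss x : cis (fun t => (egauss t)%:C) x (egauss x * x)%:C.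
Proof. exact: cis_real (is_derive_egauss x). Qed.

Lemma cis_gauss x : cis (fun t => ((egauss t)^-1)%:C) x (- (x / egauss x))%:C.
Proof.
apply: cis_real; have dE := is_derive_egauss x.
have e0 : egauss x != 0 by rewrite gt_eqF ?egauss_gt0.
apply: (is_derive_congr (@is_deriveV _ egauss x _ 1 e0 dE)).
by rewrite /GRing.scale /=; field.
Qed.

Lemma gauss_ode (E g : R -> R[i]) : (forall x, cis E x ((egauss x)%:C * g x)) ->
  forall x, cis (fun t => ((egauss t)^-1)%:C * E t) x
    (g x - x%:C * (((egauss x)^-1)%:C * E x)).
Proof.
move=> dE x; have := cisM (cis_gauss x) (dE x).
have e0 : (egauss x)%:C != 0 :> R[i] by rewrite fmorph_eq0 gt_eqF ?egauss_gt0.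
by rewrite rmorphN rmorphM /= fmorphV mulKf//; congr cis; ring.
Qed.

(** Any primitive of [egauss * g] will do: a change of the constant adds a multiple of the Gaussian,
    which is a Schwartz function. So the equation has no solvability condition. *)
Lemma schwartz_solution g : schwartz g ->
  exists2 f, schwartz f & forall x, cis f x (g x - x%:C * f x).
Proof.
move=> sg; have cg := schwartz_ccont sg.
have ce : ccont (fun x => (egauss x)%:C * g x).
  apply: ccontM => //; exact: (cdiff_ccont cis_egauss).
have [E dE] := cprimitive_exists ce.
exists (fun t => ((egauss t)^-1)%:C * E t); last exact: gauss_ode.
have dg := gauss_decays dE (schwartz_decays sg).
exact: schwartz_ode sg (gauss_ode dE) dg.
Qed.

End Gaussian.

Section Calibration.
Variable R : realType.
Notation V := (R -> R[i]^o).

Let e0 (x : R) : (egauss x)%:C != 0 :> R[i].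
Proof. by rewrite fmorph_eq0 gt_eqF ?egauss_gt0. Qed.

Definition gauss (x : R) : R[i] := ((egauss x)^-1)%:C.

Lemma gauss_ode0 x : cis gauss x (0 - x%:C * gauss x).
Proof.
have H t : cis (fun _ : R => 1 : R[i]) t ((egauss t)%:C * 0) by rewrite mulr0; exact: cis_cst.
by have := gauss_ode (g := fun=> 0) H x; under eq_fun do rewrite mulr1; rewrite mulr1.
Qed.

Lemma schwartz0 : schwartz (fun _ : R => 0 : R[i]).
Proof.
apply: (@schwartz_coind _ [set fun _ : R => 0 : R[i]]) => //.
- by move=> _ -> x; apply: cdiff_cis; exact: cis_cst.
- by move=> _ -> /=; exact: (cis_cdiff (fun x => cis_cst 0 x)).
- by move=> _ -> m; exists 0; split=> // x; rewrite Normc.normc0 mulr0.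
Qed.

Lemma schwartz_gauss : schwartz gauss.
Proof.
apply: schwartz_ode schwartz0 gauss_ode0 _.
have H t : cis (fun _ : R => 1 : R[i]) t ((egauss t)%:C * 0) by rewrite mulr0; exact: cis_cst.
have := gauss_decays (g := fun=> 0) H (schwartz_decays schwartz0).
by under eq_fun do rewrite mulr1.
Qed.

Lemma gauss_unique f : (forall x, cis f x (- (x%:C * f x))) -> forall x, f x = f 0 * gauss x.
Proof.
move=> df x; have H t : cis (fun t => (egauss t)%:C * f t) t 0.
  have := cisM (cis_egauss t) (df t); rewrite rmorphM /=.
  by congr (cis _ t); ring.
have := cdiff_cst_eq0 x 0 H.
rewrite /egauss expr0n mul0r expR0 mul1r => <-.
by rewrite /gauss fmorphV /= -/(egauss x) mulrAC divff// mul1r.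
Qed.

Let W : set V := (fun f : R -> R[i] => f) @` @schwartz R.
Let D : V -> V := compressed (fun f : R -> R[i] => f).

Lemma oscillator_kernel : has_quot_dim (kernel_in W D) [set 0] 1.
Proof.
have Wg : W gauss by exists gauss => //; exact: schwartz_gauss.
exists (fun=> gauss); split.
  move=> _; split=> //; apply/funext => x; rewrite /D /compressed.
  by rewrite (cis_derive (gauss_ode0 x)) sub0r addrN.
move=> w [[f sf <-] Df].
have E x : f x = f 0 * gauss x.
  apply: gauss_unique => {}x; have := congr1 (fun k : R -> R[i] => k x) Df.
  rewrite /D /compressed -[X in _ = X]/(0 : R[i]) => /eqP; rewrite addrC addr_eq0 => /eqP <-.
  exact: schwartz_cdiff.
have g0 : gauss 0 = 1 by rewrite /gauss /egauss expr0n mul0r expR0 invr1.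
exists (const_mx (f 0)); split.
  apply/funext => x; rewrite big_ord1 mxE -[LHS]/(f x - f 0 * gauss x) -E subrr//.
move=> c; rewrite big_ord1 => /(congr1 (fun k : R -> R[i] => k 0)).
rewrite -[LHS]/(f 0 - c ord0 ord0 * gauss 0) g0 mulr1 -[RHS]/(0 : R[i]) => /subr0_eq Ec.
by apply/rowP => i; rewrite mxE ord1.
Qed.

Lemma oscillator_range : has_quot_dim W (D @` W) 0.
Proof.
exists (fun=> 0); split; first by case.
move=> w [g sg <-]; have [f sf df] := schwartz_solution sg.
exists 0; split; last by move=> c _; apply/rowP; case.
rewrite big_ord0 subr0; exists f; first by exists f.
by apply/funext => x; rewrite /D /compressed (cis_derive (df x)) addrC subrK.
Qed.

Lemma oscillator_index : fredholm_index W D = 1.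
Proof.
have W0 : W 0 by exists (fun=> 0) => //; exact: schwartz0.
have sub0 : subspace [set (0 : V)].
  by split=> // c u v -> ->; rewrite scaler0 addr0.
have D_lin (c : R[i]) (f g : V) : schwartz f -> schwartz g -> D (c *: f + g) = c *: D f + D g.
  move=> sf sg; apply/funext => x.
  have := cis_derive (cisD (cisZ c (schwartz_cdiff sf x)) (schwartz_cdiff sg x)).
  rewrite /D /compressed -[(fun t => c * f t + g t)]/(c *: f + g) => ->.
  rewrite -[(c *: f + g) x]/(c * f x + g x).
  rewrite -[RHS]/(c * (x%:C * f x + cderive f x) + (x%:C * g x + cderive g x)); ring.
have subD : subspace (D @` W).
  split.
    exists 0 => //; apply/funext => x; rewrite /D /compressed.
    have -> : cderive (0 : R -> R[i]) x = 0 by apply: cis_derive; exact: cis_cst.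
    by rewrite mulr0 addr0.
  move=> c _ _ [_ [f sf <-] <-] [_ [g sg <-] <-]; exists (c *: (f : V) + g); last exact: D_lin.
  exists (c *: (f : V) + g) => //; apply: schwartzD => //; exact: schwartzZ.
by rewrite /fredholm_index (quot_dimE sub0 oscillator_kernel) (quot_dimE subD oscillator_range).
Qed.

Lemma omega_delta0 theta : omega theta (@delta0 R) (0, 0) = 1.
Proof.
have x0 : xcoef (@delta0 R) = fun=> 0.
  by apply/funext => z; rewrite /xcoef /delta0; case: eqP => [->|_]; rewrite ?mulr0// mul0r.
have d0 : dcoef theta (@delta0 R) = fun=> 0.
  by apply/funext => z; rewrite /dcoef /delta0; case: eqP => [->|_]; rewrite ?mulr0// mul0r.
have c0 b : conv theta (fun=> 0 : R[i]) b = fun=> 0.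
  apply/funext => z; rewrite -[RHS](@csum0 R Z2); congr csum.
  by apply/funext => y; rewrite !mul0r.
have c0' b : conv theta b (fun=> 0 : R[i]) = fun=> 0.
  apply/funext => z; rewrite -[RHS](@csum0 R Z2); congr csum.
  by apply/funext => y; rewrite mulr0.
rewrite /omega x0 d0 c0 subr0.
by rewrite c0' subr0 /delta0 eqxx.
Qed.

(** The projection 1 belongs to the algebra for every theta, its integrand is 1, and the index of x
    + d/dx is 1, so [index_omega] can be solved for the constant. *)
Lemma calibration (theta : R) : 0 < theta -> theta <= 1 ->
  - kap theta (2 * pi) * (be R)^-1 = 1.
Proof.
move=> th0 th1.
have [_] := index_omega th0 th1 (@rapid_delta0 R) (P := fun f => f)
  (fun f _ => esym (op_delta theta f)) (fun f _ => erefl).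
by rewrite omega_delta0 mulr1 => <-; rewrite oscillator_index.
Qed.

End Calibration.

Theorem mainTheorem5 (R : realType) (theta : R) (P : operator R) :
  0 < theta -> theta <= 1 ->
  Ainf theta P ->
  (forall f, schwartz f -> P (P f) = P f) ->
  let PS : set (R -> R[i]^o) := P @` @schwartz R in
  let D : (R -> R[i]^o) -> (R -> R[i]^o) := compressed P in
  fredholm PS D /\
  (fredholm_index PS D)%:~R =
    (theta^-1)%:C * cintegral 0 theta (zcoef theta (index_integrand theta P) 0).
Proof.
move=> th0 th1 [a /has_coef_op[ra HP]] PP PS D.
have [Fr ->] := index_omega th0 th1 ra HP PP.
split=> //; rewrite (calibration th0 th1) mul1r.
have rO : rapid (omega theta (fun z => a z.1 z.2)) := rapid_omega theta ra.
(* The mean of the integrand over a period is its zeroth Fourier coefficient [omega (0, 0)]. *)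
rewrite (zcoefE th0 _ th1 rO (index_integrand_op th0 th1 ra HP)) trig0//.
by rewrite fmorphV mulKf// fmorph_eq0 gt_eqF.
Qed.
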